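(* Let $\beta>0$ be a constant. (i) In the low temperature phase, i.e. if either $\beta>\limsup_n(1-\Delta_n-\kappa_n^{-1})$, or $\beta=\limsup_n(1-\Delta_n-\kappa_n^{-1})$ and $\limsup_n\kappa_n<\infty$: the choice $m^*=N_{d_n^*}$ satisfies $\tilde\Phi^*_{G_n,\beta}=\tilde\Phi_{G_n,\beta}(m^* )+o_p(n)$, and \[\log Z_{G_n,\beta}=n\Psi_0(\lambda_n)+\lambda_n n\log\big(\alpha_n(1-\lambda_n)\log n\big)-\beta\log\log(n)\,(d_n^*+\lambda_n)n+o_p(n).\] (ii) In the high temperature phase $\beta<\liminf_n(1-\Delta_n-\kappa_n^{-1})$: the choice $m^*=\big\lfloor\frac{N_{d_n^*}}{(1-\Delta_n-\beta)\kappa_n}\big\rfloor$ satisfies $\tilde\Phi^*_{G_n,\beta}=\tilde\Phi_{G_n,\beta}(m^* )+o_p(n)$, and \[\log Z_{G_n,\beta}=n\log\Big(\frac{\alpha_n\log n}{(1-\Delta_n-\beta)\log\log n}\Big)-n-\beta\log\log(n)\,(d_n^*+1)n+o_p(n).\]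
   Context: Let $(\alpha_n)$ be a sequence in $(0,\infty)$ with $0<\liminf\alpha_n\le\limsup\alpha_n<\infty$, $q_n=\alpha_n\log n/n$, $G_n\sim\mathcal G(n,q_n)$ on $\{1,\dots,n\}$. Let $\ell_n^*=\log n/\log(nq_n)$, $d_n^*=\min\{d\in\mathbb Z:(nq_n)^d\ge n/(\log\log n)^2\}$, $\Delta_n=d_n^*-\ell_n^*$, $\lambda_n\in(0,1)$ with $\log(1/\lambda_n)=(nq_n)^{d_n^*}/n$, $\kappa_n=(1-\lambda_n)\log\log n$, and $N_d$ the number of vertices at distance $d$ from $1$ in $G_n$. Let $\overline G_n$ be the component of $G_n$ containing $1$, vertex set $\overline V_n$, and $Z_{G_n,\beta}=\sum_T\exp\big(-\beta\log\log(n)\sum_{v\in\overline V_n}\mathsf d_T(1,v)\big)$ over spanning trees $T$ of $\overline G_n$. $\mathrm{ZTP}(\mu)$ is the Poisson$(\mu)$ distribution conditioned to be positive. For integers $1\le m\le N$ and $\lambda\in(0,1)$, $\Psi(m;N,\lambda)=\mathbb E\big[\log\sum_{I\subseteq[N],|I|=m}\prod_{i\in I}X_i\big]$ with $X_1,\dots,X_N$ i.i.d. $\mathrm{ZTP}(\log(1/\lambda))$. Define $\tilde\Phi_{G_n,\beta}(m)=\Psi(m;N_{d_n^*},\lambda_n)+(n-m)\log(mq_n)+\beta\log\log(n)\,m-\beta\log\log(n)(d_n^*+1)n$ and $\tilde\Phi^*_{G_n,\beta}=\max_{1\le m\le N_{d_n^*}}\tilde\Phi_{G_n,\beta}(m)$.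 $\Psi_0(\lambda)=\mathbb E[\log(X\vee1)]$ with $X\sim\mathrm{Poisson}(\log(1/\lambda))$. $Y_n=o_p(n)$ means $Y_n/n\to0$ in probability. *)

(* Defs.v *)
From HB Require Import structures.
From mathcomp Require Export all_boot all_order all_algebra.
From mathcomp Require Export all_classical all_reals all_analysis.
Export Order.TTheory GRing.Theory Num.Theory.
Export numFieldNormedType.Exports.

Set Implicit Arguments.
Unset Strict Implicit.
Unset Printing Implicit Defensive.

Local Open Scope set_scope.
Local Open Scope ring_scope.

(* A simple graph on V is given by its edge set E, with E \subset pairs V. *)
Section graphs.
Variable V : finType.
Implicit Types (E T : {set {set V}}) (u v : V).

Definition pairs : {set {set V}} := [set e : {set V} | #|e| == 2%N].

Definition adj E : rel V := fun u v => [set u; v] \in E.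

Definition component E u : {set V} := [set v | connect (adj E) u v].

Definition has_walk E (k : nat) u v : bool :=
  [exists p : k.-tuple V, path (adj E) u p && (last u p == v)].

(* Least length of a walk from u to v; a shortest walk has length < #|V|, and
   the value is #|V| when v is not in the component of u. *)
Definition gdist E u v : nat :=
  find (fun k => has_walk E k u v) (iota 0 #|V|).

Definition layer_size E u (d : int) : nat :=
  #|[set v in component E u | Posz (gdist E u v) == d]|.

Definition acyclic T : Prop :=
  forall c : seq V, ucycle (adj T) c -> (size c <= 2)%N.

(* T is the edge set of a spanning tree of the component of u in E. *)
Definition spanning_tree E u T : Prop :=
  [/\ T \subset E,
      (forall e, e \in T -> e \subset component E u),
      {in component E u &, forall v w, connect (adj T) v w}
    & acyclic T].

Variable R : realType.

(* Law of the random graph in which each pair is an edge with probability q,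
   independently; it is a probability when 0 <= q <= 1. *)
Definition gnp_weight (q : R) E : R :=
  \prod_(e in pairs) (if e \in E then q else 1 - q).

Definition gnp_prob (q : R) (A : pred {set {set V}}) : R :=
  \sum_(E : {set {set V}} | (E \subset pairs) && A E) gnp_weight q E.

End graphs.

(* The n vertices 1, ..., n are the ordinals 0, ..., n-1 (n >= 1). *)
Definition vertex (n : nat) := 'I_n.-1.+1.
Definition vertex1 (n : nat) : vertex n := ord0.
Definition graph (n : nat) := {set {set vertex n}}.

(* Y_n = o_p(n) for functions Y_n of G_n ~ G(n, q_n).  Only large n matter, so
   the finitely many n with q_n > 1 are harmless when q_n tends to 0. *)
Definition is_op_n (R : realType) (q : nat -> R)
    (Y : forall n : nat, graph n -> R) : Prop :=
  forall eps : R, 0 < eps ->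
    ((fun n : nat => gnp_prob (q n) (fun G : graph n => eps < `|Y n G / n%:R|))
       @ \oo --> (0 : R))%classic.

Section poisson.
Variable R : realType.

Definition ztp_pmf (mu : R) (k : nat) : R :=
  if k == 0%N then 0 else poisson_pmf mu k / (1 - poisson_pmf mu 0).

Definition elem_sym (N m : nat) (x : {ffun 'I_N -> nat}) : nat :=
  (\sum_(I : {set 'I_N} | #|I| == m) \prod_(i in I) x i)%N.

(* Expectation over i.i.d. X_i, as a sum over the values of (X_1, ..., X_N);
   all terms are nonnegative and the sum is finite. *)
Definition Psi (m N : nat) (lambda : R) : R :=
  fine (\esum_(x in [set: {ffun 'I_N -> nat}]%classic)
    ((\prod_(i < N) ztp_pmf (ln lambda^-1) (x i))
     * ln (elem_sym m x)%:R)%:E)%E.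

(* The second argument of poisson_prob is a dummy. *)
Definition Psi0 (lambda : R) : R :=
  fine ('E_(poisson_prob (ln lambda^-1) 0)[fun k : nat => ln (maxn k 1)%:R])%E.

End poisson.

Section model.
Variables (R : realType) (alpha : nat -> R).
Implicit Type n : nat.

Definition edge_prob n : R := alpha n * ln n%:R / n%:R.

Definition loglog n : R := ln (ln n%:R).

Definition ell_star n : R := ln n%:R / ln (n%:R * edge_prob n).

Definition above_threshold n (d : int) : Prop :=
  n%:R / loglog n ^+ 2 <= (n%:R * edge_prob n) ^ d.

(* The minimum exists as soon as n q_n > 1 and log log n != 0. *)
Definition d_star n : int :=
  xget 0 [set d : int | above_threshold n d
                        /\ forall e, above_threshold n e -> d <= e]%classic.

Definition Delta n : R := (d_star n)%:~R - ell_star n.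

Definition lambda_ n : R := expR (- ((n%:R * edge_prob n) ^ d_star n / n%:R)).

Definition kappa n : R := (1 - lambda_ n) * loglog n.

Definition N_dstar n (G : graph n) : nat :=
  layer_size G (vertex1 n) (d_star n).

Definition partition_function (beta : R) n (G : graph n) : R :=
  \sum_(T : graph n | `[< spanning_tree G (vertex1 n) T >])
    expR (- (beta * loglog n
             * (\sum_(v in component G (vertex1 n)) gdist T (vertex1 n) v)%N%:R)).

Definition tPhi (beta : R) n (G : graph n) (m : nat) : R :=
  Psi m (N_dstar G) (lambda_ n)
  + (n%:R - m%:R) * ln (m%:R * edge_prob n)
  + beta * loglog n * m%:R
  - beta * loglog n * ((d_star n)%:~R + 1) * n%:R.

(* The range of m is nonempty unless N_dstar G = 0. *)
Definition tPhi_max (beta : R) n (G : graph n) : R :=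
  \big[Num.max/tPhi beta G 1]_(1 <= m < (N_dstar G).+1) tPhi beta G m.

Definition beta_crit n : R := 1 - Delta n - (kappa n)^-1.

End model.

(* Main.v *)
Require Import Defs.
From mathcomp Require Import ring lra zify.
From mathcomp Require Import fintype finset.

(** Let D = n q_n, L = log log n, d = d*, and explore G_n from vertex 1 in layers. A
    spanning tree is encoded by its parent map. Up to o(n) in the exponent, the vertices
    below layer d contribute nothing, a set I of vertices of layer d keeps depth d, each
    v in I having X_v possible parents in layer d - 1, and every other vertex gets a
    parent in I and depth d + 1. Hence
      Z = exp (o(n) - beta L (d + 1) n) *
          sum_I exp (beta L |I|) (prod_(v in I) X_v) (|I| q_n) ^ (n - |I|).
    For the upper bound the edges between I and the unexplored vertices are averaged out
    conditionally on the exploration (first moment); for the lower bound a single set I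
    suffices, chosen from the exploration, for which the number of neighbours of a
    vertex in I concentrates. The sum over I of given size m is at most an elementary
    symmetric function of the X_v, bounded through prod (1 + x) <= exp (sum x). With
    Delta log D = log (log (1 / lambda)), the exponent is then an explicit function of
    m, maximal at m = N_d in the low temperature phase, because its slope at N_d is
    asymptotically L (beta - beta_crit), and at m = n / ((1 - Delta - beta) L) otherwise.
    The same two estimates, with the bounds on Psi, give the claims on tPhi. *)

(** The threshold n / L ^ 2 in the definition of d explains the two-level picture. The layers below
    d hold O(n / L ^ 2) vertices, so even at a price of order L each they cost o(n); layer d holds
    about n (1 - lambda) vertices, at least n / (2 L ^ 2), so an unexplored vertex expects many more
    than L neighbours there and almost nothing lies beyond depth d + 1. A vertex at the wrong depth
    costs a factor exp (beta L), so the size of layer d is needed up to o(n / L). Since log (1 /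
    lambda) is only known to lie between 1 / L ^ 2 and D / L ^ 2, lambda may tend to 0 or to 1, and
    the estimates are made relative to 1 - lambda. The upper bound needs no union bound over I: the
    whole sum over I is divided by its conditional mean given the exploration, a ratio of mean 1, so
    Markov's inequality loses only exp (eps n). The parents outside I are absorbed by a term [pad]
    added to each factor. In the lower bound, I must be a function of the exploration, so that its
    edges to the unexplored vertices are still fresh. *)

Set Implicit Arguments.
Unset Strict Implicit.
Unset Printing Implicit Defensive.

Local Open Scope ring_scope.

(** * Random edge sets and breadth-first exploration *)

Section expectation.
Variables (R : realType) (T : finType) (q : R).
Implicit Types (P K G H : {set T}) (f g h : {set T} -> R).

Definition wt P G : R := \prod_(e in P) (if e \in G then q else 1 - q).

(** The expectation of f over a random subset of P. The ground set is a parameter so that edges can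
    be exposed in two stages ([ex_split]); the algebraic rules hold for every real q, while
    comparisons need q to be a probability. *)
Definition ex P f : R := \sum_(G : {set T} | G \subset P) wt P G * f G.

Lemma eq_ex P f g : (forall G, G \subset P -> f G = g G) -> ex P f = ex P g.
Proof. by move=> fg; apply: eq_bigr => G GP; rewrite fg. Qed.

(** Fubini: a subset of P is the disjoint union of its traces on K and on P :\: K, and the weight is
    a product over elements. *)
Lemma ex_split K P f : K \subset P ->
  ex P f = ex K (fun G1 => ex (P :\: K) (fun G2 => f (G1 :|: G2))).
Proof.
move=> KP; rewrite /ex.
under [RHS]eq_bigr do rewrite big_distrr.
rewrite pair_big_dep /=.
rewrite (reindex_onto (fun p : {set T} * {set T} => p.1 :|: p.2)
  (fun G => (G :&: K, G :\: K))) /=; last by move=> G _; rewrite setID.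
apply: eq_big => [[A B]|[A B]] /=.
  apply/andP/andP => [[/subsetP ABP /eqP[eA eB]]|[/subsetP AK /subsetP BP]].
    rewrite -{1}eA subsetIr; split=> //; rewrite -{}eB; apply/subsetP => x.
    by rewrite in_setD => /andP[xK xAB]; rewrite in_setD xK ABP.
  split; last first.
    apply/eqP; congr pair; apply/setP => x; rewrite !inE.
      have [/AK -> //|xA /=] := boolP (x \in A).
      by have [/BP|//] := boolP (x \in B); rewrite inE => /andP[/negPf->].
    have [xA /=|xA /=] := boolP (x \in A).
      rewrite AK //=; by apply/esym/negbTE/negP => /BP; rewrite inE AK.
    by have [/BP|_] := boolP (x \in B); rewrite ?andbF// inE andbT => /andP[->].
  apply/subsetP => x; rewrite inE => /orP[/AK|/BP]; last by rewrite inE => /andP[].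
  exact: (subsetP KP).
move=> /andP[/subsetP ABP /eqP[eA eB]].
rewrite mulrA; congr (_ * _); rewrite /wt (big_setID K) /= (setIidPr KP).
have AK : A \subset K by rewrite -eA subsetIr.
have BK : B \subset ~: K.
  by rewrite -eB; apply/subsetP => x; rewrite !inE => /andP[].
congr (_ * _); apply: eq_bigr => e.
  move=> eK; rewrite inE; have [//|_/=] := boolP (e \in A).
  by have [/(subsetP BK)|//] := boolP (e \in B); rewrite inE eK.
rewrite inE => /andP[eK _]; rewrite inE.
by have [/(subsetP AK)|//] := boolP (e \in A); rewrite (negPf eK).
Qed.

Lemma ex_set0 f : ex set0 f = f set0.
Proof.
rewrite /ex (big_pred1 set0) => [|G]; last by rewrite subset0.
by rewrite /wt big_set0 mul1r.
Qed.

Lemma ex_set1 e f : ex [set e] f = q * f [set e] + (1 - q) * f set0.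
Proof.
rewrite /ex (bigD1 [set e]) //= (bigD1 set0) /=; last first.
  by rewrite sub0set eq_sym -cards_eq0 cards1.
rewrite big1 => [|G]; last first.
  by rewrite subset1 => /andP[/andP[/orP[] /eqP ->]]; rewrite eqxx.
by rewrite /wt !big_set1 !inE eqxx addr0.
Qed.

Lemma exD P f g : ex P (fun G => f G + g G) = ex P f + ex P g.
Proof. by rewrite -big_split; apply: eq_bigr => G _; rewrite mulrDr. Qed.

Lemma exZ P c f : ex P (fun G => c * f G) = c * ex P f.
Proof. by rewrite big_distrr; apply: eq_bigr => G _; rewrite /= mulrCA. Qed.

Lemma exZr P c f : ex P (fun G => f G * c) = ex P f * c.
Proof. by rewrite mulrC -exZ; apply: eq_ex => G _; rewrite mulrC. Qed.

Lemma exN P f : ex P (fun G => - f G) = - ex P f.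
Proof. by rewrite -mulN1r -exZ; apply: eq_ex => G _; rewrite mulN1r. Qed.

Lemma exB P f g : ex P (fun G => f G - g G) = ex P f - ex P g.
Proof. by rewrite exD exN. Qed.

Lemma ex_sum (I : Type) (r : seq I) (Q : pred I) P (F : I -> {set T} -> R) :
  ex P (fun G => \sum_(i <- r | Q i) F i G) = \sum_(i <- r | Q i) ex P (F i).
Proof.
by rewrite exchange_big; apply: eq_bigr => G _; rewrite big_distrr.
Qed.

Lemma ex1 P : ex P (fun=> 1) = 1.
Proof.
elim: {P}_.+1 {-2}P (ltnSn #|P|) => // n IH P Pn.
have [->|[e eP]] := set_0Vmem P; first by rewrite ex_set0.
rewrite (@ex_split [set e]) ?sub1set// ex_set1 IH ?IH; first by ring.
all: by move: Pn; rewrite (cardsD1 e) eP.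
Qed.

Lemma ex_const P c : ex P (fun=> c) = c.
Proof. by rewrite -[c in LHS]mulr1 exZ ex1 mulr1. Qed.

Hypothesis q01 : 0 <= q <= 1.

Lemma wt_ge0 P G : 0 <= wt P G.
Proof.
apply: prodr_ge0 => e _; case/andP: q01 => q0 q1.
by case: ifP; rewrite ?subr_ge0.
Qed.

Lemma ex_le P f g : (forall G, G \subset P -> f G <= g G) -> ex P f <= ex P g.
Proof. by move=> fg; apply: ler_sum => G GP; rewrite ler_wpM2l ?wt_ge0 ?fg. Qed.

Lemma ex_ge0 P f : (forall G, G \subset P -> 0 <= f G) -> 0 <= ex P f.
Proof. by move=> fg; rewrite -(ex_const P 0); exact: ex_le. Qed.

End expectation.

(** * Independence over disjoint sets of edges *)

Section independence.
Variables (R : realType) (T : finType) (q : R).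
Implicit Types (P K G H : {set T}) (f g h : {set T} -> R).
Local Notation ex := (ex q).

Lemma ex_local K P f : K \subset P -> (forall G, f G = f (G :&: K)) ->
  ex P f = ex K f.
Proof.
move=> KP fK; rewrite (ex_split q _ KP); apply: eq_ex => G GK.
rewrite -[RHS](ex_const q (P :\: K)); apply: eq_ex => G' G'P.
rewrite fK [RHS]fK; congr f; apply/setP => x; rewrite !inE.
by have [/(subsetP G'P)|] := boolP (x \in G');
  rewrite ?orbF// inE => /andP[/negPf->]; rewrite !andbF.
Qed.

Lemma ex_indep K P f h : K \subset P ->
  (forall G, f G = f (G :&: K)) -> (forall G, h G = h (G :\: K)) ->
  ex P (fun G => f G * h G) = ex P f * ex P h.
Proof.
move=> KP fK hK; rewrite (ex_local KP fK).
have hK' : forall G, h G = h (G :&: (~: K)) by move=> G; rewrite hK setDE.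
have -> : ex P h = ex (P :\: K) h.
  rewrite (@ex_split _ _ q (P :\: K)) ?subsetDl//; apply: eq_ex => G GPK.
  rewrite -[RHS](ex_const q (P :\: (P :\: K))); apply: eq_ex => G'.
  move=> /subsetP G'P; rewrite hK [RHS]hK; congr h; apply/setP => x.
  rewrite !inE; have [xK//|xK/=] := boolP (x \in K).
  have [/G'P|] := boolP (x \in G'); rewrite ?orbF// !inE xK /= => /andP[].
  by move=> /negPf->.
rewrite (ex_split q _ KP) mulrC -exZ; apply: eq_ex => G GK.
rewrite mulrC -exZ; apply: eq_ex => G' G'P.
rewrite fK hK; congr (f _ * h _); apply/setP => x; rewrite !inE.
  have [/(subsetP GK)->//|xG/=] := boolP (x \in G).
  by have [/(subsetP G'P)|//] := boolP (x \in G'); rewrite inE => /andP[/negPf->].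
have [/(subsetP G'P)|xG'] := boolP (x \in G').
  by rewrite inE orbT => /andP[->].
by rewrite orbF; apply/negbTE/negP => /andP[/negP xK /(subsetP GK)].
Qed.

(** The mean of g under Binomial(s, q), unfolded along the first trial: no binomial coefficients
    appear, and identities follow by induction on s. *)
Fixpoint binex (s : nat) (g : nat -> R) : R :=
  if s is s'.+1 then q * binex s' (g \o S) + (1 - q) * binex s' g else g 0%N.

Lemma ex_card K (g : nat -> R) : ex K (fun G => g #|G|) = binex #|K| g.
Proof.
move: {-2}#|K| (erefl #|K|) => n; elim: n K g => [|n IH] K g.
  by move/esym/eqP; rewrite cards_eq0 => /eqP->; rewrite ex_set0 cards0.
have [->|[e eK]] := set_0Vmem K; first by rewrite cards0.
rewrite (cardsD1 e) eK add1n => -[Kn].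
rewrite (@ex_split _ _ q [set e]) ?sub1set// ex_set1 /=; congr (_ * _ + _ * _).
  rewrite -(IH _ (g \o S) Kn); apply: eq_ex => G /subsetP GK /=.
  rewrite cardsU1; have [/GK|//] := boolP (e \in G).
  by rewrite !inE eqxx.
by rewrite -(IH _ g Kn); apply: eq_ex => G _; rewrite set0U.
Qed.

End independence.

(** * Breadth-first layers and conditioning on the exploration *)

Section graph_exploration.
Variables (V : finType) (u : V).
Implicit Types (G H : {set {set V}}) (S J B : {set V}) (v w : V).

Definition deg G v S : nat := #|[set w in S | [set v; w] \in G]|.

Definition touch B : {set {set V}} := [set e : {set V} | e :&: B != set0].

Lemma adj_sym G v w : adj G v w = adj G w v.
Proof. by rewrite /adj setUC. Qed.

Fixpoint ball G k : {set V} :=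
  if k is k'.+1 then
    [set v | (v \in ball G k') || [exists w in ball G k', adj G w v]]
  else [set u].

(** The ball of radius k - 1, empty for k = 0: the vertices whose edges have been examined once
    layer k is known. *)
Definition rball G k : {set V} := if k is k'.+1 then ball G k' else set0.

Definition lay G k : {set V} := ball G k :\: rball G k.

(** Exactly what the search has seen when layer k is known: edges from layer k to the outside are
    still unexposed. *)
Definition hist G k : {set {set V}} := G :&: touch (rball G k).

Lemma ballS G k : ball G k \subset ball G k.+1.
Proof. by apply/subsetP => v; rewrite inE => ->. Qed.

Lemma ball_mono G j k : (j <= k)%N -> ball G j \subset ball G k.
Proof.
move=> /subnK <-; elim: (k - j)%N => // i IH.
exact: subset_trans IH (ballS _ _).
Qed.

Lemma rball_mono G k : rball G k \subset ball G k.
Proof. by case: k => [|k]; rewrite ?sub0set// ballS. Qed.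

(** A breadth-first step out of a ball of radius j < k only reads edges that touch this ball, hence
    edges that touch [rball G k]. *)
Lemma ball_agree G H k : G :&: touch (rball G k) = H :&: touch (rball G k) ->
  forall j, (j <= k)%N -> ball H j = ball G j.
Proof.
move=> GH; elim=> // j IH jk; rewrite /= IH ?(ltnW jk)//.
apply/setP => v; rewrite !inE; congr (_ || _).
apply: eq_existsb => w; have [wB/=|//] := boolP (w \in ball G j).
have wt : [set w; v] \in touch (rball G k).
  rewrite inE; apply/set0Pn; exists w; rewrite !inE eqxx/=.
  by case: k jk {GH IH} => // k jk; apply: (subsetP (ball_mono _ _)) wB.
rewrite /adj; have := congr1 (fun A : {set {set V}} => [set w; v] \in A) GH.
by rewrite !in_setI wt !andbT.
Qed.

Lemma rball_agree G H k : G :&: touch (rball G k) = H :&: touch (rball G k) ->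
  rball H k = rball G k.
Proof. by case: k => // k /ball_agree; apply. Qed.

Lemma hist_ball G k j : (j <= k)%N -> ball (hist G k) j = ball G j.
Proof.
apply: ball_agree; rewrite /hist; apply/setP => x; rewrite !inE.
by case: (x \in G); case: (_ != _).
Qed.

Lemma hist_rball G k : rball (hist G k) k = rball G k.
Proof. by case: k => // k; rewrite /= hist_ball. Qed.

Lemma hist_lay G k : lay (hist G k) k = lay G k.
Proof. by rewrite /lay hist_ball// hist_rball. Qed.

Lemma hist_rballj G k j : (j <= k)%N -> rball (hist G k) j = rball G j.
Proof. by case: j => // j jk; rewrite /= hist_ball // ltnW. Qed.

Lemma hist_layj G k j : (j <= k)%N -> lay (hist G k) j = lay G j.
Proof. by move=> jk; rewrite /lay hist_ball// hist_rballj. Qed.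

Lemma hist_deg G k v S : S \subset rball G k -> deg (hist G k) v S = deg G v S.
Proof.
move=> SB; rewrite /deg; congr #|pred_of_set _|; apply/setP => w; rewrite !inE.
have [wS/=|//] := boolP (w \in S); suff -> : [set v; w] :&: rball G k != set0.
  by rewrite andbT.
by apply/set0Pn; exists w; rewrite !inE eqxx orbT (subsetP SB).
Qed.

(** The event that the history equals H depends only on the edges touching the fixed set
    [rball H k], although the explored set is random; this is what allows conditioning on the
    history. *)
Lemma hist_eqE G H k :
  (hist G k == H) = (G :&: touch (rball H k) == H) && (hist H k == H).
Proof.
apply/eqP/andP => [<-|[/eqP GH /eqP HH]].
  by rewrite hist_rball eqxx /hist hist_rball -setIA setIid eqxx.
have GH' : H :&: touch (rball H k) = G :&: touch (rball H k).
  by rewrite GH.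
by rewrite /hist (rball_agree GH').
Qed.

Variables (R : realType) (q : R).
Local Notation exG := (ex q (pairs V)).
Local Notation binex := (binex q).

Lemma star_card v S : v \notin S -> #|[set [set v; w] | w in S]| = #|S|.
Proof.
move=> vS; apply: card_in_imset => w w' wS w'S /setP/(_ w).
rewrite !inE eqxx orbT => /esym/orP[/eqP wv|/eqP//].
by rewrite wv in wS; rewrite wS in vS.
Qed.

Lemma deg_star G v S : v \notin S ->
  deg G v S = #|G :&: [set [set v; w] | w in S]|.
Proof.
move=> vS; rewrite /deg -(@star_card v); last by rewrite inE (negPf vS).
congr #|pred_of_set _|; apply/setP => e; rewrite !inE.
apply/imsetP/andP => [[w]|[eG /imsetP[w wS ew]]].
  by rewrite inE => /andP[wS wG] ->; split=> //; apply/imsetP; exists w.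
by exists w => //; rewrite inE wS -ew.
Qed.

Lemma star_pairs v S : v \notin S ->
  [set [set v; w] | w in S] \subset pairs V.
Proof.
move=> vS; apply/subsetP => e /imsetP[w wS ->].
by rewrite inE cards2; have [vw|//] := eqVneq v w; rewrite -vw (negPf vS) in wS.
Qed.

(** The stars from the vertices of J to S are pairwise disjoint sets of edges that avoid B, so the
    degrees are independent binomials, independent of Phi. One star is peeled off at a time. *)
Lemma ex_star B S J (Phi : {set {set V}} -> R) (g : V -> nat -> R) :
  [disjoint J & S] -> [disjoint J & B] -> [disjoint S & B] ->
  (forall G, Phi G = Phi (G :&: touch B)) ->
  exG (fun G => Phi G * \prod_(v in J) g v (deg G v S)) =
  exG Phi * \prod_(v in J) binex #|S| (g v).
Proof.
move=> JS JB SB PhiB.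
move: {-2}#|J| (erefl #|J|) => n; elim: n J JS JB => [|n IH] J JS JB.
  move=> /esym/eqP; rewrite cards_eq0 => /eqP->; rewrite big_set0 mulr1.
  by apply: eq_ex => G _; rewrite big_set0 mulr1.
have [->|[v vJ]] := set_0Vmem J; first by rewrite cards0.
rewrite (cardsD1 v) vJ add1n => -[Jn].
have vS : v \notin S by rewrite (disjointFr JS).
have DJ : J :\ v \subset J by rewrite subsetDl.
set K := [set [set v; w] | w in S].
have KP : K \subset pairs V by exact: star_pairs.
transitivity (exG (fun G => g v (deg G v S) *
    (Phi G * \prod_(w in J :\ v) g w (deg G w S)))).
  apply: eq_ex => G _; rewrite (big_setD1 v)//= mulrCA; congr (_ * _).
rewrite (ex_indep _ KP); first last.
- move=> G; congr (_ * _).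
    rewrite PhiB [RHS]PhiB; congr Phi; apply/setP => e; rewrite !inE.
    have [/imsetP[w wS ->]|//] := boolP (e \in K).
    suff -> : ([set v; w] :&: B != set0) = false by rewrite !andbF.
    apply/negbTE; rewrite negbK; apply/eqP/setP => x; rewrite !inE.
    apply/negbTE/negP => /andP[/orP[/eqP->|/eqP->]].
      by rewrite (disjointFr JB).
    by rewrite (disjointFr SB).
  apply: eq_bigr => w; rewrite !inE => /andP[wv wJ]; congr (g w).
  rewrite /deg; congr #|pred_of_set _|; apply/setP => x; rewrite !inE.
  have [xS/=|//] := boolP (x \in S).
  suff -> : ([set w; x] \in K) = false by [].
  apply/negbTE/imsetP => -[y yS] /setP/(_ w); rewrite !inE eqxx/=.
  rewrite (negPf wv)/= => /esym/eqP wy; move: yS.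
  by rewrite -wy (disjointFr JS).
- by move=> G; rewrite !deg_star// -setIA setIid.
rewrite IH//; try by rewrite (disjointWl DJ).
rewrite [in RHS](big_setD1 v)//= mulrCA; congr (_ * _).
rewrite -[in RHS](star_card vS) -ex_card -/K.
rewrite (ex_local _ KP) => [|G]; last by rewrite !deg_star// -setIA setIid.
congr (_ * _); last by rewrite star_card.
by apply: eq_ex => G GK; rewrite deg_star// (setIidPl GK).
Qed.

(** The sum is split over the value H of the history, on which Phi, S, J and g are frozen; [ex_star]
    then applies with B := [rball H k]. *)
Lemma ex_cond k (Phi : {set {set V}} -> R) (S J : {set {set V}} -> {set V})
    (g : {set {set V}} -> V -> nat -> R) :
  (forall G, [disjoint J G & S G]) ->
  (forall G, [disjoint J G & rball G k]) ->
  (forall G, [disjoint S G & rball G k]) ->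
  (forall G, Phi (hist G k) = Phi G) -> (forall G, S (hist G k) = S G) ->
  (forall G, J (hist G k) = J G) -> (forall G, g (hist G k) = g G) ->
  exG (fun G => Phi G * \prod_(v in J G) g G v (deg G v (S G))) =
  exG (fun G => Phi G * \prod_(v in J G) binex #|S G| (g G v)).
Proof.
move=> JS JB SB PhiH SH JH gH.
have histE (F : {set {set V}} -> R) :
    exG F = \sum_(H : {set {set V}}) exG (fun G => (hist G k == H)%:R * F G).
  rewrite -ex_sum; apply: eq_ex => G _; rewrite (bigD1 (hist G k))//= eqxx mul1r.
  by rewrite big1 ?addr0// => H; rewrite eq_sym => /negPf->; rewrite mulr0n mul0r.
rewrite histE [RHS]histE; apply: eq_bigr => H _.
transitivity (exG (fun G => (hist G k == H)%:R * Phi H *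
    \prod_(v in J H) g H v (deg G v (S H)))).
  apply: eq_ex => G _; case: eqP => [<-|_]; rewrite ?mulr0n ?mul0r// !mulr1n !mul1r.
  by rewrite PhiH SH JH gH.
rewrite (@ex_star (rball H k)) => [| | | |G].
- rewrite -exZr; apply: eq_ex => G _.
  case: eqP => [<-|_]; rewrite ?mulr0n ?mul0r// !mulr1n !mul1r.
  by rewrite PhiH SH JH gH.
- exact: JS.
- exact: JB.
- exact: SB.
- by rewrite [in LHS]hist_eqE [in RHS]hist_eqE -setIA setIid.
Qed.

Lemma prod_setI1 (A : {set V}) v (h : V -> R) : v \in A ->
  \prod_(w in [set v] :&: A) h w = h v.
Proof. by move=> vA; rewrite (setIidPl _) ?sub1set// big_set1. Qed.

(** Turns a sum over a random set into a sum over fixed v of products over a random set, the shape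
    that [ex_cond] accepts. *)
Lemma sum_in (A : {set V}) (h : V -> R) : \sum_(v in A) h v =
  \sum_(v : V) (v \in A)%:R * \prod_(w in [set v] :&: A) h w.
Proof.
rewrite big_mkcond; apply: eq_bigr => v _.
by case: ifP => vA; rewrite ?mulr1n ?mulr0n ?mul0r// mul1r prod_setI1.
Qed.

Lemma ex_cond1 k (Phi : {set {set V}} -> R) (S J : {set {set V}} -> {set V})
    (g : {set {set V}} -> nat -> R) :
  (forall G, [disjoint J G & S G]) ->
  (forall G, [disjoint J G & rball G k]) ->
  (forall G, [disjoint S G & rball G k]) ->
  (forall G, Phi (hist G k) = Phi G) -> (forall G, S (hist G k) = S G) ->
  (forall G, J (hist G k) = J G) -> (forall G, g (hist G k) = g G) ->
  exG (fun G => Phi G * \sum_(v in J G) g G (deg G v (S G))) =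
  exG (fun G => Phi G * (#|J G|%:R * binex #|S G| (g G))).
Proof.
move=> JS JB SB PhiH SH JH gH.
transitivity (exG (fun G => \sum_(v : V) (v \in J G)%:R * Phi G *
    \prod_(w in [set v] :&: J G) g G (deg G w (S G)))).
  apply: eq_ex => G _; rewrite sum_in mulr_sumr; apply: eq_bigr => v _.
  by rewrite mulrCA mulrA.
transitivity (exG (fun G => \sum_(v : V) (v \in J G)%:R * Phi G *
    \prod_(w in [set v] :&: J G) binex #|S G| (g G))); last first.
  apply: eq_ex => G _; rewrite mulr_natl -sumr_const sum_in mulr_sumr.
  by apply: eq_bigr => v _; rewrite mulrCA mulrA.
rewrite !ex_sum; apply: eq_bigr => v _.
apply: (@ex_cond k _ S (fun G => [set v] :&: J G) (fun G _ => g G)) => // G.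
- by apply: disjointWl (JS G); rewrite subsetIr.
- by apply: disjointWl (JB G); rewrite subsetIr.
- by rewrite PhiH JH.
- by rewrite JH.
- by rewrite gH.
Qed.

(* Given the history, the degrees are independent, so only the diagonal terms
   of the square survive. *)
Lemma ex_cond_var k (S J : {set {set V}} -> {set V}) (g : nat -> R) :
  (forall G, [disjoint J G & S G]) ->
  (forall G, [disjoint J G & rball G k]) ->
  (forall G, [disjoint S G & rball G k]) ->
  (forall G, S (hist G k) = S G) -> (forall G, J (hist G k) = J G) ->
  exG (fun G => (\sum_(v in J G) g (deg G v (S G))
                 - #|J G|%:R * binex #|S G| g) ^+ 2) =
  exG (fun G => #|J G|%:R
                 * binex #|S G| (fun i => (g i - binex #|S G| g) ^+ 2)).
Proof.
move=> JS JB SB SH JH.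
pose h G i := g i - binex #|S G| g.
have bl c s : forall g1 : nat -> R, binex s (fun i => g1 i - c) = binex s g1 - c.
  elim: s => [|s IH] g1 //=.
  by rewrite -[(fun i => g1 i - c) \o _]/(fun i => (g1 \o succn) i - c) !IH; ring.
have hH G : h (hist G k) = h G by rewrite /h SH.
have h0 G : binex #|S G| (h G) = 0 by rewrite bl subrr.
transitivity (exG (fun G => \sum_(v : V) \sum_(w : V)
    ((v \in J G) && (w \in J G))%:R *
    (h G (deg G v (S G)) * h G (deg G w (S G))))).
  apply: eq_ex => G _; rewrite mulr_natl -sumr_const -sumrB expr2 mulr_suml.
  rewrite big_mkcond; apply: eq_bigr => v _; rewrite mulr_sumr big_mkcond.
  case: (v \in J G) => /=; last first.
    by rewrite big1// => w _; rewrite mulr0n mul0r.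
  by apply: eq_bigr => w _; case: (w \in J G); rewrite ?mulr0n ?mulr1n ?mul0r ?mul1r.
transitivity (exG (fun G => 1 * \sum_(v in J G) (fun i => h G i ^+ 2) (deg G v (S G)))).
  rewrite ex_sum; under eq_bigr do rewrite ex_sum.
  transitivity (exG (fun G => \sum_(v : V) (v \in J G)%:R * h G (deg G v (S G)) ^+ 2)).
    rewrite ex_sum; apply: eq_bigr => v _; rewrite (bigD1 v)//= [X in _ + X]big1 ?addr0.
      by apply: eq_ex => G _; rewrite andbb expr2.
    move=> w wv.
    transitivity (exG (fun G => ((v \in J G) && (w \in J G))%:R *
       \prod_(x in [set v; w] :&: J G) h G (deg G x (S G)))).
      apply: eq_ex => G _.
      have [vJ/=|] := boolP (v \in J G); last by rewrite mulr0n !mul0r.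
      have [wJ/=|] := boolP (w \in J G); last by rewrite mulr0n !mul0r.
      congr (_ * _); rewrite (setIidPl _); last first.
        by apply/subsetP => x; rewrite !inE => /orP[] /eqP->.
      by rewrite (big_setD1 v) ?inE ?eqxx//= (big_setD1 w) ?inE ?eqxx ?orbT ?wv//=
        big1 ?mulr1// => x; rewrite !inE => /and3P[/negPf-> /negPf->].
    rewrite (@ex_cond k _ S (fun G => [set v; w] :&: J G) (fun G _ => h G)) => //.
    - rewrite -(ex_const q (pairs V) 0); apply: eq_ex => G _.
      have [vJ/=|] := boolP (v \in J G); last by rewrite mulr0n !mul0r.
      by rewrite (bigD1 v) ?inE ?eqxx//= h0 mul0r mulr0.
    - by move=> G; apply: disjointWl (JS G); rewrite subsetIr.
    - by move=> G; apply: disjointWl (JB G); rewrite subsetIr.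
    - by move=> G; rewrite JH.
    - by move=> G; rewrite JH.
    - by move=> G; rewrite hH.
  apply: eq_ex => G _; rewrite mul1r [RHS]big_mkcond.
  by apply: eq_bigr => v _; case: (v \in J G); rewrite ?mulr0n ?mulr1n ?mul1r ?mul0r.
rewrite (@ex_cond1 k (fun=> 1) S J (fun G i => h G i ^+ 2)) => //.
  by apply: eq_ex => G _; rewrite mul1r.
by move=> G; rewrite hH.
Qed.

End graph_exploration.

(** * Spanning trees *)

Section distance.
Variables (V : finType) (u : V).
Implicit Types (G T : {set {set V}}) (v w : V).

Lemma has_walkP G k v :
  reflect (exists p, [/\ size p = k, path (adj G) u p & last u p = v])
    (has_walk G k u v).
Proof.
apply: (iffP existsP) => [[p /andP[Gp /eqP pv]]|[p [pk Gp pv]]].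
  by exists p; rewrite size_tuple.
by exists (tcast pk (in_tuple p)); rewrite val_tcast Gp pv/=.
Qed.

Lemma has_walk0 G v : has_walk G 0 u v = (v == u).
Proof.
apply/has_walkP/eqP => [[p [/size0nil-> _ /=]]//|->].
by exists [::].
Qed.

Lemma has_walkS G k v :
  has_walk G k.+1 u v = [exists w, has_walk G k u w && adj G w v].
Proof.
apply/has_walkP/existsP => [[p]|[w /andP[/has_walkP[p [pk Gp pw]] wv]]].
  case/lastP: p => [|p x] [] //; rewrite size_rcons last_rcons rcons_path.
  move=> [pk] /andP[Gp lx] <-; exists (last u p); rewrite lx andbT.
  by apply/has_walkP; exists p.
exists (rcons p v); rewrite size_rcons pk last_rcons rcons_path Gp pw.
by split.
Qed.

Lemma ballP G k v :
  reflect (exists2 j, (j <= k)%N & has_walk G j u v) (v \in ball u G k).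
Proof.
elim: k v => [|k IH] v /=.
  rewrite inE; apply: (iffP eqP) => [->|[[|//] _]].
    by exists 0%N => //; rewrite has_walk0.
  by rewrite has_walk0 => /eqP.
rewrite inE; apply: (iffP orP) => [[/IH[j jk]|]|[[|j] jk vj]].
- by exists j => //; exact: leqW.
- move=> /existsP[w /andP[/IH[j jk wj] wv]]; exists j.+1 => //.
  by rewrite has_walkS; apply/existsP; exists w; rewrite wj.
- by left; apply/IH; exists 0%N.
- right; move: vj; rewrite has_walkS => /existsP[w /andP[wj wv]].
  by apply/existsP; exists w; rewrite wv andbT; apply/IH; exists j.
Qed.

Lemma component_walk G v : v \in component G u ->
  exists2 k, (k < #|V|)%N & has_walk G k u v.
Proof.
rewrite inE => /connectP[p Gp ->]; case/shortenP: Gp => p' Gp' up' _.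
exists (size p'); last by apply/has_walkP; exists p'.
have := max_card (mem (u :: p')); rewrite (card_uniqP up')/=.
exact.
Qed.

Lemma gdist_walk G v : v \in component G u -> has_walk G (gdist G u v) u v.
Proof.
move=> /component_walk[k kV vk].
have vi : has (fun k => has_walk G k u v) (iota 0 #|V|).
  by apply/hasP; exists k => //; rewrite mem_iota.
have := nth_find 0%N vi; rewrite nth_iota//.
by move: vi; rewrite has_find size_iota.
Qed.

Lemma gdist_le G k v : has_walk G k u v -> (gdist G u v <= k)%N.
Proof.
move=> vk; have [kV|Vk] := ltnP k #|V|.
  rewrite leqNgt; apply/negP => kd.
  by have := before_find 0%N kd; rewrite nth_iota// add0n vk.
by apply: leq_trans Vk; rewrite -[leqRHS](size_iota 0); exact: find_size.
Qed.

Lemma walk_component G k v : has_walk G k u v -> v \in component G u.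
Proof.
by move=> /has_walkP[p [_ Gp <-]]; rewrite inE; apply/connectP; exists p.
Qed.

Lemma ball_gdist G k v :
  (v \in ball u G k) = (v \in component G u) && (gdist G u v <= k)%N.
Proof.
apply/ballP/andP => [[j jk vj]|[vC vk]].
  by split; [exact: walk_component vj | exact: leq_trans (gdist_le vj) jk].
by exists (gdist G u v) => //; exact: gdist_walk.
Qed.

Lemma lay_gdist G k v :
  (v \in lay u G k) = (v \in component G u) && (gdist G u v == k).
Proof.
rewrite /lay inE ball_gdist; case: k => [|k] /=.
  by rewrite inE leqn0.
rewrite ball_gdist; case: (_ \in _) => //=.
by rewrite -ltnNge eqn_leq andbC.
Qed.

Lemma layer_sizeE G k : layer_size G u (Posz k) = #|lay u G k|.
Proof.
rewrite /layer_size; congr #|pred_of_set _|; apply/setP => v.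
by rewrite lay_gdist in_set.
Qed.

Lemma gdist_root G : gdist G u u = 0%N.
Proof. by apply/eqP; rewrite -leqn0; apply: gdist_le; rewrite has_walk0. Qed.

Lemma root_component G : u \in component G u.
Proof. by rewrite inE connect0. Qed.

Lemma adj_component G v w : v \in component G u -> adj G v w ->
  w \in component G u.
Proof.
rewrite !inE => uv vw; apply: connect_trans uv _; exact: connect1.
Qed.

Lemma gdist_adj G v w : v \in component G u -> adj G v w ->
  (gdist G u w <= (gdist G u v).+1)%N.
Proof.
move=> vC vw; apply: gdist_le; rewrite has_walkS; apply/existsP; exists v.
by rewrite vw gdist_walk.
Qed.

Lemma gdist_parent G v : v \in component G u -> v != u ->
  exists w, [&& w \in component G u, adj G w v
    & gdist G u v == (gdist G u w).+1].
Proof.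
move=> vC vu; have := gdist_walk vC.
case d : (gdist G u v) => [|k].
  by rewrite has_walk0 (negPf vu).
rewrite has_walkS => /existsP[w /andP[wk wv]]; exists w.
have wC := walk_component wk.
rewrite wC wv/= eqn_leq ltnS; apply/andP; split; last exact: gdist_le wk.
by rewrite -ltnS -d; exact: gdist_adj.
Qed.

Lemma has_walk_sub G T k v : T \subset G -> has_walk T k u v -> has_walk G k u v.
Proof.
move=> TG /has_walkP[p [pk Tp pv]]; apply/has_walkP; exists p; split=> //.
by apply: sub_path Tp => x y; rewrite /adj => /(subsetP TG).
Qed.

End distance.

(** * Spanning trees as parent maps *)

Section trees.
Variables (V : finType) (u : V) (G : {set {set V}}).
Implicit Types (T : {set {set V}}) (v w : V) (p : {ffun V -> V}).
Local Notation C := (component G u).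

Definition parent_tree p : {set {set V}} := [set [set v; p v] | v in C :\ u].

Lemma mem_parent_tree p v w : [set v; w] \in parent_tree p -> v != w ->
  (v \in C :\ u /\ w = p v) \/ (w \in C :\ u /\ v = p w).
Proof.
move=> /imsetP[x xC vw] nvw.
have := congr1 (fun A : {set V} => v \in A) vw.
have := congr1 (fun A : {set V} => w \in A) vw.
rewrite !in_set2 !eqxx orbT /= => /esym/orP[/eqP wx|/eqP wp].
  move=> /esym/orP[/eqP vx|/eqP vp]; first by rewrite wx vx eqxx in nvw.
  by right; rewrite wx.
move=> /esym/orP[/eqP vx|/eqP vp]; last by rewrite wp vp eqxx in nvw.
by left; rewrite vx.
Qed.

Section decreasing.
Variables (h : V -> nat) (p : {ffun V -> V}).
Hypothesis pP : forall v, v \in C -> v != u ->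
  [/\ p v \in C, adj G v (p v) & (h (p v) < h v)%N].

Lemma parent_tree_ball v : v \in C -> v \in ball u (parent_tree p) (h v).
Proof.
have [k] := ubnP (h v); elim: k v => // k IH v hv vC.
have [->|vu] := eqVneq v u.
  by apply: (subsetP (ball_mono u _ (leq0n _))); rewrite inE.
have [pC _ pv] := pP vC vu.
apply: (subsetP (ball_mono u _ pv)).
rewrite /= inE; apply/orP; right; apply/existsP; exists (p v).
rewrite (IH _ (leq_trans pv hv) pC) /=.
by rewrite adj_sym /adj; apply/imsetP; exists v => //; rewrite in_setD1 vu.
Qed.

(** Acyclicity comes from the heights: on a cycle, the vertex of largest height can only be joined
    to its own parent, yet it has two distinct neighbours on the cycle. *)
Lemma parent_tree_spanning : spanning_tree G u (parent_tree p).
Proof.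
have conn v : v \in C -> connect (adj (parent_tree p)) u v.
  by move=> /parent_tree_ball/ballP[j _ /walk_component]; rewrite inE.
have symT : connect_sym (adj (parent_tree p)).
  by apply: sym_connect_sym => v w; rewrite adj_sym.
split.
- apply/subsetP => e /imsetP[v]; rewrite in_setD1 => /andP[vu vC] ->.
  by have [] := pP vC vu.
- move=> e /imsetP[v]; rewrite in_setD1 => /andP[vu vC] ->.
  have [pC _ _] := pP vC vu.
  by apply/subsetP => x; rewrite in_set2 => /orP[] /eqP->.
- move=> v w vC wC; apply: (@connect_trans _ _ u); last exact: conn.
  by rewrite symT conn.
- move=> c uc; rewrite leqNgt; apply/negP => c3.
  have [x0 x0c] : exists x, x \in c.
    by case: c c3 {uc} => // x c _; exists x; rewrite mem_head.
  have [v vc vmax] : exists2 v, v \in c & forall w, w \in c -> (h w <= h v)%N.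
    by case: (@arg_maxnP _ x0 (mem c) h x0c) => v vc vm; exists v.
  have [i s cs] := rot_to vc.
  have : ucycle (adj (parent_tree p)) (rot i c) by rewrite rot_ucycle.
  have : size (rot i c) = size c by rewrite size_rot.
  have memc x : x \in v :: s -> x \in c by rewrite -cs mem_rot.
  rewrite cs => ss /andP[].
  case: s ss memc {cs} => [|x s] /=; first by lia.
  case/lastP: s => [|s y] /= ss memc; first by lia.
  rewrite !rcons_path last_rcons => /andP[vx /andP[_ yv]].
  rewrite !inE !mem_rcons !inE !negb_or => /andP[/and3P[nvx nvy _]].
  move=> /andP[/andP[nxy _] _].
  have par z : z \in c -> adj (parent_tree p) v z -> v != z -> z = p v.
    move=> zc vz nvz; have [[_ //]|[zC vp]] := mem_parent_tree vz nvz.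
    move: zC; rewrite in_setD1 => /andP[zu zC].
    have [_ _] := pP zC zu; rewrite -vp => hv.
    by rewrite ltnNge vmax in hv.
  move: nxy; rewrite (par x) ?memc ?inE ?eqxx ?orbT//.
  by rewrite (par y) ?eqxx ?memc ?inE ?mem_rcons ?inE ?eqxx ?orbT// adj_sym.
Qed.

Lemma parent_tree_gdist v : v \in C -> (gdist (parent_tree p) u v <= h v)%N.
Proof.
by move=> /parent_tree_ball; rewrite ball_gdist => /andP[].
Qed.

End decreasing.

(** By induction on the height: the edge from v to p' v lies in the tree of p, so either p v = p' v,
    or v is the parent of p' v under p, hence under p' by induction, and the height would decrease
    twice and return to v. *)
Lemma parent_tree_inj (h : V -> nat) p p' :
  (forall v, v \in C -> v != u ->
    [/\ p v \in C, adj G v (p v) & (h (p v) < h v)%N]) ->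
  (forall v, v \in C -> v != u ->
    [/\ p' v \in C, adj G v (p' v) & (h (p' v) < h v)%N]) ->
  parent_tree p = parent_tree p' ->
  forall v, v \in C -> v != u -> p v = p' v.
Proof.
move=> pP p'P pp' v; have [k] := ubnP (h v); elim: k v => // k IH v hv vC vu.
have [p'C _ p'v] := p'P _ vC vu.
have vp' : [set v; p' v] \in parent_tree p.
  by rewrite pp'; apply/imsetP; exists v => //; rewrite in_setD1 vu.
have nv : v != p' v by apply/eqP => e; rewrite -e ltnn in p'v.
have [[_ //]|[wC vp]] := mem_parent_tree vp' nv.
move: wC; rewrite in_setD1 => /andP[wu wC].
have e := IH _ (leq_trans p'v hv) wC wu.
have [_ _] := p'P _ wC wu; rewrite -e -vp => h2.
by have := ltn_trans p'v h2; rewrite ltnn.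
Qed.

Variable R : realType.
Implicit Type c : R.

Definition treeZ c : R :=
  \sum_(T : {set {set V}} | `[< spanning_tree G u T >])
    expR (- (c * (\sum_(v in C) gdist T u v)%N%:R)).

(** Every choice of parents in the sets O v is a spanning tree, distinct choices give distinct
    trees, and depths are at most h; so the product counts trees whose weight is at least the
    exponential. *)
Lemma treeZ_ge c (h : V -> nat) (O : V -> {set V}) : 0 <= c ->
  (forall v w, v \in C -> v != u -> w \in O v ->
    [/\ w \in C, adj G v w & (h w < h v)%N]) ->
  \prod_(v in C :\ u) #|O v|%:R * expR (- (c * (\sum_(v in C) h v)%N%:R))
    <= treeZ c.
Proof.
move=> c0 OP.
(* Off C :\ u the parent is frozen to u, so that a map is determined by its tree. *)
pose F (v : V) : {set V} := if v \in C :\ u then O v else [set u].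
have FP (p : {ffun V -> V}) : p \in family F -> forall v, v \in C -> v != u ->
    [/\ p v \in C, adj G v (p v) & (h (p v) < h v)%N].
  move=> /familyP pF v vC vu; apply: OP => //.
  by have := pF v; rewrite /F in_setD1 vu vC.
have -> : \prod_(v in C :\ u) #|O v|%:R = \sum_(p in family F) 1 :> R.
  transitivity (\prod_v \sum_(w in F v) (1 : R)).
    rewrite [LHS]big_mkcond; apply: eq_bigr => v _.
    rewrite /F; case: ifP => vC; rewrite sumr_const ?cards1 //.
  by rewrite bigA_distr_big_dep; apply: eq_bigr => f _; rewrite big1.
rewrite mulr_suml.
have injp : {in family F &, injective parent_tree}.
  move=> p p' pF p'F pp'; apply/ffunP => v.
  have [/andP[vu vC]|nv] := boolP ((v != u) && (v \in C)).
    exact: (parent_tree_inj (FP _ pF) (FP _ p'F) pp').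
  move: pF p'F => /familyP/(_ v) + /familyP/(_ v).
  by rewrite /F in_setD1 (negPf nv) !inE => /eqP-> /eqP->.
pose A := [set parent_tree p | p in family F].
apply: (@le_trans _ _ (\sum_(T in A)
    expR (- (c * (\sum_(v in C) gdist T u v)%N%:R)))).
  rewrite big_imset //=; apply: ler_sum => p pF; rewrite mul1r ler_expR lerN2.
  rewrite ler_wpM2l// ler_nat; apply: leq_sum => v vC.
  exact: (parent_tree_gdist (FP _ pF)).
rewrite /treeZ [leLHS]big_mkcond [leRHS]big_mkcond; apply: ler_sum => T _.
case: ifPn => [/imsetP[p pF ->]|_]; last by case: ifP; rewrite ?expR_ge0.
rewrite ifT//; apply/asboolP; exact: (parent_tree_spanning (FP _ pF)).
Qed.

Definition parent_of T v w :=
  [&& w \in C, adj G w v & gdist T u v == (gdist T u w).+1].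

Definition tree_parent T : {ffun V -> V} :=
  [ffun v => if v \in C :\ u then
     odflt u [pick w | [&& w \in C, adj T w v & gdist T u v == (gdist T u w).+1]]
   else u].

Lemma spanning_component T : spanning_tree G u T -> component T u = C.
Proof.
move=> [TG eC conn _]; apply/setP => v; apply/idP/idP; last first.
  by move=> vC; rewrite inE; apply: conn => //; exact: root_component.
move=> vT; have := gdist_walk vT; move=> /(has_walk_sub TG).
exact: walk_component.
Qed.

Lemma tree_parentP T : spanning_tree G u T -> forall v, v \in C :\ u ->
  [&& tree_parent T v \in C, adj T (tree_parent T v) v
    & gdist T u v == (gdist T u (tree_parent T v)).+1].
Proof.
move=> Tst v vC; rewrite ffunE vC; case: pickP => [w //|no].
move: vC; rewrite in_setD1 => /andP[vu vC].
have := gdist_parent; move/(_ _ u T v); rewrite (spanning_component Tst).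
by move=> /(_ vC vu)[w]; rewrite no.
Qed.

(** An edge of T missing from the tree of parents would close a path of that tree into a cycle of T
    with at least three vertices. *)
Lemma tree_parentK T : G \subset pairs V -> spanning_tree G u T -> parent_tree (tree_parent T) = T.
Proof.
move=> GP Tst; have CT := spanning_component Tst.
have pP := tree_parentP Tst; set p := tree_parent T in pP *.
have [TG eC conn acT] := Tst.
have sub : parent_tree p \subset T.
  apply/subsetP => e /imsetP[v vC ->]; have /and3P[_ + _] := pP _ vC.
  by rewrite adj_sym.
apply/eqP; rewrite eqEsubset sub /=; apply/subsetP => e eT; apply/negPn/negP.
move=> eP.
have hT v : v \in C -> connect (adj (parent_tree p)) u v.
  have [k] := ubnP (gdist T u v); elim: k v => // k IH v vk vC.
  have [->//|vu] := eqVneq v u.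
  have vCu : v \in C :\ u by rewrite in_setD1 vu.
  have /and3P[pC pv /eqP dv] := pP _ vCu.
  apply: (@connect_trans _ _ (p v)); first by apply: IH => //; rewrite dv in vk.
  by apply: connect1; rewrite adj_sym; apply/imsetP; exists v.
have symT : connect_sym (adj (parent_tree p)).
  by apply: sym_connect_sym => v w; rewrite adj_sym.
have /cards2P[a [b [ab eab]]] : #|e| == 2%N.
  by have /(subsetP GP) := subsetP TG _ eT; rewrite inE.
have /subsetP eC' := eC _ eT.
have aC : a \in C by apply: eC'; rewrite eab !inE eqxx.
have bC : b \in C by apply: eC'; rewrite eab !inE eqxx orbT.
have /connectP[s0 Ps0 bs0] : connect (adj (parent_tree p)) a b.
  by apply: (@connect_trans _ _ u); [rewrite symT|]; exact: hT.
case/shortenP: Ps0 bs0 => s Ps us _ bs.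
have : ucycle (adj T) (a :: s).
  rewrite /ucycle us andbT /= rcons_path -bs {2}/adj setUC -eab eT andbT.
  by apply: sub_path Ps => x y; rewrite /adj => /(subsetP sub).
move=> /acT; case: s Ps us bs => [|x [|y s]] //= Ps us bs _.
  by rewrite bs eqxx in ab.
by move: Ps; rewrite andbT -bs /adj -eab (negPf eP).
Qed.

(* A spanning tree is determined by its parent map, so the sum over trees is at
   most a sum over maps, which factorizes. *)
Lemma treeZ_le c (QI : pred {set V}) (It : {set {set V}} -> {set V})
    (om : {set V} -> V -> V -> R) : G \subset pairs V ->
  (forall I v w, 0 <= om I v w) ->
  (forall T, spanning_tree G u T -> QI (It T)) ->
  (forall T p, spanning_tree G u T ->
    (forall v, v \in C :\ u -> parent_of T v (p v)) ->
    (forall v, v \notin C :\ u -> p v = u) ->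
    expR (- (c * (\sum_(v in C) gdist T u v)%N%:R)) <= \prod_v om (It T) v (p v)) ->
  treeZ c <= \sum_(I : {set V} | QI I) \prod_v \sum_w om I v w.
Proof.
move=> GP om0 QIt omP.
under [leRHS]eq_bigr do rewrite bigA_distr_bigA.
rewrite pair_big_dep /=.
pose D := [set T : {set {set V}} | `[< spanning_tree G u T >]].
pose f T := (It T, tree_parent T).
have injf : {in D &, injective f}.
  move=> T T'; rewrite !inE => /asboolP Tst /asboolP T'st [_ e].
  by rewrite -(tree_parentK GP Tst) e tree_parentK.
rewrite /treeZ; apply: (@le_trans _ _ (\sum_(T in D)
    \prod_v om (f T).1 v ((f T).2 v))).
  rewrite [leRHS](eq_bigl (fun T => `[< spanning_tree G u T >])) => [|T]; last first.
    by rewrite inE.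
  apply: ler_sum => T /asboolP Tst; apply: omP => // v vC.
    have /and3P[a b d] := tree_parentP Tst vC; rewrite /parent_of a d andbT/=.
    by have [TG _ _ _] := Tst; apply: (subsetP TG).
  by rewrite ffunE (negPf vC).
rewrite -(big_imset (fun x : {set V} * {ffun V -> V} =>
  \prod_v om x.1 v (x.2 v)) injf) /=.
rewrite [leLHS]big_mkcond [leRHS]big_mkcond; apply: ler_sum => x _.
case: ifPn => [/imsetP[T TD ->]|_] /=.
  by move: TD; rewrite inE => /asboolP /QIt ->.
by case: ifP => // _; apply: prodr_ge0.
Qed.

End trees.

(** * Deterministic bounds on the sum over spanning trees *)

Section tree_bounds.
Variables (V : finType) (u : V) (G : {set {set V}}) (R : realType) (c : R).
Variable (d : nat).
Hypotheses (GP : G \subset pairs V) (c0 : 0 <= c) (d0 : (0 < d)%N).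
Implicit Types (I : {set V}) (v w : V).
Local Notation C := (component G u).
Local Notation A := (lay u G d).
Local Notation A' := (lay u G d.-1).
Local Notation B := (rball u G d).
Local Notation dist := (gdist G u).
Local Notation X v := (deg G v A').
Local Notation dg v := (deg G v setT).

Lemma gdist_sub (T : {set {set V}}) v : T \subset G -> v \in component T u ->
  (dist v <= gdist T u v)%N.
Proof. by move=> TG vT; apply: gdist_le; apply: has_walk_sub TG _; exact: gdist_walk. Qed.

Lemma rball_gdist v : (v \in B) = (v \in C) && (dist v < d)%N.
Proof. by case: d d0 => // k _; rewrite /= ball_gdist. Qed.

Lemma deg_sum v (S : {set V}) : (deg G v S)%:R = \sum_(w in S) (adj G v w)%:R :> R.
Proof.
rewrite /deg -sum1_card natr_sum big_mkcond [RHS]big_mkcond.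
by apply: eq_bigr => w _; rewrite inE /adj; case: (w \in S); case: (_ \in G).
Qed.

Lemma prod_split3 (a b e : V -> R) I : [disjoint I & B] ->
  \prod_v (if v \in B then a v else if v \in I then b v else e v) =
  \prod_(v in B) a v * \prod_(v in I) b v * \prod_(v in ~: (B :|: I)) e v.
Proof.
move=> IB; rewrite (bigID (mem B)) /= -mulrA; congr (_ * _).
  by apply: eq_bigr => v ->.
rewrite (bigID (mem I)) /=; congr (_ * _).
  apply: eq_big => [v|v /andP[/negPf-> ->]//].
  by have [vI|] := boolP (v \in I); rewrite ?andbF// andbT (disjointFr IB).
apply: eq_big => [v|v /andP[/negPf-> /negPf->]//].
by rewrite !inE negb_or.
Qed.

(** Bounds the factor of v when w is its tree parent and I is the set of vertices of layer d whose
    depth in the tree is d. A vertex outside B and I has depth at least d + 1, and at least d + 2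
    unless w lies in I or in layer d - 1: hence the extra exp (- c). *)
Definition om I v w : R :=
  if v \notin C :\ u then (w == u)%:R else
  (adj G v w)%:R *
  (if v \in B then expR (- (c * (dist v)%:R))
   else if v \in I then (w \in A')%:R * expR (- (c * d%:R))
   else expR (- (c * d.+1%:R)) * ((w \in I)%:R + (w \in A')%:R + expR (- c))).

Lemma om_ge0 I v w : 0 <= om I v w.
Proof.
rewrite /om; case: ifP => // _; apply: mulr_ge0 => //.
case: ifP => _; first exact: expR_ge0.
case: ifP => _; first by rewrite mulr_ge0 ?expR_ge0.
by rewrite mulr_ge0 ?expR_ge0 ?addr_ge0 ?expR_ge0.
Qed.

Lemma expR_le_nat m k : (m <= k)%N -> expR (- (c * k%:R)) <= expR (- (c * m%:R)).
Proof. by move=> mk; rewrite ler_expR lerN2 ler_wpM2l ?ler_nat. Qed.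

Lemma treeZ_om : treeZ u G c <=
  \sum_(I : {set V} | I \subset A) \prod_v \sum_w om I v w.
Proof.
pose It T := [set v in A | gdist T u v == d].
apply: (@treeZ_le _ _ _ _ _ _ It) => //.
- exact: om_ge0.
- by move=> T _; apply/subsetP => v; rewrite inE => /andP[].
move=> T p Tst pP pu; have CT := spanning_component Tst.
have [TG _ _ _] := Tst.
have gT v : v \in C -> (dist v <= gdist T u v)%N.
  by move=> vC; apply: gdist_sub; rewrite ?CT.
rewrite natr_sum mulr_sumr -sumrN expR_sum big_mkcond /=.
apply: ler_prod => v _; apply/andP; split; first by case: ifP; rewrite ?expR_ge0.
rewrite /om; have [vCu|vCu] := boolP (v \in C :\ u); last first.
  rewrite pu// eqxx; case: ifP => // vC; move: vCu; rewrite in_setD1 vC andbT.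
  by rewrite negbK => /eqP->; rewrite gdist_root mulr0 oppr0 expR0.
have /and3P[wC wv /eqP dT] := pP _ vCu; move: (p v) wC wv dT => w wC wv dT.
move: vCu; rewrite in_setD1 => /andP[vu vC]; rewrite vC adj_sym wv mul1r.
rewrite rball_gdist vC /=; case: ltnP => vd.
  by apply: expR_le_nat; exact: gT.
have dvw := gdist_adj wC wv.
have gw := gT _ wC; have gv := gT _ vC.
case: ifPn => [|vI].
  rewrite inE => /andP[_ /eqP vd']; rewrite vd'.
  suff -> : w \in A' by rewrite mul1r.
  rewrite lay_gdist wC /=; rewrite vd' in dT.
  by apply/eqP/anti_leq; move: dT gw dvw vd; clear; lia.
have vd1 : (d < gdist T u v)%N.
  rewrite ltn_neqAle (leq_trans vd gv) andbT; apply/eqP => e.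
  move: vI; rewrite inE -e eqxx andbT lay_gdist vC/=.
  by rewrite eqn_leq vd andbT e gv.
have [wI|wI] /= := boolP (w \in It T).
  rewrite -[leLHS]mulr1; apply: ler_pM; rewrite ?expR_ge0//.
    exact: expR_le_nat.
  by have := expR_ge0 (- c); case: (_ \in A') => /=; lra.
have [wA|wA] /= := boolP (w \in A').
  rewrite -[leLHS]mulr1; apply: ler_pM; rewrite ?expR_ge0//.
    exact: expR_le_nat.
  by have := expR_ge0 (- c); lra.
rewrite !add0r -expRD.
have wd : (d < gdist T u w)%N.
  have dw : (d <= dist w)%N.
    rewrite leqNgt; apply/negP => dw; move: wA; rewrite lay_gdist wC/=.
    by move=> /eqP; apply; move: dw dvw vd d0; clear; lia.
  rewrite ltn_neqAle (leq_trans dw gw) andbT; apply/eqP => e.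
  move: wI; rewrite inE -e eqxx andbT lay_gdist wC/=.
  by rewrite eqn_leq dw andbT e gw.
rewrite ler_expR dT -[_.+1 in leLHS]addn1 natrD mulrDr mulr1 opprD lerD2r.
by rewrite lerN2 ler_wpM2l// ler_nat.
Qed.

Variable pad : R.
Hypothesis pad1 : 1 <= pad.

(** The common factor exp (- c (d + 1)) is extracted from every vertex; the vertices outside the
    component, whose true factor is 1, therefore carry a compensating exp (c (d + 1)). *)
Definition psi I v : R := expR (- (c * d.+1%:R)) *
  (if v \in B then (maxn 1 (dg v))%:R * expR (c * (d.+1 - dist v)%N%:R)
   else if v \in I then (X v)%:R * expR c
   else ((deg G v I)%:R + pad)
        * (expR (((X v)%:R + expR (- c) * (dg v)%:R) / pad)
        * expR (c * (v \notin C)%:R * d.+1%:R))).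

Lemma sum_om_le I v : I \subset A -> \sum_w om I v w <= psi I v.
Proof.
move=> IA; have pad0 : 0 < pad by exact: lt_le_trans ltr01 pad1.
have Edx (k : nat) : (k <= d.+1)%N -> expR (- (c * k%:R)) =
    expR (- (c * d.+1%:R)) * expR (c * (d.+1 - k)%N%:R).
  by move=> kd; rewrite -expRD natrB//; congr expR; ring.
have Ed (r : R) : expR (- r) * expR r = 1 by rewrite -expRD addNr expR0.
have Ed' (r : R) : expR r * expR (- r) = 1 by rewrite mulrC.
(* This is how [pad] turns the additive contribution y of the parents outside I into a factor that
   does not depend on I. *)
have X1 (x y : R) : 0 <= x -> 0 <= y -> x + y <= (x + pad) * expR (y / pad).
  move=> x0 y0; apply: (@le_trans _ _ ((x + pad) * (1 + y / pad))); last first.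
    by rewrite ler_wpM2l ?expR_ge1Dx// addr_ge0 // ltW.
  rewrite mulrDr mulr1 mulrDl [pad * _]mulrC divfK ?gt_eqF//.
  have : 0 <= x * (y / pad) by rewrite mulr_ge0// divr_ge0// ltW.
  by lra.
rewrite /psi /om; have [vCu|vCu] := boolP (v \in C :\ u); last first.
  rewrite /= (bigD1 u)//= eqxx big1 ?addr0 => [|w /negPf->//].
  have [vB|vB] := boolP (v \in B).
    have -> : dist v = 0%N.
      move: vB vCu; rewrite rball_gdist in_setD1 => /andP[-> _].
      by rewrite andbT negbK => /eqP->; rewrite gdist_root.
    rewrite subn0 mulrCA Ed mulr1 (_ : 1 = 1%:R)// ler_nat.
    by rewrite leq_maxl.
  have vC : v \notin C.
    move: vCu; rewrite in_setD1; have [vu|//] := eqVneq v u.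
    by rewrite vu rball_gdist root_component gdist_root d0 in vB.
  rewrite ifF; last first.
    by apply/negbTE/negP => /(subsetP IA); rewrite lay_gdist (negPf vC).
  rewrite vC mulr1n mulr1 [leRHS]mulrC -!mulrA Ed' mulr1.
  have e1 : 1 <= expR (((X v)%:R + expR (- c) * (dg v)%:R) / pad).
    rewrite -[leLHS]expR0 ler_expR divr_ge0 ?addr_ge0 ?mulr_ge0 ?expR_ge0//.
    by rewrite ltW.
  rewrite -[leLHS]mulr1; apply: ler_pM => //.
  by rewrite -[leLHS]add0r lerD.
move: vCu; rewrite in_setD1 => /andP[vu vC]; rewrite vC /= mulr0 mul0r expR0 mulr1.
case: ifPn => vB.
  have -> : \sum_w (adj G v w)%:R * expR (- (c * (dist v)%:R)) =
      (dg v)%:R * expR (- (c * (dist v)%:R)) :> R.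
    by rewrite -mulr_suml deg_sum; congr (_ * _); apply: eq_bigl => w; rewrite inE.
  rewrite (Edx (dist v)); last first.
    by move: vB; rewrite rball_gdist => /andP[_ /ltnW/leqW].
  rewrite mulrCA ler_wpM2l ?expR_ge0// ler_wpM2r ?expR_ge0// ler_nat.
  exact: leq_maxr.
case: ifPn => vI.
  under eq_bigr do rewrite mulrA.
  rewrite -mulr_suml (Edx d)// subSnn mulr1 mulrCA ler_wpM2l ?expR_ge0//.
  rewrite ler_wpM2r ?expR_ge0// deg_sum [leRHS]big_mkcond ler_sum// => w _.
  by case: (w \in A'); rewrite ?mulr1 ?mulr0.
under eq_bigr do rewrite mulrCA.
rewrite -mulr_sumr ler_wpM2l ?expR_ge0//.
apply: le_trans (X1 _ _ _ _); rewrite ?addr_ge0 ?mulr_ge0 ?expR_ge0//.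
under eq_bigr do rewrite !mulrDr.
rewrite !big_split /= -addrA; apply: lerD; [|apply: lerD].
- rewrite deg_sum [leRHS]big_mkcond ler_sum// => w _.
  by case: (w \in I); rewrite ?mulr1 ?mulr0.
- rewrite deg_sum [leRHS]big_mkcond ler_sum// => w _.
  by case: (w \in A'); rewrite ?mulr1 ?mulr0.
- rewrite -mulr_suml mulrC ler_wpM2l ?expR_ge0// deg_sum.
  by rewrite [leRHS](eq_bigl xpredT)// => w; rewrite inE.
Qed.

(** The depth saved below layer d, compared with the baseline of d + 1 per vertex. *)
Definition near_excess : nat := (\sum_(v in B) (d.+1 - dist v))%N.

Definition treeZ_err : R :=
  c * near_excess%:R + c * d.+1%:R * #|~: C|%:R
  + (\sum_(v in ~: B) ((X v)%:R + expR (- c) * (dg v)%:R)) / pad.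

Lemma treeZ_upper : treeZ u G c <=
  expR (treeZ_err - c * d.+1%:R * #|V|%:R)
  * \prod_(v in B) (maxn 1 (dg v))%:R
  * \sum_(I : {set V} | I \subset A)
      (expR (c * #|I|%:R) * \prod_(v in I) (X v)%:R
       * \prod_(v in ~: (B :|: I)) ((deg G v I)%:R + pad)).
Proof.
apply: le_trans treeZ_om _; rewrite mulr_sumr; apply: ler_sum => I IA.
apply: (@le_trans _ _ (\prod_v psi I v)).
  by apply: ler_prod => v _; rewrite sum_om_le// sumr_ge0// => w _; exact: om_ge0.
have IB : [disjoint I & B].
  apply: disjointWl IA _; rewrite /lay -setI_eq0.
  by apply/eqP/setP => v; rewrite !inE; case: (v \in rball _ _ _); rewrite ?andbF.
rewrite /psi big_split /= prod_split3// prodr_const !big_split /= cardT -cardE.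
rewrite -!expR_sum -expRM_natl sumr_const -[c *+ _]mulr_natl.
set PB := \prod_(i in B) _; set PI := \prod_(i in I) _.
set PJ := \prod_(i in ~: _) _.
rewrite -mulr_sumr -natr_sum -/near_excess.
set E1 := \sum_(i in ~: (B :|: I)) _; set E2 := \sum_(i in ~: (B :|: I)) _.
have -> : expR (#|V|%:R * - (c * d.+1%:R)) *
  (PB * expR (c * near_excess%:R) * (PI * expR (#|I|%:R * c)) *
   (PJ * (expR E1 * expR E2))) =
  (PB * PI * PJ) * expR (#|V|%:R * - (c * d.+1%:R) + c * near_excess%:R
    + #|I|%:R * c + E1 + E2).
  by rewrite !expRD; ring.
rewrite [leRHS](_ : _ = (PB * PI * PJ) *
  expR (treeZ_err - c * d.+1%:R * #|V|%:R + c * #|I|%:R)); last first.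
  by rewrite [in RHS]expRD; ring.
rewrite ler_wpM2l//.
  by rewrite !mulr_ge0// prodr_ge0// => v _; rewrite addr_ge0// (le_trans ler01 pad1).
rewrite ler_expR /treeZ_err.
have p0 : 0 < pad by exact: lt_le_trans ltr01 pad1.
have le1 : E1 <= (\sum_(v in ~: B) ((X v)%:R + expR (- c) * (dg v)%:R)) / pad.
  rewrite mulr_suml /E1 [leLHS]big_mkcond [leRHS]big_mkcond ler_sum// => v _.
  rewrite !inE negb_or; case: (v \in B) => //=; case: (v \in I) => //=.
  by rewrite divr_ge0 ?addr_ge0 ?mulr_ge0 ?expR_ge0// ltW.
have le2 : E2 <= c * d.+1%:R * #|~: C|%:R.
  rewrite -sum1_card natr_sum mulr_sumr /E2 [leLHS]big_mkcond [leRHS]big_mkcond.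
  apply: ler_sum => v _; rewrite [v \in ~: C]in_setC; case: (v \in C) => /=.
    by rewrite mulr0 mul0r if_same.
  by rewrite !mulr1; case: ifP => // _; rewrite mulr_ge0.
by lra.
Qed.

Definition bad I : nat := #|[set v in ~: (B :|: I) | deg G v I == 0%N]|.

(** By how much the heights used in [treeZ_lower] exceed d + 1 at the vertices beyond distance d +
    1: such a vertex gets height one more than its distance. *)
Definition far : nat := (\sum_(v in C | (d.+1 < dist v)%N) (dist v - d))%N.

(** Explicit parent sets for [treeZ_ge]: a vertex of I chooses in layer d - 1, an unexplored vertex
    with a neighbour in I chooses in I, and every other vertex keeps a breadth-first parent. *)
Lemma treeZ_lower I : I \subset A ->
  \prod_(v in I) (X v)%:R * \prod_(v in ~: (B :|: I)) (maxn 1 (deg G v I))%:R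
  * expR (c * #|I|%:R - c * (d.+1 * #|V| + bad I + far)%N%:R) <= treeZ u G c.
Proof.
move=> IA.
have IC v : v \in I -> v \in C /\ dist v = d.
  by move=> /(subsetP IA); rewrite lay_gdist => /andP[? /eqP].
have IB : [disjoint I & B].
  apply: disjointWl IA _; rewrite /lay -setI_eq0.
  by apply/eqP/setP => v; rewrite !inE; case: (v \in rball _ _ _); rewrite ?andbF.
(* A vertex with no neighbour in I gets height one above its distance, because its breadth-first
   parent may itself have been delayed by one level. *)
pose h v : nat := if (v \in B) || (v \in I) then dist v
  else if (0 < deg G v I)%N then d.+1 else (dist v).+1.
pose par v : {set V} := [set w in C | adj G v w & dist v == (dist w).+1].
pose O v : {set V} := if v \in I then [set w in A' | [set v; w] \in G]
  else if (v \notin B) && (0 < deg G v I)%N then [set w in I | [set v; w] \in G]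
  else par v.
have hle v : v \in C -> (h v <= (dist v).+1)%N.
  move=> vC; rewrite /h; case: ifPn => // vBI; case: ifP => // _.
  by move: vBI; rewrite negb_or rball_gdist vC -leqNgt => /andP[].
apply: le_trans (@treeZ_ge _ u G R c h O c0 _); last first.
  move=> v w vC vu; rewrite /O; case: ifPn => vI.
    rewrite inE => /andP[+ vw]; rewrite lay_gdist => /andP[wC /eqP dw]; split=> //.
    have [_ dv] := IC _ vI.
    have -> : h v = d by rewrite /h vI orbT.
    by rewrite /h rball_gdist wC dw ltn_predL d0 /= ltn_predL.
  case: ifPn => [/andP[vB dg0]|].
    rewrite inE => /andP[wI vw]; have [wC dw] := IC _ wI; split=> //.
    by rewrite /h wI orbT (negPf vB) (negPf vI) dg0 dw ltnS.
  rewrite inE => nb /and3P[wC vw /eqP dvw]; split=> //.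
  have [vB|vB] := boolP (v \in B).
    have wB : w \in B.
      by move: vB; rewrite !rball_gdist wC dvw => /andP[_ /ltnW].
    by rewrite /h vB wB dvw.
  by rewrite {2}/h (negPf vB) (negPf vI) /= ifN ?dvw ?ltnS ?hle//;
    move: nb; rewrite vB.
apply: ler_pM; rewrite ?expR_ge0 ?mulr_ge0 ?prodr_ge0//.
- have -> : \prod_(v in I) (X v)%:R * \prod_(v in ~: (B :|: I)) (maxn 1 (deg G v I))%:R
    = \prod_v (if v \in B then 1 else if v \in I then (X v)%:R
        else (maxn 1 (deg G v I))%:R) :> R.
    by rewrite prod_split3// [Y in Y * _ * _]big1 ?mul1r.
  rewrite [leRHS]big_mkcond; apply: ler_prod => v _; apply/andP; split.
    by case: ifP => // _; case: ifP.
  have par1 : v \in C -> v != u -> (1 <= #|par v|)%N.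
    move=> vC vu; have [w /and3P[wC wv dw]] := gdist_parent vC vu.
    by apply/card_gt0P; exists w; rewrite inE wC adj_sym wv.
  have [vCu|vCu] := boolP (v \in C :\ u); last first.
    case: ifPn => // vB; rewrite ifN; last first.
      apply/negP => /IC[vC dv]; move: vCu vB; rewrite in_setD1 vC andbT negbK.
      by move=> /eqP->; rewrite rball_gdist root_component gdist_root d0.
    have -> : deg G v I = 0%N.
      apply/eqP; rewrite cards_eq0; apply/eqP/setP => w; rewrite !inE.
      apply/negbTE/negP => /andP[/IC[wC dw] vw].
      have vC : v \in C by apply: (adj_component wC); rewrite adj_sym.
      move: vCu vB; rewrite in_setD1 vC andbT negbK.
      by move=> /eqP->; rewrite rball_gdist root_component gdist_root d0.
    by [].
  move: vCu; rewrite in_setD1 => /andP[vu vC].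
  rewrite /O; case: ifPn => vB /=.
    rewrite (disjointFl IB vB) (_ : 1 = 1%:R)// ler_nat; exact: par1.
  case: ifPn => vI //.
  rewrite ler_nat; case: ltnP => [g0|]; first by rewrite geq_max g0 leqnn.
  rewrite leqn0 => /eqP->; exact: par1.
- rewrite ler_expR -mulrBr -mulrN ler_wpM2l// lerBlDr addrC lerBrDr -natrD ler_nat.
  have cardE' (S : {set V}) : #|S| = (\sum_v (v \in S))%N.
    by rewrite -sum1_card big_mkcond; apply: eq_bigr => v _; case: (v \in S).
  have -> : (d.+1 * #|V|)%N = (\sum_(v : V) d.+1)%N by rewrite sum_nat_const mulnC.
  rewrite /bad /far (cardE' I) (cardE' [set v in _ | _]) (big_mkcond (mem C)).
  rewrite [Y in (_ <= _ + _ + Y)%N]big_mkcond -!big_split /=.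
  apply: leq_sum => v _; rewrite in_set in_setC in_setU negb_or.
  have [vI|vI] := boolP (v \in I).
    have [vC dv] := IC _ vI; rewrite vC /h vI orbT dv add1n.
    by rewrite -addnA leq_addr.
  rewrite add0n andbT; case: ifPn => // vC; rewrite /h (negPf vI) orbF.
  rewrite rball_gdist vC /=; case: ltnP => vd.
    by apply: leq_trans (leqW (ltnW vd)) _; rewrite -addnA leq_addr.
  case: ltnP => vI0; first by rewrite -addnA leq_addr.
  rewrite /= -leqn0 vI0 /= addn1.
  case: (ltnP d.+1 (dist v)) => dv; last by rewrite addn0 ltnS.
  by move: dv vd; clear; lia.
Qed.

End tree_bounds.

Lemma ln_le_subr1 (R : realType) (x : R) : 0 < x -> ln x <= x - 1.
Proof. by move=> x0; have := expR_ge1Dx (ln x); rewrite lnK ?posrE//; lra. Qed.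

(** * Binomial and Poisson expectations *)

Section binomial_expectation.
Variables (R : realType) (q : R).
Implicit Types (g h : nat -> R) (s : nat).
Local Notation binex := (binex q).

Lemma eq_binex s g h : g =1 h -> binex s g = binex s h.
Proof.
elim: s g h => [|s IH] g h gh /=; first exact: gh.
by rewrite (IH _ (h \o succn) (fun i => gh i.+1)) (IH _ _ gh).
Qed.

Lemma binexD s g h : binex s (fun i => g i + h i) = binex s g + binex s h.
Proof.
elim: s g h => [//|s IH] g h /=.
rewrite (@eq_binex s _ (fun i => (g \o succn) i + (h \o succn) i))// !IH.
by ring.
Qed.

Lemma binexZ s c g : binex s (fun i => c * g i) = c * binex s g.
Proof.
elim: s g => [//|s IH] g /=.
rewrite (@eq_binex s _ (fun i => c * (g \o succn) i))// !IH.
by ring.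
Qed.

Lemma binex_const s c : binex s (fun=> c) = c.
Proof.
elim: s => [//|s IH] /=; rewrite (@eq_binex s _ (fun=> c))// IH; ring.
Qed.

Lemma binexB s g h : binex s (fun i => g i - h i) = binex s g - binex s h.
Proof.
rewrite (@eq_binex _ _ (fun i => g i + -1 * h i)) => [|i]; last by rewrite mulN1r.
by rewrite binexD binexZ mulN1r.
Qed.

Lemma binex_id s : binex s (fun i => i%:R) = s%:R * q.
Proof.
elim: s => [|s IH] /=; first by rewrite mul0r.
rewrite (@eq_binex s _ (fun i => i%:R + 1)) => [|i /=]; last by rewrite -natr1.
by rewrite binexD binex_const IH -natr1; ring.
Qed.

Lemma binex_sq s : binex s (fun i => i%:R ^+ 2) = s%:R * q + s%:R * (s%:R - 1) * q ^+ 2.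
Proof.
elim: s => [|s IH] /=; first by rewrite !mul0r expr0n /= addr0.
rewrite (@eq_binex s _ (fun i => i%:R ^+ 2 + (2 * i%:R + 1))); last first.
  by move=> i /=; rewrite -natr1; ring.
rewrite binexD binexD binexZ binex_const binex_id IH -natr1; ring.
Qed.

Lemma binex_var s : binex s (fun i => (i%:R - s%:R * q) ^+ 2) = s%:R * q * (1 - q).
Proof.
rewrite (@eq_binex s _ (fun i => i%:R ^+ 2 + ((- 2 * (s%:R * q)) * i%:R + (s%:R * q) ^+ 2))).
  by rewrite binexD binexD binexZ binex_const binex_id binex_sq; ring.
by move=> i; ring.
Qed.

Lemma binex_pos s : binex s (fun i => (0 < i)%N%:R) = 1 - (1 - q) ^+ s.
Proof.
elim: s => [|s IH] /=; first by rewrite expr0 subrr.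
rewrite (@eq_binex s _ (fun=> 1))// binex_const IH exprS; ring.
Qed.

(** Size biasing of the binomial law. *)
Lemma binex_bias s g : binex s.+1 (fun i => i%:R * g i) =
  s.+1%:R * q * binex s (g \o succn).
Proof.
elim: s g => [|s IH] g; first by rewrite /=; ring.
have -> : binex s.+2 (fun i => i%:R * g i) =
    q * binex s.+1 ((fun i => i%:R * g i) \o succn)
    + (1 - q) * binex s.+1 (fun i => i%:R * g i) by [].
rewrite (@eq_binex s.+1 ((fun i => i%:R * g i) \o succn)
  (fun i => i%:R * (g \o succn) i + (g \o succn) i)); last first.
  by move=> i /=; rewrite -natr1; ring.
rewrite binexD !IH.
have -> : binex s.+1 (g \o succn) = q * binex s ((g \o succn) \o succn)
    + (1 - q) * binex s (g \o succn) by [].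
by rewrite -[s.+2%:R]natr1; ring.
Qed.

Hypothesis q01 : 0 <= q <= 1.

Lemma binex_le s g h : (forall i, g i <= h i) -> binex s g <= binex s h.
Proof.
case/andP: q01 => q0 q1.
elim: s g h => [|s IH] g h gh /=; first exact: gh.
by apply: lerD; rewrite ler_wpM2l ?subr_ge0// IH// => i /=; exact: gh.
Qed.

Lemma binex_ge0 s g : (forall i, 0 <= g i) -> 0 <= binex s g.
Proof. by move=> g0; rewrite -(binex_const s 0); exact: binex_le. Qed.

(** 1 / i is at most 2 / (i + 1), and size biasing turns the mean of 1 / (i + 1) into the
    probability that a binomial variable is positive, divided by (s + 1) q. *)
Lemma binex_inv s : 0 < q -> (0 < s)%N ->
  binex s (fun i => if i is j.+1 then (j.+1%:R)^-1 else 0) <= 2 / (s%:R * q).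
Proof.
move=> q0 s0.
apply: (@le_trans _ _ (binex s (fun i => 2 * ((fun j => j%:R^-1) \o succn) i))).
  apply: binex_le => -[|i] /=; first by rewrite invr1 mulr1.
  rewrite -[leLHS]div1r ler_pdivrMr ?ltr0n// mulrAC ler_pdivlMr ?ltr0n// mul1r.
  by rewrite -natrM ler_nat; lia.
rewrite binexZ ler_wpM2l// -[leRHS]div1r ler_pdivlMr ?mulr_gt0 ?ltr0n//.
have := @binex_bias s (fun j => j%:R^-1); move: (binex s _) => y yE.
have y0 : 0 <= y.
  have h : 0 <= s.+1%:R * q * y.
    rewrite -yE; apply: binex_ge0 => i; rewrite mulr_ge0// invr_ge0.
  by move: h; rewrite pmulr_rge0// mulr_gt0 ?ltr0n.
apply: (@le_trans _ _ (s.+1%:R * q * y)).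
  by rewrite mulrC ler_wpM2r// ler_wpM2r ?(ltW q0)// ler_nat.
rewrite -yE; apply: (@le_trans _ _ (binex s.+1 (fun=> 1))); last by rewrite binex_const.
apply: binex_le => -[|i]; first by rewrite mul0r.
by rewrite divff ?pnatr_eq0.
Qed.

Lemma pow_bernoulli s : 1 - s%:R * q <= (1 - q) ^+ s
  /\ (1 - q) ^+ s <= 1 - s%:R * q + s%:R ^+ 2 * q ^+ 2 / 2.
Proof.
case/andP: q01 => q0 q1.
elim: s => [|s [IH1 IH2]]; first by rewrite expr0 mul0r subr0 expr0n/= mul0r mul0r addr0.
rewrite exprS -natr1; have s0 : (0 : R) <= s%:R by [].
have := @ler_wpM2l _ (1 - q) _ _ _ IH1; rewrite subr_ge0 => /(_ q1).
have := @ler_wpM2l _ (1 - q) _ _ _ IH2; rewrite subr_ge0 => /(_ q1).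
have p1 : 0 <= s%:R * q ^+ 2 by rewrite mulr_ge0// sqr_ge0.
have p3 : 0 <= s%:R ^+ 2 * q ^+ 3.
  by rewrite mulr_ge0 ?exprn_ge0.
by move=> h2 h1; split; [nra|nra].
Qed.

(* The loss of replacing a binomial variable by its mean inside the logarithm. *)
Lemma binex_defect s (M := s%:R * q) : 1 <= M ->
  binex s (fun i => Num.max 0 (ln M - ln (maxn 1 i)%:R))
    <= 2 / Num.sqrt M + 4 * ln M / M.
Proof.
move=> M1; have M0 : 0 < M by lra.
set r := Num.sqrt M; have r0 : 0 < r by rewrite sqrtr_gt0.
have rr : r ^+ 2 = M by rewrite sqr_sqrtr// ltW.
have lM : 0 <= ln M by exact: ln_ge0.
apply: (@le_trans _ _ (binex s (fun i => r^-1
    + ((r^-1) ^+ 3 + 4 * ln M / M ^+ 2) * (i%:R - s%:R * q) ^+ 2))).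
  apply: binex_le => i; rewrite -/M.
  have sq0 : 0 <= (i%:R - M) ^+ 2 by exact: sqr_ge0.
  have c0 : 0 <= 4 * ln M / M ^+ 2 by rewrite !mulr_ge0 ?invr_ge0 ?sqr_ge0.
  have c1 : 0 <= r^-1 by rewrite invr_ge0 ltW.
  have c3 : 0 <= (r^-1) ^+ 3 by rewrite exprn_ge0.
  rewrite ge_max; apply/andP; split.
    by apply: addr_ge0 => //; apply: mulr_ge0 => //; exact: addr_ge0.
  have [iM|Mi] := ltP i%:R (M / 2).
    apply: (@le_trans _ _ (ln M)).
      by rewrite lerBlDr lerDl ln_ge0// ler1n leq_maxl.
    apply: (@le_trans _ _ (4 * ln M / M ^+ 2 * (i%:R - M) ^+ 2)).
      rewrite -[leLHS]mulr1 -!mulrA [4 * _]mulrCA ler_wpM2l//.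
      rewrite [_^-1 * _]mulrC mulrA ler_pdivlMr ?exprn_gt0// mul1r.
      have : (M / 2) ^+ 2 <= (M - i%:R) ^+ 2.
        by rewrite ler_sqr ?nnegrE; lra.
      by nra.
    by rewrite mulrDl; have := mulr_ge0 c3 sq0; lra.
  have i0 : (0 : R) < i%:R by lra.
  have i1 : (0 < i)%N by rewrite ltr0n in i0.
  rewrite (maxn_idPr i1) -ln_div ?posrE//.
  apply: (@le_trans _ _ (M / i%:R - 1)).
    by apply: ln_le_subr1; rewrite divr_gt0.
  apply: (@le_trans _ _ (2 * `|M - i%:R| / M)).
    rewrite ler_pdivlMr// mulrBl mul1r.
    have h : (M - i%:R) * M <= (2 * `|M - i%:R|) * i%:R.
      have a0 := normr_ge0 (M - i%:R); have := ler_norm (M - i%:R); nra.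
    have -> : M / i%:R * M - M = ((M - i%:R) * M) / i%:R by field; rewrite gt_eqF.
    by rewrite ler_pdivrMr.
  apply: (@le_trans _ _ (r^-1 + r^-1 ^+ 3 * (i%:R - M) ^+ 2)); last first.
    by rewrite lerD2l ler_wpM2r// lerDl.
  rewrite -(real_normK (num_real (i%:R - M))) distrC; set a := `|_|; rewrite -rr.
  have -> : 2 * a / r ^+ 2 = r^-1 * (2 * (a / r)) by field; rewrite gt_eqF.
  have -> : r^-1 + r^-1 ^+ 3 * a ^+ 2 = r^-1 * (1 + (a / r) ^+ 2).
    by field; rewrite gt_eqF.
  by rewrite ler_wpM2l//; have := sqr_ge0 (a / r - 1); nra.
rewrite binexD binexZ binex_const binex_var -/M.
have q1 : M * (1 - q) <= M by case/andP: q01 => q0 q1; nra.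
apply: (@le_trans _ _ (r^-1 + (r^-1 ^+ 3 + 4 * ln M / M ^+ 2) * M)).
  rewrite lerD2l ler_wpM2l// addr_ge0 ?exprn_ge0 ?invr_ge0 ?(ltW r0)//.
  by rewrite !mulr_ge0 ?invr_ge0 ?sqr_ge0.
rewrite mulrDl le_eqVlt; apply/orP; left; apply/eqP; rewrite -rr.
by field; rewrite gt_eqF.
Qed.

End binomial_expectation.

(** * Poisson expectations and their comparison with binomial ones *)

Section poisson_expectation.
Variable R : realType.
Implicit Types (g h : nat -> R) (a b : R).

(** The mean of g under Poisson(a), kept as a power series so that it can be differentiated in the
    parameter a. *)
Definition pois g a : R :=
  expR (- a) * limn (pseries (fun k => g k / k`!%:R) a).

(** A growth condition under which the series converges everywhere, stable under shifts and
    differences. *)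
Definition tame g := exists K : R, forall k, `|g k| <= K * 2 ^+ k.

Definition fdiff g k : R := g k.+1 - g k.

Lemma tame_shift g : tame g -> tame (g \o succn).
Proof.
by move=> [K gK]; exists (2 * K) => k /=; rewrite [2 * K]mulrC -mulrA -exprS.
Qed.

Lemma tameD g h : tame g -> tame h -> tame (fun k => g k + h k).
Proof.
move=> [K gK] [L hL]; exists (K + L) => k; apply: le_trans (ler_normD _ _) _.
by rewrite mulrDl lerD.
Qed.

Lemma tameZ c g : tame g -> tame (fun k => c * g k).
Proof.
move=> [K gK]; exists (`|c| * K) => k; rewrite normrM -mulrA ler_wpM2l//.
Qed.

Lemma tameB g h : tame g -> tame h -> tame (fun k => g k - h k).
Proof.
move=> tg th; have [K gK] := tameD tg (tameZ (-1) th).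
by exists K => k; have := gK k; rewrite mulN1r.
Qed.

Lemma tame_fdiff g : tame g -> tame (fdiff g).
Proof. by move=> tg; apply: tameB => //; exact: tame_shift. Qed.

Lemma tame_const c : tame (fun=> c).
Proof.
by exists `|c| => k; rewrite ler_peMr// -natrX ler1n expn_gt0.
Qed.

Lemma tame_lin g (c : R) : (forall k, `|g k| <= c * k.+1%:R) -> tame g.
Proof.
move=> gk; have c0 : 0 <= c by have := gk 0%N; rewrite mulr1; exact: le_trans.
exists c => k; apply: le_trans (gk k) _; rewrite ler_wpM2l// -natrX ler_nat.
exact: ltn_expl.
Qed.

Lemma tame_cvg g a : tame g -> cvgn (pseries (fun k => g k / k`!%:R) a).
Proof.
move=> [K gK]; apply: normed_cvg.
have K0 : 0 <= K by have := gK 0%N; rewrite expr0 mulr1; exact: le_trans.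
apply: (@series_le_cvg _ _ (K *: exp_coeff (2 * `|a|))).
- by move=> k; exact: normr_ge0.
- move=> k; rewrite mulr_ge0// exp_coeff_ge0// mulr_ge0//.
- move=> k /=; rewrite normrM normrM normfV normr_nat normrX.
  rewrite -[leRHS]/(K * exp_coeff (2 * `|a|) k) /exp_coeff /= exprMn mulrA mulrA.
  rewrite [leLHS]mulrAC ler_wpM2r ?invr_ge0// ler_wpM2r ?exprn_ge0//.
- by apply: is_cvg_seriesZ; exact: is_cvg_series_exp_coeff.
Qed.

Lemma pois_le g h a : 0 <= a -> tame g -> tame h -> (forall k, g k <= h k) ->
  pois g a <= pois h a.
Proof.
move=> a0 tg th gh; rewrite ler_wpM2l ?expR_ge0//.
apply: lim_series_le; [exact: tame_cvg|exact: tame_cvg|move=> k].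
by rewrite ler_wpM2r ?exprn_ge0// ler_wpM2r ?invr_ge0.
Qed.

Lemma poisD g h a : tame g -> tame h ->
  pois (fun k => g k + h k) a = pois g a + pois h a.
Proof.
move=> tg th; rewrite /pois -mulrDr; congr (_ * _).
rewrite /pseries -lim_seriesD; [|exact: tame_cvg|exact: tame_cvg].
congr (limn (series _)); apply/funext => k /=.
by rewrite -mulrDl -mulrDl.
Qed.

Lemma poisZ c g a : tame g -> pois (fun k => c * g k) a = c * pois g a.
Proof.
move=> tg; rewrite /pois mulrCA; congr (_ * _).
rewrite /pseries -[c * _]/(c *: _) -lim_seriesZ; last exact: tame_cvg.
congr (limn (series _)); apply/funext => k /=.
by rewrite -[RHS]/(c * (g k / k`!%:R * a ^+ k)) !mulrA.
Qed.

Lemma pois1 a : pois (fun=> 1) a = 1.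
Proof.
rewrite /pois (_ : limn _ = expR a); first by rewrite -expRD addNr expR0.
rewrite expRE; congr (limn (pseries _ a)); apply/funext => k.
by rewrite mul1r.
Qed.

Lemma pois_const c a : pois (fun=> c) a = c.
Proof.
rewrite -[RHS]mulr1 -(pois1 a) -poisZ; last exact: tame_const.
by congr (pois _ a); apply/funext => k; rewrite mulr1.
Qed.

Lemma poisB g h a : tame g -> tame h ->
  pois (fun k => g k - h k) a = pois g a - pois h a.
Proof.
move=> tg th; rewrite -[- _]mulN1r -poisZ// -poisD//; last exact: tameZ.
by congr (pois _ a); apply/funext => k; rewrite mulN1r.
Qed.

Lemma pois_ge0 g a : 0 <= a -> tame g -> (forall k, 0 <= g k) -> 0 <= pois g a.
Proof.
by move=> a0 tg g0; rewrite -(pois_const 0 a); apply: pois_le => //; exact: tame_const.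
Qed.

(** Differentiation in the parameter becomes a forward difference: the factor exp (- a) contributes
    - g and the series contributes the shift of g. *)
Lemma is_derive_pois g a : tame g ->
  is_derive a (1 : R) (pois g) (pois (fdiff g) a).
Proof.
move=> tg; pose c k : R := g k / k`!%:R.
have dE h : pseries_diffs (fun k => h k / k`!%:R) = (fun k => h k.+1 / k`!%:R) :> (nat -> R).
  apply/funext => k; rewrite /pseries_diffs factS natrM.
  have : k.+1%:R != 0 :> R by rewrite pnatr_eq0.
  have : k`!%:R != 0 :> R by rewrite pnatr_eq0 -lt0n fact_gt0.
  move: k.+1%:R k`!%:R => x y y0 x0; field; by rewrite x0 y0.
have dP : is_derive a (1 : R) (fun x => limn (pseries c x))
    (limn (pseries (pseries_diffs c) a)).
  apply: (@pseries_snd_diffs _ c (`|a| + 1)).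
  - exact: tame_cvg.
  - by rewrite dE; apply: (@tame_cvg (g \o succn)); exact: tame_shift.
  - by rewrite dE (dE (g \o succn)); apply: (@tame_cvg (g \o succn \o succn));
      apply: tame_shift; exact: tame_shift.
  - by rewrite [ltRHS]ger0_norm ?addr_ge0// ltrDl.
have eP : is_derive a (1 : R) (fun x => expR (- x)) (- expR (- a)).
  have dN : is_derive a (1 : R) (-%R : R -> R) (- 1 : R) := is_deriveN (is_derive_id a 1).
  by apply: (is_derive_eq (is_derive1_comp (is_derive_expR (- a)) dN)); rewrite mulrN1.
apply: (is_derive_eq (is_deriveM eP dP)).
transitivity (pois (g \o succn) a - pois g a); last first.
  by rewrite -poisB//; exact: tame_shift.
rewrite /pois dE /= -/c; set A := limn _; set B := limn _.
by rewrite -[_ *: A]/(expR (- a) * A) -[B *: _]/(B * - expR (- a)) mulrN [B * _]mulrC.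
Qed.

Lemma pois_MVT g a b : tame g -> a <= b ->
  exists2 c, a <= c <= b & pois g b - pois g a = pois (fdiff g) c * (b - a).
Proof.
move=> tg ab; have cg : {within `[a, b], continuous (pois g)}%classic.
  apply: derivable_within_continuous => x _.
  by have [] := is_derive_pois x tg.
have [c] := MVT_segment ab (fun x _ => is_derive_pois x tg) cg.
by rewrite in_itv /= => ? ?; exists c.
Qed.

Lemma pois_norm g a (K : R) : 0 <= a -> tame g -> (forall k, `|g k| <= K) ->
  `|pois g a| <= K.
Proof.
move=> a0 tg gK; have gK' k : - K <= g k <= K by rewrite -ler_norml.
rewrite ler_norml; apply/andP; split.
  rewrite -(pois_const (- K) a).
  by apply: pois_le => //; [exact: tame_const|move=> k; case/andP: (gK' k)].
rewrite -[leRHS](pois_const K a).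
by apply: pois_le => //; [exact: tame_const|move=> k; case/andP: (gK' k)].
Qed.

Lemma lip_tame g : (forall k, `|fdiff g k| <= 1) -> tame g.
Proof.
move=> g1; apply: (@tame_lin _ (`|g 0%N| + 1)); elim=> [|k IH].
  by rewrite mulr1 lerDl.
have -> : g k.+1 = fdiff g k + g k by rewrite /fdiff subrK.
apply: le_trans (ler_normD _ _) _.
rewrite -[k.+2%:R]natr1 mulrDr mulr1 addrC lerD// (le_trans (g1 k))//.
by rewrite lerDr.
Qed.

(** One Bernoulli(q) trial against a Poisson parameter raised by q: the terms of first order in q
    agree, and two applications of the mean value theorem bound the rest by the second difference,
    which is at most 2. *)
Lemma pois_step g (q a : R) : 0 <= q <= 1 -> 0 <= a -> (forall k, `|fdiff g k| <= 1) ->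
  `|pois g (a + q) - pois (fun k => q * g k.+1 + (1 - q) * g k) a| <= 2 * q ^+ 2.
Proof.
move=> /andP[q0 q1] a0 g1; have tg := lip_tame g1.
have tdg := tame_fdiff tg; have tddg := tame_fdiff tdg.
have -> : pois (fun k => q * g k.+1 + (1 - q) * g k) a = pois g a + q * pois (fdiff g) a.
  rewrite -poisZ// -poisD//; last exact: tameZ.
  by congr (pois _ a); apply/funext => k; rewrite /fdiff; ring.
have aq : a <= a + q by rewrite lerDl.
have [c /andP[ac caq] ce] := pois_MVT tg aq.
have [e /andP[ae ec] ee] := pois_MVT tdg ac.
have -> : pois g (a + q) - (pois g a + q * pois (fdiff g) a) =
    pois (fdiff (fdiff g)) e * (c - a) * q.
  by rewrite -ee opprD addrA ce; ring.
rewrite 2!normrM (ger0_norm q0) (@ger0_norm _ (c - a)) ?subr_ge0//.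
have h2 : `|pois (fdiff (fdiff g)) e| <= 2.
  apply: pois_norm => //; first exact: le_trans ae.
  move=> k; rewrite /fdiff; apply: le_trans (ler_normB _ _) _.
  by have := g1 k; have := g1 k.+1; rewrite /fdiff; lra.
have : c - a <= q by lra.
move: h2; set y := `|_|; have y0 : 0 <= y by exact: normr_ge0.
have ca : 0 <= c - a by lra.
move=> y2 cq; rewrite expr2 mulrA ler_wpM2r//.
by apply: ler_pM.
Qed.

Lemma pois_support0 g a : (forall k, g k.+1 = 0) -> pois g a = expR (- a) * g 0%N.
Proof.
move=> g0; congr (_ * _); apply/cvg_lim => //; apply: cvg_near_cst.
exists 1%N => //= -[//|n] _; rewrite /pseries /series /= big_nat_recl//=.
by rewrite fact0 invr1 expr0 !mulr1 big1 ?addr0// => i _; rewrite g0 !mul0r.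
Qed.

Lemma pois0 g : tame g -> pois g 0 = g 0%N.
Proof.
move=> tg; rewrite /pois oppr0 expR0 mul1r; apply/cvg_lim => //.
apply: cvg_near_cst; exists 1%N => //= -[//|n] _.
rewrite /pseries /series /= big_nat_recl//=.
by rewrite fact0 invr1 expr0 !mulr1 big1 ?addr0// => i _; rewrite expr0n/= mulr0.
Qed.

(** The trials are replaced by Poisson mass one at a time, each at cost 2 q ^ 2; averaging over one
    trial preserves the Lipschitz condition on g. *)
Lemma binex_pois g q s : 0 <= q <= 1 -> (forall k, `|fdiff g k| <= 1) ->
  `|binex q s g - pois g (s%:R * q)| <= 2 * s%:R * q ^+ 2.
Proof.
move=> q01; case/andP: (q01) => q0 q1; elim: s g => [|s IH] g g1.
  by rewrite mul0r /= mulr0 mul0r pois0 ?subrr ?normr0//; exact: lip_tame.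
pose h k := q * g k.+1 + (1 - q) * g k.
have -> : binex q s.+1 g = binex q s h.
  rewrite /= /h (@binexD _ _ s (fun k => q * (g \o succn) k)) !binexZ.
  by [].
have h1 k : `|fdiff h k| <= 1.
  have -> : fdiff h k = q * fdiff g k.+1 + (1 - q) * fdiff g k.
    by rewrite /fdiff /h; ring.
  apply: le_trans (ler_normD _ _) _; rewrite !normrM (ger0_norm q0).
  rewrite (@ger0_norm _ (1 - q)) ?subr_ge0//.
  have := g1 k; have := g1 k.+1; have := normr_ge0 (fdiff g k).
  by have := normr_ge0 (fdiff g k.+1); nra.
have sq0 : 0 <= s%:R * q by rewrite mulr_ge0.
have := pois_step q01 sq0 g1; rewrite -/h distrC => h2.
have := IH _ h1; move: h2.
have -> : s.+1%:R * q = s%:R * q + q by rewrite -natr1; ring.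
have -> : 2 * s.+1%:R * q ^+ 2 = 2 * s%:R * q ^+ 2 + 2 * q ^+ 2.
  by rewrite -natr1; ring.
set x := pois h _; set y := pois g _; set z := binex _ _ _ => a b.
have -> : z - y = (z - x) + (x - y) by ring.
by apply: le_trans (ler_normD _ _) _; exact: lerD.
Qed.

(** The Chen-Stein identity, the Poisson form of size biasing. *)
Lemma pois_bias g a : tame (fun k => k%:R * g k) -> tame g ->
  a * pois (g \o succn) a = pois (fun k => k%:R * g k) a.
Proof.
move=> tkg tg; rewrite /pois mulrCA; congr (_ * _).
have cs := @tame_cvg _ a (tame_shift tg).
apply/esym/cvg_lim => //; rewrite -cvg_shiftS /=.
rewrite (_ : (fun n => _) = (fun n => a * pseries (fun k => (g \o succn) k / k`!%:R) a n)).
  by apply: cvgMr.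
apply/funext => n; rewrite /pseries /series /= big_nat_recl//= !mul0r add0r.
rewrite mulr_sumr; apply: eq_bigr => k _; rewrite factS natrM exprS.
have : k.+1%:R != 0 :> R by rewrite pnatr_eq0.
have : k`!%:R != 0 :> R by rewrite pnatr_eq0 -lt0n fact_gt0.
by move: k.+1%:R k`!%:R => x y y0 x0; field; rewrite x0 y0.
Qed.

Definition lnp (k : nat) : R := ln (maxn 1 k)%:R.
Definition inv0 (k : nat) : R := if k is j.+1 then (j.+1%:R)^-1 else 0.

Lemma lnp_ge0 k : 0 <= lnp k.
Proof. by rewrite ln_ge0// ler1n leq_maxl. Qed.

Lemma lnpS k : lnp k.+1 = ln k.+1%:R.
Proof. by rewrite /lnp (maxn_idPr _). Qed.

Lemma lnp_le k : lnp k <= k%:R.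
Proof.
case: k => [|k]; first by rewrite /lnp /= ln1.
by rewrite lnpS; apply: le_trans (ln_le_subr1 _) _; rewrite ?ltr0n// lerBlDr lerDl.
Qed.

Lemma fdiff_lnp k : 0 <= fdiff lnp k /\ fdiff lnp k <= 2 * (k.+1%:R)^-1.
Proof.
rewrite /fdiff lnpS; case: k => [|k].
  by rewrite ln1 /lnp /= ln1 subrr; split => //; rewrite mulr_ge0.
rewrite lnpS; have k1 : (0 : R) < k.+1%:R by rewrite ltr0n.
have k2 : (0 : R) < k.+2%:R by rewrite ltr0n.
split; first by rewrite subr_ge0 ler_ln ?posrE// ler_nat.
rewrite -ln_div ?posrE//; apply: le_trans (ln_le_subr1 (divr_gt0 _ _)) _ => //.
have -> : k.+2%:R / k.+1%:R - 1 = (k.+1%:R)^-1 :> R.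
  by rewrite -[k.+2%:R]natr1; field; rewrite gt_eqF.
rewrite -[leLHS]div1r ler_pdivrMr// mulrAC ler_pdivlMr// mul1r.
by rewrite -natrM ler_nat; lia.
Qed.

Lemma fdiff_lnp1 k : `|fdiff lnp k| <= 1.
Proof.
have [f0 f1] := fdiff_lnp k; rewrite ger0_norm//.
case: k f0 f1 => [|k] f0 f1; first by rewrite /fdiff lnpS ln1 /lnp/= ln1 subrr.
apply: le_trans f1 _; rewrite ler_pdivrMr ?ltr0n// mul1r ler_nat.
by [].
Qed.

Lemma tame_lnp : tame lnp. Proof. exact: lip_tame fdiff_lnp1. Qed.

Lemma tame_bounded g : (forall k, `|g k| <= 1) -> tame g.
Proof.
move=> g1; apply: (@tame_lin _ 1) => k; rewrite mul1r.
by apply: le_trans (g1 k) _; rewrite ler1n.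
Qed.

Lemma tame_invS : tame (fun k => (k.+1%:R)^-1).
Proof.
apply: tame_bounded => k; rewrite ger0_norm ?invr_ge0//.
by rewrite invf_le1 ?ltr0n// ler1n.
Qed.

Lemma tame_inv0 : tame inv0.
Proof.
apply: tame_bounded => -[|k]; first by rewrite normr0.
by rewrite ger0_norm ?invr_ge0// invf_le1 ?ltr0n// ler1n.
Qed.

Lemma tame_pos : tame (fun k => (0 < k)%N%:R).
Proof. by apply: tame_bounded => k; case: (0 < k)%N; rewrite ?normr1 ?normr0. Qed.

Lemma pois_pos a : pois (fun k => (0 < k)%N%:R) a = 1 - expR (- a).
Proof.
have t0 : tame (fun k => (k == 0%N)%:R).
  by apply: tame_bounded => k; case: (k == 0%N); rewrite ?normr1 ?normr0.
rewrite -[X in X - _](pois1 a) -[X in _ - X]mulr1 -(@pois_support0 (fun k => (k == 0%N)%:R))//.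
rewrite -poisB//; last exact: tame_const.
by congr (pois _ a); apply/funext => -[|k] /=; rewrite ?subrr ?subr0.
Qed.

Lemma pois_invS a : 0 < a -> pois (fun k => (k.+1%:R)^-1) a = (1 - expR (- a)) / a.
Proof.
move=> a0; rewrite -pois_pos; apply: (mulfI (lt0r_neq0 a0)).
rewrite [RHS]mulrCA divff ?gt_eqF// mulr1.
have E : (fun k => k%:R * inv0 k) = (fun k => (0 < k)%N%:R).
  by apply/funext => -[|k]; rewrite /= ?mul0r// mulfV// pnatr_eq0.
have := @pois_bias inv0 a; rewrite E; apply; [exact: tame_pos|exact: tame_inv0].
Qed.

Lemma pois_inv0 a : 0 < a -> pois inv0 a <= 2 * (1 - expR (- a)) / a.
Proof.
move=> a0; rewrite -mulrA -pois_invS// -poisZ; last exact: tame_invS.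
apply: pois_le; [exact: ltW|exact: tame_inv0|exact/tameZ/tame_invS|].
case=> [|k] /=; first by rewrite mulr_ge0.
rewrite -[leLHS]div1r ler_pdivrMr ?ltr0n// mulrAC ler_pdivlMr ?ltr0n// mul1r.
by rewrite -natrM ler_nat; lia.
Qed.

(** At a point c between a and b the derivative is the mean of the increments of [lnp], which are at
    most 2 / (k + 1), and the mean of 1 / (k + 1) is at most 1 / c. *)
Lemma pois_lnp_lip a b : 0 < a -> a <= b ->
  0 <= pois lnp b - pois lnp a /\ pois lnp b - pois lnp a <= 2 * (b - a) / a.
Proof.
move=> a0 ab; have [c /andP[ac cb] ->] := pois_MVT tame_lnp ab.
have c0 : 0 < c by exact: lt_le_trans ac.
have td := tame_fdiff tame_lnp.
have p0 : 0 <= pois (fdiff lnp) c.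
  by apply: pois_ge0 => //; [exact: ltW|move=> k; case: (fdiff_lnp k)].
have ba : 0 <= b - a by rewrite subr_ge0.
split; first exact: mulr_ge0.
rewrite [leRHS]mulrAC ler_wpM2r//.
apply: (@le_trans _ _ (2 * ((1 - expR (- c)) / c))).
  rewrite -pois_invS// -poisZ; last exact: tame_invS.
  apply: pois_le => //; [exact: ltW|exact/tameZ/tame_invS|].
  by move=> k; case: (fdiff_lnp k).
rewrite ler_wpM2l//; apply: (@le_trans _ _ c^-1).
  by rewrite -[leRHS]mul1r ler_wpM2r ?invr_ge0 ?(ltW c0)// lerBlDr lerDl expR_ge0.
by rewrite lef_pV2.
Qed.

(** From ln k >= ln a + 1 - a / k for k > 0; the mean of a / k costs twice the probability of being
    positive, which turns ln a + 1 into ln a - 1. *)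
Lemma pois_lnp_ge a : 0 < a -> (1 - expR (- a)) * (ln a - 1) <= pois lnp a.
Proof.
move=> a0.
have tp := tame_pos; have ti := tame_inv0.
apply: (@le_trans _ _ (pois (fun k => (ln a + 1) * (0 < k)%N%:R - a * inv0 k) a)).
  rewrite poisB; [|exact: tameZ|exact: tameZ].
  rewrite !poisZ// pois_pos.
  have := pois_inv0 a0; rewrite ler_pdivlMr//.
  by set y := pois inv0 a; lra.
apply: pois_le; [exact: ltW|apply: tameB; exact: tameZ|exact: tame_lnp|].
case=> [|k]; first by rewrite /= !mulr0 subr0 lnp_ge0.
rewrite lnpS /= mulr1; have k0 : (0 : R) < k.+1%:R by rewrite ltr0n.
have := ln_le_subr1 (divr_gt0 a0 k0); rewrite ln_div ?posrE//.
by set x := a / _; set y := ln k.+1%:R; set z := ln a; lra.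
Qed.

(** Jensen's inequality, through the tangent of ln at 1 + a. *)
Lemma pois_lnp_le a : 0 <= a -> pois lnp a <= ln (1 + a).
Proof.
move=> a0; have a1 : 0 < 1 + a by lra.
have ti : tame (fun k => k%:R).
  by apply: (@tame_lin _ 1) => k; rewrite mul1r ger0_norm ?ler_nat.
have mean : pois (fun k => k%:R) a = a.
  have := @pois_bias (fun=> 1) a; rewrite (_ : (fun k => k%:R * 1) = (fun k => k%:R)).
    by move=> /(_ ti (tame_const 1)) <-; rewrite -[_ \o _]/(fun=> 1) pois1 mulr1.
  by apply/funext => k; rewrite mulr1.
apply: (@le_trans _ _ (pois (fun k => (ln (1 + a) - 1 + (1 + a)^-1) + (1 + a)^-1 * k%:R) a)).
  apply: pois_le => //; first exact: tame_lnp.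
    by apply: tameD; [exact: tame_const|exact: tameZ].
  move=> k; have k1 : (0 : R) < k%:R + 1 by rewrite natr1 ltr0n.
  apply: (@le_trans _ _ (ln (k%:R + 1))).
    by rewrite /lnp natr1 ler_ln ?posrE ?ltr0n ?leq_max// ler_nat geq_max leqnSn.
  have := ln_le_subr1 (divr_gt0 k1 a1); rewrite ln_div ?posrE//.
  by rewrite mulrDl mul1r mulrC; lra.
rewrite poisD ?poisZ ?pois_const ?mean//; [|exact: tame_const|exact: tameZ].
by rewrite le_eqVlt; apply/orP; left; apply/eqP; field; rewrite gt_eqF.
Qed.

(** The Poisson law is rewritten as a series of weighted Dirac masses, which turns the integral into
    the power series. *)
Lemma Psi0E (lambda : R) : 0 < lambda < 1 -> Psi0 lambda = pois lnp (ln lambda^-1).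
Proof.
move=> /andP[l0 l1]; set a := ln lambda^-1.
have a0 : 0 < a by rewrite ln_gt0// invf_gt1.
have pmf0 k : 0 <= poisson_pmf a k by exact: poisson_pmf_ge0.
pose m k : measure nat R := mscale (NngNum (pmf0 k)) \d_k.
rewrite /Psi0 unlock.
rewrite (@eq_measure_integral _ _ _ _ (mseries m 0)) => [|A _ _]; last first.
  transitivity (if (0 < a)%R
    then \esum_(k in A) (poisson_pmf a k)%:E else \d_0%N A)%E; first by [].
  rewrite a0 /mseries /=.
  transitivity (\sum_(k <oo | k \in A) (poisson_pmf a k)%:E)%E.
    by rewrite nneseries_esum ?set_mem_set// => *; rewrite lee_fin.
  rewrite eseries_mkcond; apply: eq_eseriesr => k _.
  transitivity ((poisson_pmf a k)%:E * \d_k A)%E => //.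
  by rewrite diracE; case: (k \in A); rewrite ?mule1 ?mule0.
rewrite ge0_integral_measure_series//; last first.
  by move=> k _; rewrite lee_fin ln_ge0// ler1n leq_max orbT.
under eq_eseriesr => k _.
  rewrite ge0_integral_mscale//; last first.
    by move=> i _; rewrite lee_fin ln_ge0// ler1n leq_max orbT.
  rewrite integral_dirac// diracT mul1e -EFinM; over.
rewrite (_ : (fun n => _) = EFin \o (fun n => expR (- a)
    * pseries (fun k => lnp k / k`!%:R) a n)); last first.
  apply/funext => n /=; rewrite sumEFin; congr EFin.
  rewrite /pseries /series /= mulr_sumr; apply: eq_bigr => k _.
  by rewrite /poisson_pmf a0 /lnp maxnC; ring.
have cl := @tame_cvg _ a tame_lnp.
rewrite EFin_lim; last by apply: is_cvgMr.
by apply/cvg_lim => //; apply: cvgMr.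
Qed.

End poisson_expectation.

(** * The function Psi *)

Section subset_products.
Variables (R : realType) (T : finType).

Lemma prod1D (A : {set T}) (x : T -> R) :
  \prod_(i in A) (1 + x i) = \sum_(I : {set T} | I \subset A) \prod_(i in I) x i.
Proof.
transitivity (\sum_(J : {set T}) \prod_(i in A) (if i \in J then x i else 1) *
  (J \subset A)%:R); last first.
  rewrite [RHS]big_mkcond; apply: eq_bigr => J _; case: ifPn => JA; last by rewrite mulr0.
  rewrite mulr1 -big_mkcondr; apply: eq_bigl => i.
  by have [/(subsetP JA)->|] := boolP (i \in J); rewrite ?andbF.
have -> : \prod_(i in A) (1 + x i) = \prod_i \sum_(b : bool)
    (if b then (if i \in A then x i else 0) else 1).
  rewrite big_mkcond; apply: eq_bigr => i _; rewrite big_bool /=.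
  by case: (i \in A); rewrite ?add0r // addrC.
rewrite bigA_distr_bigA.
rewrite (reindex (fun J : {set T} => [ffun i => i \in J])) /=; last first.
  exists (fun f : {ffun T -> bool} => [set i | f i]) => [J _|f _].
    by apply/setP => i; rewrite inE ffunE.
  by apply/ffunP => i; rewrite ffunE inE.
apply: eq_bigr => J _; have [JA|/subsetPn[i iJ iA]] := boolP (J \subset A).
  rewrite mulr1 [RHS]big_mkcond; apply: eq_bigr => i _; rewrite ffunE.
  by case: ifPn => [iJ|_]; [rewrite (subsetP JA)|case: ifP].
by rewrite mulr0 (bigD1 i)//= ffunE iJ (negPf iA) mul0r.
Qed.

Lemma prod1D_le_exp (A : {set T}) (x : T -> R) : (forall i, i \in A -> 0 <= x i) ->
  \prod_(i in A) (1 + x i) <= expR (\sum_(i in A) x i).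
Proof.
move=> x0; rewrite expR_sum; apply: ler_prod => i iA.
by rewrite addr_ge0 ?x0// expR_ge1Dx.
Qed.

End subset_products.

(** * Expectations under products of zero-truncated Poisson laws *)

Section zero_truncated_poisson.
Variables (R : realType) (lambda : R).
Hypothesis l01 : 0 < lambda < 1.
Local Notation mu := (ln lambda^-1).
Local Notation p := (ztp_pmf mu).

Lemma mu_gt0 : 0 < mu.
Proof. by case/andP: l01 => l0 l1; rewrite ln_gt0// invf_gt1. Qed.

Lemma expRN_mu : expR (- mu) = lambda.
Proof.
by case/andP: l01 => l0 l1; rewrite lnV ?posrE// opprK lnK.
Qed.

Lemma ztp_pmfE k : p k = (0 < k)%N%:R * (lambda * (mu ^+ k / k`!%:R) / (1 - lambda)).
Proof.
rewrite /ztp_pmf /poisson_pmf mu_gt0 expr0 fact0 invr1 mulr1 mul1r expRN_mu.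
by case: k => [|k]; rewrite ?mul0r //= mul1r [lambda * _]mulrC.
Qed.

Lemma l1_gt0 : 0 < 1 - lambda.
Proof. by case/andP: l01 => l0 l1; rewrite subr_gt0. Qed.

Lemma ztp_pmf_ge0 k : 0 <= p k.
Proof.
rewrite ztp_pmfE mulr_ge0// divr_ge0 ?(ltW l1_gt0)// mulr_ge0 ?divr_ge0 ?exprn_ge0//.
  by case/andP: l01 => /ltW.
exact: ltW mu_gt0.
Qed.

(** The expectation restricted to values below K. On finite boxes independence is a finite product
    expansion; K tends to infinity only in the final bounds. *)
Definition psum K (h : nat -> R) : R := \sum_(k < K) p k * h k.

Lemma psum_cvg h : tame h -> h 0%N = 0 ->
  (psum K h @[K --> \oo] --> pois h mu / (1 - lambda))%classic.
Proof.
move=> th h0.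
rewrite (_ : (fun K => psum K h) = (fun K => (lambda * pseries (fun k => h k / k`!%:R) mu K) / (1 - lambda))).
  apply: cvgMl; rewrite /pois expRN_mu; apply: cvgMr; exact: tame_cvg.
apply/funext => K; rewrite /psum /pseries /series /= big_mkord.
rewrite mulr_sumr mulr_suml; apply: eq_bigr => -[[|k] kK] _ /=.
  by rewrite h0 !(mulr0, mul0r).
by rewrite ztp_pmfE mul1r; ring.
Qed.

Lemma psum_nd h : (forall k, 0 <= h k) -> {homo psum^~ h : K L / (K <= L)%N >-> K <= L}.
Proof.
move=> h0 K L /subnK <-; elim: (L - K)%N => // i IH; apply: le_trans IH _.
by rewrite addSn /psum big_ord_recr /= lerDl mulr_ge0// ztp_pmf_ge0.
Qed.

Lemma psum_le h K : tame h -> h 0%N = 0 -> (forall k, 0 <= h k) ->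
  psum K h <= pois h mu / (1 - lambda).
Proof.
move=> th h0 hge; have c := psum_cvg th h0.
rewrite -(cvg_lim _ c)//; apply: nondecreasing_cvgn_le; first exact: psum_nd.
by apply/cvg_ex; eexists; exact: c.
Qed.

Lemma psum1E K : psum K (fun=> 1) = psum K (fun k => (0 < k)%N%:R).
Proof.
by apply: eq_bigr => -[[|k] kK] _ //=; rewrite /ztp_pmf /= !mul0r.
Qed.

Lemma psum1_cvg : (psum K (fun=> 1) @[K --> \oo] --> (1 : R))%classic.
Proof.
rewrite (_ : (fun K => _) = (fun K => psum K (fun k => (0 < k)%N%:R))); last first.
  by apply/funext => K; rewrite psum1E.
have := @psum_cvg (fun k => (0 < k)%N%:R) (tame_pos R) erefl.
by rewrite pois_pos expRN_mu divff// gt_eqF// l1_gt0.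
Qed.

Lemma psum1_le K : psum K (fun=> 1) <= 1.
Proof.
rewrite psum1E; apply: le_trans (psum_le _ _ _ _) _ => //; first exact: tame_pos.
by rewrite pois_pos expRN_mu divff// gt_eqF// l1_gt0.
Qed.

Lemma psum_ge0 K h : (forall k, 0 <= h k) -> 0 <= psum K h.
Proof. by move=> h0; apply: sumr_ge0 => k _; rewrite mulr_ge0// ztp_pmf_ge0. Qed.

Lemma psum_id_le K : psum K (fun k => k%:R) <= mu / (1 - lambda).
Proof.
have ti : tame (fun k => k%:R : R).
  by apply: (@tame_lin _ _ 1) => k; rewrite mul1r ger0_norm ?ler_nat.
apply: le_trans (psum_le _ ti _ _) _ => //.
have := @pois_bias _ (fun=> 1) mu; rewrite (_ : (fun k => k%:R * 1) = (fun k => k%:R)).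
  by move=> /(_ ti (tame_const 1)) <-; rewrite -[_ \o _]/(fun=> 1) pois1 mulr1.
by apply/funext => k; rewrite mulr1.
Qed.

Lemma psum_inv0_le K : psum K (@inv0 R) <= Num.min 1 (2 / mu).
Proof.
have i0 k : 0 <= inv0 R k by case: k => [|k]//=; rewrite invr_ge0.
rewrite le_min; apply/andP; split.
  apply: le_trans (psum1_le K); apply: ler_sum => k _; rewrite ler_wpM2l ?ztp_pmf_ge0//.
  by case: (nat_of_ord k) => [|j]//=; rewrite invf_le1 ?ltr0n// ler1n.
apply: le_trans (psum_le _ (tame_inv0 R) _ _) _ => //.
rewrite ler_pdivrMr ?l1_gt0//; apply: le_trans (pois_inv0 mu_gt0) _.
by rewrite expRN_mu mulrAC.
Qed.

Variable N : nat.
Implicit Types (K m : nat) (x : {ffun 'I_N -> nat}).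

Definition emb K (z : {ffun 'I_N -> 'I_K}) : {ffun 'I_N -> nat} := [ffun i => val (z i)].

Definition pw x : R := \prod_(i < N) p (x i).

Definition bx K (F : {ffun 'I_N -> nat} -> R) : R :=
  \sum_(z : {ffun 'I_N -> 'I_K}) pw (emb z) * F (emb z).

Lemma pw_ge0 x : 0 <= pw x.
Proof. by apply: prodr_ge0 => i _; exact: ztp_pmf_ge0. Qed.

Lemma pw_pos x : pw x != 0 -> forall i, (0 < x i)%N.
Proof.
move=> /prodf_neq0 x0 i; have := x0 i isT; rewrite lt0n; apply: contraNneq => ->.
by rewrite /ztp_pmf.
Qed.

Lemma bx_le K F1 F2 : (forall x, (forall i, (0 < x i)%N) -> F1 x <= F2 x) ->
  bx K F1 <= bx K F2.
Proof.
move=> F12; apply: ler_sum => z _; have [->|/pw_pos w0] := eqVneq (pw (emb z)) 0.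
  by rewrite !mul0r.
by rewrite ler_wpM2l ?pw_ge0// F12.
Qed.

Lemma bxD K F1 F2 : bx K (fun x => F1 x + F2 x) = bx K F1 + bx K F2.
Proof. by rewrite -big_split; apply: eq_bigr => z _; rewrite mulrDr. Qed.

Lemma bxZ K c F : bx K (fun x => c * F x) = c * bx K F.
Proof. by rewrite mulr_sumr; apply: eq_bigr => z _; rewrite mulrCA. Qed.

Lemma bx_sum K (I : Type) (r : seq I) (P : pred I) (F : I -> {ffun 'I_N -> nat} -> R) :
  bx K (fun x => \sum_(i <- r | P i) F i x) = \sum_(i <- r | P i) bx K (F i).
Proof. by rewrite exchange_big; apply: eq_bigr => z _; rewrite mulr_sumr. Qed.

Lemma bx_prod K (h : 'I_N -> nat -> R) :
  bx K (fun x => \prod_i h i (x i)) = \prod_i psum K (h i).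
Proof.
rewrite /psum bigA_distr_bigA; apply: eq_bigr => z _.
by rewrite /pw -big_split; apply: eq_bigr => i _; rewrite ffunE.
Qed.

(** The probability that all N values are below K; on the box it multiplies every constant, and it
    tends to 1. *)
Definition PK K : R := psum K (fun=> 1) ^+ N.

Lemma bx_const K c : bx K (fun=> c) = c * PK K.
Proof.
have -> : PK K = bx K (fun x => \prod_(i < N) (fun _ : nat => 1) (x i)).
  by rewrite (@bx_prod K (fun _ _ => 1)) prodr_const card_ord.
by rewrite -bxZ; apply: eq_bigr => z _; rewrite big1// mulr1.
Qed.

Lemma PK_cvg : (PK K @[K --> \oo] --> (1 : R))%classic.
Proof.
rewrite -(expr1n R N).
exact: (continuous_cvg _ (@exprn_continuous R N 1) psum1_cvg).
Qed.

Lemma bx_site_le K (i : 'I_N) (h : nat -> R) : (forall k, 0 <= h k) ->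
  bx K (fun x => h (x i)) <= psum K h.
Proof.
move=> h0.
have -> : bx K (fun x => h (x i)) = bx K (fun x => \prod_j (if j == i then h else fun=> 1) (x j)).
  apply: eq_bigr => z _; congr (_ * _); rewrite (bigD1 i)//= eqxx big1 ?mulr1//.
  by move=> j /negPf->.
rewrite (@bx_prod K (fun j => if j == i then h else fun=> 1)) (bigD1 i)//= eqxx ler_piMr ?psum_ge0//.
rewrite (eq_bigr (fun=> psum K (fun=> 1))) => [|j /negPf->//].
apply: (@le_trans _ _ (\prod_(j < N | j != i) 1)); last by rewrite big1.
by apply: ler_prod => j _; rewrite psum_ge0 ?psum1_le.
Qed.

(** The box as a list of functions into nat, so that boxes of different sizes can be compared with
    each other and with the finite sets of the infinite sum. *)
Lemma fboxP K : exists s : seq {ffun 'I_N -> nat}, [/\ uniq s,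
  forall x, (x \in s) = [forall i, (x i < K)%N] &
  forall F : {ffun 'I_N -> nat} -> R, \sum_(x <- s) F x = \sum_z F (@emb K z)].
Proof.
exists [seq emb z | z <- index_enum {ffun 'I_N -> 'I_K}]; split.
- rewrite map_inj_uniq ?index_enum_uniq// => z z' /ffunP zz; apply/ffunP => i.
  by apply: val_inj; have := zz i; rewrite !ffunE.
- move=> x; apply/mapP/forallP => [[z _ ->] i|xK]; first by rewrite ffunE; exact: ltn_ord.
  exists [ffun i => Ordinal (xK i)]; first by rewrite mem_index_enum.
  by apply/ffunP => i; rewrite !ffunE.
- by move=> F; rewrite big_map.
Qed.

Section log_moments.
Variable F : {ffun 'I_N -> nat} -> R.
Hypothesis F0 : forall x, (forall i, (0 < x i)%N) -> 0 <= F x.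

Lemma wF_ge0 x : 0 <= pw x * F x.
Proof.
have [->|/pw_pos w0] := eqVneq (pw x) 0; first by rewrite mul0r.
by rewrite mulr_ge0 ?pw_ge0 ?F0.
Qed.

Lemma bx_mono K L : (K <= L)%N -> bx K F <= bx L F.
Proof.
move=> KL; have [s [us sK sE]] := fboxP K; have [t [ut tL tE]] := fboxP L.
rewrite /bx -(sE (fun x => pw x * F x)) -(tE (fun x => pw x * F x)).
have pt : perm_eq t (s ++ [seq x <- t | x \notin s]).
  rewrite perm_sym; apply: uniq_perm => //.
    rewrite cat_uniq us filter_uniq// andbT -all_predC.
    by apply/allP => x; rewrite mem_filter /= => /andP[].
  move=> x; rewrite mem_cat mem_filter; have [xs|//] := boolP (x \in s).
  rewrite tL; move: xs; rewrite sK => /forallP xK; apply/esym/forallP => i.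
  exact: leq_trans (xK i) KL.
rewrite [leRHS](perm_big _ pt) big_cat /= lerDl sumr_ge0// => x _; exact: wF_ge0.
Qed.

Local Notation E := (\esum_(x in [set: {ffun 'I_N -> nat}]%classic) (pw x * F x)%:E)%E.

Lemma bx_le_esum K : ((bx K F)%:E <= E)%E.
Proof.
have [s [us sK sE]] := fboxP K; apply: esum_ge; exists [set` s]%classic.
  by split => //; exact: finite_seq.
by rewrite -fsbig_seq// sumEFin lee_fin /bx -(sE (fun x => pw x * F x)).
Qed.

Lemma esum_le_bx c : (forall K, bx K F <= c) -> (E <= c%:E)%E.
Proof.
move=> bc; apply: ge_ereal_sup => _ /= [A [fA _] <-].
have /finite_seqP[X XA] := fA.
pose K := (\max_(x <- X) \max_i x i).+1.
have [s [us sK sE]] := fboxP K.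
apply: (@le_trans _ _ (\sum_(x \in [set` s]%classic) (pw x * F x)%:E)%E).
  apply: lee_fsum_nneg_subset => //; first exact: finite_seq.
    move=> x /set_mem; rewrite XA /= => xX; apply/mem_set => /=; rewrite sK.
    apply/forallP => i.
    rewrite /K ltnS; apply: leq_trans (leq_bigmax_seq _ xX isT).
    exact: (leq_bigmax i).
  by move=> x _; rewrite lee_fin wF_ge0.
rewrite -fsbig_seq// sumEFin lee_fin (sE (fun x => pw x * F x)); exact: bc.
Qed.

(** The uniform bound c guarantees that the sum is finite; [fine] would send +oo to 0. *)
Lemma fine_esum_ge c : (forall K, bx K F <= c) -> forall K, bx K F <= fine E.
Proof.
move=> bc K; rewrite -lee_fin fineK; first exact: bx_le_esum.
rewrite ge0_fin_numE; first exact: le_lt_trans (esum_le_bx bc) (ltry _).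
by apply: esum_ge0 => x _; rewrite lee_fin wF_ge0.
Qed.

Lemma fine_esum_le c : (forall K, bx K F <= c) -> fine E <= c.
Proof.
move=> bc; rewrite -lee_fin fineK; first exact: esum_le_bx.
rewrite ge0_fin_numE; first exact: le_lt_trans (esum_le_bx bc) (ltry _).
by apply: esum_ge0 => x _; rewrite lee_fin wF_ge0.
Qed.

(** The truncated expectation increases with K, so its bound follows from the limit over larger
    boxes, where [PK] tends to 1. *)
Lemma bx_lim A b : (forall K, bx K F <= A + b * PK K) -> forall K, bx K F <= A + b.
Proof.
move=> AbK K.
have c : (A + b * PK K @[K --> \oo] --> A + b)%classic.
  have c1 : (b * PK K @[K --> \oo] --> b * 1)%classic.
    by apply: cvgMr; exact: PK_cvg.
  by rewrite mulr1 in c1; apply: cvgD => //; exact: cvg_cst.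
rewrite -(cvg_lim _ c)//; apply: limr_ge; first by apply/cvg_ex; eexists; exact: c.
by exists K => // L /= KL; apply: le_trans (bx_mono KL) _.
Qed.

End log_moments.

Lemma card_lt_ord m : (m <= N)%N -> #|[set i : 'I_N | (i < m)%N]| = m.
Proof.
move=> mN; rewrite -sum1_card (eq_bigl (fun i : 'I_N => (i < m)%N)) => [|i]; last by rewrite inE.
by rewrite -(big_ord_widen N (fun=> 1%N) mN) sum1_card card_ord.
Qed.

Lemma elem_sym_gt0 m x : (m <= N)%N -> (forall i, (0 < x i)%N) -> (0 < elem_sym m x)%N.
Proof.
move=> mN x0; rewrite /elem_sym.
rewrite (bigD1 [set i : 'I_N | (i < m)%N]) ?card_lt_ord//= addn_gt0 prodn_gt0//.
Qed.

Definition lse m x : R := ln (elem_sym m x)%:R.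

Lemma lse_ge0 m x : (m <= N)%N -> (forall i, (0 < x i)%N) -> 0 <= lse m x.
Proof. by move=> mN x0; rewrite ln_ge0// ler1n elem_sym_gt0. Qed.

Lemma PsiE m : Psi m N lambda =
  fine (\esum_(x in [set: {ffun 'I_N -> nat}]%classic) (pw x * lse m x)%:E)%E.
Proof. by []. Qed.

Lemma elem_symR m x : (elem_sym m x)%:R =
  \sum_(I : {set 'I_N} | #|I| == m) \prod_(i in I) (x i)%:R :> R.
Proof. by rewrite natr_sum; apply: eq_bigr => I _; rewrite natr_prod. Qed.

(** The symmetric function of degree m is at most y ^ m times the product of the factors 1 + x_i /
    y, for any scale y, which is left to the caller. *)
Lemma lse_le m x y : 0 < y -> (m <= N)%N -> (forall i, (0 < x i)%N) ->
  lse m x <= m%:R * ln y + \sum_i y^-1 * (x i)%:R.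
Proof.
move=> y0 mN x0.
rewrite /lse -[leRHS]expRK ler_ln ?posrE ?expR_gt0 ?ltr0n ?elem_sym_gt0//.
rewrite expRD expRM_natl lnK ?posrE// elem_symR.
have -> : \sum_i y^-1 * (x i)%:R = \sum_(i in [set: 'I_N]) y^-1 * (x i)%:R.
  by apply: eq_bigl => i; rewrite inE.
apply: le_trans (ler_wpM2l (exprn_ge0 _ (ltW y0)) (prod1D_le_exp _)); last first.
  by move=> i _; rewrite mulr_ge0// invr_ge0 ltW.
rewrite prod1D mulr_sumr [leLHS]big_mkcond [leRHS]big_mkcond; apply: ler_sum => I _.
rewrite subsetT; case: ifPn => [/eqP Im|_].
  rewrite big_split /= prodr_const Im mulrA -exprMn divff ?gt_eqF// expr1n.
  by rewrite mul1r.
by rewrite mulr_ge0 ?exprn_ge0 ?(ltW y0)// prodr_ge0// => i _; rewrite mulr_ge0// invr_ge0 ltW.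
Qed.

(** By complements, the symmetric function of degree m in x is the full product times the one of
    degree N - m in the reciprocals, and the previous argument applies to the latter. *)
Lemma lse_le_full m x y : 0 < y -> (m <= N)%N -> (forall i, (0 < x i)%N) ->
  lse m x <= lse N x + (N - m)%N%:R * ln y + \sum_i y^-1 * inv0 R (x i).
Proof.
move=> y0 mN x0.
have inv0E i : inv0 R (x i) = ((x i)%:R)^-1 by case: (x i) (x0 i).
have xp : 0 < \prod_i ((x i)%:R : R) by apply: prodr_gt0 => i _; rewrite ltr0n.
have eN : (elem_sym N x)%:R = \prod_i (x i)%:R :> R.
  rewrite elem_symR (big_pred1 setT) => [|I].
    by apply: eq_bigl => i; rewrite inE.
  apply/eqP/eqP => [IN|->]; last by rewrite cardsT card_ord.
  by apply/eqP; rewrite eqEcard subsetT cardsT card_ord IN leqnn.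
rewrite /lse eN -[leRHS]expRK ler_ln ?posrE ?expR_gt0 ?ltr0n ?elem_sym_gt0//.
rewrite !expRD expRM_natl !lnK ?posrE// elem_symR -mulrA.
have -> : \sum_i y^-1 * inv0 R (x i) = \sum_(i in [set: 'I_N]) y^-1 * ((x i)%:R)^-1.
  by apply: eq_big => [i|i _]; rewrite ?inE// inv0E.
have yx i : 0 <= y^-1 * ((x i)%:R)^-1 by rewrite mulr_ge0// invr_ge0// ltW.
apply: (@le_trans _ _ (\prod_i (x i)%:R * (y ^+ (N - m) *
    \prod_(i in [set: 'I_N]) (1 + y^-1 * ((x i)%:R)^-1)))); last first.
  rewrite ler_wpM2l ?(ltW xp)// ler_wpM2l ?exprn_ge0 ?(ltW y0)//.
  exact: prod1D_le_exp.
rewrite prod1D !mulr_sumr [leLHS]big_mkcond [leRHS](reindex_inj (@setC_inj _)) /=.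
rewrite [leRHS]big_mkcond; apply: ler_sum => I _; rewrite subsetT.
case: ifPn => [/eqP Im|_]; last first.
  by rewrite !mulr_ge0 ?exprn_ge0 ?(ltW y0) ?(ltW xp)// prodr_ge0.
rewrite big_split /= prodr_const cardsCs setCK card_ord Im mulrA mulrA.
rewrite mulrAC [X in X * _]mulrAC -mulrA -exprMn divff ?gt_eqF// expr1n mulr1.
rewrite [\prod_i _](bigID (mem I)) /= -mulrA -[leLHS]mulr1 ler_wpM2l ?prodr_ge0//.
rewrite [X in _ * X](_ : _ = \prod_(i | i \notin I) ((x i)%:R)^-1); last first.
  by apply: eq_bigl => i; rewrite inE.
rewrite -big_split big1//= => i _; rewrite divff// pnatr_eq0 -lt0n; exact: x0.
Qed.

Lemma bx_lse_le m K (y : R) : (m <= N)%N -> 0 < y ->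
  bx K (lse m) <= N%:R * (mu / (1 - lambda)) / y + m%:R * ln y * PK K.
Proof.
move=> mN y0; apply: (@le_trans _ _ (bx K (fun x => m%:R * ln y + \sum_i y^-1 * (x i)%:R))).
  by apply: bx_le => x; exact: lse_le.
rewrite bxD bx_const addrC lerD2r bx_sum.
rewrite -[N in leRHS]card_ord -sumr_const mulr_suml mulr_suml; apply: ler_sum => i _.
rewrite mul1r bxZ mulrC ler_wpM2r ?invr_ge0 ?(ltW y0)//.
exact: le_trans (bx_site_le _ _ _) (psum_id_le K).
Qed.

Lemma Psi_bounded m : (m <= N)%N -> forall K, bx K (lse m) <= N%:R * (mu / (1 - lambda)).
Proof.
move=> mN K; have := @bx_lse_le m K 1 mN ltr01.
by rewrite ln1 mulr0 mul0r addr0 divr1.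
Qed.

Lemma Psi_le m (y : R) : (m <= N)%N -> 0 < y ->
  Psi m N lambda <= m%:R * ln y + N%:R * (mu / (1 - lambda)) / y.
Proof.
move=> mN y0; have l0 := fun x => @lse_ge0 m x mN.
rewrite PsiE; apply: fine_esum_le => // K; rewrite addrC.
by apply: bx_lim => // L; exact: bx_lse_le.
Qed.

Lemma Psi_le_full m (y : R) : (m <= N)%N -> 0 < y ->
  Psi m N lambda <= Psi N N lambda + (N - m)%N%:R * ln y
    + N%:R * Num.min 1 (2 / mu) / y.
Proof.
move=> mN y0; have l0 := fun x => @lse_ge0 m x mN.
rewrite PsiE; apply: fine_esum_le => // K; rewrite addrAC.
apply: bx_lim => // L; apply: (@le_trans _ _ (bx L (fun x =>
    lse N x + (N - m)%N%:R * ln y + \sum_i y^-1 * inv0 R (x i)))).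
  by apply: bx_le => x; exact: lse_le_full.
rewrite !bxD bx_const addrAC lerD2r; apply: lerD.
  by rewrite PsiE; apply: fine_esum_ge (Psi_bounded _) _ => // x; exact: lse_ge0.
rewrite bx_sum -[N in leRHS]card_ord -sumr_const mulr_suml mulr_suml.
apply: ler_sum => i _; rewrite mul1r bxZ mulrC ler_wpM2r ?invr_ge0 ?(ltW y0)//.
apply: le_trans (bx_site_le _ _ _) (psum_inv0_le L).
by case=> [|k]//=; rewrite invr_ge0.
Qed.

(** A single subset of size m is kept, and ln x >= ln mu + 1 - mu / x is averaged, the mean of 1 / x
    being at most 2 / mu. *)
Lemma Psi_ge m : (m <= N)%N -> m%:R * (ln mu - 1) <= Psi m N lambda.
Proof.
move=> mN; have l0 := fun x => @lse_ge0 m x mN.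
have mu0 := mu_gt0.
have lb K : m%:R * ((ln mu + 1) * PK K - 2) <= Psi m N lambda.
  rewrite PsiE; apply: le_trans (fine_esum_ge l0 (Psi_bounded mN) K).
  apply: (@le_trans _ _ (bx K (fun x => \sum_(i < N | (i < m)%N)
      (ln mu + 1 + - mu * inv0 R (x i))))); last first.
    apply: bx_le => x x0.
    apply: (@le_trans _ _ (\sum_(i < N | (i < m)%N) ln (x i)%:R)).
      apply: ler_sum => i _; case: (x i) (x0 i) => // k _.
      have k0 : (0 : R) < k.+1%:R by rewrite ltr0n.
      have := ln_le_subr1 (divr_gt0 mu0 k0); rewrite ln_div ?posrE//= mulNr.
      by set a := mu / _; set b := ln k.+1%:R; set e := ln mu; lra.
    rewrite /lse; pose I := [set i : 'I_N | (i < m)%N].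
    have Im : #|I| == m by rewrite card_lt_ord.
    rewrite -[leLHS]expRK ler_ln ?posrE ?expR_gt0 ?ltr0n ?elem_sym_gt0//.
    rewrite expR_sum elem_symR (bigD1 I)//=.
    rewrite [X in _ <= X + _](_ : _ = \prod_(i < N | (i < m)%N) expR (ln (x i)%:R)).
      by rewrite lerDl sumr_ge0// => J _; rewrite prodr_ge0.
    apply: eq_big => i; rewrite ?inE// => _.
    by rewrite lnK// posrE ltr0n.
  rewrite bx_sum.
  have -> : m%:R * ((ln mu + 1) * PK K - 2) = \sum_(i < N | (i < m)%N) ((ln mu + 1) * PK K - 2).
    rewrite -(big_ord_widen N (fun=> (ln mu + 1) * PK K - 2) mN) sumr_const card_ord.
    by rewrite mulr_natl.
  apply: ler_sum => i _; rewrite bxD bx_const bxZ lerD2l mulNr lerN2.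
  apply: (@le_trans _ _ (mu * (2 / mu))); last by rewrite mulrCA divff ?gt_eqF// mulr1.
  rewrite ler_wpM2l ?(ltW mu0)//; apply: le_trans (bx_site_le _ _ _) _.
    by case=> [|k]//=; rewrite invr_ge0.
  by apply: le_trans (psum_inv0_le K) _; rewrite ge_min lexx orbT.
have c : (m%:R * ((ln mu + 1) * PK K - 2) @[K --> \oo] --> m%:R * ((ln mu + 1) * 1 - 2))%classic.
  apply: cvgMr; apply: cvgB; last exact: cvg_cst.
  by apply: cvgMr; exact: PK_cvg.
have -> : m%:R * (ln mu - 1) = m%:R * ((ln mu + 1) * 1 - 2) by ring.
rewrite -(cvg_lim _ c)//; apply: limr_le; first by apply/cvg_ex; eexists; exact: c.
by exists 0%N.
Qed.

End zero_truncated_poisson.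

(** * Moments of the exploration *)

Section layer_moments.
Variables (V : finType) (u : V) (R : realType) (q : R).
Hypothesis q01 : 0 <= q <= 1.
Implicit Types (G : {set {set V}}) (k d : nat).
Local Notation exG := (ex q (pairs V)).
Local Notation binex := (binex q).
Local Notation n := (#|V|%:R : R).
Local Notation D := (n * q).

Definition Nk k G : R := #|lay u G k|%:R.

Lemma q_ge0 : 0 <= q. Proof. by case/andP: q01. Qed.
Lemma D_ge0 : 0 <= D. Proof. by rewrite mulr_ge0 ?q_ge0. Qed.

Lemma lay_sub G k : lay u G k \subset ball u G k.
Proof. exact: subsetDl. Qed.

Lemma disj_ball_lay G k : [disjoint ~: ball u G k & lay u G k].
Proof.
rewrite disjoint_sym disjoints_subset setCK; exact: lay_sub.
Qed.

Lemma disj_ball_rball G k : [disjoint ~: ball u G k & rball u G k].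
Proof.
rewrite disjoint_sym disjoints_subset setCK; exact: rball_mono.
Qed.

Lemma disj_lay_rball G k : [disjoint lay u G k & rball u G k].
Proof.
by rewrite disjoints_subset; apply/subsetP => v; rewrite !inE => /andP[].
Qed.

Lemma lay_degE G k v :
  (v \in lay u G k.+1) = (v \in ~: ball u G k) && (0 < deg G v (lay u G k))%N.
Proof.
rewrite /lay in_setD /= in_setC; have [//|vb/=] := boolP (v \in ball u G k).
rewrite inE (negPf vb) /=; apply/existsP/card_gt0P.
  move=> [w /andP[wB wv]]; exists w; rewrite inE -/(adj G v w) adj_sym wv andbT.
  rewrite /lay in_setD wB andbT; apply/negP => wr; move/negP: vb; apply.
  case: k wr {wB} => [|k]; first by rewrite inE.
  by move=> wr; rewrite /= inE; apply/orP; right; apply/existsP; exists w; rewrite wr.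
move=> [w]; rewrite inE -/(adj G v w) adj_sym => /andP[wL wv]; exists w.
by rewrite wv andbT; exact: (subsetP (lay_sub G k)).
Qed.

Lemma NkS k G : Nk k.+1 G =
  \sum_(v in ~: ball u G k) (fun i => (0 < i)%N%:R) (deg G v (lay u G k)).
Proof.
rewrite /Nk -sum1_card natr_sum big_mkcond [RHS]big_mkcond.
by apply: eq_bigr => v _; rewrite lay_degE; case: (v \in ~: _) => //=;
  case: (0 < _)%N.
Qed.

Lemma Nk0 G : Nk 0 G = 1.
Proof. by rewrite /Nk /lay /= setD0 cards1. Qed.

(** The conditional mean of the size of layer k + 1 given the exploration up to layer k. *)
Definition Mk k G : R := #|~: ball u G k|%:R * (1 - (1 - q) ^+ #|lay u G k|).

Lemma card_setC_le (A : {set V}) : #|~: A|%:R <= n.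
Proof. by rewrite ler_nat max_card. Qed.

Lemma Mk_le k G : 0 <= Mk k G <= D * Nk k G.
Proof.
have [p1 _] := pow_bernoulli q01 #|lay u G k|.
have q1 : 0 <= (1 - q) ^+ #|lay u G k| <= 1.
  case/andP: q01 => q0 q1; rewrite exprn_ge0 ?subr_ge0// exprn_ile1// ?subr_ge0//.
  by rewrite lerBlDr lerDl.
rewrite mulr_ge0 ?subr_ge0//=; last by case/andP: q1.
rewrite -mulrA [q * _]mulrC; apply: ler_pM => //.
- by rewrite subr_ge0; case/andP: q1.
- exact: card_setC_le.
- by rewrite lerBlDr -lerBlDl.
Qed.

Lemma ex_layer k (Phi : {set {set V}} -> R) (g : nat -> R) :
  (forall G, Phi (hist u G k) = Phi G) ->
  exG (fun G => Phi G * \sum_(v in ~: ball u G k) g (deg G v (lay u G k))) =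
  exG (fun G => Phi G * (#|~: ball u G k|%:R * binex #|lay u G k| g)).
Proof.
move=> PhiH; apply: (@ex_cond1 _ u _ q k Phi (fun G => lay u G k)
  (fun G => ~: ball u G k) (fun _ => g)) => // G.
- exact: disj_ball_lay.
- exact: disj_ball_rball.
- exact: disj_lay_rball.
- exact: hist_lay.
- by rewrite hist_ball.
Qed.

Lemma ex_layer_var k (g : nat -> R) :
  exG (fun G => (\sum_(v in ~: ball u G k) g (deg G v (lay u G k))
                 - #|~: ball u G k|%:R * binex #|lay u G k| g) ^+ 2)
  <= exG (fun G => #|~: ball u G k|%:R * binex #|lay u G k| (fun i => g i ^+ 2)).
Proof.
rewrite (@ex_cond_var _ u _ q k (fun G => lay u G k) (fun G => ~: ball u G k)).
- apply: ex_le => // G _; rewrite ler_wpM2l//.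
  set c := binex _ g.
  rewrite (@eq_binex _ _ _ _ (fun i => g i ^+ 2 + (- 2 * c * g i + c ^+ 2))).
    rewrite binexD binexD binexZ binex_const -/c.
    by have := sqr_ge0 c; move: (binex _ _) => b; nra.
  by move=> i; ring.
- by move=> G; exact: disj_ball_lay.
- by move=> G; exact: disj_ball_rball.
- by move=> G; exact: disj_lay_rball.
- by move=> G; exact: hist_lay.
- by move=> G; rewrite hist_ball.
Qed.

Lemma ex_NkS k (Phi : {set {set V}} -> R) : (forall G, Phi (hist u G k) = Phi G) ->
  exG (fun G => Phi G * Nk k.+1 G) = exG (fun G => Phi G * Mk k G).
Proof.
move=> PhiH; under eq_ex => G _ do rewrite NkS.
rewrite (@ex_layer k Phi (fun i => (0 < i)%N%:R) PhiH).
by apply: eq_ex => G _; rewrite binex_pos.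
Qed.

Lemma ex_Nk_var k : exG (fun G => (Nk k.+1 G - Mk k G) ^+ 2) <= exG (Mk k).
Proof.
under eq_ex => G _ do rewrite NkS /Mk -binex_pos.
apply: le_trans (ex_layer_var _ _) _; apply: ex_le => // G _.
rewrite /Mk -binex_pos; apply: ler_wpM2l => //; apply: binex_le => // i.
by case: (0 < i)%N; rewrite ?expr1n ?expr0n.
Qed.

Lemma ex_Nk_le k : exG (Nk k) <= D ^+ k.
Proof.
elim: k => [|k IH].
  by rewrite expr0 (eq_ex _ (g := fun=> 1)) ?ex_const// => G _; exact: Nk0.
have := @ex_NkS k (fun=> 1) (fun=> erefl).
rewrite (eq_ex _ (g := Nk k.+1)) => [->|G _]; last by rewrite mul1r.
apply: (@le_trans _ _ (exG (fun G => D * Nk k G))).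
  by apply: ex_le => // G _; rewrite mul1r; case/andP: (Mk_le k G).
by rewrite exZ exprS ler_wpM2l ?D_ge0.
Qed.

Lemma ex_Nk_var_le k : exG (fun G => (Nk k.+1 G - Mk k G) ^+ 2) <= D ^+ k.+1.
Proof.
apply: le_trans (ex_Nk_var k) _; apply: (@le_trans _ _ (exG (fun G => D * Nk k G))).
  by apply: ex_le => // G _; case/andP: (Mk_le k G).
by rewrite exZ exprS ler_wpM2l ?D_ge0// ex_Nk_le.
Qed.

Lemma Mk_hist k G : Mk k (hist u G k) = Mk k G.
Proof. by rewrite /Mk hist_ball// hist_lay. Qed.

Hypothesis D2 : 2 <= D.

Lemma n_gt0 : 0 < n.
Proof.
rewrite ltr0n lt0n; apply/eqP => V0; move: D2; rewrite V0 mul0r.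
by rewrite lern0.
Qed.

(** The second moment is the variance around the conditional mean plus the second moment of that
    mean. The subtracted term makes the induction close: the new variance D ^ (k + 1) is absorbed
    because D >= 2. *)
Lemma ex_Nk_sq k : exG (fun G => Nk k G ^+ 2) <= (1 + 2 / D) * D ^+ k ^+ 2 - 2 / D * D ^+ k.
Proof.
have D0 : 0 < D by apply: lt_le_trans D2.
elim: k => [|k IH].
  rewrite (eq_ex _ (g := fun=> 1)) ?ex_const => [|G _]; last by rewrite Nk0 expr1n.
  by rewrite expr0 expr1n !mulr1 addrK.
have -> : exG (fun G => Nk k.+1 G ^+ 2) =
    exG (fun G => (Nk k.+1 G - Mk k G) ^+ 2) + exG (fun G => Mk k G * Mk k G).
  have e := ex_NkS (@Mk_hist k).
  rewrite -exD.
  have -> : exG (fun G => (Nk k.+1 G - Mk k G) ^+ 2 + Mk k G * Mk k G) =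
    exG (fun G => Nk k.+1 G ^+ 2 + (2 * (Mk k G * Mk k G) - 2 * (Mk k G * Nk k.+1 G))).
    by apply: eq_ex => G _; ring.
  by rewrite exD exB !exZ e subrr addr0.
apply: (@le_trans _ _ (D ^+ k.+1 + D ^+ 2 * ((1 + 2 / D) * D ^+ k ^+ 2 - 2 / D * D ^+ k))).
  apply: lerD; first exact: ex_Nk_var_le.
  apply: (@le_trans _ _ (exG (fun G => D ^+ 2 * Nk k G ^+ 2))).
    apply: ex_le => // G _; have /andP[M0 M1] := Mk_le k G.
    by rewrite -exprMn [leRHS]expr2; apply: ler_pM.
  by rewrite exZ ler_wpM2l// sqr_ge0.
set x := D ^+ k; have x0 : 0 < x by rewrite exprn_gt0.
rewrite exprS -/x.
have -> : (1 + 2 / D) * (D * x) ^+ 2 - 2 / D * (D * x) =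
   D ^+ 2 * ((1 + 2 / D) * x ^+ 2 - 2 / D * x) + D * x + x * (D - 2).
  by clear -D0; clearbody x; move: (n * q) D0 => E E0; field; rewrite gt_eqF.
by rewrite [leLHS]addrC lerDl mulr_ge0 ?(ltW x0)// subr_ge0.
Qed.

Lemma ex_Nk_sq2 k : exG (fun G => Nk k G ^+ 2) <= 2 * D ^+ k ^+ 2.
Proof.
have D0 : 0 < D by apply: lt_le_trans D2.
apply: le_trans (ex_Nk_sq k) _.
have : 2 / D <= 1 by rewrite ler_pdivrMr// mul1r.
have : 0 <= 2 / D by rewrite divr_ge0// ltW.
have : 0 < D ^+ k by rewrite exprn_gt0.
move: (D ^+ k) (2 / D) => x y x0 y0 y1.
by have := sqr_ge0 x; nra.
Qed.

Lemma card_ball G k : #|ball u G k|%:R = \sum_(j < k.+1) Nk j G.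
Proof.
elim: k => [|k IH]; first by rewrite big_ord1 Nk0 /= cards1.
rewrite big_ord_recr /= -IH /Nk -natrD /lay; congr _%:R.
by rewrite -(cardsID (ball u G k) (ball u G k.+1)) (setIidPr (ballS _ _ _)).
Qed.

Lemma geo_le k : \sum_(j < k.+1) D ^+ j <= 2 * D ^+ k.
Proof.
elim: k => [|k IH]; first by rewrite big_ord1 expr0 mulr1 ler1n.
have x0 : 0 <= D ^+ k by rewrite exprn_ge0// (le_trans _ D2).
by rewrite big_ord_recr /= exprS; have := ler_wpM2r x0 D2; lra.
Qed.

Lemma ex_ball_Nk k : exG (fun G => #|ball u G k|%:R * Nk k G) <= 4 * D ^+ k ^+ 2.
Proof.
have D0 : 0 < D by apply: lt_le_trans D2.
under eq_ex => G _ do rewrite card_ball mulr_suml.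
rewrite ex_sum; apply: (@le_trans _ _ (\sum_(j < k.+1) 2 * D ^+ k * D ^+ j)).
  apply: ler_sum => j _; have jk : (j <= k)%N by rewrite -ltnS.
  (* Weighted arithmetic-geometric inequality, where t is the ratio of the typical sizes of layers k
     and j. *)
  set t := D ^+ (k - j); have t0 : 0 < t by rewrite exprn_gt0.
  have kt : D ^+ k = t * D ^+ j by rewrite -exprD subnK.
  apply: (@le_trans _ _ (exG (fun G => t / 2 * Nk j G ^+ 2 + (2 * t)^-1 * Nk k G ^+ 2))).
    apply: ex_le => // G _; set a := Nk j G; set b := Nk k G.
    have -> : t / 2 * a ^+ 2 + (2 * t)^-1 * b ^+ 2 =
      a * b + (t * a - b) ^+ 2 / (2 * t) by field; rewrite gt_eqF.
    by rewrite lerDl divr_ge0 ?sqr_ge0// mulr_ge0// ltW.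
  rewrite exD !exZ; apply: (@le_trans _ _ (t / 2 * (2 * D ^+ j ^+ 2)
      + (2 * t)^-1 * (2 * D ^+ k ^+ 2))).
    by apply: lerD; rewrite ler_wpM2l ?ex_Nk_sq2// ?invr_ge0 ?divr_ge0 ?mulr_ge0 ?(ltW t0).
  rewrite kt le_eqVlt; apply/orP; left; apply/eqP; field; by rewrite gt_eqF.
rewrite -mulr_sumr; have := geo_le k.
have : 0 <= D ^+ k by rewrite exprn_ge0// ltW.
set x := D ^+ k; set s := \sum_(j < _) _ => x0 h.
by have := ler_wpM2l x0 h; nra.
Qed.

(** Each layer loses the vertices already in the ball and the second-order term of 1 - (1 - q) ^ N.
    Both losses are controlled by second moments, and the constant 10 is large enough for the
    induction when D >= 2. *)
Lemma ex_Nk_ge k : D ^+ k - 10 * D ^+ k ^+ 2 / n <= exG (Nk k).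
Proof.
have D0 : 0 < D by apply: lt_le_trans D2.
have n0 := n_gt0.
elim: k => [|k IH].
  rewrite (eq_ex _ (g := fun=> 1)) ?ex_const => [|G _]; last exact: Nk0.
  by rewrite expr0 lerBlDr lerDl divr_ge0// ltW.
have := @ex_NkS k (fun=> 1) (fun=> erefl).
rewrite (eq_ex _ (g := Nk k.+1)) => [->|G _]; last by rewrite mul1r.
apply: (@le_trans _ _ (exG (fun G => D * Nk k G - q * (#|ball u G k|%:R * Nk k G)
    - n * q ^+ 2 / 2 * Nk k G ^+ 2))); last first.
  apply: ex_le => // G _; rewrite mul1r /Mk.
  have [_ p2] := pow_bernoulli q01 #|lay u G k|.
  have -> : #|~: ball u G k|%:R = n - #|ball u G k|%:R :> R.
    by rewrite -(cardsC (ball u G k)) natrD addrC addKr.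
  set b := #|ball u G k|%:R; have b0 : 0 <= b by [].
  have bn : 0 <= n - b by rewrite subr_ge0 ler_nat max_card.
  apply: (@le_trans _ _ ((n - b) * (Nk k G * q - Nk k G ^+ 2 * q ^+ 2 / 2))).
    rewrite -subr_ge0 (_ : _ - _ = b * (Nk k G ^+ 2 * q ^+ 2 / 2)); last by ring.
    by rewrite mulr_ge0// divr_ge0// mulr_ge0// sqr_ge0.
  rewrite ler_wpM2l// /Nk; move: p2; move: (_ ^+ #|_|) (#|lay _ _ _|%:R) => x y.
  by lra.
rewrite !exB !exZ.
have q0 := q_ge0.
have h1 : q * exG (fun G => #|ball u G k|%:R * Nk k G) <= q * (4 * D ^+ k ^+ 2).
  by rewrite ler_wpM2l// ex_ball_Nk.
have h2 : n * q ^+ 2 / 2 * exG (fun G => Nk k G ^+ 2) <= n * q ^+ 2 / 2 * (2 * D ^+ k ^+ 2).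
  by rewrite ler_wpM2l ?ex_Nk_sq2// divr_ge0// mulr_ge0 ?sqr_ge0// ltW.
have h3 : D * (D ^+ k - 10 * D ^+ k ^+ 2 / n) <= D * exG (Nk k) by rewrite ler_wpM2l// ltW.
apply: le_trans (lerB (lerB h3 h1) h2).
rewrite exprS; set x := D ^+ k.
have -> : D * (x - 10 * x ^+ 2 / n) - q * (4 * x ^+ 2) - n * q ^+ 2 / 2 * (2 * x ^+ 2)
  = (D * x - 10 * (D * x) ^+ 2 / n) + x ^+ 2 * q * (9 * D - 14).
  by field; rewrite gt_eqF.
rewrite lerDl; apply: mulr_ge0; first by rewrite mulr_ge0// sqr_ge0.
by move: (n * q) D2 => E E2; lra.
Qed.

Lemma ex_Nk_dev k : exG (fun G => (Nk k G - D ^+ k) ^+ 2)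
  <= D ^+ k ^+ 2 * (2 / D + 20 * D ^+ k / n).
Proof.
have D0 : 0 < D by apply: lt_le_trans D2.
have n0 := n_gt0.
set x := D ^+ k; have x0 : 0 < x by rewrite exprn_gt0.
have -> : exG (fun G => (Nk k G - x) ^+ 2) =
    exG (fun G => Nk k G ^+ 2) - 2 * x * exG (Nk k) + x ^+ 2.
  rewrite -exZ -exB -[X in _ + X](ex_const q (pairs V)) -exD.
  by apply: eq_ex => G _; ring.
have := ex_Nk_sq k; have := ex_Nk_ge k; rewrite -/x => h1 h2.
have h3 : 2 * x * (x - 10 * x ^+ 2 / n) <= 2 * x * exG (Nk k).
  by rewrite ler_wpM2l// mulr_ge0// ltW.
have : 0 <= 2 / D * x by rewrite mulr_ge0 ?divr_ge0// ltW.
have -> : x ^+ 2 * (2 / D + 20 * x / n) =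
  x ^+ 2 * (2 / D) + 2 * x * (10 * x ^+ 2 / n).
  clear -D0 n0; clearbody x; move: (n * q) D0 => E E0.
  by field; rewrite !gt_eqF.
by move: h2 h3; set y := 10 * _ / n; set z := 2 / D; nra.
Qed.

Lemma near_excessE G d : (0 < d)%N ->
  (near_excess u G d)%:R = \sum_(j < d) (d.+1 - j)%N%:R * Nk j G.
Proof.
move=> d0; rewrite /near_excess natr_sum.
under [RHS]eq_bigr => j _.
  rewrite /Nk -sum1_card natr_sum mulr_sumr big_mkcond; over.
rewrite exchange_big big_mkcond; apply: eq_bigr => v _.
rewrite rball_gdist//; have [/andP[vC vd]|nv] := ifPn.
  rewrite (bigD1 (Ordinal vd))//= lay_gdist vC eqxx mulr1 big1 ?addr0//.
  move=> j jv; rewrite ifF// lay_gdist vC /=; apply/negbTE/eqP => e.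
  by move/eqP: jv; apply; apply: val_inj.
rewrite big1// => j _; rewrite ifF// lay_gdist; apply/negbTE/negP => /andP[vC /eqP e].
by move: nv; rewrite vC e ltn_ord.
Qed.

Lemma ex_near d : (0 < d)%N -> exG (fun G => (near_excess u G d)%:R) <= 6 * D ^+ d.-1.
Proof.
move=> d0; under eq_ex => G _ do rewrite near_excessE//.
rewrite ex_sum; case: d d0 => // d _ /=.
apply: (@le_trans _ _ (\sum_(j < d.+1) (d.+2 - j)%N%:R * D ^+ j)).
  by apply: ler_sum => j _; rewrite exZ ler_wpM2l// ex_Nk_le.
elim: d => [|d IH]; first by rewrite big_ord1 expr0 !mulr1 ler_nat.
rewrite big_ord_recr /=.
have -> : \sum_(j < d.+1) (d.+3 - j)%N%:R * D ^+ j =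
    \sum_(j < d.+1) (d.+2 - j)%N%:R * D ^+ j + \sum_(j < d.+1) D ^+ j.
  rewrite -big_split /=; apply: eq_bigr => j _.
  by rewrite subSn ?(ltnW (leqW (ltn_ord j)))// -natr1 mulrDl mul1r.
have := geo_le d; have x0 : 0 <= D ^+ d by rewrite exprn_ge0// (le_trans _ D2).
have -> : (d.+3 - d.+1)%N = 2%N by rewrite !subSS subSn// subSn// subnn.
rewrite exprS; have := ler_wpM2r x0 D2.
by move: IH; set s := \sum_(j < d.+1) _; set t := \sum_(j < d.+1) _; lra.
Qed.

End layer_moments.

(** * Conditional estimates on the degrees into a layer *)

Section exploration_estimates.
Variables (V : finType) (u : V) (R : realType) (q : R).
Hypothesis q01 : 0 <= q <= 1.
Implicit Types (G : {set {set V}}) (k d : nat).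
Local Notation exG := (ex q (pairs V)).
Local Notation binex := (binex q).
Local Notation n := (#|V|%:R : R).
Local Notation D := (n * q).
Local Notation Nk := (Nk u R).

Lemma ex_sumX k :
  exG (fun G => \sum_(v in ~: ball u G k) (deg G v (lay u G k))%:R) <= D ^+ k.+1.
Proof.
have := @ex_layer _ u _ q k (fun=> 1) (fun i => i%:R) (fun=> erefl).
rewrite (eq_ex _ (g := fun G => \sum_(v in ~: ball u G k) (deg G v (lay u G k))%:R)).
  move=> ->; apply: (@le_trans _ _ (exG (fun G => D * Nk k G))).
    apply: ex_le => // G _; rewrite mul1r binex_id [_ * q]mulrC mulrA.
    by rewrite !ler_wpM2r ?(q_ge0 q01)// card_setC_le.
  by rewrite exZ exprS ler_wpM2l ?(D_ge0 _ q01)// ex_Nk_le.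
by move=> G _; rewrite mul1r.
Qed.

Lemma ex_lnp_var k : 2 <= D ->
  exG (fun G => (\sum_(v in ~: ball u G k) lnp R (deg G v (lay u G k))
                 - #|~: ball u G k|%:R * binex #|lay u G k| (lnp R)) ^+ 2)
  <= n * (q * D ^+ k + 2 * q ^+ 2 * D ^+ k ^+ 2).
Proof.
move=> D2; apply: le_trans (ex_layer_var u q01 k (lnp R)) _.
apply: (@le_trans _ _ (exG (fun G => n * (q * Nk k G + q ^+ 2 * Nk k G ^+ 2)))).
  apply: ex_le => // G _; apply: ler_pM => //.
  - by apply: binex_ge0 => // i; exact: sqr_ge0.
  - exact: card_setC_le.
  - apply: (@le_trans _ _ (binex #|lay u G k| (fun i => i%:R ^+ 2))).
      by apply: binex_le => // i; rewrite ler_sqr ?nnegrE ?lnp_ge0// lnp_le.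
    rewrite binex_sq /Nk; have := q_ge0 q01; move: #|lay u G k|%:R (ler0n R #|lay u G k|).
    by move=> s s0 q0; have := sqr_ge0 q; nra.
rewrite exZ exD !exZ ler_wpM2l//; apply: lerD.
  by rewrite ler_wpM2l ?(q_ge0 q01)// ex_Nk_le.
by rewrite -mulrA mulrCA ler_wpM2l ?sqr_ge0// ex_Nk_sq2.
Qed.

(** The indicator is known from the history and keeps the binomial mean away from 0, so that
    [binex_inv] applies. *)
Lemma ex_suminv k (L : R) : 0 < q -> 0 < L ->
  exG (fun G => (L <= Nk k G)%R%:R
        * \sum_(v in ~: ball u G k) inv0 R (deg G v (lay u G k)))
  <= n * (2 / (L * q)).
Proof.
move=> q0 L0; rewrite (@ex_layer _ u _ q k (fun G => (L <= Nk k G)%R%:R)); last first.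
  by move=> G; rewrite /Nk hist_lay.
rewrite -[leRHS](ex_const q (pairs V)); apply: ex_le => // G _.
case: (leP L (Nk k G)) => LN; last by rewrite mul0r mulr_ge0 ?divr_ge0 ?mulr_ge0// ltW.
rewrite mul1r; apply: ler_pM => //.
- by apply: binex_ge0 => // -[|i]//=; rewrite invr_ge0.
- exact: card_setC_le.
- have s0 : (0 < #|lay u G k|)%N.
    by rewrite -(ltr0n R); exact: lt_le_trans LN.
  apply: le_trans (binex_inv q01 q0 s0) _; rewrite ler_wpM2l//.
  rewrite lef_pV2 ?posrE ?mulr_gt0 ?ltr0n//.
  by rewrite ler_wpM2r// ltW.
Qed.

Lemma ex_degsum : exG (fun G => \sum_v (deg G v setT)%:R) <= n * D.
Proof.
rewrite ex_sum.
have -> : n * D = \sum_(v : V) D by rewrite sumr_const mulr_natl.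
apply: ler_sum => v _.
apply: (@le_trans _ _ (\sum_(w : V) q)); last by rewrite sumr_const mulr_natl.
rewrite (eq_ex _ (g := fun G => \sum_(w in [set: V]) ([set v; w] \in G)%:R)).
  rewrite ex_sum big_mkcond; apply: ler_sum => w _; rewrite inE.
  have [vw|vw] := eqVneq v w.
    rewrite (eq_ex _ (g := fun=> 0)) ?ex_const ?(q_ge0 q01)// => G /subsetP GP.
    have [/GP|//] := boolP (_ \in G).
    by rewrite inE vw setUid cards1.
  have eP : [set [set v; w]] \subset pairs V.
    by rewrite sub1set inE cards2 vw.
  rewrite (ex_local _ eP) => [|G]; last by rewrite !inE eqxx andbT.
  by rewrite ex_set1 !inE eqxx mulr1 mulr0 addr0.
by move=> G _; rewrite deg_sum.
Qed.

Lemma ballC_degE G k v : (v \in ~: ball u G k.+1) =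
  (v \in ~: ball u G k) && (deg G v (lay u G k) == 0%N).
Proof.
rewrite !in_setC; have := lay_degE u G k v; rewrite /lay in_setD /= in_setC lt0n.
case: (boolP (v \in ball u G k)) => vb /=.
  by rewrite inE vb.
by move=> ->; rewrite negbK.
Qed.

Lemma card_ballC G k : #|~: ball u G k.+1|%:R =
  \sum_(v in ~: ball u G k) (deg G v (lay u G k) == 0%N)%:R :> R.
Proof.
rewrite -sum1_card natr_sum big_mkcond [RHS]big_mkcond; apply: eq_bigr => v _.
by rewrite ballC_degE; case: (v \in ~: _) => //=; case: (_ == _).
Qed.

Lemma ex_ballC d (L : R) :
  exG (fun G => (L <= Nk d G)%R%:R * #|~: ball u G d.+1|%:R) <= n * expR (- (q * L)).
Proof.
under eq_ex => G _ do rewrite card_ballC.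
rewrite (@ex_layer _ u _ q d (fun G => (L <= Nk d G)%R%:R) (fun i => (i == 0%N)%:R)); last first.
  by move=> G; rewrite /Nk hist_lay.
rewrite -[leRHS](ex_const q (pairs V)); apply: ex_le => // G _.
have q0 := q_ge0 q01.
case: (leP L (Nk d G)) => LN; last by rewrite mul0r mulr_ge0// expR_ge0.
rewrite mul1r; apply: ler_pM => //.
- by apply: binex_ge0.
- exact: card_setC_le.
- rewrite (@eq_binex _ _ _ _ (fun i => 1 - (0 < i)%N%:R)) => [|[|i]]; last 2 first.
  + by rewrite subr0.
  + by rewrite subrr.
  rewrite binexB binex_const binex_pos subKr.
  apply: (@le_trans _ _ (expR (- q) ^+ #|lay u G d|)).
    have := expR_ge1Dx (- q) => h; case/andP: q01 => _ q1.
    by rewrite lerXn2r// nnegrE ?subr_ge0 ?expR_ge0.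
  rewrite -expRM_natl ler_expR mulrN lerN2 mulrC ler_wpM2r//.
Qed.

Lemma farE G d : (far u G d)%:R =
  \sum_(i < #|V|) i.+2%:R * Nk (d.+2 + i) G :> R.
Proof.
rewrite /far natr_sum.
under [RHS]eq_bigr => i _.
  rewrite /Nk -sum1_card natr_sum mulr_sumr big_mkcond; over.
rewrite exchange_big big_mkcond; apply: eq_bigr => v _.
have [/andP[vC dv]|nv] := ifPn; last first.
  rewrite big1// => i _; rewrite ifF//; apply/negbTE/negP; rewrite lay_gdist.
  move=> /andP[vC /eqP dv]; move/negP: nv; apply; rewrite vC dv.
  by rewrite !addSn ltnS ltnS leq_addr.
have iV : (gdist G u v - d.+2 < #|V|)%N.
  have [k kV vk] := component_walk vC.
  apply: leq_ltn_trans (leq_subr _ _) _; exact: leq_ltn_trans (gdist_le vk) kV.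
rewrite (bigD1 (Ordinal iV))//= lay_gdist vC subnKC// eqxx /= mulr1.
rewrite big1 ?addr0 => [|j jv].
  by congr _%:R; move: dv; clear; lia.
rewrite ifF// lay_gdist vC /=; apply/negbTE/eqP => e; move/eqP: jv; apply.
by apply: val_inj => /=; rewrite e addKn.
Qed.

(** Once at most c vertices are left, with c q <= 1 / 4, each further layer has conditional mean at
    most a quarter of the previous one; as i + 2 <= 2 * 2 ^ i, the weights leave a geometric series
    of ratio 1 / 2. *)
Lemma ex_far d (L c : R) : 0 <= c -> c * q <= 1 / 4 ->
  exG (fun G => (L <= Nk d G)%R%:R * (#|~: ball u G d.+1|%:R <= c)%R%:R * (far u G d)%:R)
  <= 4 * (n * expR (- (q * L))).
Proof.
move=> c0 cq; have q0 := q_ge0 q01.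
pose phi G : R := (L <= Nk d G)%R%:R * (#|~: ball u G d.+1|%:R <= c)%R%:R.
have phi0 G : 0 <= phi G by rewrite mulr_ge0.
set x := n * expR _; have x0 : 0 <= x by rewrite mulr_ge0// expR_ge0.
have step i : exG (fun G => phi G * Nk (d.+2 + i) G) <= x * (1 / 4) ^+ i.
  elim: i => [|i IH].
    rewrite expr0 mulr1 addn0; apply: le_trans (ex_ballC d L).
    apply: ex_le => // G _; rewrite /phi -mulrA ler_wpM2l//.
    apply: (@le_trans _ _ (Nk d.+2 G)); first by case: (_ <= c); rewrite ?mul1r ?mul0r.
    rewrite /Nk ler_nat subset_leq_card//; apply/subsetP => v.
    by rewrite lay_degE => /andP[].
  rewrite addnS ex_NkS//; last first.
    move=> G; rewrite /phi /Nk hist_layj ?hist_ball//.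
      by rewrite !addSn ltnS ltnW// ltnS leq_addr.
    by rewrite !addSn ltnW// ltnS ltnW// ltnS leq_addr.
  apply: (@le_trans _ _ (exG (fun G => (1 / 4) * (phi G * Nk (d.+2 + i) G)))).
    apply: ex_le => // G _.
    have [/andP[LN Fc]|np] := boolP ((L <= Nk d G) && (#|~: ball u G d.+1|%:R <= c)); last first.
      suff -> : phi G = 0 by rewrite !mul0r mulr0.
      move: np; rewrite /phi; case: (L <= _) => /=; last by rewrite mul0r.
      by move=> /negPf->; rewrite mulr0.
    have -> : phi G = 1 by rewrite /phi LN Fc mulr1.
    rewrite !mul1r /Mk; have [p1 _] := pow_bernoulli q01 #|lay u G (d.+2 + i)|.
    apply: (@le_trans _ _ (c * (#|lay u G (d.+2 + i)|%:R * q))).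
      apply: ler_pM => //.
      + rewrite subr_ge0; case/andP: q01 => _ q1; rewrite exprn_ile1// ?subr_ge0//.
        by rewrite lerBlDr lerDl.
      + apply: le_trans Fc; rewrite ler_nat subset_leq_card// setCS.
        by apply: ball_mono; rewrite addSn ltnS addSn ltnW// ltnS leq_addr.
      + by rewrite lerBlDr -lerBlDl.
    by rewrite mulrCA mulrC ler_wpM2r// -[leRHS]div1r.
  by rewrite exZ exprS mulrCA ler_wpM2l.
under eq_ex => G _ do rewrite farE mulr_sumr.
rewrite ex_sum; apply: (@le_trans _ _ (\sum_(i < #|V|) x * (2 * (1 / 2) ^+ i))).
  apply: ler_sum => i _.
  rewrite (eq_ex _ (g := fun G => i.+2%:R * (phi G * Nk (d.+2 + i) G))); last first.
    by move=> G _; rewrite mulrCA.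
  rewrite exZ; apply: (@le_trans _ _ (i.+2%:R * (x * (1 / 4) ^+ i))).
    by rewrite ler_wpM2l.
  rewrite mulrCA ler_wpM2l//.
  have -> : (1 / 4 : R) = (1 / 2) * (1 / 2) by field.
  rewrite exprMn mulrA ler_wpM2r ?exprn_ge0 ?divr_ge0//.
  rewrite div1r exprVn ler_pdivrMr ?exprn_gt0// -exprS -natrX ler_nat.
  by elim: (nat_of_ord i) => // m IHm; rewrite expnS mul2n -addnn; apply: leq_trans (leq_add IHm IHm); lia.
rewrite -mulr_sumr -mulr_sumr mulrC ler_wpM2r//.
have geo m : \sum_(i < m) (1 / 2 : R) ^+ i = 2 - 2 * (1 / 2) ^+ m.
  elim: m => [|m IHm]; first by rewrite big_ord0 expr0 mulr1 subrr.
  by rewrite big_ord_recr /= IHm exprS; field.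
rewrite geo; have : 0 <= (1 / 2 : R) ^+ #|V| by rewrite exprn_ge0// divr_ge0.
by move: ((1 / 2) ^+ #|V|) => y; lra.
Qed.

(** The sum over I of the overview, where f stands either for the actual number of neighbours in I
    or for its mean |I| q. *)
Definition isum (pad c : R) d (f : {set {set V}} -> {set V} -> V -> R) G : R :=
  \sum_(I : {set V} | I \subset lay u G d)
    (expR (c * #|I|%:R) * \prod_(v in I) (deg G v (lay u G d.-1))%:R
     * \prod_(v in ~: (rball u G d :|: I)) (f G I v + pad)).

(** Given the history up to layer d, the degrees into I are independent binomials of mean |I| q, so
    the denominator is the conditional mean of the numerator. *)
Lemma ex_fresh d (pad c : R) : (0 < d)%N -> 0 < pad ->
  exG (fun G => isum pad c d (fun G I v => (deg G v I)%:R) G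
                / isum pad c d (fun G I v => #|I|%:R * q) G) = 1.
Proof.
move=> d0 pad0; have q0 := q_ge0 q01.
set den := isum pad c d (fun G I v => #|I|%:R * q).
have t0 G (I : {set V}) : 0 <= expR (c * #|I|%:R) * \prod_(v in I) (deg G v (lay u G d.-1))%:R
     * \prod_(v in ~: (rball u G d :|: I)) (#|I|%:R * q + pad).
  rewrite !mulr_ge0 ?expR_ge0 ?prodr_ge0// => v _.
  by rewrite addr_ge0 ?mulr_ge0// ltW.
have den0 G : 0 < den G.
  rewrite /den /isum (bigD1 set0) ?sub0set//= ltr_pwDl ?sumr_ge0//.
  rewrite big_set0 mulr1 mulr_gt0 ?expR_gt0// prodr_gt0// => v _.
  by rewrite cards0 mul0r add0r.
have subr G : lay u G d.-1 \subset rball u G d.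
  by rewrite -{2}(prednK d0); exact: lay_sub.
have hdeg G v : deg (hist u G d) v (lay u (hist u G d) d.-1) = deg G v (lay u G d.-1).
  by rewrite hist_layj ?leq_pred// hist_deg.
have denH G : den (hist u G d) = den G.
  rewrite /den /isum hist_lay hist_rball; apply: eq_bigr => I _.
  by congr (_ * _ * _); apply: eq_bigr => v _; rewrite hdeg.
pose w (I : {set V}) G : R := (I \subset lay u G d)%:R *
  (expR (c * #|I|%:R) * \prod_(v in I) (deg G v (lay u G d.-1))%:R) / den G.
have wH I G : w I (hist u G d) = w I G.
  rewrite /w hist_lay denH; congr (_ * (_ * _) / _).
  by apply: eq_bigr => v _; rewrite hdeg.
(* A set I not contained in the layer has weight 0; replacing it by the empty set gives, for every
   graph, the disjointness that [ex_cond] asks for. *)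
pose S (I : {set V}) G : {set V} := if I \subset lay u G d then I else set0.
pose J I G : {set V} := ~: (rball u G d :|: S I G).
have SH I G : S I (hist u G d) = S I G by rewrite /S hist_lay.
have JH I G : J I (hist u G d) = J I G by rewrite /J SH hist_rball.
have E (f : {set {set V}} -> {set V} -> V -> R) G :
    isum pad c d f G / den G = \sum_(I : {set V}) w I G *
      \prod_(v in J I G) (f G (S I G) v + pad).
  rewrite /isum mulr_suml big_mkcond; apply: eq_bigr => I _.
  rewrite /w /J /S; case: ifP => IL; last by rewrite mul0r mul0r mul0r.
  by rewrite mul1r mulrAC.
transitivity (exG (fun G => den G / den G)); last first.
  by rewrite (eq_ex _ (g := fun=> 1)) ?ex_const// => G _; rewrite divff ?gt_eqF.
under eq_ex => G _ do rewrite E.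
under [RHS]eq_ex => G _ do rewrite E.
rewrite !ex_sum; apply: eq_bigr => I _.
rewrite (@ex_cond _ u _ q d (w I) (S I) (J I) (fun _ _ i => i%:R + pad)) => //.
- apply: eq_ex => G _; congr (_ * _); apply: eq_bigr => v _.
  by rewrite binexD binex_id binex_const.
- move=> G; rewrite disjoints_subset /J setCS; exact: subsetUr.
- move=> G; rewrite disjoints_subset /J setCS; exact: subsetUl.
- move=> G; rewrite /S; case: ifP => IL; last by rewrite disjoints_subset sub0set.
  exact: disjointWl IL (disj_lay_rball u G d).
Qed.

(** The set [Is G] is read off the history, so its edges to the unexplored vertices are fresh and
    [binex_defect] applies. With ln M <= 2 sqrt M its bound becomes (2 + 8) / sqrt M. *)
Lemma ex_defect d (Is : {set {set V}} -> {set V}) (L : R) : 1 <= L ->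
  (forall G, Is G \subset lay u G d) -> (forall G, Is (hist u G d) = Is G) ->
  exG (fun G => (L <= #|Is G|%:R * q)%R%:R * \sum_(v in ~: (rball u G d :|: Is G))
      Num.max 0 (ln (#|Is G|%:R * q) - lnp R (deg G v (Is G))))
  <= n * (10 / Num.sqrt L).
Proof.
move=> L1 IL IH.
rewrite (@ex_cond1 _ u _ q d (fun G => (L <= #|Is G|%:R * q)%R%:R) Is
  (fun G => ~: (rball u G d :|: Is G))
  (fun G i => Num.max 0 (ln (#|Is G|%:R * q) - lnp R i))).
- rewrite -[leRHS](ex_const q (pairs V)); apply: ex_le => // G _.
  have sL : 0 < Num.sqrt L by rewrite sqrtr_gt0 (lt_le_trans _ L1).
  case: (leP L (#|Is G|%:R * q)) => LM; last by rewrite mul0r mulr_ge0// divr_ge0// ltW.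
  rewrite mul1r; apply: ler_pM => //.
  + by apply: binex_ge0 => // i; rewrite le_max lexx.
  + exact: card_setC_le.
  set M := #|Is G|%:R * q in LM *; have M1 : 1 <= M by exact: le_trans LM.
  apply: le_trans (binex_defect q01 M1) _; rewrite -/M.
  have M0 : 0 < M by exact: lt_le_trans M1.
  set r := Num.sqrt M; have r0 : 0 < r by rewrite sqrtr_gt0.
  have rr : M = r ^+ 2 by rewrite sqr_sqrtr// ltW.
  have lM : ln M <= 2 * r.
    rewrite rr lnXn// -[_ *+ 2]mulr_natl ler_wpM2l//.
    by have := ln_le_subr1 r0; lra.
  apply: (@le_trans _ _ (10 / r)); last first.
    by rewrite ler_wpM2l// lef_pV2 ?posrE// ler_sqrt// ltW.
  have -> : 10 / r = 2 / r + 4 * (2 * r) / M by rewrite rr; field; rewrite gt_eqF.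
  by rewrite lerD2l ler_wpM2r ?invr_ge0 ?(ltW M0)// ler_wpM2l.
- by move=> G; rewrite disjoints_subset setCS subsetUr.
- by move=> G; rewrite disjoints_subset setCS subsetUl.
- by move=> G; exact: disjointWl (IL G) (disj_lay_rball u G d).
- by move=> G; rewrite IH.
- exact: IH.
- by move=> G; rewrite IH hist_rball.
- by move=> G; rewrite IH.
Qed.

End exploration_estimates.

(** * Asymptotic regime *)

Section growth.
Variable R : realType.

Lemma expR_ge_pow (k : nat) (x : R) : 0 <= x -> x ^+ k / k`!%:R <= expR x.
Proof.
move=> x0; have -> : x ^+ k / k`!%:R = exp_coeff x k by [].
apply: (@le_trans _ _ (series (exp_coeff x) k.+1)).
  by rewrite /series /= big_nat_recr//= lerDr sumr_ge0// => i _; exact: exp_coeff_ge0.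
apply: nondecreasing_cvgn_le; last exact: is_cvg_series_exp_coeff.
by apply: nondecreasing_series => i _ _; exact: exp_coeff_ge0.
Qed.

Lemma pow_le_exp (C b : R) (k : nat) : 0 < b ->
  exists x0 : R, forall x, x0 <= x -> C * x ^+ k <= expR (b * x).
Proof.
move=> b0; pose F : R := k.+1`!%:R; have F0 : 0 < F by rewrite ltr0n fact_gt0.
exists (Num.max 1 (`|C| * F / b ^+ k.+1)) => x; rewrite ge_max => /andP[x1 xC].
have x0 : 0 < x by exact: lt_le_trans x1.
apply: le_trans (expR_ge_pow k.+1 (ltW (mulr_gt0 b0 x0))); rewrite -/F.
rewrite ler_pdivlMr// exprMn [x ^+ k.+1]exprSr mulrA.
rewrite [C * _ * F]mulrAC [b ^+ _ * _ * x]mulrAC ler_wpM2r ?exprn_ge0 ?(ltW x0)//.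
apply: (@le_trans _ _ (`|C| * F)); first by rewrite ler_wpM2r ?(ltW F0)// ler_norm.
by move: xC; rewrite ler_pdivrMr ?exprn_gt0// [x * _]mulrC.
Qed.

Definition ev (P : nat -> Prop) := exists n0, forall n, (n0 <= n)%N -> P n.

Lemma evI P Q : ev P -> ev Q -> ev (fun n => P n /\ Q n).
Proof.
move=> [a Pa] [b Qb]; exists (maxn a b) => n; rewrite geq_max => /andP[an bn].
by split; [exact: Pa|exact: Qb].
Qed.

Lemma ev_mono (P Q : nat -> Prop) : (forall n, P n -> Q n) -> ev P -> ev Q.
Proof. by move=> PQ [a Pa]; exists a => n /Pa/PQ. Qed.

Lemma ev_mono2 (P Q S : nat -> Prop) :
  (forall n, P n -> Q n -> S n) -> ev P -> ev Q -> ev S.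
Proof. by move=> PQ /evI h /h; apply: ev_mono => n [] /PQ. Qed.

Lemma ev_ln (K : R) : ev (fun n => K <= ln n%:R).
Proof.
have [n0 n0K] : exists n0 : nat, expR K <= n0%:R.
  exists (Num.bound (expR K)); apply: ltW; apply: le_lt_trans (archi_boundP _) => //.
exists n0 => n nn; rewrite -[leLHS]expRK ler_ln ?posrE ?expR_gt0//.
  by apply: le_trans n0K _; rewrite ler_nat.
by apply: lt_le_trans (expR_gt0 K) _; apply: le_trans n0K _; rewrite ler_nat.
Qed.

Lemma ev_loglog (K : R) : ev (fun n => K <= loglog R n).
Proof.
apply: ev_mono (ev_ln (expR K)) => n h.
by rewrite /loglog -[leLHS]expRK ler_ln ?posrE ?expR_gt0//; exact: lt_le_trans (expR_gt0 K) h.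
Qed.

Lemma ev_gt0 : ev (fun n => (0 < n)%N).
Proof. by exists 1%N. Qed.

Lemma ev_lnE : ev (fun n => ln n%:R = expR (loglog R n)).
Proof.
apply: ev_mono (ev_ln 1) => n h; rewrite /loglog lnK// posrE.
exact: lt_le_trans h.
Qed.

Lemma ev_pow_exp (C b : R) (k : nat) : 0 < b ->
  ev (fun n => C * loglog R n ^+ k <= expR (b * loglog R n)).
Proof.
move=> b0; have [x0 h] := pow_le_exp C k b0.
by apply: ev_mono (ev_loglog x0) => n; exact: h.
Qed.

Lemma ev_pow_n (C : R) (k : nat) : ev (fun n => C * ln n%:R ^+ k <= n%:R).
Proof.
have [x0 h] := pow_le_exp C k ltr01.
apply: ev_mono2 (ev_ln x0) ev_gt0 => n /h hn n0.
by apply: le_trans hn _; rewrite mul1r lnK// posrE ltr0n.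
Qed.

Lemma ev_lnL (C : R) : ev (fun n => C * ln (loglog R n) <= loglog R n).
Proof.
have [x0 h] := pow_le_exp C 1 ltr01.
apply: ev_mono2 (ev_loglog 1) (ev_loglog (expR x0)) => n L1 Lx.
have L0 : 0 < loglog R n by exact: lt_le_trans L1.
have := h (ln (loglog R n)); rewrite expr1 mul1r lnK ?posrE//; apply.
by rewrite -[leLHS]expRK ler_ln ?posrE ?expR_gt0.
Qed.

(** A strict bound on the limsup yields an eventual bound with a fixed margin, which the estimates
    need. *)
Lemma limn_esup_lt (x : nat -> R) (b : \bar R) :
  (limn_esup (fun n => (x n)%:E) < b)%E ->
  exists2 c : R, (c%:E < b)%E & ev (fun n => x n <= c).
Proof.
move=> /ereal_inf_lt[y /= [V [n0 _ Vn0] <-] yb].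
have ub n : (n0 <= n)%N -> ((x n)%:E <= ereal_sup [set (x k)%:E | k in V]%classic)%E.
  by move=> nn; apply: ereal_sup_ubound; exists n => //; exact: Vn0.
move: yb ub; case: (ereal_sup _) => [r rb ub| |_ ub].
- by exists r => //; exists n0 => n /ub; rewrite lee_fin.
- by rewrite ltNge leey.
- by have := ub n0 (leqnn _); rewrite leeNy_eq.
Qed.

Lemma limn_einf_gt (x : nat -> R) (b : \bar R) :
  (b < limn_einf (fun n => (x n)%:E))%E ->
  exists2 c : R, (b < c%:E)%E & ev (fun n => c <= x n).
Proof.
rewrite /limn_einf lteNr => h.
have [|c cb [n0 h0]] := @limn_esup_lt (fun n => - x n) (- b)%E.
  by rewrite (_ : (fun n => (- x n)%:E) = (\- (fun n => (x n)%:E))%E).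
exists (- c); first by rewrite EFinN lteNr.
by exists n0 => n /h0; rewrite lerNl.
Qed.

End growth.

(** * Events of probability tending to 1 *)

Section whp.
Variables (R : realType) (q : nat -> R).
Hypothesis q01 : ev (fun n => 0 <= q n <= 1).
Implicit Types (P Q : forall n, graph n -> Prop).

Local Notation exn n := (ex (q n) (pairs (vertex n))).

Definition whp P := forall e : R, 0 < e ->
  ev (fun n => exn n (fun G => (~~ `[< P n G >])%:R) <= e).

Lemma gnp_probE n (A : pred (graph n)) : gnp_prob (q n) A = exn n (fun G => (A G)%:R).
Proof.
rewrite /gnp_prob /ex big_mkcondr; apply: eq_bigr => G _.
by rewrite /wt /gnp_weight; case: (A G); rewrite ?mulr1 ?mulr0.
Qed.

Lemma whp_mono P Q : ev (fun n => forall G : graph n, G \subset pairs (vertex n) -> P n G -> Q n G) ->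
  whp P -> whp Q.
Proof.
move=> PQ wP e e0; have := evI q01 (evI PQ (wP e e0)); apply: ev_mono => n [qn [pq h]].
apply: le_trans h; apply: ex_le => // G GP.
case: (asboolP (Q n G)) => [//|nQ]; case: (asboolP (P n G)) => [/(pq _ GP)/nQ//|//].
Qed.

Lemma whpI P Q : whp P -> whp Q -> whp (fun n G => P n G /\ Q n G).
Proof.
move=> wP wQ e e0; have e2 : 0 < e / 2 by rewrite divr_gt0.
have := evI q01 (evI (wP _ e2) (wQ _ e2)); apply: ev_mono => n [qn [h1 h2]].
rewrite [leRHS](_ : e = e / 2 + e / 2); last by field.
apply: le_trans (lerD h1 h2); rewrite -exD; apply: ex_le => // G _.
case: (asboolP (P n G)) => p; case: (asboolP (Q n G)) => q';
  case: asboolP => // r; rewrite ?addr0 ?add0r// ?lerDl//.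
- by case: r.
- by rewrite addr_ge0.
Qed.

Lemma whp_markov (X : forall n, graph n -> R) :
  ev (fun n => forall G : graph n, G \subset pairs (vertex n) -> 0 <= X n G) ->
  (forall e : R, 0 < e -> ev (fun n => exn n (X n) <= e)) ->
  whp (fun n G => X n G <= 1).
Proof.
move=> X0 Xe e e0; have := evI q01 (evI X0 (Xe _ e0)).
apply: ev_mono => n [qn [x0 xe]]; apply: le_trans xe; apply: ex_le => // G GP.
case: asboolP => [_|/negP]; first exact: x0.
by rewrite -ltNge => /ltW.
Qed.

Lemma whp_op (Y : forall n, graph n -> R) :
  (forall e : R, 0 < e -> whp (fun n G => `|Y n G| <= e * n%:R)) -> is_op_n q Y.
Proof.
move=> h eps eps0; apply/cvgrPdist_le => e e0.
have [n0 n0P] := evI q01 (evI (ev_gt0) (h _ eps0 _ e0)).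
exists n0 => // n /= /n0P[qn [n_gt0 hn]]; rewrite gnp_probE sub0r normrN ger0_norm.
  apply: le_trans hn; apply: ex_le => // G _.
  case: asboolP => [Yn|]; last by case: (_ < _).
  suff -> : (eps < `|Y n G / n%:R|) = false by [].
  apply/negbTE; rewrite -leNgt normrM normfV [`|n%:R|]ger0_norm//.
  by rewrite ler_pdivrMr ?ltr0n.
exact: ex_ge0.
Qed.

End whp.

(** * Bounds on the parameters for large n *)

Section regime.
Variables (R : realType) (alpha : nat -> R).

Definition qn n : R := edge_prob alpha n.
Definition Dn n : R := n%:R * qn n.
Definition Ln n : R := loglog R n.
Definition dn n : nat := `|d_star alpha n|%N.
(** This is log (1 / lambda), approximately the mean number of neighbours of an unexplored vertex in
    layer d - 1. *)
Definition mun n : R := Dn n ^+ dn n / n%:R.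
Definition lamn n : R := lambda_ alpha n.

(** Facts valid for all large n. The last two restate the definition of d, D ^ (d - 1) < n / L ^ 2
    <= D ^ d, and give the whole window in which mu may vary. *)
Record regime (a0 a1 : R) n : Prop := Regime {
  rg_n : (0 < n)%N;
  rg_q : 0 < qn n <= 1;
  rg_a : a0 <= alpha n <= a1;
  rg_L : 1 <= Ln n;
  rg_ln : ln n%:R = expR (Ln n);
  rg_D : Dn n = alpha n * expR (Ln n);
  rg_D2 : 2 <= Dn n;
  rg_d : d_star alpha n = Posz (dn n);
  rg_d2 : (2 <= dn n)%N;
  rg_mu1 : (Ln n ^+ 2)^-1 <= mun n;
  rg_mu2 : mun n <= Dn n / Ln n ^+ 2 }.

(** The bound D < n / L ^ 2 excludes every exponent below 2, negative ones included, so the minimum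
    over the integers is a minimum over nat. *)
Lemma d_starP n : (0 < n)%N -> 2 <= Dn n -> 1 <= Ln n -> Dn n < n%:R / Ln n ^+ 2 ->
  [/\ d_star alpha n = Posz (dn n), (2 <= dn n)%N,
      n%:R / Ln n ^+ 2 <= Dn n ^+ dn n & Dn n ^+ (dn n).-1 < n%:R / Ln n ^+ 2].
Proof.
move=> n0 D2 L1 DnL; set T := n%:R / Ln n ^+ 2.
have D1 : 1 < Dn n by apply: lt_le_trans D2; rewrite ltr1n.
have D0 : 0 < Dn n by exact: lt_trans D1.
have exd : exists k : nat, T <= Dn n ^+ k.
  exists (Num.bound T); apply: (@le_trans _ _ (Num.bound T)%:R).
    by apply: ltW; apply: archi_boundP; rewrite divr_ge0// sqr_ge0.
  apply: (@le_trans _ _ (2 ^+ Num.bound T)).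
    by rewrite -natrX ler_nat ltnW// ltn_expl.
  by rewrite lerXn2r// nnegrE ltW.
pose k := ex_minn exd; have kP : T <= Dn n ^+ k by rewrite /k; case: ex_minnP.
have kmin j : T <= Dn n ^+ j -> (k <= j)%N by rewrite /k; case: ex_minnP => ? _; exact.
have dE : d_star alpha n = Posz k.
  rewrite /d_star; case: xgetP => [d _ [dA dmin]|/(_ (Posz k)) []].
    apply/eqP; rewrite eq_le; apply/andP; split; first exact: dmin.
    case: d dA {dmin} => j; first exact: kmin.
    rewrite /above_threshold -/(qn n) -/(Dn n) -/(Ln n) -/T NegzE => h; exfalso.
    have : T <= 1.
      apply: le_trans h _; rewrite -exprnN invf_le1 ?exprn_gt0//.
      by rewrite exprn_ege1// ltW.
    by rewrite leNgt (lt_trans _ DnL).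
  split; first exact: kP.
  case=> j; first exact: kmin.
  rewrite /above_threshold -/(qn n) -/(Dn n) -/(Ln n) -/T NegzE => h; exfalso.
  have : T <= 1.
    apply: le_trans h _; rewrite -exprnN invf_le1 ?exprn_gt0//.
    by rewrite exprn_ege1// ltW.
  by rewrite leNgt (lt_trans _ DnL).
have dk : dn n = k by rewrite /dn dE.
have k2 : (2 <= k)%N.
  rewrite ltnNge; apply/negP => k1; move: kP; rewrite leNgt => /negP; apply.
  apply: le_lt_trans DnL; rewrite -[leRHS]expr1 ler_weXn2l// ltW//.
rewrite dk; split=> //; rewrite ltNge; apply/negP => /kmin.
by rewrite leqNgt ltn_predL (leq_trans _ k2).
Qed.

Variables (a0 a1 : R).
Hypotheses (a0_gt0 : 0 < a0) (alpha_bd : ev (fun n => a0 <= alpha n <= a1)).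

Lemma ev_regime : ev (regime a0 a1).
Proof.
have H1 := evI (ev_gt0) (evI (ev_lnE R) (evI (ev_loglog (1 : R)) (evI alpha_bd
  (evI (ev_pow_exp (2 / a0) 0 (@ltr01 R)) (evI (ev_pow_n (a1 + 1) 3) (ev_pow_n (a1 + 1) 1)))))).
have H2 := ev_pow_exp 1 1 (@ltr01 R).
apply: ev_mono2 H1 H2 => n [n0 [lnE [L1 [/andP[a0a aa1] [e1 [e3 e4]]]]]] e2.
have nr : (0 : R) < n%:R by rewrite ltr0n.
have L0 : 0 < Ln n by exact: lt_le_trans L1.
have DE : Dn n = alpha n * expR (Ln n).
  by rewrite /Dn /qn /edge_prob mulrC divfK ?gt_eqF// lnE.
have al0 : 0 < alpha n by exact: lt_le_trans a0a.
have a10 : 0 < a1 + 1 by have := le_trans a0a aa1; lra.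
move: e1 e2 e3 e4; rewrite expr0 mulr1 !mul1r !expr1 -/(Ln n) lnE -/(Ln n) => e1 e2 e3 e4.
have D2 : 2 <= Dn n.
  rewrite DE; apply: (@le_trans _ _ (a0 * expR (Ln n))).
    by move: e1; rewrite ler_pdivrMr// mulrC.
  by rewrite ler_wpM2r ?expR_ge0.
have DnL : Dn n < n%:R / Ln n ^+ 2.
  rewrite ltr_pdivlMr ?exprn_gt0// DE.
  apply: lt_le_trans e3; rewrite [_ ^+ 3]exprS mulrA.
  apply: (@le_lt_trans _ _ (alpha n * expR (Ln n) * expR (Ln n) ^+ 2)).
    rewrite ler_wpM2l ?mulr_ge0 ?expR_ge0 ?(ltW al0)//.
    by rewrite lerXn2r ?nnegrE ?(ltW L0) ?expR_ge0.
  by rewrite ltr_pM2r ?exprn_gt0 ?expR_gt0// ltr_pM2r ?expR_gt0//; lra.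
have [dE d2 dlo dhi] := d_starP n0 D2 L1 DnL.
have D0 : 0 < Dn n by exact: lt_le_trans D2.
split=> //.
- rewrite /qn /edge_prob lnE divr_gt0 ?mulr_gt0 ?expR_gt0//=.
  rewrite ler_pdivrMr// mul1r; apply: le_trans e4.
  by rewrite ler_wpM2r ?expR_ge0// (le_trans aa1)// lerDl.
- by rewrite a0a.
- by rewrite /mun ler_pdivlMr// mulrC.
- have e : Dn n ^+ dn n = Dn n * Dn n ^+ (dn n).-1 by rewrite -exprS prednK// ltnW.
  rewrite /mun ler_pdivrMr//; apply: (@le_trans _ _ (Dn n * (n%:R / Ln n ^+ 2))).
    by rewrite e ler_wpM2l ?(ltW D0) ?(ltW dhi).
  by rewrite [n%:R / _]mulrC mulrA.
Qed.

Lemma rg_lam n : regime a0 a1 n -> lamn n = expR (- mun n).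
Proof. by move=> rg; rewrite /lamn /lambda_ (rg_d rg). Qed.

Lemma rg_mu_gt0 n : regime a0 a1 n -> 0 < mun n.
Proof.
move=> rg; apply: lt_le_trans (rg_mu1 rg); rewrite invr_gt0 exprn_gt0//.
exact: lt_le_trans (rg_L rg).
Qed.

Lemma rg_lam01 n : regime a0 a1 n -> 0 < lamn n < 1.
Proof.
move=> rg; rewrite (rg_lam rg) expR_gt0 -expR0 ltr_expR oppr_lt0 (rg_mu_gt0 rg).
by [].
Qed.

Lemma rg_lnlam n : regime a0 a1 n -> ln (lamn n)^-1 = mun n.
Proof. by move=> rg; rewrite lnV ?posrE ?(rg_lam rg) ?expR_gt0// expRK opprK. Qed.

Lemma rg_Dpred n : regime a0 a1 n -> Dn n ^+ (dn n).-1 = n%:R * mun n / Dn n.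
Proof.
move=> rg; have D0 : 0 < Dn n by exact: lt_le_trans (rg_D2 rg).
have nr : (0 : R) < n%:R by rewrite ltr0n (rg_n rg).
rewrite /mun mulrCA divff ?gt_eqF// mulr1 -{2}(prednK (ltnW (rg_d2 rg))) exprSr.
by rewrite mulfK// gt_eqF.
Qed.

Lemma rg_Dpow n : regime a0 a1 n -> Dn n ^+ dn n = n%:R * mun n.
Proof.
move=> rg; have nr : (0 : R) < n%:R by rewrite ltr0n (rg_n rg).
by rewrite /mun mulrCA divff ?gt_eqF// mulr1.
Qed.

(** D to the power [ell_star] is n, so Delta measures D ^ d / n on the scale of ln D. *)
Lemma rg_Delta n : regime a0 a1 n -> Delta alpha n * ln (Dn n) = ln (mun n).
Proof.
move=> rg; have D1 : 1 < Dn n by apply: lt_le_trans (rg_D2 rg); rewrite ltr1n.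
have D0 : 0 < Dn n by exact: lt_trans D1.
have nr : (0 : R) < n%:R by rewrite ltr0n (rg_n rg).
rewrite /Delta /ell_star (rg_d rg) -/(qn n) -/(Dn n) mulrBl divfK; last first.
  by rewrite gt_eqF// ln_gt0.
by rewrite /mun ln_div ?posrE ?exprn_gt0// lnXn// mulr_natl.
Qed.

Lemma rg_lamC n : regime a0 a1 n -> (2 * Ln n ^+ 2)^-1 <= 1 - lamn n.
Proof.
move=> rg; have L1 := rg_L rg; have L0 : 0 < Ln n by exact: lt_le_trans L1.
rewrite (rg_lam rg); set x := (Ln n ^+ 2)^-1.
have x0 : 0 < x by rewrite invr_gt0 exprn_gt0.
have x1 : x <= 1 by rewrite invf_le1 ?exprn_gt0// exprn_ege1.
rewrite invfM -/x; apply: (@le_trans _ _ (1 - expR (- x))); last first.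
  by rewrite lerD2l lerN2 ler_expR lerN2 (rg_mu1 rg).
have h : expR (- x) <= (1 + x)^-1.
  by rewrite expRN lef_pV2 ?posrE ?expR_gt0 ?expR_ge1Dx//; lra.
apply: (@le_trans _ _ (1 - (1 + x)^-1)); last by rewrite lerD2l lerN2.
have -> : 1 - (1 + x)^-1 = x / (1 + x) by field; rewrite gt_eqF//; lra.
by rewrite mulrC ler_wpM2l ?(ltW x0)// lef_pV2 ?posrE; lra.
Qed.

Lemma rg_lamC_half n : regime a0 a1 n -> Num.min 1 (mun n) / 2 <= 1 - lamn n.
Proof.
move=> rg; rewrite (rg_lam rg); have m0 := rg_mu_gt0 rg.
set x := Num.min 1 (mun n).
have x0 : 0 < x by rewrite lt_min ltr01.
have x1 : x <= 1 by rewrite ge_min lexx.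
have xm : x <= mun n by rewrite ge_min lexx orbT.
apply: (@le_trans _ _ (1 - expR (- x))); last by rewrite lerD2l lerN2 ler_expR lerN2.
have h : expR (- x) <= (1 + x)^-1.
  by rewrite expRN lef_pV2 ?posrE ?expR_gt0 ?expR_ge1Dx//; lra.
apply: (@le_trans _ _ (1 - (1 + x)^-1)); last by rewrite lerD2l lerN2.
have -> : 1 - (1 + x)^-1 = x / (1 + x) by field; rewrite gt_eqF//; lra.
by rewrite ler_wpM2l ?(ltW x0)// lef_pV2 ?posrE; lra.
Qed.

End regime.

(** * Typical graphs *)

Section events.
Variables (R : realType) (alpha : nat -> R) (a0 a1 : R).
Hypotheses (a0_gt0 : 0 < a0) (alpha_bd : ev (fun n => a0 <= alpha n <= a1)).
Local Notation rgm := (regime alpha a0 a1).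
Local Notation q := (qn alpha).
Local Notation D := (Dn alpha).
Local Notation L := (Ln R).
Local Notation d := (dn alpha).
Local Notation mu := (mun alpha).
Local Notation lam := (lamn alpha).
Local Notation u := vertex1.
Local Notation exn n := (ex (q n) (pairs (vertex n))).
Local Notation whp := (whp q).
Local Notation evr := (ev_regime a0_gt0 alpha_bd).

Lemma card_vertex n : (0 < n)%N -> #|vertex n| = n.
Proof. by move=> n0; rewrite card_ord prednK. Qed.

Lemma rgV n : rgm n -> #|vertex n|%:R * q n = D n :> R.
Proof. by move=> rg; rewrite card_vertex ?(rg_n rg). Qed.

Lemma rg_q01 n : rgm n -> 0 <= q n <= 1.
Proof. by move=> rg; case/andP: (rg_q rg) => /ltW -> ->. Qed.

Lemma ev_q01 : ev (fun n => 0 <= q n <= 1).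
Proof. by apply: ev_mono evr => n; exact: rg_q01. Qed.

(** Markov's inequality: a nonnegative variable of mean o(b n) is at most b n. The bounds below
    carry a spare factor, such as L or ln L, for this purpose. *)
Lemma whp_le (Y : forall n, graph n -> R) (b : nat -> R) :
  (forall n (G : graph n), 0 <= Y n G) -> ev (fun n => 0 < b n) ->
  (forall e : R, 0 < e -> ev (fun n => exn n (Y n) <= e * b n)) ->
  whp (fun n G => Y n G <= b n).
Proof.
move=> Y0 b0 Ye.
apply: (@whp_mono _ _ ev_q01 (fun n G => Y n G / b n <= 1)).
  by apply: ev_mono b0 => n bn G _; rewrite ler_pdivrMr// mul1r.
apply: whp_markov; first exact: ev_q01.
  by apply: ev_mono b0 => n bn G _; rewrite divr_ge0// ltW.
move=> e e0; apply: ev_mono2 (Ye e e0) b0 => n h bn.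
by rewrite exZr ler_pdivrMr.
Qed.

Lemma evL (K : R) : ev (fun n => K <= L n).
Proof. exact: ev_loglog. Qed.

Lemma rgn0 n : rgm n -> 0 < n%:R :> R.
Proof. by move=> rg; rewrite ltr0n (rg_n rg). Qed.
Lemma rgL0 n : rgm n -> 0 < L n.
Proof. by move=> rg; exact: lt_le_trans (rg_L rg). Qed.
Lemma rgD0 n : rgm n -> 0 < D n.
Proof. by move=> rg; exact: lt_le_trans (rg_D2 rg). Qed.
Lemma rgd0 n : rgm n -> (0 < d n)%N.
Proof. by move=> rg; exact: ltnW (rg_d2 rg). Qed.
Lemma rgq0 n : rgm n -> 0 < q n.
Proof. by move=> rg; case/andP: (rg_q rg). Qed.

Lemma rg_Dpred_le n : rgm n -> D n ^+ (d n).-1 <= n%:R / L n ^+ 2.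
Proof.
move=> rg; rewrite (rg_Dpred rg) -mulrA ler_wpM2l ?(ltW (rgn0 rg))//.
rewrite ler_pdivrMr ?rgD0//; apply: le_trans (rg_mu2 rg) _.
by rewrite mulrC.
Qed.

Lemma rg_qDpred n : rgm n -> q n * D n ^+ (d n).-1 = mu n.
Proof.
move=> rg; rewrite (rg_Dpred rg); have n0 := rgn0 rg; have D0 := rgD0 rg.
have -> : D n = n%:R * q n by [].
by field; rewrite !gt_eqF// rgq0.
Qed.

Lemma rg_mu_le n : rgm n -> mu n <= D n.
Proof.
move=> rg; apply: le_trans (rg_mu2 rg) _; rewrite ler_piMr ?(ltW (rgD0 rg))//.
by rewrite invf_le1 ?exprn_gt0 ?rgL0// exprn_ege1// (rg_L rg).
Qed.

Lemma whp_near (e : R) : 0 < e ->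
  whp (fun n G => (near_excess (u n) G (d n))%:R <= e * n%:R / L n).
Proof.
move=> e0; apply: whp_le => //.
  by apply: ev_mono evr => n rg; rewrite divr_gt0 ?rgL0// mulr_gt0 ?rgn0.
move=> e' e'0; apply: ev_mono2 evr (evL (6 / (e * e'))) => n rg h.
have L0 := rgL0 rg; have n0 := rgn0 rg.
have := @ex_near _ (u n) _ _ (rg_q01 rg); rewrite rgV// => /(_ (rg_D2 rg) _ (rgd0 rg)) h1.
apply: le_trans h1 _; apply: (@le_trans _ _ (6 * (n%:R / L n ^+ 2))).
  by rewrite ler_wpM2l// rg_Dpred_le.
have -> : 6 * (n%:R / L n ^+ 2) = 6 / L n * (n%:R / L n) by field; rewrite gt_eqF.
have -> : e' * (e * n%:R / L n) = e' * e * (n%:R / L n) by rewrite !mulrA.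
rewrite ler_wpM2r ?divr_ge0 ?(ltW L0) ?(ltW n0)//.
by move: h; rewrite ler_pdivrMr ?mulr_gt0// ler_pdivrMr// mulrC [e' * e]mulrC.
Qed.

(** The bound on the relative variance of layer d - 1, times the spare factor L. *)
Definition dev n : R := L n * (2 + 20 * mu n) / D n.

Lemma whp_prev : whp (fun n G =>
  (Nk (u n) R (d n).-1 G - D n ^+ (d n).-1) ^+ 2 <= dev n * D n ^+ (d n).-1 ^+ 2).
Proof.
apply: whp_le.
- by move=> n G; exact: sqr_ge0.
- apply: ev_mono evr => n rg; rewrite mulr_gt0 ?exprn_gt0 ?rgD0// divr_gt0 ?rgD0//.
  by rewrite mulr_gt0 ?rgL0// addr_gt0// mulr_gt0// (rg_mu_gt0 rg).
move=> e e0; apply: ev_mono2 evr (evL e^-1) => n rg h.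
have L0 := rgL0 rg; have n0 := rgn0 rg; have D0 := rgD0 rg.
have := @ex_Nk_dev _ (u n) _ _ (rg_q01 rg); rewrite rgV// => /(_ (rg_D2 rg) (d n).-1) h1.
apply: le_trans h1 _; rewrite mulrC mulrA ler_wpM2r ?sqr_ge0//.
rewrite card_vertex ?(rg_n rg)// {1}(rg_Dpred rg) /dev.
have m0 := rg_mu_gt0 rg.
have -> : 2 / D n + 20 * (n%:R * mu n / D n) / n%:R = (2 + 20 * mu n) / D n.
  by field; rewrite !gt_eqF.
have -> : e * (L n * (2 + 20 * mu n) / D n) = e * L n * ((2 + 20 * mu n) / D n).
  by move: (mu n) (L n) (D n) => x y z; rewrite !mulrA.
have eL : 1 <= e * L n by move: h; rewrite -[e^-1]div1r ler_pdivrMr// mulrC.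
apply: ler_peMl => //; apply: divr_ge0; last exact: ltW.
by apply: addr_ge0 => //; apply: mulr_ge0 => //; exact: ltW.
Qed.

Lemma ev_Dpow (C : R) (k : nat) : ev (fun n => C * (D n ^+ k * L n ^+ k) <= n%:R).
Proof.
have H := evI (ev_pow_n (`|C| * a1 ^+ k) (k + k)) (ev_pow_exp 1 1 (@ltr01 R)).
apply: ev_mono2 evr H => n rg [h e1]; apply: le_trans h; rewrite (rg_ln rg).
move: e1; rewrite !mul1r expr1 -/(Ln R n) => e1.
have /andP[al0 al1] := rg_a rg; have al : 0 <= alpha n by apply: le_trans al0; exact: ltW.
rewrite exprD (rg_D rg) -mulrA; apply: (@le_trans _ _ (`|C| * ((alpha n * expR (L n)) ^+ k * L n ^+ k))).
  rewrite ler_wpM2r ?ler_norm// mulr_ge0 ?exprn_ge0 ?mulr_ge0 ?expR_ge0//.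
  exact: ltW (rgL0 rg).
rewrite ler_wpM2l//.
have -> : a1 ^+ k * (expR (L n) ^+ k * expR (L n) ^+ k) = (a1 * expR (L n)) ^+ k * expR (L n) ^+ k.
  by rewrite exprMn mulrA.
apply: ler_pM.
- by rewrite exprn_ge0// mulr_ge0 ?expR_ge0.
- by rewrite exprn_ge0// ltW// rgL0.
- by rewrite lerXn2r ?nnegrE ?mulr_ge0 ?expR_ge0 ?(le_trans al al1)// ler_wpM2r ?expR_ge0.
- by rewrite lerXn2r ?nnegrE ?expR_ge0// ltW// rgL0.
Qed.

Lemma whp_fluct : whp (fun n G =>
  (Nk (u n) R (d n) G - Mk (u n) (q n) (d n).-1 G) ^+ 2 <= (n%:R / L n ^+ 4) ^+ 2).
Proof.
apply: whp_le.
- by move=> n G; exact: sqr_ge0.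
- by apply: ev_mono evr => n rg; rewrite exprn_gt0// divr_gt0 ?exprn_gt0 ?rgL0 ?rgn0.
move=> e e0; apply: ev_mono2 evr (ev_Dpow e^-1 8) => n rg h.
have L0 := rgL0 rg; have n0 := rgn0 rg; have D0 := rgD0 rg.
have := @ex_Nk_var_le _ (u n) _ _ (rg_q01 rg) (d n).-1; rewrite rgV// (prednK (rgd0 rg)) => h1.
apply: le_trans h1 _; rewrite (rg_Dpow rg).
have -> : e * (n%:R / L n ^+ 4) ^+ 2 = n%:R * (e * n%:R / L n ^+ 8).
  by field; rewrite gt_eqF.
rewrite ler_wpM2l ?(ltW n0)//; apply: le_trans (rg_mu_le rg) _.
rewrite ler_pdivlMr ?exprn_gt0//; apply: (@le_trans _ _ (D n ^+ 8 * L n ^+ 8)).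
  rewrite ler_wpM2r ?exprn_ge0 ?(ltW L0)// -[leLHS]expr1 ler_weXn2l//.
  by apply: le_trans (rg_D2 rg); rewrite ler1n.
by move: h; rewrite ler_pdivrMl.
Qed.

Lemma whp_lnp_fluct (e : R) : 0 < e -> whp (fun n G =>
  (\sum_(v in ~: ball (u n) G (d n).-1) lnp R (deg G v (lay (u n) G (d n).-1))
   - #|~: ball (u n) G (d n).-1|%:R * binex (q n) #|lay (u n) G (d n).-1| (lnp R)) ^+ 2
  <= (e * n%:R) ^+ 2).
Proof.
move=> e0; apply: whp_le.
- by move=> n G; exact: sqr_ge0.
- by apply: ev_mono evr => n rg; rewrite exprn_gt0// mulr_gt0 ?rgn0.
move=> e' e'0; apply: ev_mono2 evr (ev_Dpow (3 / (e' * e ^+ 2)) 2) => n rg h.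
have L0 := rgL0 rg; have n0 := rgn0 rg; have D0 := rgD0 rg; have m0 := rg_mu_gt0 rg.
have := @ex_lnp_var _ (u n) _ _ (rg_q01 rg) (d n).-1; rewrite rgV// => /(_ (rg_D2 rg)) h1.
apply: le_trans h1 _; rewrite card_vertex ?(rg_n rg)//.
have -> : 2 * q n ^+ 2 * D n ^+ (d n).-1 ^+ 2 = 2 * (q n * D n ^+ (d n).-1) ^+ 2.
  by rewrite -[2 * _ * _]mulrA -[in LHS]exprMn.
rewrite !(rg_qDpred rg).
have -> : e' * (e * n%:R) ^+ 2 = n%:R * (e' * e ^+ 2 * n%:R) by ring.
rewrite ler_wpM2l ?(ltW n0)//.
have D1 : 1 <= D n by apply: le_trans (rg_D2 rg); rewrite ler1n.
have mD := rg_mu_le rg; have L1 := rg_L rg.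
apply: (@le_trans _ _ (3 * (D n ^+ 2 * L n ^+ 2))).
  have x1 : D n ^+ 2 <= D n ^+ 2 * L n ^+ 2 by rewrite ler_peMr ?sqr_ge0// exprn_ege1.
  have x2 : mu n ^+ 2 <= D n ^+ 2 by rewrite lerXn2r ?nnegrE ?(ltW m0) ?(ltW D0).
  have x3 : D n <= D n ^+ 2 by rewrite expr2 ler_peMr// ltW.
  move: x1 x2 x3 mD; move: (D n) (mu n) (D n ^+ 2) (mu n ^+ 2) (_ * _) => x y z w t.
  by lra.
by move: h; move: (D n ^+ 2 * L n ^+ 2) => x; rewrite mulrAC ler_pdivrMr ?mulr_gt0 ?exprn_gt0// [n%:R * _]mulrC.
Qed.

Lemma ev_lnL_ge (K : R) : ev (fun n => K <= ln (L n)).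
Proof.
apply: ev_mono (evL (expR K)) => n h.
by rewrite -[leLHS]expRK ler_ln ?posrE ?expR_gt0//; exact: lt_le_trans (expR_gt0 K) h.
Qed.

Lemma whp_sumX : whp (fun n G =>
  \sum_(v in ~: ball (u n) G (d n).-1) (deg G v (lay (u n) G (d n).-1))%:R
  <= ln (L n) * (n%:R * mu n)).
Proof.
apply: whp_le.
- by move=> n G; exact: sumr_ge0.
- apply: ev_mono2 evr (ev_lnL_ge 1) => n rg h.
  apply: mulr_gt0; first exact: lt_le_trans ltr01 h.
  by apply: mulr_gt0; [exact: rgn0 rg|exact: rg_mu_gt0 rg].
move=> e e0; apply: ev_mono2 evr (ev_lnL_ge e^-1) => n rg h.
have := @ex_sumX _ (u n) _ _ (rg_q01 rg) (d n).-1; rewrite rgV// (prednK (rgd0 rg)) => h1.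
apply: le_trans h1 _; rewrite (rg_Dpow rg).
have := mulr_ge0 (ltW (rgn0 rg)) (ltW (rg_mu_gt0 rg)).
move: (n%:R * mu n) => x x0; rewrite mulrA; apply: ler_peMl => //.
by move: h; rewrite -[e^-1]div1r ler_pdivrMr// mulrC.
Qed.

(** For mu >= 1 the reciprocals have mean of order 1 / mu; for mu < 1 each reciprocal is at most the
    degree itself, whose mean is already of order 1 - lambda. *)
Lemma whp_suminv : whp (fun n G =>
  (D n ^+ (d n).-1 / 2 <= Nk (u n) R (d n).-1 G)%R%:R *
  \sum_(v in ~: ball (u n) G (d n).-1) inv0 R (deg G v (lay (u n) G (d n).-1))
  <= L n * (n%:R * (1 - lam n) / Num.max 1 (mu n))).
Proof.
have i0 k : 0 <= inv0 R k by case: k => [|k]//=; rewrite invr_ge0.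
apply: whp_le.
- by move=> n G; rewrite mulr_ge0// sumr_ge0.
- apply: ev_mono evr => n rg; have /andP[_ l1] := rg_lam01 rg.
  rewrite mulr_gt0 ?rgL0// divr_gt0 ?mulr_gt0 ?rgn0 ?subr_gt0//.
  by rewrite lt_max ltr01.
move=> e e0; apply: ev_mono2 evr (evL (8 / e)) => n rg h.
have L0 := rgL0 rg; have n0 := rgn0 rg; have D0 := rgD0 rg; have m0 := rg_mu_gt0 rg.
have hL : 8 <= e * L n by move: h; rewrite ler_pdivrMr// mulrC.
have lh := rg_lamC_half rg.
have [m1|m1] := leP 1 (mu n).
  have x0 : 0 < D n ^+ (d n).-1 / 2 by rewrite divr_gt0// exprn_gt0.
  have := @ex_suminv _ (u n) _ _ (rg_q01 rg) (d n).-1 _ (rgq0 rg) x0 => h1.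
  apply: le_trans h1 _; rewrite card_vertex ?(rg_n rg)//.
  have -> : D n ^+ (d n).-1 / 2 * q n = mu n / 2.
    by rewrite mulrAC [_ * q n]mulrC (rg_qDpred rg).
  have -> : n%:R * (2 / (mu n / 2)) = 8 * (n%:R * (1 / 2) / mu n) by field; rewrite gt_eqF.
  have -> : e * (L n * (n%:R * (1 - lam n) / mu n)) = e * L n * (n%:R * (1 - lam n) / mu n).
    by move: (n%:R * _ / _) => x; rewrite mulrA.
  apply: ler_pM => //.
    apply: divr_ge0; last exact: ltW.
    by apply: mulr_ge0; [exact: ltW|rewrite divr_ge0].
  rewrite ler_wpM2r ?invr_ge0 ?(ltW m0)// ler_wpM2l ?(ltW n0)//.
  by move: lh; rewrite (min_idPl m1).
apply: (@le_trans _ _ (exn n (fun G =>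
    \sum_(v in ~: ball (u n) G (d n).-1) (deg G v (lay (u n) G (d n).-1))%:R))).
  apply: ex_le; first exact: rg_q01.
  move=> G _; apply: (@le_trans _ _ (\sum_(v in ~: ball (u n) G (d n).-1)
    inv0 R (deg G v (lay (u n) G (d n).-1)))).
    by rewrite ler_piMl ?sumr_ge0// lern1 leq_b1.
  apply: ler_sum => v _; case: (deg _ _ _) => [|k]//=.
  by apply: (@le_trans _ _ 1); rewrite ?ler1n// invf_le1 ?ltr0n// ler1n.
have := @ex_sumX _ (u n) _ _ (rg_q01 rg) (d n).-1; rewrite rgV// (prednK (rgd0 rg)) => h1.
apply: le_trans h1 _; rewrite (rg_Dpow rg) divr1.
rewrite (min_idPr (ltW m1)) in lh.
rewrite mulrA; apply: (@le_trans _ _ (8 * (n%:R * (mu n / 2)))).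
  have : 0 <= n%:R * mu n by rewrite mulr_ge0 ?(ltW n0) ?(ltW m0).
  by move: (n%:R * mu n) (mulrA n%:R (mu n) 2^-1) => x e1; rewrite e1; lra.
apply: ler_pM => //; last by rewrite ler_wpM2l ?(ltW n0).
by apply: mulr_ge0; [exact: ltW|apply: divr_ge0 => //; exact: ltW].
Qed.

Lemma whp_degsum : whp (fun n G => \sum_v (deg G v setT)%:R <= L n * (n%:R * D n)).
Proof.
apply: whp_le.
- by move=> n G; exact: sumr_ge0.
- apply: ev_mono evr => n rg; apply: mulr_gt0; first exact: rgL0 rg.
  by apply: mulr_gt0; [exact: rgn0 rg|exact: rgD0 rg].
move=> e e0; apply: ev_mono2 evr (evL e^-1) => n rg h.
have := @ex_degsum (vertex n) _ _ (rg_q01 rg); rewrite rgV// card_vertex ?(rg_n rg)// => h1.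
apply: le_trans h1 _.
have := mulr_ge0 (ltW (rgn0 rg)) (ltW (rgD0 rg)).
move: (n%:R * D n) => x x0; rewrite mulrA; apply: ler_peMl => //.
by move: h; rewrite -[e^-1]div1r ler_pdivrMr// mulrC.
Qed.

Lemma whp_fresh (e : R) (pad c : nat -> R) : 0 < e -> ev (fun n => 0 < pad n) ->
  whp (fun n G => isum (u n) (pad n) (c n) (d n) (fun G I v => (deg G v I)%:R) G
    <= expR (e * n%:R)
       * isum (u n) (pad n) (c n) (d n) (fun G I v => #|I|%:R * q n) G).
Proof.
move=> e0 pad0.
(* The maximum with 0 makes Y nonnegative for every n, including the finitely many for which [pad n]
   or [q n] is out of range. *)
pose Y n (G : graph n) := Num.max 0 (isum (u n) (pad n) (c n) (d n) (fun G I v => (deg G v I)%:R) G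
  / isum (u n) (pad n) (c n) (d n) (fun G I v => #|I|%:R * q n) G).
have i_ge0 n (G : graph n) (f : graph n -> {set vertex n} -> vertex n -> R) : 0 < pad n ->
    (forall G I v, 0 <= f G I v) -> 0 <= isum (u n) (pad n) (c n) (d n) f G.
  move=> p0 f0; apply: sumr_ge0 => I _; rewrite !mulr_ge0 ?expR_ge0 ?prodr_ge0// => v _.
  by rewrite addr_ge0// ltW.
apply: (@whp_mono _ _ ev_q01 (fun n G => Y n G <= expR (e * n%:R))).
  apply: ev_mono2 evr pad0 => n rg p0 G _; rewrite ge_max => /andP[_].
  rewrite ler_pdivrMr// /isum (bigD1 set0) ?sub0set//= ltr_pwDl ?sumr_ge0//.
    rewrite big_set0 mulr1 mulr_gt0 ?expR_gt0// prodr_gt0// => v _.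
    by rewrite cards0 mul0r add0r.
  move=> I _; rewrite !mulr_ge0 ?expR_ge0 ?prodr_ge0// => v _.
  by apply: addr_ge0; [apply: mulr_ge0 => //; exact: ltW (rgq0 rg)|exact: ltW].
apply: whp_le.
- by move=> n G; rewrite /Y le_max lexx.
- by exists 0%N => n _; exact: expR_gt0.
move=> e' e'0; have := evI pad0 (ev_pow_n (e'^-1 / e) 0).
move=> H; apply: ev_mono2 evr H => n rg [p0]; rewrite expr0 mulr1 => h.
apply: (@le_trans _ _ 1).
  rewrite -(ex_fresh (u n) (rg_q01 rg) (c n) (rgd0 rg) p0).
  apply: ex_le; first exact: rg_q01.
  move=> G _; rewrite ge_max lexx andbT divr_ge0//.
    exact: i_ge0.
  by apply: i_ge0 => // _ I _; rewrite mulr_ge0// ltW// rgq0.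
have h2 : e'^-1 <= expR (e * n%:R).
  apply: le_trans (le_trans _ (expR_ge1Dx _)) => //.
  by move: h; rewrite ler_pdivrMr// mulrC => h; rewrite ler_wpDl.
by move: h2; rewrite -[e'^-1]div1r ler_pdivrMr// mulrC.
Qed.

Lemma whp_defect (e : R) (Is : forall n, graph n -> {set vertex n}) : 0 < e ->
  (forall n (G : graph n), Is n G \subset lay (u n) G (d n)) ->
  (forall n (G : graph n), Is n (hist (u n) G (d n)) = Is n G) ->
  whp (fun n G => (L n <= #|Is n G|%:R * q n)%R%:R *
    \sum_(v in ~: (rball (u n) G (d n) :|: Is n G))
      Num.max 0 (ln (#|Is n G|%:R * q n) - lnp R (deg G v (Is n G))) <= e * n%:R).
Proof.
move=> e0 IL IH; apply: whp_le.
- by move=> n G; rewrite mulr_ge0// sumr_ge0// => v _; rewrite le_max lexx.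
- by apply: ev_mono evr => n rg; rewrite mulr_gt0 ?rgn0.
move=> e' e'0; apply: ev_mono2 evr (evL ((10 / (e' * e)) ^+ 2)) => n rg h.
have L0 := rgL0 rg; have n0 := rgn0 rg.
have := @ex_defect _ (u n) _ _ (rg_q01 rg) (d n) (Is n) (L n) (rg_L rg) (IL n) (IH n).
rewrite card_vertex ?(rg_n rg)// => h1; apply: le_trans h1 _.
rewrite mulrA mulrC ler_wpM2r ?(ltW n0)// ler_pdivrMr ?sqrtr_gt0//.
rewrite -ler_pdivrMl ?mulr_gt0// mulrC.
have x0 : 0 <= 10 / (e' * e) by rewrite divr_ge0// mulr_ge0// ltW.
by rewrite -(ger0_norm x0) -sqrtr_sqr ler_wsqrtr.
Qed.

(** Half of the lower bound n / (2 L ^ 2) for n (1 - lambda): a crude lower bound on the size of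
    layer d. *)
Definition Lam n : R := n%:R / (4 * L n ^+ 2).

Lemma ev_expD : ev (fun n => expR (- (q n * Lam n)) <= expR (- (2 * L n))).
Proof.
have H := ev_pow_exp (8 / a0) 3 (@ltr01 R).
apply: ev_mono2 evr H => n rg; rewrite mul1r -/(Ln R n) => h.
have L0 := rgL0 rg; have n0 := rgn0 rg; have /andP[al _] := rg_a rg.
rewrite ler_expR lerN2 /Lam mulrA [q n * _]mulrC -/(Dn alpha n) (rg_D rg).
rewrite ler_pdivlMr ?mulr_gt0 ?exprn_gt0//.
have -> : 2 * L n * (4 * L n ^+ 2) = 8 * L n ^+ 3 by ring.
apply: (@le_trans _ _ (a0 * expR (L n))); last by rewrite ler_wpM2r ?expR_ge0.
by move: h; rewrite [8 / a0 * _]mulrAC ler_pdivrMr// [expR _ * _]mulrC.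
Qed.

Lemma whp_out (e : R) : 0 < e -> whp (fun n G =>
  (Lam n <= Nk (u n) R (d n) G)%R%:R * #|~: ball (u n) G (d n).+1|%:R
  <= e * n%:R / expR (L n)).
Proof.
move=> e0; apply: whp_le.
- by move=> n G; rewrite mulr_ge0.
- by apply: ev_mono evr => n rg; rewrite divr_gt0 ?expR_gt0// mulr_gt0 ?rgn0.
move=> e' e'0; have H := evI ev_expD (ev_pow_exp (e' * e)^-1 0 (@ltr01 R)).
apply: ev_mono2 evr H => n rg [h1]; rewrite expr0 mulr1 mul1r -/(Ln R n) => h2.
have n0 := rgn0 rg.
have := @ex_ballC _ (u n) _ _ (rg_q01 rg) (d n) (Lam n).
rewrite card_vertex ?(rg_n rg)// => h3; apply: le_trans h3 _.
apply: (@le_trans _ _ (n%:R * expR (- (2 * L n)))); first by rewrite ler_wpM2l ?(ltW n0).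
have -> : e' * (e * n%:R / expR (L n)) = n%:R * (e' * e / expR (L n)).
  by field; rewrite gt_eqF ?expR_gt0.
rewrite ler_wpM2l ?(ltW n0)// mulr2n mulrDl mul1r opprD expRD expRN.
rewrite ler_wpM2r ?invr_ge0 ?expR_ge0//.
by rewrite -[leRHS]invrK lef_pV2 ?posrE ?expR_gt0// invr_gt0 mulr_gt0.
Qed.

Lemma whp_far (e : R) : 0 < e -> whp (fun n G =>
  (Lam n <= Nk (u n) R (d n) G)%R%:R
  * (#|~: ball (u n) G (d n).+1|%:R <= 1 / (4 * q n))%R%:R * (far (u n) G (d n))%:R
  <= e * n%:R / L n).
Proof.
move=> e0; apply: whp_le.
- by move=> n G; rewrite !mulr_ge0.
- by apply: ev_mono evr => n rg; rewrite divr_gt0 ?rgL0// mulr_gt0 ?rgn0.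
move=> e' e'0; have H := evI ev_expD (ev_pow_exp (4 / (e' * e)) 1 (@ltr0n R 2)).
apply: ev_mono2 evr H => n rg [h1]; rewrite expr1 -/(Ln R n) => h2.
have n0 := rgn0 rg; have q0 := rgq0 rg; have L0 := rgL0 rg.
have c0 : 0 <= 1 / (4 * q n) by rewrite divr_ge0// mulr_ge0// ltW.
have cq : 1 / (4 * q n) * q n <= 1 / 4.
  by rewrite le_eqVlt; apply/orP; left; apply/eqP; field; rewrite gt_eqF.
have := @ex_far _ (u n) _ _ (rg_q01 rg) (d n) (Lam n) _ c0 cq.
rewrite card_vertex ?(rg_n rg)// => h3; apply: le_trans h3 _.
apply: (@le_trans _ _ (4 * (n%:R * expR (- (2 * L n))))).
  by rewrite ler_wpM2l// ler_wpM2l ?(ltW n0).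
have -> : e' * (e * n%:R / L n) = n%:R * (e' * e / L n) by field; rewrite gt_eqF.
rewrite mulrCA ler_wpM2l ?(ltW n0)// ler_pdivlMr// expRN mulrAC ler_pdivrMr ?expR_gt0//.
by move: h2; rewrite mulrAC ler_pdivrMr ?mulr_gt0// [expR _ * _]mulrC.
Qed.

End events.

(** * Perturbation of exponentials relative to 1 - exp (- x) *)

Section exponentials.
Variable R : realType.

Lemma norm_le_sq (x y : R) : 0 <= y -> x ^+ 2 <= y ^+ 2 -> `|x| <= y.
Proof. by move=> y0 h; rewrite -ler_sqr ?nnegrE// real_normK ?num_real. Qed.

Lemma expRN_mul_le (x : R) : expR (- x) * x <= 1 - expR (- x).
Proof.
have := ler_wpM2l (expR_ge0 (- x)) (expR_ge1Dx x).
rewrite [_ * expR x]mulrC expRxMexpNx_1; lra.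
Qed.

(** The error is relative to 1 - exp (- x), which matters for small x; it comes from the convexity
    of exp and from x exp (- x) <= 1 - exp (- x). *)
Lemma expRN_close (x a t : R) : 0 < x -> 0 <= t <= 1 / 2 -> `|a - x| <= t * x ->
  `|expR (- a) - expR (- x)| <= 2 * t * (1 - expR (- x)).
Proof.
move=> x0 /andP[t0 t1]; rewrite ler_norml => /andP[h1 h2].
have step (y z : R) : expR (- y) - expR (- z) <= expR (- y) * (z - y).
  have -> : - z = - y + (y - z) by ring.
  have h := expR_ge1Dx (y - z); rewrite [expR (- y + (y - z))]expRD.
  have := ler_wpM2l (expR_ge0 (- y)) h; lra.
have E0 := expR_ge0 (- x); have F0 := expR_ge0 (- a).
have Ex := expRN_mul_le x; have Fa := expRN_mul_le a.
have [ax|ax] := leP x a.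
  have EF : expR (- a) <= expR (- x) by rewrite ler_expR lerN2.
  have s := step x a.
  have s2 : expR (- x) * (a - x) <= expR (- x) * (t * x) by rewrite ler_wpM2l//; lra.
  have s3 : t * (expR (- x) * x) <= t * (1 - expR (- x)) by rewrite ler_wpM2l.
  have s4 : 0 <= t * (1 - expR (- x)).
    by rewrite mulr_ge0// subr_ge0 -expR0 ler_expR oppr_le0 ltW.
  rewrite ler_norml; apply/andP; split; lra.
have EF : expR (- x) <= expR (- a) by rewrite ler_expR lerN2 ltW.
have s := step a x.
have s2 : expR (- a) * (x - a) <= expR (- a) * (t * x) by rewrite ler_wpM2l//; lra.
have s5 : t * x <= 1 / 2 * x by rewrite ler_wpM2r// ltW.
have s6 : expR (- a) * x <= expR (- a) * (2 * a) by rewrite ler_wpM2l//; lra.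
have s3 : t * (expR (- a) * x) <= t * (2 * (1 - expR (- x))) by rewrite ler_wpM2l//; lra.
have s4 : 0 <= t * (1 - expR (- x)).
  by rewrite mulr_ge0// subr_ge0 -expR0 ler_expR oppr_le0 ltW.
rewrite ler_norml; apply/andP; split; lra.
Qed.

Lemma pow1B_expR (q : R) (x : nat) : 0 <= q <= 1 / 2 ->
  expR (- (x%:R * q * (1 + 2 * q))) <= (1 - q) ^+ x <= expR (- (x%:R * q)).
Proof.
move=> /andP[q0 q1].
have q2 : 0 <= 1 - q by lra.
have h : expR (- (q * (1 + 2 * q))) <= 1 - q.
  have := expR_ge1Dx (q * (1 + 2 * q)) => h.
  rewrite expRN -[leLHS]mul1r ler_pdivrMr ?expR_gt0//.
  have := ler_wpM2l q2 h.
  have : 0 <= q ^+ 2 * (1 - 2 * q) by rewrite mulr_ge0 ?sqr_ge0//; lra.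
  rewrite !expr2; lra.
have e1 : expR (- (x%:R * q)) = expR (- q) ^+ x by rewrite -expRM_natl mulrN.
have e2 : expR (- (x%:R * q * (1 + 2 * q))) = expR (- (q * (1 + 2 * q))) ^+ x.
  by rewrite -expRM_natl mulrN mulrA.
rewrite e1 e2 !lerXn2r ?nnegrE ?expR_ge0//=.
by have := expR_ge1Dx (- q); lra.
Qed.

Lemma pow1B_close (q mu t : R) (x : nat) : 0 < mu -> 0 <= q <= 1 / 4 -> 0 <= t <= 1 / 2 ->
  `|x%:R * q - mu| <= t * mu ->
  `|(1 - q) ^+ x - expR (- mu)| <= (2 * t + 8 * q) * (1 - expR (- mu)).
Proof.
move=> m0 /andP[q0 q1] /andP[t0 t1] h.
have h1 := expRN_close m0 (introT andP (conj t0 t1)) h.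
have /andP[b1 b2] : expR (- (x%:R * q * (1 + 2 * q))) <= (1 - q) ^+ x <= expR (- (x%:R * q)).
  by apply: pow1B_expR; lra.
have a0 : 0 < x%:R * q.
  move: h; rewrite ler_norml => /andP[h _].
  have : t * mu <= 1 / 2 * mu by rewrite ler_wpM2r// ltW.
  lra.
have h2 : `|x%:R * q * (1 + 2 * q) - x%:R * q| <= (2 * q) * (x%:R * q).
  have -> : x%:R * q * (1 + 2 * q) - x%:R * q = 2 * q * (x%:R * q) by ring.
  by rewrite ger0_norm// mulr_ge0 ?(ltW a0)//; lra.
have := expRN_close a0 _ h2 => h3.
have /h3 {}h3 : 0 <= 2 * q <= 1 / 2 by lra.
move: h1 h3 b1 b2; move: (expR _) (_ ^+ x) => y z.
have := expR_ge0 (- (x%:R * q)).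
have M0 : 0 <= 1 - expR (- mu) by rewrite subr_ge0 -expR0 ler_expR oppr_le0 ltW.
move: M0; move: (expR _) (expR _) => E F M0 F0.
rewrite !ler_norml => /andP[h1 h2'] /andP[h3 h4] b1 b2.
have k1 : t * (1 - F) <= 1 / 2 * (1 - F) by rewrite ler_wpM2r.
have k2 : q * (1 - y) <= q * (2 * (1 - F)) by rewrite ler_wpM2l//; lra.
have k3 : 0 <= q * (1 - F) by rewrite mulr_ge0.
apply/andP; split; lra.
Qed.

End exponentials.

(** * Concentration of the size of layer d and of the sum of logarithms *)

Section derived_events.
Variables (R : realType) (alpha : nat -> R) (a0 a1 : R).
Hypotheses (a0_gt0 : 0 < a0) (alpha_bd : ev (fun n => a0 <= alpha n <= a1)).
Local Notation rgm := (regime alpha a0 a1).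
Local Notation q := (qn alpha).
Local Notation D := (Dn alpha).
Local Notation L := (Ln R).
Local Notation d := (dn alpha).
Local Notation mu := (mun alpha).
Local Notation lam := (lamn alpha).
Local Notation u := vertex1.
Local Notation whp := (whp q).
Local Notation evr := (ev_regime a0_gt0 alpha_bd).
Local Notation q01 := (ev_q01 a0_gt0 alpha_bd).

Lemma ev_D (K : R) (k : nat) : ev (fun n => K * L n ^+ k <= D n).
Proof.
have H := ev_pow_exp (K / a0) k (@ltr01 R).
apply: ev_mono2 evr H => n rg; rewrite mul1r -/(Ln R n) => h.
have /andP[al _] := rg_a rg.
rewrite (rg_D rg); apply: (@le_trans _ _ (a0 * expR (L n))); last by rewrite ler_wpM2r ?expR_ge0.
by move: h; rewrite [K / a0 * _]mulrAC ler_pdivrMr// [expR _ * _]mulrC.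
Qed.

Lemma ev_qL (C : R) : ev (fun n => C * L n * q n <= 1).
Proof.
apply: ev_mono2 evr (ev_Dpow a0_gt0 alpha_bd C 1) => n rg.
rewrite !expr1 => h; have n0 := rgn0 rg.
rewrite -(ler_pM2l n0) mulr1; apply: le_trans h.
by rewrite le_eqVlt; apply/orP; left; apply/eqP; rewrite /Dn; ring.
Qed.

Lemma ev_qD (C : R) : ev (fun n => C * (q n * D n) <= 1).
Proof.
apply: ev_mono2 evr (ev_Dpow a0_gt0 alpha_bd `|C| 2) => n rg h; have n0 := rgn0 rg.
have L1 := rg_L rg.
rewrite -(ler_pM2l n0) mulr1; apply: le_trans h.
have -> : n%:R * (C * (q n * D n)) = C * D n ^+ 2 by rewrite /Dn; ring.
apply: (@le_trans _ _ (`|C| * D n ^+ 2)); first by rewrite ler_wpM2r ?sqr_ge0// ler_norm.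
by rewrite ler_wpM2l// ler_peMr ?sqr_ge0// exprn_ege1.
Qed.

Lemma rg_muL2 n : rgm n -> L n * (L n * mu n) <= D n.
Proof.
move=> rg; have L0 := rgL0 rg.
have := rg_mu2 rg; rewrite ler_pdivlMr ?exprn_gt0// => h.
by apply: le_trans h; rewrite le_eqVlt; apply/orP; left; apply/eqP; ring.
Qed.

(** With its spare factor the relative variance is of order L (1 + mu) / D, where mu / D may be as
    large as 1 / L ^ 2; the accuracy e / L is therefore obtained only for mu <= L. *)
Lemma whp_theta (e : R) : 0 < e -> whp (fun n G =>
  `|#|lay (u n) G (d n).-1|%:R * q n - mu n| <= e * mu n /\
  (mu n <= L n -> `|#|lay (u n) G (d n).-1|%:R * q n - mu n| <= e / L n * mu n)).
Proof.
move=> e0; apply: (whp_mono q01) (whp_prev a0_gt0 alpha_bd).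
have H := evI (evL (40 / e ^+ 2)) (evI (ev_D (4 / e ^+ 2) 1) (ev_D (22 / e ^+ 2) 4)).
apply: ev_mono2 evr H => n rg [h1 [h2 h3]] G _.
have L0 := rgL0 rg; have n0 := rgn0 rg; have D0 := rgD0 rg; have m0 := rg_mu_gt0 rg.
have q0 := rgq0 rg; have e20 : 0 < e ^+ 2 by rewrite exprn_gt0.
rewrite /Nk /dev => dv.
have key (t : R) : 0 <= t -> L n * (2 + 20 * mu n) <= t ^+ 2 * D n ->
    `|#|lay (u n) G (d n).-1|%:R * q n - mu n| <= t * mu n.
  move=> t0 ht; rewrite -(rg_qDpred rg).
  have := norm_le_sq (y := t * D n ^+ (d n).-1).
  move: dv; move: (D n ^+ (d n).-1) (exprn_ge0 (d n).-1 (ltW D0)) => P P0 dv.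
  move/(_ (#|lay (u n) G (d n).-1|%:R - P)) => nl.
  have {nl} := nl (mulr_ge0 t0 P0) => nl.
  have -> : #|lay (u n) G (d n).-1|%:R * q n - q n * P = q n * (#|lay (u n) G (d n).-1|%:R - P).
    by ring.
  rewrite normrM gtr0_norm// mulrCA ler_wpM2l ?(ltW q0)// nl//.
  apply: le_trans dv _; rewrite [(t * P) ^+ 2]exprMn ler_wpM2r ?sqr_ge0//.
  by rewrite ler_pdivrMr.
have Lm := rg_muL2 rg; have L1 := rg_L rg; move=> {dv}.
split.
  apply: key; first exact: ltW.
  move: h1 h2; rewrite expr1 ler_pdivrMr// mulrAC ler_pdivrMr// => h1 h2.
  have s1 : 40 * (L n * mu n) <= L n * e ^+ 2 * (L n * mu n).
    by apply: ler_wpM2r => //; apply: mulr_ge0; exact: ltW.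
  have s2 : e ^+ 2 * (L n * (L n * mu n)) <= e ^+ 2 * D n by rewrite ler_wpM2l// ltW.
  move: s1 s2 h2 {h1 h3 Lm L1 L0 n0 D0 m0 q0 e20}; move: (L n) (mu n) (D n) (e ^+ 2) => l m D' e2; lra.
move=> mL; apply: key; first by rewrite divr_ge0 ?ltW.
move: h3; rewrite mulrAC ler_pdivrMr// => h3.
rewrite expr_div_n mulrAC ler_pdivlMr ?exprn_gt0// [e ^+ 2 * D n]mulrC; apply: le_trans h3.
apply: (@le_trans _ _ (L n * (22 * L n) * L n ^+ 2)).
  by rewrite ler_wpM2r ?sqr_ge0// ler_wpM2l ?(ltW L0)//; lra.
by rewrite le_eqVlt; apply/orP; left; apply/eqP; ring.
Qed.

(** For mu <= L the finer estimate of [whp_theta] is used; for mu > L both lambda and its empirical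
    version are at most exp (- L / 2), while 1 - lambda is at least 1 / 2. *)
Lemma whp_lamp (e : R) : 0 < e -> whp (fun n G =>
  `|(1 - q n) ^+ #|lay (u n) G (d n).-1| - lam n| <= e / L n * (1 - lam n)).
Proof.
move=> e0; pose t := Num.min (e / 4) (1 / 2).
have t0 : 0 < t by rewrite lt_min !divr_gt0.
have t1 : t <= 1 / 2 by rewrite ge_min lexx orbT.
have t2 : t <= e / 4 by rewrite ge_min lexx.
apply: (whp_mono q01) (whp_theta t0).
have H := evI (ev_qL (16 / e)) (evI (ev_qL 4) (ev_pow_exp (2 / e) 1 (@divr_gt0 _ 1 2 (@ltr01 R) (@ltr0n R 2)))).
apply: ev_mono2 evr H => n rg [h1 [h2 h3]] G _ [th1 th2].
have L0 := rgL0 rg; have m0 := rg_mu_gt0 rg; have L1 := rg_L rg; have q0 := rgq0 rg.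
have q4 : q n <= 1 / 4.
  have : 4 * q n <= 4 * L n * q n by rewrite mulrAC ler_peMr// mulr_ge0// ltW.
  lra.
rewrite (rg_lam rg).
have [mL|mL] := leP (mu n) (L n).
  have tl0 : 0 <= t / L n <= 1 / 2.
    rewrite divr_ge0 ?(ltW t0) ?(ltW L0)//= ler_pdivrMr//; apply: le_trans t1 _.
    by rewrite ler_peMr.
  have qq : 0 <= q n <= 1 / 4 by rewrite ltW.
  have := pow1B_close m0 qq tl0 (th2 mL); move=> h; apply: le_trans h _.
  have E1 : 0 <= 1 - expR (- mu n) by rewrite subr_ge0 -expR0 ler_expR oppr_le0 ltW.
  rewrite ler_wpM2r//.
  rewrite ler_pdivlMr//; move: h1.
  have -> : (2 * (t / L n) + 8 * q n) * L n = 2 * t + 8 * (L n * q n) by field; rewrite gt_eqF.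
  have -> : 16 / e * L n * q n = 16 * (L n * q n) / e by field; rewrite gt_eqF.
  by rewrite ler_pdivrMr// mul1r; lra.
have qx : L n / 2 <= #|lay (u n) G (d n).-1|%:R * q n.
  move: th1; rewrite ler_norml => /andP[th1 _].
  have : t * mu n <= 1 / 2 * mu n by rewrite ler_wpM2r// ltW.
  lra.
have b4 : expR (- mu n) <= expR (- (L n / 2)).
  by rewrite ler_expR lerN2; lra.
have q1 : 0 <= 1 - q n by lra.
have qh : 0 <= q n <= 1 / 2 by lra.
have x0 : 0 <= (1 - q n) ^+ #|lay (u n) G (d n).-1| by rewrite exprn_ge0.
have /andP[_ b2] : expR (- (#|lay (u n) G (d n).-1|%:R * q n * (1 + 2 * q n)))
    <= (1 - q n) ^+ #|lay (u n) G (d n).-1| <= expR (- (#|lay (u n) G (d n).-1|%:R * q n)).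
  exact: pow1B_expR.
have b3 : expR (- (#|lay (u n) G (d n).-1|%:R * q n)) <= expR (- (L n / 2)).
  by rewrite ler_expR lerN2.
move: b2 x0; move: (_ ^+ #|_|) => z b2 x0.
have := expR_ge0 (- mu n) => y0.
have h4 : expR (- (L n / 2)) <= e / L n * (1 / 2).
  move: h3; rewrite expr1 -/(Ln R n) mulrC => h3.
  rewrite expRN; have -> : L n / 2 = 1 / 2 * L n by lra.
  rewrite -[leRHS]invrK lef_pV2 ?posrE ?expR_gt0 ?invr_gt0 ?mulr_gt0 ?divr_gt0 ?invr_gt0//.
  apply: le_trans h3; rewrite le_eqVlt; apply/orP; left; apply/eqP; field.
  by rewrite !gt_eqF.
have h5 : e / L n * (1 / 2) <= e / L n * (1 - expR (- mu n)).
  rewrite ler_wpM2l ?divr_ge0 ?(ltW e0) ?(ltW L0)//.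
  have := expRN_mul_le (mu n).
  have : expR (- mu n) * 1 <= expR (- mu n) * mu n by rewrite ler_wpM2l//; lra.
  lra.
rewrite ler_norml; apply/andP; split; lra.
Qed.

Lemma card_ball_near n (G : graph n) : (0 < d n)%N ->
  (#|ball (u n) G (d n).-1| <= near_excess (u n) G (d n))%N.
Proof.
move=> d0; rewrite /near_excess -sum1_card.
have -> : rball (u n) G (d n) = ball (u n) G (d n).-1 by case: (d n) d0.
apply: leq_sum => v; rewrite ball_gdist => /andP[_ h].
by rewrite subn_gt0 ltnS; apply: leq_trans h (leq_pred _).
Qed.

(** Layer d is compared with its conditional mean, then (1 - q) ^ |layer d - 1| with lambda, and the
    explored ball is discarded. The fluctuation n / L ^ 4 is negligible even against n (1 - lambda)
    / L, by [rg_lamC]. *)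
Lemma whp_N (e : R) : 0 < e -> whp (fun n G =>
  `|#|lay (u n) G (d n)|%:R - n%:R * (1 - lam n)| <= e / L n * (n%:R * (1 - lam n))).
Proof.
move=> e0; pose t := Num.min (e / 4) 1.
have t0 : 0 < t by rewrite lt_min !divr_gt0/=.
have t1 : t <= 1 by rewrite ge_min lexx orbT.
have t2 : t <= e / 4 by rewrite ge_min lexx.
have H := whpI q01 (whp_lamp t0) (whpI q01 (whp_near a0_gt0 alpha_bd t0) (whp_fluct a0_gt0 alpha_bd)).
apply: (whp_mono q01) H.
apply: ev_mono2 evr (evL (8 / e)) => n rg h G _ [hl [hn hf]].
have L0 := rgL0 rg; have n0 := rgn0 rg; have L1 := rg_L rg.
have /andP[l0 l1] := rg_lam01 rg; have lC := rg_lamC rg.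
have hf2 : `|Nk (u n) R (d n) G - Mk (u n) (q n) (d n).-1 G| <= n%:R / L n ^+ 4.
  by apply: norm_le_sq hf; rewrite divr_ge0 ?exprn_ge0 ?ltW.
have hB : #|ball (u n) G (d n).-1|%:R <= t / L n * n%:R.
  have -> : t / L n * n%:R = t * n%:R / L n by rewrite mulrAC.
  by apply: le_trans hn; rewrite ler_nat; exact: card_ball_near (rgd0 rg).
have h4 : n%:R / L n ^+ 4 <= e / 4 / L n * (n%:R * (1 - lam n)).
  apply: (@le_trans _ _ (e / 4 / L n * (n%:R * (2 * L n ^+ 2)^-1))); last first.
    by rewrite ler_wpM2l ?ler_wpM2l ?divr_ge0 ?(ltW L0) ?(ltW n0) ?(ltW e0).
  have -> : e / 4 / L n * (n%:R * (2 * L n ^+ 2)^-1) = n%:R / L n ^+ 4 * (e * L n / 8).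
    by field; rewrite gt_eqF.
  rewrite ler_peMr ?divr_ge0 ?exprn_ge0 ?(ltW L0) ?(ltW n0)//.
  by move: h; rewrite ler_pdivrMr// ler_pdivlMr// mul1r mulrC.
rewrite /Nk /Mk in hf2.
have cB : #|~: ball (u n) G (d n).-1|%:R = n%:R - #|ball (u n) G (d n).-1|%:R :> R.
  by rewrite -[in n%:R](card_vertex (rg_n rg)) -(cardsC (ball (u n) G (d n).-1)) natrD addrC addKr.
rewrite cB in hf2.
have b0 : 0 <= #|ball (u n) G (d n).-1|%:R :> R by [].
have q0 := rgq0 rg; have /andP[_ q1] := rg_q rg.
have z1 : (1 - q n) ^+ #|lay (u n) G (d n).-1| <= 1.
  by rewrite exprn_ile1 ?subr_ge0// gerBl ltW.
have tl : t / L n <= 1 by rewrite ler_pdivrMr// mul1r (le_trans t1 L1).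
have tL0 : 0 <= t / L n by rewrite divr_ge0 ?ltW.
have -> : e / L n * (n%:R * (1 - lam n)) = 4 * (e / 4 / L n * (n%:R * (1 - lam n))) by field; rewrite gt_eqF.
have e4 : t / L n <= e / 4 / L n by rewrite ler_wpM2r ?invr_ge0 ?(ltW L0).
move: hl hf2 hB cB b0 z1 h4 {hn hf lC h L0 L1 rg q0 q1 t0 t1 t2 e0} tl tL0 e4 l0 l1 n0; move: (_ ^+ _) #|_|%:R #|_|%:R (_ / L n) (_ / L n) (n%:R) (lam n) (_ / L n ^+ 4).
move=> z B N e' t' nn l w hl hf hB _ b0 z1 h4 tl tL0 e4 l0 l1 n0.
move: hl hf; rewrite !ler_norml => /andP[hl1 hl2] /andP[hf1 hf2].
have l2 : 0 <= 1 - l by lra.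
have k1 : B * (1 - z) <= t' * nn * (1 - z) by rewrite ler_wpM2r//; lra.
have k2 : t' * (1 - l) <= 1 * (1 - l) by rewrite ler_wpM2r.
have k3 : t' * nn * (1 - z) <= t' * nn * (2 * (1 - l)).
  by rewrite ler_wpM2l ?mulr_ge0 ?(ltW n0)//; lra.
have k4 : 0 <= B * (1 - z) by rewrite mulr_ge0//; lra.
have k5 : nn * (z - l) <= nn * (t' * (1 - l)) by rewrite ler_wpM2l ?(ltW n0).
have k6 : nn * (l - z) <= nn * (t' * (1 - l)) by rewrite ler_wpM2l ?(ltW n0)//; lra.
have k7 : t' * (nn * (1 - l)) <= e' * (nn * (1 - l)) by rewrite ler_wpM2r ?mulr_ge0 ?(ltW n0)//; lra.
apply/andP; split; lra.
Qed.

(** Three replacements: the sum by its conditional mean, the binomial law by a Poisson law, and the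
    Poisson parameter by mu. The explored ball costs its size times Psi0 <= 2 L, still o(n). *)
Lemma whp_lnX (e : R) : 0 < e -> whp (fun n G =>
  `|\sum_(v in ~: ball (u n) G (d n).-1) lnp R (deg G v (lay (u n) G (d n).-1))
    - n%:R * Psi0 (lam n)| <= e * n%:R).
Proof.
move=> e0; pose t := Num.min (e / 20) (1 / 2).
have t0 : 0 < t by rewrite lt_min !divr_gt0/=.
have t1 : t <= 1 / 2 by rewrite ge_min lexx orbT.
have t2 : t <= e / 20 by rewrite ge_min lexx.
have H := whpI q01 (whp_theta t0) (whpI q01 (whp_near a0_gt0 alpha_bd t0) (whp_lnp_fluct a0_gt0 alpha_bd t0)).
apply: (whp_mono q01) H.
have H2 := evI (ev_qD (4 / t)) (ev_pow_exp (a1 + 1) 0 (@ltr01 R)).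
apply: ev_mono2 evr H2 => n rg [hq ha] G _ [[th _] [hn hf]].
have L0 := rgL0 rg; have n0 := rgn0 rg; have L1 := rg_L rg; have m0 := rg_mu_gt0 rg.
have q0 := rgq0 rg; have D0 := rgD0 rg; have mD := rg_mu_le rg.
rewrite (Psi0E (rg_lam01 rg)) (rg_lnlam rg).
have hf2 := norm_le_sq (mulr_ge0 (ltW t0) (ltW n0)) hf.
have hB : #|ball (u n) G (d n).-1|%:R * L n <= t * n%:R.
  by rewrite -ler_pdivlMr//; apply: le_trans hn; rewrite ler_nat; exact: card_ball_near (rgd0 rg).
have cB : #|~: ball (u n) G (d n).-1|%:R = n%:R - #|ball (u n) G (d n).-1|%:R :> R.
  by rewrite -[in n%:R](card_vertex (rg_n rg)) -(cardsC (ball (u n) G (d n).-1)) natrD addrC addKr.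
have hb := binex_pois #|lay (u n) G (d n).-1| (rg_q01 rg) (@fdiff_lnp1 R).
have p0 : 0 <= pois (lnp R) (mu n).
  by apply: pois_ge0; [exact: ltW|exact: tame_lnp|exact: lnp_ge0].
have pl : pois (lnp R) (mu n) <= 2 * L n.
  apply: le_trans (pois_lnp_le (ltW m0)) _.
  rewrite -[leRHS]expRK ler_ln ?posrE ?expR_gt0//; last by lra.
  have /andP[_ al] := rg_a rg; move: ha; rewrite expr0 mulr1 mul1r -/(Ln R n) => ha.
  apply: (@le_trans _ _ (1 + D n)); first by rewrite lerD2l.
  rewrite (rg_D rg) mulr2n mulrDl mul1r expRD.
  have E1 : 1 <= expR (L n) by rewrite -expR0 ler_expR ltW.
  have s1 : alpha n * expR (L n) <= a1 * expR (L n) by rewrite ler_wpM2r ?expR_ge0.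
  have s2 : (a1 + 1) * expR (L n) <= expR (L n) * expR (L n) by rewrite ler_wpM2r ?expR_ge0.
  lra.
have al : mu n / 2 <= #|lay (u n) G (d n).-1|%:R * q n.
  move: th; rewrite ler_norml => /andP[th _].
  have : t * mu n <= 1 / 2 * mu n by rewrite ler_wpM2r// ltW.
  lra.
have au : #|lay (u n) G (d n).-1|%:R * q n <= 2 * mu n.
  move: th; rewrite ler_norml => /andP[_ th].
  have : t * mu n <= 1 / 2 * mu n by rewrite ler_wpM2r// ltW.
  lra.
have hb2 : 2 * #|lay (u n) G (d n).-1|%:R * q n ^+ 2 <= t.
  apply: (@le_trans _ _ (4 * (q n * D n))).
    have : q n * (#|lay (u n) G (d n).-1|%:R * q n) <= q n * (2 * D n).
      by rewrite ler_wpM2l ?(ltW q0)//; lra.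
    move: #|_|%:R (D n) => x y; rewrite expr2; lra.
  move: hq; rewrite [4 / t * _]mulrAC ler_pdivrMr//; lra.
have hp : `|pois (lnp R) (#|lay (u n) G (d n).-1|%:R * q n) - pois (lnp R) (mu n)| <= 4 * t.
  move: th al; move: (_ * q n) => a th al.
  have ap : 0 < a by apply: lt_le_trans al; rewrite divr_gt0.
  have [am|am] := leP a (mu n).
    have [g1 g2] := pois_lnp_lip ap am.
    rewrite distrC ger0_norm//; apply: le_trans g2 _.
    rewrite ler_pdivrMr//; move: th; rewrite ler_norml => /andP[th _].
    have : t * (mu n / 2) <= t * a by rewrite ler_wpM2l ?(ltW t0).
    lra.
  have [g1 g2] := pois_lnp_lip m0 (ltW am).
  rewrite ger0_norm//; apply: le_trans g2 _.
  rewrite ler_pdivrMr//; move: th; rewrite ler_norml => /andP[_ th].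
  have : 0 <= t * mu n by rewrite mulr_ge0 ?ltW.
  lra.
have bd : `|binex (q n) #|lay (u n) G (d n).-1| (lnp R) - pois (lnp R) (mu n)| <= 5 * t.
  have -> : 5 * t = t + 4 * t by ring.
  by apply: le_trans (ler_distD (pois (lnp R) (#|lay (u n) G (d n).-1|%:R * q n)) _ _) (lerD (le_trans hb hb2) hp).
have b0 : 0 <= #|ball (u n) G (d n).-1|%:R :> R by [].
have bn : #|ball (u n) G (d n).-1|%:R <= n%:R :> R.
  by rewrite ler_nat -[leqRHS](card_vertex (rg_n rg)) max_card.
rewrite cB in hf2.
move: hf2 bd p0 pl hB b0 bn n0 {th hf hn cB hb al au hb2 hp hq ha}.
move: (\sum_(_ in _) _) (binex _ _ _) (pois _ _) #|_|%:R (n%:R) => S b p B nn.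
rewrite !ler_norml => /andP[h1 h2] /andP[h3 h4] p0 pl hB b0 bn n0.
have k1 : (nn - B) * (b - p) <= (nn - B) * (5 * t) by rewrite ler_wpM2l//; lra.
have k2 : (nn - B) * (p - b) <= (nn - B) * (5 * t) by rewrite ler_wpM2l//; lra.
have k3 : B * p <= B * (2 * L n) by rewrite ler_wpM2l.
have k4 : 0 <= B * p by rewrite mulr_ge0.
have k5 : 0 <= B * t by rewrite mulr_ge0// ltW.
have k6 : t * nn <= e / 20 * nn by rewrite ler_wpM2r// ltW.
apply/andP; split; lra.
Qed.

End derived_events.

Section typical_graphs.
Variables (R : realType) (alpha : nat -> R) (a0 a1 : R).
Hypotheses (a0_gt0 : 0 < a0) (alpha_bd : ev (fun n => a0 <= alpha n <= a1)).
Local Notation rgm := (regime alpha a0 a1).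
Local Notation q := (qn alpha).
Local Notation D := (Dn alpha).
Local Notation L := (Ln R).
Local Notation d := (dn alpha).
Local Notation mu := (mun alpha).
Local Notation lam := (lamn alpha).
Local Notation u := vertex1.
Local Notation whp := (whp q).
Local Notation evr := (ev_regime a0_gt0 alpha_bd).
Local Notation q01 := (ev_q01 a0_gt0 alpha_bd).
Local Notation X n G v := (deg G v (lay (u n) G (d n).-1)).

(* The properties of G(n, q_n) on which both bounds on the partition function rest;
   N_{d*} is #|lay (u n) G (d n)| and X v counts the neighbours of v in the previous layer. *)
Record typical (e : R) n (G : graph n) : Prop := Typical {
  ty_near : (near_excess (u n) G (d n))%:R * L n <= e * n%:R;
  ty_N : `|#|lay (u n) G (d n)|%:R - n%:R * (1 - lam n)| <= e / L n * (n%:R * (1 - lam n));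
  ty_lnX : `|\sum_(v in lay (u n) G (d n)) ln (X n G v)%:R - n%:R * Psi0 (lam n)| <= e * n%:R;
  ty_sumX : \sum_(v in ~: rball (u n) G (d n)) (X n G v)%:R <= ln (L n) * (n%:R * mu n);
  ty_inv : \sum_(v in lay (u n) G (d n)) (X n G v)%:R^-1
    <= L n * (n%:R * (1 - lam n) / Num.max 1 (mu n));
  ty_deg : \sum_v (deg G v setT)%:R <= L n * (n%:R * D n);
  ty_out : #|~: component G (u n)|%:R * expR (L n) <= e * n%:R;
  ty_far : (far (u n) G (d n))%:R * L n <= e * n%:R;
  ty_X : forall v, v \in lay (u n) G (d n) -> (0 < X n G v)%N }.

Lemma rball_pred (V : finType) (w : V) G k : (0 < k)%N -> rball w G k = ball w G k.-1.
Proof. by case: k. Qed.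

Lemma sum_lay n (G : graph n) (f : nat -> R) : (0 < d n)%N -> f 0%N = 0 ->
  \sum_(v in ~: ball (u n) G (d n).-1) f (X n G v) = \sum_(v in lay (u n) G (d n)) f (X n G v).
Proof.
case: (d n) => // k _ f0 /=; rewrite big_mkcond [RHS]big_mkcond; apply: eq_bigr => v _.
by rewrite lay_degE; case: (v \in ~: _) => //=; case: (deg _ _ _).
Qed.

Lemma whp_typical (e : R) : 0 < e -> whp (fun n G => typical e G).
Proof.
move=> e0.
have a10 : 0 < a1.
  case: alpha_bd => n0 /(_ n0 (leqnn _)) /andP[h1 h2].
  by apply: lt_le_trans (le_trans h1 h2).
(* The bound 1 / (4 a1) turns [whp_out] into at most 1 / (4 q) vertices outside the ball of radius d
   + 1, as [whp_far] requires. *)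
pose t := Num.min e (Num.min (1 / 2) (1 / (4 * a1))).
have t0 : 0 < t by rewrite !lt_min e0/= divr_gt0//= divr_gt0// mulr_gt0.
have t1 : t <= 1 / 2 by rewrite !ge_min lexx orbT.
have t2 : t <= e by rewrite !ge_min lexx.
have t3 : t <= 1 / (4 * a1) by rewrite !ge_min lexx !orbT.
have H1 := whpI q01 (whp_near a0_gt0 alpha_bd e0) (whpI q01 (whp_N a0_gt0 alpha_bd t0)
  (whpI q01 (whp_lnX a0_gt0 alpha_bd e0) (whpI q01 (whp_theta a0_gt0 alpha_bd t0) (whp_sumX a0_gt0 alpha_bd)))).
have H2 := whpI q01 (whp_suminv a0_gt0 alpha_bd) (whpI q01 (whp_degsum a0_gt0 alpha_bd)
  (whpI q01 (whp_out a0_gt0 alpha_bd t0) (whp_far a0_gt0 alpha_bd e0))).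
apply: (whp_mono q01) (whpI q01 H1 H2).
apply: ev_mono evr => n rg G _ [[hn [hN [hl [[th _] hX]]]] [hi [hd [ho hf]]]].
have L0 := rgL0 rg; have n0 := rgn0 rg; have L1 := rg_L rg; have m0 := rg_mu_gt0 rg.
have q0 := rgq0 rg; have D0 := rgD0 rg; have d0 := rgd0 rg.
have /andP[l0 l1] := rg_lam01 rg; have lC := rg_lamC rg.
have nl0 : 0 < n%:R * (1 - lam n) by rewrite mulr_gt0// subr_gt0.
have tL : t / L n <= 1 / 2 by rewrite ler_pdivrMr//; apply: le_trans t1 _; rewrite ler_peMr.
have NL : Lam R n <= Nk (u n) R (d n) G.
  apply: (@le_trans _ _ (1 / 2 * (n%:R * (1 - lam n)))).
    rewrite /Lam; have -> : n%:R / (4 * L n ^+ 2) = 1 / 2 * (n%:R * (2 * L n ^+ 2)^-1).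
      by field; rewrite gt_eqF.
    by rewrite ler_wpM2l// ler_wpM2l// ltW.
  move: hN; rewrite ler_norml => /andP[hN _].
  have : t / L n * (n%:R * (1 - lam n)) <= 1 / 2 * (n%:R * (1 - lam n)) by rewrite ler_wpM2r// ltW.
  rewrite /Nk; lra.
have NP : D n ^+ (d n).-1 / 2 <= Nk (u n) R (d n).-1 G.
  move: th; rewrite ler_norml => /andP[th _].
  rewrite -(ler_pM2l q0) mulrA (rg_qDpred rg) [leRHS]mulrC /Nk.
  have : t * mu n <= 1 / 2 * mu n by rewrite ler_wpM2r// ltW.
  move: th {hX hi}; move: (_ * q n) (mu n) => x y; lra.
rewrite NL mul1r in ho; rewrite NP mul1r in hi.
have ho2 : #|~: ball (u n) G (d n).+1|%:R <= 1 / (4 * q n).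
  apply: le_trans ho _; rewrite ler_pdivrMr ?expR_gt0//.
  have /andP[_ al] := rg_a rg; have aE : alpha n * expR (L n) = n%:R * q n by rewrite -(rg_D rg).
  have al0 : 0 < alpha n by apply: lt_le_trans a0_gt0 _; case/andP: (rg_a rg).
  have -> : 1 / (4 * q n) * expR (L n) = 1 / (4 * alpha n) * n%:R.
    rewrite -[expR (L n)](mulKf (lt0r_neq0 al0)) aE; field; rewrite !gt_eqF//.
  rewrite ler_wpM2r ?(ltW n0)//; apply: le_trans t3 _.
  by rewrite ler_wpM2l// lef_pV2 ?posrE ?mulr_gt0// ler_pM2l.
rewrite NL ho2 -mulrA [true%:R * _]mul1r [true%:R * _]mul1r in hf.
have CB : ball (u n) G (d n).+1 \subset component G (u n).
  by apply/fintype.subsetP => v; rewrite ball_gdist => /andP[].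
split.
- by move: hn; rewrite ler_pdivlMr.
- apply: le_trans hN _; rewrite ler_wpM2r ?(ltW nl0)//.
  by rewrite ler_wpM2r// invr_ge0 ltW.
- move: hl; rewrite (sum_lay G d0); last by rewrite /lnp maxn0 ln1.
  rewrite (eq_bigr (fun v => ln (X n G v)%:R)) // => v.
  rewrite -(prednK d0) lay_degE => /andP[_]; rewrite /= /lnp.
  by move=> X0; rewrite (maxn_idPr X0).
- by rewrite rball_pred.
- move: hi; rewrite (sum_lay G d0)// (eq_bigr (fun v => (X n G v)%:R^-1))// => v.
  rewrite -(prednK d0) lay_degE => /andP[_]; rewrite /=.
  by case: (deg _ _ _).
- exact: hd.
- apply: (@le_trans _ _ (t * n%:R)); last by rewrite ler_wpM2r ?(ltW n0).
  rewrite -ler_pdivlMr ?expR_gt0//; apply: le_trans ho; rewrite ler_nat subset_leq_card//.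
  by rewrite setCS.
- by move: hf; rewrite ler_pdivlMr.
- by move=> v; rewrite -{1}(prednK d0) lay_degE => /andP[].
Qed.

End typical_graphs.

(** * Bounds on the partition function *)

Section optimisation.
Variable R : realType.

(** The bracket bounded by W is minus the slope of the left-hand side at m = N when p = 0. By the
    tangent of ln at N q, going down from N gains at most N W, and eta pays for p. *)
Lemma low_temperature_max (n N m q p c ly W eta : R) :
  0 < n -> 0 < N <= n -> 0 <= m <= N -> 0 < q -> 0 < m * q + p ->
  0 <= eta -> p <= eta * (N * q) -> 0 <= W -> ln (N * q) + 1 - n / N - c + ly <= W ->
  (n - m) * ln (m * q + p) + c * m + (N - m) * ly
    <= (n - N) * ln (N * q) + c * N + N * W + n * eta.
Proof.
move=> n0 /andP[N0 Nn] /andP[m0 mN] q0 mp eta0 pe W0 hW.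
have Nq : 0 < N * q by rewrite mulr_gt0.
have h1 : ln (m * q + p) <= ln (N * q) - (N - m) / N + eta.
  have := ln_le_subr1 (divr_gt0 mp Nq); rewrite ln_div ?posrE// => h.
  have : (m * q + p) / (N * q) <= m / N + eta.
    rewrite ler_pdivrMr//; have -> : (m / N + eta) * (N * q) = m * q + eta * (N * q).
      by field; rewrite gt_eqF.
    by rewrite lerD2l.
  have -> : (N - m) / N = 1 - m / N by field; rewrite gt_eqF.
  by move: h; move: (m / N) (ln _) (ln _) (_ / _) => *; lra.
have h2 : (n - m) * ln (m * q + p) <= (n - m) * (ln (N * q) - (N - m) / N + eta).
  by rewrite ler_wpM2l//; lra.
have h3 : (N - m) * (ln (N * q) + 1 - n / N - c + ly) <= (N - m) * W by rewrite ler_wpM2l//; lra.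
have h4 : (N - m) * W <= N * W by rewrite ler_wpM2r//; lra.
have h5 : (n - m) * ((N - m) / N) = (N - m) * (n / N) - (N - m) + (N - m) * ((N - m) / N).
  by field; rewrite gt_eqF.
have h6 : 0 <= (N - m) * ((N - m) / N).
  have j0 : 0 <= N - m by lra.
  by rewrite mulr_ge0// divr_ge0// ltW.
have h7 : 0 <= m * eta by rewrite mulr_ge0.
move: h2 h3 h4 h5 h6 h7 {h1 hW}.
have -> : (n - m) * (ln (N * q) - (N - m) / N + eta) =
  (n - m) * ln (N * q) - (n - m) * ((N - m) / N) + (n - m) * eta by ring.
move: ((N - m) / N) (n / N) (ln _) (ln _) => x y z w; nra.
Qed.

(** With x = (m q + p) / (n q), close to m / n, the tangent bound ln x <= x h - ln h - 1 at x = 1 /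
    h places the optimum at m = n / h. The remaining - m ln x is compared with m ln t through m <= n
    x, at cost n / t, and h k pays for p. *)
Lemma high_temperature_max (n m q p c ly h t k : R) :
  0 < n -> 0 <= m <= n -> 0 < q -> 0 <= p -> 0 < m * q + p -> 0 < t ->
  p <= k * (n * q) -> 0 < h -> h + ln t <= ln (n * q) - c - ly ->
  (n - m) * ln (m * q + p) + c * m + m * ly
    <= n * (ln (n * q) - ln h - 1 + t^-1 + h * k).
Proof.
move=> n0 /andP[m0 mn] q0 p0 mp t0 pk h0 hh.
have D0 : 0 < n * q by rewrite mulr_gt0.
pose x := (m * q + p) / (n * q).
have x0 : 0 < x by rewrite divr_gt0.
have lE : ln (m * q + p) = ln (n * q) + ln x by rewrite /x ln_div ?posrE//; lra.
have xm : m <= n * x.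
  rewrite /x; have -> : n * ((m * q + p) / (n * q)) = m + p / q by field; rewrite !gt_eqF.
  by rewrite lerDl divr_ge0// ltW.
have xk : n * (x - k) <= m.
  rewrite /x; have -> : n * ((m * q + p) / (n * q) - k) = m + (p - k * (n * q)) / q.
    by field; rewrite !gt_eqF.
  by rewrite gerDl pmulr_lle0 ?invr_gt0// subr_le0.
have l1 : - (m * ln x) <= n / t + m * ln t.
  have h1 := ln_le_subr1 (divr_gt0 t0 (mulr_gt0 x0 (mulr_gt0 t0 t0))).
  have e1 : t / (x * (t * t)) = (x * t)^-1 by field; rewrite !gt_eqF.
  have xt0 : 0 < x * t by rewrite mulr_gt0.
  have e2 : ln (x * t)^-1 = - (ln x + ln t) by rewrite lnV ?posrE// lnM ?posrE.
  rewrite e1 e2 in h1.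
  have h2 : m * (- (ln x + ln t)) <= m * (x * t)^-1 by rewrite ler_wpM2l//; lra.
  have h3 : m * (x * t)^-1 <= n / t.
    have -> : n / t = n * x * (x * t)^-1 by field; rewrite !gt_eqF.
    by rewrite ler_wpM2r// invr_ge0 ltW// mulr_gt0.
  by move: h2 h3; move: (_^-1) (n / t) (ln x) (ln t) => *; lra.
have l2 : ln x <= x * h - ln h - 1.
  by have := ln_le_subr1 (mulr_gt0 x0 h0); rewrite lnM ?posrE//; lra.
have l3 : n * ln x <= n * (x * h - ln h - 1) by rewrite ler_wpM2l// ltW.
have l4 : n * (x - k) * h <= m * h by rewrite ler_wpM2r// ltW.
have l5 : m * (h + ln t) <= m * (ln (n * q) - c - ly) by rewrite ler_wpM2l.
rewrite lE.
move: l1 l3 l4 l5.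
move: (ln x) (ln h) (ln t) (ln (n * q)) t^-1 => *; lra.
Qed.

End optimisation.

(** * The sum over I bounded through products over the layer *)

Section subset_sums.
Variables (V : finType) (u : V) (R : realType) (q pad c : R) (d : nat) (G : {set {set V}}).
Hypotheses (q_ge0 : 0 <= q) (pad1 : 1 <= pad).
Local Notation A := (lay u G d).
Local Notation X v := (deg G v (lay u G d.-1)).
Local Notation S := (isum u pad c d (fun G I v => #|I|%:R * q) G).

Lemma isum_term_le (I : {set V}) (a y : R) :
  (#|V|%:R - #|I|%:R) * ln (#|I|%:R * q + pad) + c * #|I|%:R + y <= a ->
  expR (c * #|I|%:R) * \prod_(v in ~: (rball u G d :|: I)) (#|I|%:R * q + pad) <= expR a * expR (- y).
Proof.
move=> h; have b1 : 1 <= #|I|%:R * q + pad by rewrite ler_wpDl// mulr_ge0.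
have b0 : 0 < #|I|%:R * q + pad by exact: lt_le_trans b1.
rewrite prodr_const; apply: (@le_trans _ _ (expR (c * #|I|%:R) * (#|I|%:R * q + pad) ^+ #|~: I|)).
  rewrite ler_wpM2l ?expR_ge0//; apply: ler_weXn2l => //.
  by rewrite subset_leq_card// setCS subsetUr.
rewrite -[#|I|%:R * q + pad]lnK ?posrE// -expRM_natl -!expRD ler_expR.
have -> : #|~: I|%:R = #|V|%:R - #|I|%:R :> R.
  by rewrite -(cardsC I) natrD addrC addKr.
by move: h; move: (_ * ln _) (c * _) => *; lra.
Qed.

(** Suited to an optimum at small |I|: the product of 1 + X v / y over the layer is expanded over I
    itself. *)
Lemma isum_le_high (a y : R) : 0 < y ->
  (forall m : nat, (m <= #|A|)%N ->
    (#|V|%:R - m%:R) * ln (m%:R * q + pad) + c * m%:R + m%:R * ln y <= a) ->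
  S <= expR (a + \sum_(v in A) (X v)%:R / y).
Proof.
move=> y0 h; rewrite expRD.
apply: (@le_trans _ _ (expR a * \prod_(v in A) (1 + (X v)%:R / y))); last first.
  by rewrite ler_wpM2l ?expR_ge0//; apply: prod1D_le_exp => i _; rewrite divr_ge0// ltW.
rewrite prod1D mulr_sumr; apply: ler_sum => I IA.
have := isum_term_le (h _ (subset_leq_card IA)) => h1.
have P0 : 0 <= \prod_(v in I) (X v)%:R :> R by apply: prodr_ge0.
have := ler_wpM2r P0 h1; rewrite mulrAC => h2; apply: le_trans h2 _.
rewrite -mulrA ler_wpM2l ?expR_ge0// big_split/= prodr_const mulrC.
by rewrite -mulrN expRM_natl expRN lnK.
Qed.

(** Suited to I close to the whole layer: the full product of the X v is taken out, and the
    expansion runs over the complement of I, in the reciprocals. *)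
Lemma isum_le_low (a y : R) : 0 < y -> (forall v, v \in A -> (0 < X v)%N) ->
  (forall m : nat, (m <= #|A|)%N ->
    (#|V|%:R - m%:R) * ln (m%:R * q + pad) + c * m%:R + (#|A|%:R - m%:R) * ln y <= a) ->
  S <= expR (a + \sum_(v in A) ln (X v)%:R + \sum_(v in A) (X v)%:R^-1 / y).
Proof.
move=> y0 X0 h; rewrite !expRD.
apply: (@le_trans _ _ (expR a * expR (\sum_(v in A) ln (X v)%:R)
    * \prod_(v in A) (1 + (X v)%:R^-1 / y))); last first.
  rewrite ler_wpM2l ?mulr_ge0 ?expR_ge0//; apply: prod1D_le_exp => i _.
  by rewrite divr_ge0 ?invr_ge0// ltW.
rewrite expR_sum prod1D mulr_sumr.
rewrite [leRHS](reindex_onto (fun I : {set V} => A :\: I) (fun I : {set V} => A :\: I))/=; last first.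
  by move=> I IA; rewrite setDDr setDv set0U; apply/setIidPr.
rewrite (eq_bigl (fun I : {set V} => I \subset A)); last first.
  move=> I; rewrite subsetDl/= setDDr setDv set0U.
  by apply/eqP/idP => [<-|/setIidPr]//; rewrite subsetIl.
apply: ler_sum => I IA.
have := isum_term_le (h _ (subset_leq_card IA)) => h1.
have P0 : 0 <= \prod_(v in I) (X v)%:R :> R by apply: prodr_ge0.
have := ler_wpM2r P0 h1; rewrite mulrAC => h2; apply: le_trans h2 _.
rewrite -!mulrA ler_wpM2l ?expR_ge0//.
rewrite [\prod_(i in A) _](big_setID I)/= (setIidPr IA) big_split/= prodr_const.
have -> : #|A|%:R - #|I|%:R = #|A :\: I|%:R :> R.
  by rewrite -(cardsID I A) (setIidPr IA) natrD addrC addKr.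
rewrite -mulrN expRM_natl expRN lnK ?posrE//.
have e1 : \prod_(v in A :\: I) expR (ln (X v)%:R) * \prod_(v in A :\: I) (X v)%:R^-1 = 1 :> R.
  rewrite -big_split big1//= => v; rewrite inE => /andP[_ vA].
  by rewrite lnK ?posrE ?ltr0n ?X0// divff// pnatr_eq0 -lt0n X0.
have e2 : \prod_(v in I) expR (ln (X v)%:R) = \prod_(v in I) (X v)%:R :> R.
  by apply: eq_bigr => v vI; rewrite lnK ?posrE// ltr0n X0// (fintype.subsetP IA).
rewrite e2 [y^-1 ^+ _ * _]mulrC -mulrA ler_wpM2l//.
by rewrite [_ * (_ * y^-1 ^+ _)]mulrA e1 mul1r.
Qed.

End subset_sums.

Section selection.
Variables (V : finType) (R : realType).

(** Removing the smallest value never lowers the average, so some subset of size m has at least the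
    average of A. *)
Lemma exists_large_subset (A : {set V}) (f : V -> R) (m : nat) : (m <= #|A|)%N ->
  exists I : {set V}, [/\ I \subset A, #|I| = m
    & m%:R * \sum_(v in A) f v <= #|A|%:R * \sum_(v in I) f v].
Proof.
move=> mA; rewrite -(subKn mA); have : (#|A| - m <= #|A|)%N by rewrite leq_subr.
elim: (#|A| - m)%N => [_|j IH jA]; first by exists A; rewrite subn0.
case: IH => [|I [IA cI hI]]; first exact: ltnW.
have [v0 v0I] : exists v, v \in I by apply/card_gt0P; rewrite cI subn_gt0.
case: (arg_minP f v0I) => v /= vI vmin.
have {}vI : v \in I by [].
have cI' : #|I :\ v| = (#|A| - j.+1)%N.
  by have := cardsD1 v I; rewrite vI cI add1n subnS => ->.
exists (I :\ v); split => //.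
  by apply: subset_trans IA; rewrite subsetDl.
have k1 : #|I|%:R * f v <= \sum_(w in I) f w.
  rewrite mulr_natl -sumr_const; apply: ler_sum => w; exact: vmin.
have cE : #|I| = (#|I :\ v|).+1 by rewrite (cardsD1 v I) vI.
rewrite (big_setD1 v vI)/= in hI k1; rewrite -cI -cI' in hI *.
rewrite cE -natr1 in hI k1.
move: hI k1; move: (\sum_(_ in _) f _) (\sum_(_ in _) f _) (f v) => S SA fv hI k1.
have k0 : 0 <= #|I :\ v|%:R :> R by [].
have N0 : 0 <= #|A|%:R :> R by [].
move: hI k1 k0 N0; move: (#|I :\ v|%:R) (#|A|%:R) => k N hI k1 k0 N0.
have k2 : 0 < k + 1 by lra.
rewrite -(ler_pM2l k2).
have h1 : k * ((k + 1) * SA) <= k * (N * (fv + S)) by rewrite ler_wpM2l.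
have h2 : N * (k * fv) <= N * S by rewrite ler_wpM2l//; lra.
by move: h1 h2; nra.
Qed.

(* A choice that depends only on A and f, hence measurable with respect to the
   exploration up to the layer A. *)
Definition large_subset (A : {set V}) (f : V -> R) (m : nat) : {set V} :=
  odflt set0 [pick I : {set V} | [&& I \subset A, #|I| == m
    & m%:R * \sum_(v in A) f v <= #|A|%:R * \sum_(v in I) f v]].

Lemma large_subset_sub (A : {set V}) f m : large_subset A f m \subset A.
Proof.
by rewrite /large_subset; case: pickP => [I /and3P[]|_] //=; rewrite sub0set.
Qed.

Lemma large_subsetP (A : {set V}) f m : (m <= #|A|)%N -> #|large_subset A f m| = m /\
  m%:R * \sum_(v in A) f v <= #|A|%:R * \sum_(v in large_subset A f m) f v.
Proof.
move=> mA; rewrite /large_subset; case: pickP => [I /and3P[_ /eqP]|] //= h.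
by have [I [i1 i2 i3]] := exists_large_subset f mA; have := h I; rewrite i1 i2 eqxx i3.
Qed.

End selection.

(** * Upper bound by first moments *)

Section upper_bound.
Variables (R : realType) (alpha : nat -> R) (a0 a1 : R).
Hypotheses (a0_gt0 : 0 < a0) (alpha_bd : ev (fun n => a0 <= alpha n <= a1)).
Local Notation rgm := (regime alpha a0 a1).
Local Notation q := (qn alpha).
Local Notation D := (Dn alpha).
Local Notation L := (Ln R).
Local Notation d := (dn alpha).
Local Notation mu := (mun alpha).
Local Notation lam := (lamn alpha).
Local Notation u := vertex1.
Local Notation whp := (whp q).
Local Notation evr := (ev_regime a0_gt0 alpha_bd).
Local Notation q01 := (ev_q01 a0_gt0 alpha_bd).
Local Notation X n G v := (deg G v (lay (u n) G (d n).-1)).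
Local Notation typ e G := (@typical R alpha e _ G).

(* Large enough to absorb, at a cost o(n), the parents of v outside I; for K large,
   small enough, compared with |I| q_n, not to move the optimum over |I|. *)
Definition padn (K : R) n : R := (1 - lam n) * D n / (K * L n).

Lemma ev_lnD : ev (fun n => L n / 2 <= ln (D n) <= 2 * L n).
Proof.
have h20 : (0 : R) < 1 / 2 by rewrite divr_gt0.
have H := evI (ev_pow_exp a0^-1 0 h20) (ev_pow_exp a1 0 (@ltr01 R)).
apply: ev_mono2 evr H => n rg; rewrite !expr0 !mulr1 !mul1r -/(Ln R n) => -[h1 h2].
have /andP[al au] := rg_a rg; have E0 := expR_gt0 (L n).
have al0 : 0 < alpha n by apply: lt_le_trans al.
apply/andP; split.
  rewrite -[leLHS]expRK ler_ln ?posrE ?expR_gt0 ?(rgD0 rg)// (rg_D rg).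
  apply: (@le_trans _ _ (a0 * expR (L n))); last by rewrite ler_wpM2r ?(ltW E0).
  have -> : expR (L n) = expR (2^-1 * L n + L n / 2) by congr expR; lra.
  rewrite expRD mulrA ler_peMl ?expR_ge0//.
  by move: h1; rewrite -[a0^-1]div1r ler_pdivrMr// mulrC.
rewrite -[leRHS]expRK ler_ln ?posrE ?expR_gt0 ?(rgD0 rg)// (rg_D rg).
rewrite mulr2n mulrDl mul1r expRD ler_wpM2r ?expR_ge0//.
exact: le_trans au h2.
Qed.

(** From D ^ (d - 1) <= n, the depth d is at most of order log n / L. This pays for the vertices
    outside the component, which [treeZ_err] charges at depth d + 1. *)
Lemma ev_dL : ev (fun n => L n * (d n).+1%:R <= 4 * expR (L n)).
Proof.
apply: ev_mono2 evr ev_lnD => n rg /andP[lD _].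
have L0 := rgL0 rg; have L1 := rg_L rg; have D0 := rgD0 rg; have n0 := rgn0 rg.
have h : ((d n).-1)%:R * ln (D n) <= expR (L n).
  rewrite -(rg_ln rg) mulr_natl -lnXn// ler_ln ?posrE ?exprn_gt0//.
  apply: le_trans (rg_Dpred_le rg) _; rewrite ler_pdivrMr ?exprn_gt0//.
  by rewrite ler_peMr ?(ltW n0)// exprn_ege1.
have h2 : ((d n).-1)%:R * (L n / 2) <= ((d n).-1)%:R * ln (D n) by rewrite ler_wpM2l.
have h3 := expR_ge1Dx (L n).
have -> : (d n).+1%:R = ((d n).-1)%:R + 2 :> R.
  by rewrite -{1}(prednK (rgd0 rg)) -[2]/(2%:R) -natrD addn2.
move: h h2 h3 L0 L1 {lD rg D0 n0}; move: (L n) ((d n).-1)%:R (ln _) (expR _) => l k x y *; nra.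
Qed.

Lemma rg_mu_s n : rgm n -> L n ^+ 2 <= D n -> mu n * L n ^+ 2 <= 2 * ((1 - lam n) * D n).
Proof.
move=> rg LD; have h := rg_lamC_half rg; have m0 := rg_mu_gt0 rg; have L0 := rgL0 rg.
have D0 := rgD0 rg.
have h2 : mu n * L n ^+ 2 <= D n by rewrite -ler_pdivlMr ?exprn_gt0// (rg_mu2 rg).
have [m1|m1] := leP 1 (mu n).
  apply: le_trans h2 _; rewrite mulrA ler_peMl ?(ltW D0)//.
  by move: h; rewrite (min_idPl m1); lra.
apply: (@le_trans _ _ (mu n * D n)); first by rewrite ler_wpM2l ?(ltW m0).
rewrite mulrA ler_wpM2r ?(ltW D0)//; move: h; rewrite (min_idPr (ltW m1)); lra.
Qed.

Lemma ev_pad (K : R) : 0 < K -> ev (fun n => 1 <= padn K n).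
Proof.
move=> K0; apply: ev_mono2 evr (ev_D a0_gt0 alpha_bd (2 * K) 3) => n rg h.
have L0 := rgL0 rg; have lC := rg_lamC rg; have D0 := rgD0 rg.
rewrite /padn ler_pdivlMr ?mulr_gt0// mul1r.
apply: (@le_trans _ _ ((2 * L n ^+ 2)^-1 * D n)); last by rewrite ler_wpM2r ?(ltW D0).
rewrite [leRHS]mulrC ler_pdivlMr ?mulr_gt0 ?exprn_gt0//; apply: le_trans h.
by rewrite le_eqVlt; apply/orP; left; apply/eqP; ring.
Qed.

Lemma ev_sumX_pad (K eps : R) : 0 < K -> 0 < eps ->
  ev (fun n => ln (L n) * (n%:R * mu n) / padn K n <= eps * n%:R).
Proof.
move=> K0 e0; have H := evI (ev_D a0_gt0 alpha_bd 1 2) (evI (ev_lnL (2 * K / eps)) (ev_lnL_ge (0 : R))).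
apply: ev_mono2 evr H => n rg [LD [h l0]]; rewrite mul1r in LD.
have L0 := rgL0 rg; have D0 := rgD0 rg; have n0 := rgn0 rg; have m0 := rg_mu_gt0 rg.
have /andP[_ l1] := rg_lam01 rg.
have p0 : 0 < padn K n.
  by apply: divr_gt0; apply: mulr_gt0 => //; rewrite subr_gt0.
rewrite ler_pdivrMr// /padn.
have h1 := rg_mu_s rg LD.
have -> : eps * n%:R * ((1 - lam n) * D n / (K * L n)) = n%:R * ((1 - lam n) * D n) * (eps / (K * L n)).
  by move: (D n) => y; field; rewrite !gt_eqF.
have -> : ln (L n) * (n%:R * mu n) = n%:R * (mu n * L n ^+ 2) * (ln (L n) / L n ^+ 2).
  by move: (mu n) => y; field; rewrite gt_eqF.
apply: (@le_trans _ _ (n%:R * (2 * ((1 - lam n) * D n)) * (ln (L n) / L n ^+ 2))).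
  by rewrite ler_wpM2r ?divr_ge0 ?exprn_ge0 ?(ltW L0)// ler_wpM2l ?(ltW n0).
have -> : n%:R * (2 * ((1 - lam n) * D n)) * (ln (L n) / L n ^+ 2)
    = n%:R * ((1 - lam n) * D n) * (2 * ln (L n) / L n ^+ 2).
  by move: (D n) => y; field; rewrite gt_eqF.
have x0 : 0 <= n%:R * ((1 - lam n) * D n).
  by apply: mulr_ge0; [exact: ltW|apply: mulr_ge0; [rewrite subr_ge0 ltW|exact: ltW]].
move: x0; move: (n%:R * _) => x x0; rewrite ler_wpM2l//.
rewrite ler_pdivrMr ?exprn_gt0//.
have -> : eps / (K * L n) * L n ^+ 2 = eps * L n / K by field; rewrite !gt_eqF.
rewrite ler_pdivlMr//; move: h; rewrite -/(Ln R n) mulrAC ler_pdivrMr//; lra.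
Qed.

Lemma ev_deg_pad (beta K eps : R) : 0 < beta -> 0 < K -> 0 < eps ->
  ev (fun n => expR (- (beta * L n)) * (L n * (n%:R * D n)) / padn K n <= eps * n%:R).
Proof.
move=> b0 K0 e0; apply: ev_mono2 evr (ev_pow_exp (2 * K / eps) 4 b0) => n rg.
rewrite -/(Ln R n) => h.
have L0 := rgL0 rg; have D0 := rgD0 rg; have n0 := rgn0 rg; have lC := rg_lamC rg.
have /andP[_ l1] := rg_lam01 rg.
have p0 : 0 < padn K n.
  by apply: divr_gt0; apply: mulr_gt0 => //; rewrite subr_gt0.
have s0 : 0 < 1 - lam n by rewrite subr_gt0.
rewrite ler_pdivrMr// /padn.
have -> : eps * n%:R * ((1 - lam n) * D n / (K * L n)) = (n%:R * D n) * (eps * (1 - lam n) / (K * L n)).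
  by move: (D n) => y; field; rewrite !gt_eqF.
have -> : expR (- (beta * L n)) * (L n * (n%:R * D n)) = (n%:R * D n) * (expR (- (beta * L n)) * L n).
  by move: (D n) => y; ring.
have x0 : 0 <= n%:R * D n by apply: mulr_ge0; exact: ltW.
move: x0; move: (n%:R * _) => x x0; rewrite ler_wpM2l//.
rewrite ler_pdivlMr ?mulr_gt0// expRN.
apply: (@le_trans _ _ (eps * (2 * L n ^+ 2)^-1)); last by rewrite ler_wpM2l ?(ltW e0).
rewrite ler_pdivlMr ?mulr_gt0 ?exprn_gt0//.
have -> : (expR (beta * L n))^-1 * L n * (K * L n) * (2 * L n ^+ 2) = 2 * K * L n ^+ 4 / expR (beta * L n).
  by ring.
rewrite ler_pdivrMr ?expR_gt0//; move: h; rewrite mulrAC ler_pdivrMr// [expR _ * _]mulrC.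
by [].
Qed.

Lemma ev_deg_exp (eps : R) : 0 < eps ->
  ev (fun n => expR (- (2 * L n)) * (L n * (n%:R * D n)) <= eps * n%:R).
Proof.
move=> e0; apply: ev_mono2 evr (ev_pow_exp (a1 / eps) 1 (@ltr01 R)) => n rg.
rewrite -/(Ln R n) mul1r expr1 => h.
have L0 := rgL0 rg; have n0 := rgn0 rg; have /andP[_ au] := rg_a rg.
rewrite (rg_D rg) mulr2n mulrDl mul1r opprD expRD expRN.
have E0 := expR_gt0 (L n).
have -> : (expR (L n))^-1 * (expR (L n))^-1 * (L n * (n%:R * (alpha n * expR (L n)))) =
   n%:R * (L n * alpha n / expR (L n)) by field; rewrite gt_eqF.
rewrite [leRHS]mulrC ler_wpM2l ?(ltW n0)// ler_pdivrMr//.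
apply: (@le_trans _ _ (L n * a1)); first by rewrite ler_wpM2l ?(ltW L0).
by move: h; rewrite mulrAC ler_pdivrMr// mulrC [_ * eps]mulrC.
Qed.

Lemma treeZ_gt0 (e beta : R) n (G : graph n) : rgm n -> 0 <= beta ->
  typ e G -> 0 < treeZ (u n) G (beta * L n).
Proof.
move=> rg b0 ty; have c0 : 0 <= beta * L n by rewrite mulr_ge0// ltW// (rgL0 rg).
apply: lt_le_trans (treeZ_lower c0 (rgd0 rg) (subxx _)).
apply: mulr_gt0; last exact: expR_gt0.
apply: mulr_gt0; apply: prodr_gt0 => v hv; rewrite ltr0n ?leq_max//.
exact: ty_X ty _ hv.
Qed.

(** The tangent of ln at exp l. With l := 2 L, the vertices of the ball contribute about 2 L each,
    plus exp (- 2 L) times the total degree; both sums are o(n). *)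
Lemma lnp_le_exp (l : R) (k : nat) : lnp R k <= l + expR (- l) * k%:R + expR (- l).
Proof.
have m0 : 0 < (maxn 1 k)%:R :> R by rewrite ltr0n leq_max.
have := ln_le_subr1 (mulr_gt0 (expR_gt0 (- l)) m0).
rewrite lnM ?posrE ?expR_gt0// expRK /lnp => h.
have : expR (- l) * (maxn 1 k)%:R <= expR (- l) * (k%:R + 1).
  rewrite ler_wpM2l ?expR_ge0// natr1 ler_nat geq_max ltnS leq0n/=; exact: leqnSn.
move: h; rewrite mulrDr mulr1; move: (ln _) (expR _) (expR _ * _) (expR _ * k%:R) => *; lra.
Qed.

Lemma ln_le_expM (x y a b : R) : 0 < x -> 0 < y -> x <= expR a * (expR b * y) ->
  ln x <= a + (b + ln y).
Proof.
move=> x0 y0 h; have -> : a + (b + ln y) = ln (expR a * (expR b * y)).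
  by rewrite !lnM ?posrE ?mulr_gt0 ?expR_gt0// !expRK.
by rewrite ler_ln ?posrE ?mulr_gt0 ?expR_gt0.
Qed.

Lemma whp_upper (beta K eps : R) : 0 < beta -> 0 < K -> 0 < eps ->
  whp (fun n G => ln (treeZ (u n) G (beta * L n)) <=
    eps * n%:R - beta * L n * (d n).+1%:R * n%:R
    + ln (isum (u n) (padn K n) (beta * L n) (d n) (fun G I v => #|I|%:R * q n) G)).
Proof.
(* The errors of a typical graph add up to (5 beta + 3) e n, at most eps n / 2; four terms eps n / 8
   make up the rest. *)
move=> b0 K0 e0; pose e := eps / (16 * (beta + 1)).
have b1 : 0 < beta + 1 by lra.
have e'0 : 0 < e by rewrite divr_gt0// mulr_gt0.
have e8 : 0 < eps / 8 by rewrite divr_gt0.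
have pad0 : ev (fun n => 0 < padn K n).
  by apply: ev_mono (ev_pad K0) => n; exact: lt_le_trans.
have H := whpI q01 (whp_typical a0_gt0 alpha_bd e'0)
  (whp_fresh a0_gt0 alpha_bd (fun n => beta * L n) e8 pad0).
apply: (whp_mono q01) H.
have H1 := evI (ev_pad K0) (evI ev_dL (evI (ev_sumX_pad K0 e8) (evI (ev_deg_pad b0 K0 e8) (evI (ev_deg_exp e8) (evL (1 : R)))))).
apply: ev_mono2 evr H1 => n rg [p1 [dL [sX [dp [de _]]]]] G GP [ty fr].
have L0 := rgL0 rg; have n0 := rgn0 rg; have d0 := rgd0 rg; have q0 := rgq0 rg.
have c0 : 0 <= beta * L n by rewrite mulr_ge0// ltW.
have p0 : 0 < padn K n by exact: lt_le_trans p1.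
have Z0 := treeZ_gt0 rg (ltW b0) ty.
have := treeZ_upper (u n) GP c0 d0 p1.
rewrite -/(isum (u n) (padn K n) (beta * L n) (d n) (fun G I v => (deg G v I)%:R) G).
set S := isum _ _ _ _ (fun G I v => #|I|%:R * q n) G.
have S0 : 0 < S.
  rewrite /S /isum (bigD1 set0) ?sub0set//= ltr_pwDl ?sumr_ge0//.
    rewrite big_set0 mulr1 mulr_gt0 ?expR_gt0// prodr_gt0// => v _.
    by rewrite cards0 mul0r add0r.
  move=> I _; rewrite !mulr_ge0 ?expR_ge0 ?prodr_ge0// => v _.
  by apply: addr_ge0; [apply: mulr_ge0 => //; exact: ltW q0|exact: ltW].
move=> up.
have prodE : \prod_(v in rball (u n) G (d n)) (maxn 1 (deg G v setT))%:R
    = expR (\sum_(v in rball (u n) G (d n)) lnp R (deg G v setT)).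
  rewrite expR_sum; apply: eq_bigr => v _.
  by rewrite lnK// posrE ltr0n leq_max.
rewrite prodE -expRD in up.
have {}up : treeZ (u n) G (beta * L n) <= expR (treeZ_err (u n) G (beta * L n) (d n) (padn K n)
    - beta * L n * (d n).+1%:R * #|vertex n|%:R
    + \sum_(v in rball (u n) G (d n)) lnp R (deg G v setT)) * (expR (eps / 8 * n%:R) * S).
  by apply: le_trans up _; rewrite ler_wpM2l ?expR_ge0.
have {}up : ln (treeZ (u n) G (beta * L n)) <= (treeZ_err (u n) G (beta * L n) (d n) (padn K n)
    - beta * L n * (d n).+1%:R * #|vertex n|%:R
    + \sum_(v in rball (u n) G (d n)) lnp R (deg G v setT)) + (eps / 8 * n%:R + ln S).
  exact: ln_le_expM.
apply: le_trans up _; rewrite card_vertex ?(rg_n rg)//.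
have cB : #|rball (u n) G (d n)|%:R * L n <= e * n%:R.
  apply: le_trans (ty_near ty); rewrite ler_wpM2r ?(ltW L0)// ler_nat rball_pred//.
  exact: card_ball_near.
have sB : \sum_(v in rball (u n) G (d n)) lnp R (deg G v setT) <= 3 * (e * n%:R) + eps / 8 * n%:R.
  apply: (@le_trans _ _ (\sum_(v in rball (u n) G (d n)) (2 * L n + expR (- (2 * L n)) * (deg G v setT)%:R + expR (- (2 * L n))))).
    by apply: ler_sum => v _; exact: lnp_le_exp.
  rewrite !big_split/= -[\sum_(i in _) expR _ * _]mulr_sumr !sumr_const.
  have x1 : expR (- (2 * L n)) <= L n.
    apply: le_trans (rg_L rg); rewrite -expR0 ler_expR oppr_le0 mulr_ge0// ltW//.
  have x2 : expR (- (2 * L n)) * (\sum_(v in rball (u n) G (d n)) (deg G v setT)%:R) <= eps / 8 * n%:R.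
    apply: le_trans de; rewrite ler_wpM2l ?expR_ge0//; apply: le_trans (ty_deg ty).
    rewrite [leRHS](bigID (mem (rball (u n) G (d n))))/= lerDl; exact: sumr_ge0.
  have x3 : expR (- (2 * L n)) *+ #|rball (u n) G (d n)| <= #|rball (u n) G (d n)|%:R * L n.
    by rewrite -[expR _ *+ _]mulr_natl ler_wpM2l.
  rewrite -[2 * L n *+ _]mulr_natl.
  move: x2 x3 cB {x1 sX dp de p1 p0}; move: (n%:R) (L n) #|_|%:R (expR _ *+ _) (expR _ * _) => *; lra.
have er : treeZ_err (u n) G (beta * L n) (d n) (padn K n) <= beta * (5 * (e * n%:R)) + 2 * (eps / 8 * n%:R).
  rewrite /treeZ_err.
  have y1 : beta * L n * (near_excess (u n) G (d n))%:R <= beta * (e * n%:R).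
    by rewrite -mulrA ler_wpM2l ?(ltW b0)// mulrC (ty_near ty).
  have y2 : beta * L n * (d n).+1%:R * #|~: component G (u n)|%:R <= beta * (4 * (e * n%:R)).
    have -> : beta * L n * (d n).+1%:R * #|~: component G (u n)|%:R =
        beta * (L n * (d n).+1%:R * #|~: component G (u n)|%:R) by rewrite !mulrA.
    rewrite ler_wpM2l ?(ltW b0)//.
    apply: (@le_trans _ _ (4 * expR (L n) * #|~: component G (u n)|%:R)); first by rewrite ler_wpM2r.
    by rewrite -mulrA ler_wpM2l// mulrC (ty_out ty).
  have y3 : (\sum_(v in ~: rball (u n) G (d n)) ((X n G v)%:R + expR (- (beta * L n)) * (deg G v setT)%:R)) / padn K n
      <= 2 * (eps / 8 * n%:R).
    rewrite big_split/= mulrDl mulr2n [leRHS]mulrDl mul1r; apply: lerD.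
      by apply: le_trans sX; rewrite ler_wpM2r ?invr_ge0 ?(ltW p0)//; exact: ty_sumX ty.
    apply: le_trans dp; rewrite ler_wpM2r ?invr_ge0 ?(ltW p0)// -mulr_sumr ler_wpM2l ?expR_ge0//.
    apply: le_trans (ty_deg ty).
    rewrite [leRHS](bigID (mem (~: rball (u n) G (d n))))/= lerDl; exact: sumr_ge0.
  by apply: le_trans (lerD (lerD y1 y2) y3) _; lra.
have eE : 16 * ((beta + 1) * (e * n%:R)) = eps * n%:R.
  by rewrite /e; field; rewrite gt_eqF.
have en : 0 <= e * n%:R by rewrite mulr_ge0// ltW.
have ben : 0 <= beta * (e * n%:R) by rewrite mulr_ge0// ltW.
move: er sB eE en ben {sX dp de dL cB p1 p0 Z0 S0 fr ty GP rg prodE pad0}.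
move: (treeZ_err _ _ _ _ _) (\sum_(_ in _) _) (ln S) (beta * L n * _ * n%:R) => E1 E2 E3 E4.
move: (n%:R) (e) => *; lra.
Qed.

End upper_bound.

(** * Lower bound from a single set I *)

Section lower_bound.
Variables (R : realType) (alpha : nat -> R) (a0 a1 : R).
Hypotheses (a0_gt0 : 0 < a0) (alpha_bd : ev (fun n => a0 <= alpha n <= a1)).
Local Notation rgm := (regime alpha a0 a1).
Local Notation q := (qn alpha).
Local Notation D := (Dn alpha).
Local Notation L := (Ln R).
Local Notation d := (dn alpha).
Local Notation mu := (mun alpha).
Local Notation lam := (lamn alpha).
Local Notation u := vertex1.
Local Notation whp := (whp q).
Local Notation evr := (ev_regime a0_gt0 alpha_bd).
Local Notation q01 := (ev_q01 a0_gt0 alpha_bd).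
Local Notation X n G v := (deg G v (lay (u n) G (d n).-1)).
Local Notation typ e G := (@typical R alpha e _ G).

Lemma sum_le_sub (V : finType) (P Q : {set V}) (f : V -> R) : P \subset Q -> (forall v, 0 <= f v) ->
  \sum_(v in P) f v <= \sum_(v in Q) f v.
Proof.
move=> PQ f0; rewrite big_mkcond [leRHS]big_mkcond; apply: ler_sum => v _.
case vP: (v \in P); first by rewrite (fintype.subsetP PQ).
by case: ifP.
Qed.

(** The size n / L ^ 3 gives |I| q_n >= D / L ^ 3 >= L, so that the degrees into I concentrate. It
    is asked of I through an implication inside the event because I is random. *)
Lemma whp_lower (beta eps : R) (Is : forall n, graph n -> {set vertex n}) :
  0 < beta -> 0 < eps ->
  (forall n (G : graph n), Is n G \subset lay (u n) G (d n)) ->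
  (forall n (G : graph n), Is n (hist (u n) G (d n)) = Is n G) ->
  whp (fun n G => n%:R / L n ^+ 3 <= #|Is n G|%:R ->
    \sum_(v in Is n G) ln (X n G v)%:R + (n%:R - #|Is n G|%:R) * ln (#|Is n G|%:R * q n)
    + beta * L n * #|Is n G|%:R - beta * L n * (d n).+1%:R * n%:R - eps * n%:R
    <= ln (treeZ (u n) G (beta * L n))).
Proof.
move=> b0 e0 Isub Ihist; pose e := eps / (5 * (beta + 1)).
have b1 : 0 < beta + 1 by lra.
have e'0 : 0 < e by rewrite divr_gt0// mulr_gt0.
have H := whpI q01 (whp_typical a0_gt0 alpha_bd e'0) (whp_defect a0_gt0 alpha_bd e'0 Isub Ihist).
apply: (whp_mono q01) H.
have H1 := evI (ev_lnD a0_gt0 alpha_bd) (evI (ev_D a0_gt0 alpha_bd 1 4) (ev_lnL (12 : R))).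
apply: ev_mono2 evr H1 => n rg [/andP[lD1 lD2] [LD lL]] G GP [ty df] mL.
have L0 := rgL0 rg; have L1 := rg_L rg; have n0 := rgn0 rg; have d0 := rgd0 rg; have q0 := rgq0 rg.
have c0 : 0 <= beta * L n by rewrite mulr_ge0// ltW.
have D0 := rgD0 rg; rewrite mul1r in LD; rewrite -/(Ln R n) in lL.
set I := Is n G in df mL *; have IA : I \subset lay (u n) G (d n) := Isub n G.
have mD : D n / L n ^+ 3 <= #|I|%:R * q n.
  have -> : D n / L n ^+ 3 = n%:R / L n ^+ 3 * q n by rewrite /Dn mulrAC.
  by rewrite ler_wpM2r ?(ltW q0).
have M0 : 0 < #|I|%:R * q n by apply: lt_le_trans mD; rewrite divr_gt0 ?exprn_gt0.
have ML : L n <= #|I|%:R * q n.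
  apply: le_trans mD; rewrite ler_pdivlMr ?exprn_gt0//; rewrite -exprS.
have lM1 : L n / 4 <= ln (#|I|%:R * q n).
  have : ln (D n / L n ^+ 3) <= ln (#|I|%:R * q n).
    by rewrite ler_ln ?posrE// divr_gt0 ?exprn_gt0.
  rewrite ln_div ?posrE ?exprn_gt0// lnXn// -[ln (L n) *+ 3]mulr_natl.
  move: lD1 lL; move: (L n) (ln _) (ln _) (ln _) => x y z w *; lra.
have lM2 : ln (#|I|%:R * q n) <= 2 * L n.
  apply: le_trans lD2; rewrite ler_ln ?posrE// /Dn ler_wpM2r ?(ltW q0)//.
  by rewrite ler_nat -[leqRHS](card_vertex (rg_n rg)) max_card.
rewrite ML mul1r in df.
set J := ~: (rball (u n) G (d n) :|: I) in df *.
have low := treeZ_lower c0 d0 IA; rewrite -/J in low.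
have P1 : \prod_(v in I) (X n G v)%:R = expR (\sum_(v in I) ln (X n G v)%:R) :> R.
  rewrite expR_sum; apply: eq_bigr => v vI; rewrite lnK// posrE ltr0n.
  exact: ty_X ty _ (fintype.subsetP IA _ vI).
have P2 : \prod_(v in J) (maxn 1 (deg G v I))%:R = expR (\sum_(v in J) lnp R (deg G v I)).
  by rewrite expR_sum; apply: eq_bigr => v _; rewrite lnK// posrE ltr0n leq_max.
rewrite P1 P2 -!expRD in low.
have {}low := low; have Z0 : 0 < treeZ (u n) G (beta * L n).
  by apply: lt_le_trans low; exact: expR_gt0.
rewrite -ler_ln ?posrE ?expR_gt0// expRK in low.
apply: le_trans low.
have sJ : #|J|%:R * ln (#|I|%:R * q n) - e * n%:R <= \sum_(v in J) lnp R (deg G v I).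
  rewrite mulr_natl -sumr_const lerBlDr; apply: (le_trans _ (lerD (lexx _) df)).
  rewrite -big_split/=; apply: ler_sum => v _; rewrite -lerBlDl le_max lexx orbT//.
have cJ : n%:R - #|I|%:R - #|rball (u n) G (d n)|%:R <= #|J|%:R :> R.
  have : (n <= #|J| + (#|rball (u n) G (d n)| + #|I|))%N.
    rewrite -{1}(card_vertex (rg_n rg)) -(cardsC (rball (u n) G (d n) :|: I)) addnC leq_add2l.
    by rewrite cardsU leq_subr.
  rewrite -(ler_nat R) !natrD; lra.
have cB : #|rball (u n) G (d n)|%:R * L n <= e * n%:R.
  apply: le_trans (ty_near ty); rewrite ler_wpM2r ?(ltW L0)// ler_nat rball_pred//.
  exact: card_ball_near.
(* A vertex with no neighbour in I has the full defect ln (|I| q_n), at least L / 4, so the total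
   defect controls the number of such vertices. *)
have bd : (bad (u n) G (d n) I)%:R * L n <= 4 * (e * n%:R).
  have : (bad (u n) G (d n) I)%:R * ln (#|I|%:R * q n) <= e * n%:R.
    apply: le_trans df; rewrite mulr_natl -sumr_const.
    apply: (@le_trans _ _ (\sum_(v in [set v in J | deg G v I == 0%N])
      Num.max 0 (ln (#|I|%:R * q n) - lnp R (deg G v I)))).
      apply: ler_sum => v; rewrite inE => /andP[_ /eqP ->].
      by rewrite /lnp maxn0 ln1 subr0 le_max lexx orbT.
    apply: sum_le_sub => [|v]; last by rewrite le_max lexx.
    by apply/fintype.subsetP => v; rewrite inE => /andP[].
  have : (bad (u n) G (d n) I)%:R * (L n / 4) <= (bad (u n) G (d n) I)%:R * ln (#|I|%:R * q n).
    by rewrite ler_wpM2l.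
  move: (ln _) (bad _ _ _ _)%:R => *; lra.
rewrite 2!natrD natrM card_vertex ?(rg_n rg)//.
have eE : 5 * ((beta + 1) * (e * n%:R)) = eps * n%:R.
  by rewrite /e; field; rewrite gt_eqF.
have en : 0 <= e * n%:R by rewrite mulr_ge0// ltW.
have h1 : (n%:R - #|I|%:R - #|rball (u n) G (d n)|%:R) * ln (#|I|%:R * q n) <= #|J|%:R * ln (#|I|%:R * q n).
  by rewrite ler_wpM2r//; apply: le_trans lM1; rewrite divr_ge0// ltW.
have h2 : #|rball (u n) G (d n)|%:R * ln (#|I|%:R * q n) <= #|rball (u n) G (d n)|%:R * (2 * L n).
  by rewrite ler_wpM2l.
have h3 : beta * ((bad (u n) G (d n) I)%:R * L n) <= beta * (4 * (e * n%:R)) by rewrite ler_wpM2l ?(ltW b0).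
have h4 : beta * ((far (u n) G (d n))%:R * L n) <= beta * (e * n%:R).
  by rewrite ler_wpM2l ?(ltW b0)//; exact: ty_far ty.
move: sJ cB eE en h1 h2 h3 h4 {df bd cJ lM1 lM2 mL mD M0 ML LD lL lD1 lD2 P1 P2 ty Z0 GP rg}.
move: (\sum_(_ in I) _) (\sum_(_ in J) _) (ln _) => S1 S2 M.
move: (n%:R) #|I|%:R #|J|%:R #|rball _ _ _|%:R (bad _ _ _ _)%:R (far _ _ _)%:R (d n).+1%:R (L n) (e) => *; lra.
Qed.

End lower_bound.

(** * The two phases *)

Section phase_common.
Variables (R : realType) (alpha : nat -> R) (a0 a1 : R).
Hypotheses (a0_gt0 : 0 < a0) (alpha_bd : ev (fun n => a0 <= alpha n <= a1)).
Local Notation rgm := (regime alpha a0 a1).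
Local Notation q := (qn alpha).
Local Notation D := (Dn alpha).
Local Notation L := (Ln R).
Local Notation d := (dn alpha).
Local Notation mu := (mun alpha).
Local Notation lam := (lamn alpha).
Local Notation u := vertex1.
Local Notation whp := (whp q).
Local Notation evr := (ev_regime a0_gt0 alpha_bd).
Local Notation q01 := (ev_q01 a0_gt0 alpha_bd).
Local Notation X n G v := (deg G v (lay (u n) G (d n).-1)).
Local Notation typ e G := (@typical R alpha e _ G).

Lemma ln_close (x y t : R) : 0 < x -> 0 <= t <= 1 / 2 -> `|y - x| <= t * x -> `|ln y - ln x| <= 2 * t.
Proof.
move=> x0 /andP[t0 t1]; rewrite ler_norml => /andP[h1 h2].
have tx : t * x <= 1 / 2 * x by rewrite ler_wpM2r// ltW.
have y0 : 0 < y by lra.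
have k1 := ln_le_subr1 (divr_gt0 y0 x0); have k2 := ln_le_subr1 (divr_gt0 x0 y0).
rewrite ln_div ?posrE// in k1; rewrite ln_div ?posrE// in k2.
have b1 : y / x <= 1 + t by rewrite ler_pdivrMr//; lra.
have b2 : x / y <= 1 + 2 * t.
  rewrite ler_pdivrMr//; have : (1 + 2 * t) * ((1 - t) * x) <= (1 + 2 * t) * y.
    by rewrite ler_wpM2l//; lra.
  have : 0 <= t * x * (1 - 2 * t) by apply: mulr_ge0; [apply: mulr_ge0; [|exact: ltW]|]; lra.
  by lra.
rewrite ler_norml; apply/andP; split; lra.
Qed.

(** Delta ln D = ln mu exactly, and ln D = L + ln alpha is within a bounded distance of L; as
    |Delta| <= 1, this gives Delta L = ln mu + O(1). *)
Lemma ev_Delta : exists C : R, ev (fun n =>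
  [/\ `|Delta alpha n * L n - ln (mu n)| <= C, `|ln (D n) - L n| <= C & `|Delta alpha n| <= 1]).
Proof.
exists (`|ln a0| + `|ln a1|).
apply: ev_mono2 evr (evI (ev_D a0_gt0 alpha_bd 1 2) (ev_lnD a0_gt0 alpha_bd)) => n rg [LD /andP[lD _]].
have L0 := rgL0 rg; have L1 := rg_L rg; have D0 := rgD0 rg; have m0 := rg_mu_gt0 rg.
have lD0 : 0 < ln (D n) by apply: lt_le_trans lD; rewrite divr_gt0.
rewrite mul1r in LD.
have /andP[al au] := rg_a rg; have al0 : 0 < alpha n by apply: lt_le_trans al.
have h2 : `|ln (D n) - L n| <= `|ln a0| + `|ln a1|.
  rewrite (rg_D rg) lnM ?posrE ?expR_gt0// expRK addrK.
  have x1 : ln a0 <= ln (alpha n) by rewrite ler_ln ?posrE.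
  have x2 : ln (alpha n) <= ln a1 by rewrite ler_ln ?posrE// (lt_le_trans al0).
  have := ler_norm (ln a1); have := ler_norm (- ln a0); rewrite normrN.
  have := normr_ge0 (ln a0); have := normr_ge0 (ln a1).
  rewrite ler_norml; move: x1 x2 `|ln a0| `|ln a1|; move: (ln a0) (ln a1) (ln _) => *.
  by apply/andP; split; lra.
have h3 : `|Delta alpha n| <= 1.
  rewrite -(ler_pM2r lD0) mul1r -{1}(gtr0_norm lD0) -normrM (rg_Delta rg).
  rewrite ler_norml; apply/andP; split; last by rewrite ler_ln ?posrE// (rg_mu_le rg).
  rewrite -lnV ?posrE// ler_ln ?posrE ?invr_gt0//; apply: le_trans (rg_mu1 rg).
  by rewrite lef_pV2 ?posrE ?exprn_gt0.
split => //.
rewrite -(rg_Delta rg).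
have -> : Delta alpha n * L n - Delta alpha n * ln (D n) = - (Delta alpha n * (ln (D n) - L n)).
  by move: (Delta _ _) => x; ring.
rewrite normrN [`|Delta _ _ * _|]normrM; apply: le_trans h2.
by rewrite ler_piMl.
Qed.

Lemma ty_N_bounds (e : R) n (G : graph n) : rgm n -> e <= 1 / 2 -> typ e G ->
  [/\ n%:R * (1 - lam n) / 2 <= #|lay (u n) G (d n)|%:R,
      #|lay (u n) G (d n)|%:R <= 2 * (n%:R * (1 - lam n)),
      0 < #|lay (u n) G (d n)|%:R :> R & #|lay (u n) G (d n)|%:R <= n%:R :> R].
Proof.
move=> rg e1 ty; have L0 := rgL0 rg; have L1 := rg_L rg; have n0 := rgn0 rg.
have /andP[_ l1] := rg_lam01 rg.
have s0 : 0 < n%:R * (1 - lam n) by rewrite mulr_gt0// subr_gt0.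
have eL : e / L n <= 1 / 2 by rewrite ler_pdivrMr//; apply: le_trans e1 _; rewrite ler_peMr.
have := ty_N ty; have := ler_wpM2r (ltW s0) eL.
move: (n%:R * (1 - lam n)) s0 (_ / L n) => x x0 t h1.
rewrite ler_norml => /andP[h2 h3].
split; [lra|lra|lra|].
by rewrite ler_nat -[leqRHS](card_vertex (rg_n rg)) max_card.
Qed.

Lemma N_dstarE n (G : graph n) : rgm n -> N_dstar alpha G = #|lay (u n) G (d n)|.
Proof. by move=> rg; rewrite /N_dstar (rg_d rg) layer_sizeE. Qed.

Lemma tPhi_max_bounds (beta b : R) n (G : graph n) (m0 : nat) :
  (1 <= m0 <= N_dstar alpha G)%N ->
  (forall m, (1 <= m <= N_dstar alpha G)%N -> tPhi alpha beta G m <= b) ->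
  tPhi alpha beta G m0 <= tPhi_max alpha beta G <= b.
Proof.
move=> /andP[m1 m2] h; apply/andP; split.
  apply: le_bigmax_seq => //; rewrite mem_index_iota m1 ltnS m2//.
rewrite /tPhi_max big_nat; apply: bigmax_le.
  by apply: h; rewrite (leq_trans m1 m2).
by move=> i; rewrite ltnS; exact: h.
Qed.

Lemma kappaE n : rgm n -> L n / kappa alpha n = (1 - lam n)^-1.
Proof.
move=> rg; have L0 := rgL0 rg; have /andP[_ l1] := rg_lam01 rg.
rewrite /kappa -/(lamn alpha n) -/(Ln R n).
by field; rewrite !gt_eqF// subr_gt0.
Qed.

End phase_common.

(** * Low temperature: the optimum at the whole layer *)

Section low_temperature.
Variables (R : realType) (alpha : nat -> R) (a0 a1 : R).
Hypotheses (a0_gt0 : 0 < a0) (alpha_bd : ev (fun n => a0 <= alpha n <= a1)).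
Local Notation rgm := (regime alpha a0 a1).
Local Notation q := (qn alpha).
Local Notation D := (Dn alpha).
Local Notation L := (Ln R).
Local Notation d := (dn alpha).
Local Notation mu := (mun alpha).
Local Notation lam := (lamn alpha).
Local Notation u := vertex1.
Local Notation whp := (whp q).
Local Notation evr := (ev_regime a0_gt0 alpha_bd).
Local Notation q01 := (ev_q01 a0_gt0 alpha_bd).
Local Notation X n G v := (deg G v (lay (u n) G (d n).-1)).
Local Notation typ e G := (@typical R alpha e _ G).

Variable beta : R.
Hypothesis beta_gt0 : 0 < beta.
Local Notation bc := (beta_crit alpha).
Local Notation N n G := (#|lay (u n) G (d n)|%:R : R).
(** The form in which the low temperature phase is used: the positive part of minus the slope at m =
    N_d, times the proportion 1 - lambda of vertices in the layer, is o(1). The term 3 ln L covers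
    the logarithm of [ylow] and the bounded errors, and 2 e L the fluctuation of n / N_d. *)
Hypothesis low_phase : forall eps : R, 0 < eps -> exists2 e : R, 0 < e &
  ev (fun n => 2 * (1 - lam n) * Num.max 0 (L n * (bc n - beta) + 2 * e * L n + 3 * ln (L n)) <= eps).

(* The scale at which the discarded factors 1 / X v sum to o(n). *)
Definition ylow n : R := L n ^+ 2 / Num.max 1 (mu n).

Lemma ylow_gt0 n : rgm n -> 0 < ylow n.
Proof.
by move=> rg; rewrite divr_gt0 ?exprn_gt0 ?(rgL0 rg)// lt_max ltr01.
Qed.

(** n / N is about 1 / (1 - lambda) = L / kappa and ln (N q) about ln (1 - lambda) + L. Together
    with the - ln max(1, mu) from [ylow], the term ln (1 - lambda) is at most - ln mu, about - Delta
    L; this assembles L (beta_crit - beta). *)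
Lemma low_bracket (C e e' : R) n (G : graph n) : rgm n -> typ e' G -> e' <= 1 / 2 -> 0 <= e' <= e ->
  `|Delta alpha n * L n - ln (mu n)| <= C -> `|ln (D n) - L n| <= C -> 2 * C + 2 <= ln (L n) ->
  ln (N n G * q n) + 1 - n%:R / N n G - beta * L n + ln (ylow n)
  <= L n * (bc n - beta) + 2 * e * L n + 3 * ln (L n).
Proof.
move=> rg ty e1 /andP[e0 ee] hD hL hC.
have L0 := rgL0 rg; have L1 := rg_L rg; have n0 := rgn0 rg; have D0 := rgD0 rg.
have m0 := rg_mu_gt0 rg; have q0 := rgq0 rg.
have /andP[l0 l1] := rg_lam01 rg; have s0 : 0 < 1 - lam n by rewrite subr_gt0.
have [N1 N2 N0 Nn] := ty_N_bounds rg e1 ty.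
have lN : ln (N n G * q n) <= 1 + ln (1 - lam n) + ln (D n).
  have sD : 0 < (1 - lam n) * D n by apply: mulr_gt0.
  have t0 : (0 : R) < 2 by [].
  have sD2 : 0 < 2 * ((1 - lam n) * D n) by apply: mulr_gt0.
  have Nq0 : 0 < N n G * q n by apply: mulr_gt0.
  apply: (@le_trans _ _ (ln (2 * ((1 - lam n) * D n)))).
    rewrite ler_ln ?posrE//.
    have -> : 2 * ((1 - lam n) * D n) = 2 * (n%:R * (1 - lam n)) * q n by rewrite /Dn; ring.
    by rewrite ler_wpM2r ?(ltW q0).
  rewrite lnM ?posrE// [ln ((1 - lam n) * _)]lnM ?posrE// addrA !lerD2r.
  by have := ln_le_subr1 t0; lra.
have lm : ln (1 - lam n) - ln (Num.max 1 (mu n)) <= - ln (mu n).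
  have x0 : 0 < Num.max 1 (mu n) by rewrite lt_max ltr01.
  have : ln ((1 - lam n) * mu n) <= ln (Num.max 1 (mu n)).
    rewrite ler_ln ?posrE//; last by apply: mulr_gt0.
    apply: (@le_trans _ _ (mu n)); last by rewrite le_max lexx orbT.
    by rewrite ler_piMl ?(ltW m0)//; lra.
  rewrite lnM ?posrE//; lra.
have ly : ln (ylow n) = 2 * ln (L n) - ln (Num.max 1 (mu n)).
  rewrite /ylow ln_div ?posrE ?exprn_gt0 ?lt_max ?ltr01// lnXn//.
  by rewrite -[ln (L n) *+ 2]mulr_natl.
have bcE : L n * (bc n - beta) = L n - Delta alpha n * L n - (1 - lam n)^-1 - beta * L n.
  rewrite -(kappaE rg) /beta_crit; move: (Delta _ _) (kappa _ _)^-1 => *; ring.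
have nN : (1 - lam n)^-1 - 2 * e * L n <= n%:R / N n G.
  rewrite ler_pdivlMr//.
  have sL : (1 - lam n)^-1 <= 2 * L n ^+ 2.
    by rewrite -[leRHS]invrK lef_pV2 ?posrE ?invr_gt0 ?mulr_gt0 ?exprn_gt0// (rg_lamC rg).
  have := ty_N ty; rewrite ler_norml => /andP[_ h].
  have hN : N n G <= n%:R * (1 - lam n) * (1 + e' / L n) by lra.
  apply: (@le_trans _ _ (((1 - lam n)^-1 * (1 - e' / L n)) * N n G)).
    rewrite ler_wpM2r ?(ltW N0)//.
    have : (1 - lam n)^-1 * (e' / L n) <= 2 * L n ^+ 2 * (e' / L n).
      by rewrite ler_wpM2r// divr_ge0// ltW.
    have -> : 2 * L n ^+ 2 * (e' / L n) = 2 * e' * L n by field; rewrite gt_eqF.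
    have : e' * L n <= e * L n by rewrite ler_wpM2r// ltW.
    by move: (_^-1) (e' / L n) => *; lra.
  have e'L : e' / L n <= 1 by rewrite ler_pdivrMr//; lra.
  apply: (@le_trans _ _ ((1 - lam n)^-1 * (1 - e' / L n) * (n%:R * (1 - lam n) * (1 + e' / L n)))).
    by apply: ler_wpM2l => //; apply: mulr_ge0; [rewrite invr_ge0 ltW|rewrite subr_ge0].
  have -> : (1 - lam n)^-1 * (1 - e' / L n) * (n%:R * (1 - lam n) * (1 + e' / L n)) = n%:R * (1 - (e' / L n) ^+ 2).
    by move: (e' / L n) => t; field; rewrite gt_eqF.
  by rewrite ler_piMr ?(ltW n0)// gerBl sqr_ge0.
rewrite ly bcE.
move: lN lm nN hD hL hC; rewrite !ler_norml.
move: (L n) (ln (N n G * q n)) (ln (1 - lam n)) (ln (Num.max _ _)) (1 - lam n)^-1 (n%:R / _) (ln (D n)) (ln (mu n)) (ln (L n)) (Delta _ _ * _).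
move=> *; lra.
Qed.

(** One optimisation for both claims: p = 0 for [tPhi], and p the padding for the partition
    function. *)
Lemma low_opt (eps : R) : 0 < eps -> exists2 e : R, 0 < e <= eps &
  ev (fun n => forall (G : graph n) (p eta : R) (m : nat), typ e G ->
    (m <= #|lay (u n) G (d n)|)%N -> 0 < m%:R * q n + p -> 0 <= eta -> p <= eta * (N n G * q n) ->
    (n%:R - m%:R) * ln (m%:R * q n + p) + beta * L n * m%:R + (N n G - m%:R) * ln (ylow n)
    <= (n%:R - N n G) * ln (N n G * q n) + beta * L n * N n G + eps * n%:R + n%:R * eta).
Proof.
move=> eps0; have [e e0 ph] := low_phase eps0; have [C HC] := ev_Delta a0_gt0 alpha_bd.
pose e' := Num.min eps (Num.min e (1 / 2)).
have e'0 : 0 < e' by rewrite !lt_min eps0 e0/= divr_gt0.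
have e'1 : e' <= 1 / 2 by rewrite !ge_min lexx !orbT.
have e'2 : e' <= e by rewrite !ge_min lexx !orbT.
have e'3 : e' <= eps by rewrite !ge_min lexx.
exists e'; first by rewrite e'0.
apply: ev_mono2 evr (evI ph (evI HC (ev_lnL_ge (2 * C + 2)))) => n rg [hp [[hD hL _] hC]].
move=> G p eta m ty mN mp eta0 pe.
have n0 := rgn0 rg; have q0 := rgq0 rg.
have [N1 N2 N0 Nn] := ty_N_bounds rg e'1 ty.
have ee : 0 <= e' <= e by rewrite ltW.
have br := low_bracket rg ty e'1 ee hD hL hC.
set W := Num.max 0 _ in hp.
have W0 : 0 <= W by rewrite le_max lexx.
have brW : ln (N n G * q n) + 1 - n%:R / N n G - beta * L n + ln (ylow n) <= W.
  by rewrite le_max br orbT.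
have NN : 0 < N n G <= n%:R by rewrite N0.
have mm : (0 : R) <= m%:R <= N n G by rewrite ler0n ler_nat.
apply: le_trans (low_temperature_max n0 NN mm q0 mp eta0 pe W0 brW) _.
have NW : N n G * W <= eps * n%:R.
  apply: (@le_trans _ _ (2 * (n%:R * (1 - lam n)) * W)); first by rewrite ler_wpM2r.
  have -> : 2 * (n%:R * (1 - lam n)) * W = 2 * (1 - lam n) * W * n%:R by ring.
  by rewrite ler_wpM2r ?(ltW n0).
by rewrite lerD2r lerD2l.
Qed.

Lemma low_tPhi : is_op_n q (fun n (G : graph n) =>
  tPhi_max alpha beta G - tPhi alpha beta G (N_dstar alpha G)).
Proof.
apply: (whp_op q01) => eps eps0; have h2 : 0 < eps / 2 by rewrite divr_gt0.
have [e /andP[e0 _] he] := low_opt h2.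
have H := whp_typical a0_gt0 alpha_bd e0.
have H2 := whp_typical a0_gt0 alpha_bd (@divr_gt0 _ 1 2 (@ltr01 R) (@ltr0n R 2)).
apply: (whp_mono q01) (whpI q01 H H2).
apply: ev_mono2 evr (evI he (evL (4 / eps))) => n rg [ho hL] G _ [ty ty2].
have L0 := rgL0 rg; have L1 := rg_L rg; have n0 := rgn0 rg; have q0 := rgq0 rg; have m0 := rg_mu_gt0 rg.
have [_ _ N0 Nn] := ty_N_bounds rg (lexx _) ty2.
have NE := N_dstarE G rg; set NN := N_dstar alpha G in NE *.
have N1 : (1 <= NN <= NN)%N by rewrite leqnn andbT NE -(ltr0n R).
have up m : (1 <= m <= NN)%N -> tPhi alpha beta G m <= tPhi alpha beta G NN + eps * n%:R.
  move=> /andP[m1 mN].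
  have mq : 0 < m%:R * q n + 0 by rewrite addr0 mulr_gt0// ltr0n.
  have mN' : (m <= #|lay (u n) G (d n)|)%N by rewrite -NE.
  have := ho G 0 0 m ty mN' mq (lexx _); rewrite mul0r !addr0 mulr0 => /(_ (lexx _)).
  have := Psi_le_full (rg_lam01 rg) mN (ylow_gt0 rg).
  rewrite (rg_lnlam rg) natrB// /tPhi -/NN -/(lamn alpha n) -/(qn alpha n) -/(Ln R n) NE addr0.
  have tail : #|lay (u n) G (d n)|%:R * Num.min 1 (2 / mu n) / ylow n <= eps / 2 * n%:R.
    have x0 : 0 < Num.max 1 (mu n) by rewrite lt_max ltr01.
    have mm : Num.min 1 (2 / mu n) * Num.max 1 (mu n) <= 2.
      have [mu1|mu1] := leP 1 (mu n).
        apply: (@le_trans _ _ (2 / mu n * mu n)); last by rewrite divfK// gt_eqF.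
        by rewrite ler_wpM2r ?(ltW m0)// ge_min lexx orbT.
      by rewrite mulr1; apply: (@le_trans _ _ 1); rewrite ?ge_min ?lexx// ler1n.
    rewrite /ylow.
    have -> : #|lay (u n) G (d n)|%:R * Num.min 1 (2 / mu n) / (L n ^+ 2 / Num.max 1 (mu n))
      = #|lay (u n) G (d n)|%:R * (Num.min 1 (2 / mu n) * Num.max 1 (mu n)) / L n ^+ 2.
      by move: (Num.min _ _) x0; move: (Num.max _ _) => x y x0; field; rewrite !gt_eqF.
    apply: (@le_trans _ _ (n%:R * 2 / L n ^+ 2)).
      rewrite ler_wpM2r ?invr_ge0 ?exprn_ge0 ?(ltW L0)//; apply: ler_pM => //.
      by apply: mulr_ge0; [rewrite le_min ler01 divr_ge0// ltW|exact: ltW].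
    rewrite ler_pdivrMr ?exprn_gt0//.
    have hL2 : 4 <= eps * L n by move: hL; rewrite ler_pdivrMr// mulrC.
    have hL3 : 4 <= eps * L n ^+ 2.
      by apply: le_trans hL2 _; rewrite ler_wpM2l ?(ltW eps0)// expr2 ler_peMr ?(ltW L0).
    have := ler_wpM2l (ltW n0) hL3; move: (L n ^+ 2) (n%:R) => *; lra.
  move: tail; move: (n%:R) (m%:R) (L n) #|_|%:R (ln _) (ln _) (ln _) (Psi _ _ _) (Psi _ _ _) (_ / ylow n).
  by move=> *; lra.
have /andP[b1 b2] := tPhi_max_bounds N1 up.
rewrite ger0_norm; last by rewrite subr_ge0.
by rewrite lerBlDl.
Qed.

(** The main term with the random size of layer d still in it; [low_compare] replaces that size by n
    (1 - lambda). *)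
Definition Flow n (G : graph n) : R := n%:R * Psi0 (lam n) + (n%:R - N n G) * ln (N n G * q n)
  + beta * L n * N n G - beta * L n * (d n).+1%:R * n%:R.

Lemma whp_low_upper (eps : R) : 0 < eps -> whp (fun n G =>
  ln (treeZ (u n) G (beta * L n)) <= Flow G + eps * n%:R).
Proof.
move=> eps0; have h5 : 0 < eps / 5 by rewrite divr_gt0.
have [e /andP[e0 e1] he] := low_opt h5.
have H := whp_typical a0_gt0 alpha_bd e0.
have H2 := whp_typical a0_gt0 alpha_bd (@divr_gt0 _ 1 2 (@ltr01 R) (@ltr0n R 2)).
apply: (whp_mono q01) (whpI q01 (whpI q01 H H2) (whp_upper a0_gt0 alpha_bd beta_gt0 (@ltr01 R) h5)).
apply: ev_mono2 evr (evI he (evI (evL (10 / eps)) (ev_pad a0_gt0 alpha_bd (@ltr01 R)))).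
move=> n rg [ho [hL p1]] G _ [[ty ty2] up].
have L0 := rgL0 rg; have L1 := rg_L rg; have n0 := rgn0 rg; have q0 := rgq0 rg; have m0 := rg_mu_gt0 rg.
have D0 := rgD0 rg; have /andP[l0 l1] := rg_lam01 rg; have s0 : 0 < 1 - lam n by rewrite subr_gt0.
have [N1 N2 N0 Nn] := ty_N_bounds rg (lexx _) ty2.
have p0 : 0 < padn alpha 1 n by exact: lt_le_trans p1.
pose eta := 2 / L n; have eta0 : 0 <= eta by rewrite divr_ge0// ltW.
have pe : padn alpha 1 n <= eta * (N n G * q n).
  apply: (@le_trans _ _ (eta * (n%:R * (1 - lam n) / 2 * q n))); last first.
    by rewrite ler_wpM2l// ler_wpM2r ?(ltW q0).
  rewrite le_eqVlt /padn /eta /Dn; apply/orP; left; apply/eqP; field.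
  by rewrite gt_eqF.
pose A := (n%:R - N n G) * ln (N n G * q n) + beta * L n * N n G + eps / 5 * n%:R + n%:R * eta.
have hA m : (m <= #|lay (u n) G (d n)|)%N ->
    (#|vertex n|%:R - m%:R) * ln (m%:R * q n + padn alpha 1 n) + beta * L n * m%:R + (N n G - m%:R) * ln (ylow n) <= A.
  move=> mN; rewrite card_vertex ?(rg_n rg)//; apply: ho => //.
  by rewrite ltr_wpDl// mulr_ge0// ltW.
have SS := isum_le_low (ltW q0) p1 (ylow_gt0 rg) (ty_X ty) hA.
have lS : ln (isum (u n) (padn alpha 1 n) (beta * L n) (d n) (fun G I v => #|I|%:R * q n) G) <=
   A + \sum_(v in lay (u n) G (d n)) ln (X n G v)%:R + \sum_(v in lay (u n) G (d n)) (X n G v)%:R^-1 / ylow n.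
  rewrite -[leRHS]expRK ler_ln ?posrE ?expR_gt0//.
  rewrite /isum (bigD1 set0) ?sub0set//= ltr_pwDl ?sumr_ge0//.
    rewrite big_set0 mulr1 mulr_gt0 ?expR_gt0// prodr_gt0// => v _.
    by rewrite cards0 mul0r add0r.
  move=> I _; rewrite !mulr_ge0 ?expR_ge0 ?prodr_ge0// => v _.
  by apply: addr_ge0; [apply: mulr_ge0 => //; exact: ltW q0|exact: ltW].
have sI : \sum_(v in lay (u n) G (d n)) (X n G v)%:R^-1 / ylow n <= eps / 5 * n%:R.
  rewrite -mulr_suml ler_pdivrMr ?(ylow_gt0 rg)//; apply: le_trans (ty_inv ty) _.
  have x0 : 0 < Num.max 1 (mu n) by rewrite lt_max ltr01.
  rewrite /ylow; have -> : eps / 5 * n%:R * (L n ^+ 2 / Num.max 1 (mu n)) = L n * (n%:R * (eps / 5 * L n) / Num.max 1 (mu n)).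
    by move: x0; move: (Num.max _ _) => x x0; field; rewrite gt_eqF.
  rewrite ler_wpM2l ?(ltW L0)// ler_wpM2r ?invr_ge0 ?(ltW x0)// ler_wpM2l ?(ltW n0)//.
  move: hL; rewrite ler_pdivrMr//; lra.
have eL : n%:R * eta <= eps / 5 * n%:R.
  rewrite mulrC ler_wpM2r ?(ltW n0)// /eta ler_pdivrMr//; move: hL; rewrite ler_pdivrMr//; lra.
have sX : \sum_(v in lay (u n) G (d n)) ln (X n G v)%:R <= n%:R * Psi0 (lam n) + eps / 5 * n%:R.
  have := ty_lnX ty; rewrite ler_norml => /andP[_ h].
  have : e * n%:R <= eps / 5 * n%:R by rewrite ler_wpM2r ?(ltW n0).
  by move: h; move: (\sum_(_ in _) _) (n%:R) (Psi0 _) => *; lra.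
apply: le_trans up _; rewrite /Flow; move: lS; rewrite /A; move: sI sX eL {hA SS ho pe}.
move: (ln (isum _ _ _ _ _ _)) (\sum_(_ in _) _^-1 / _) (\sum_(_ in _) ln _) (n%:R * eta).
move=> x1 x2 x3 x4; move: (n%:R) (L n) #|_|%:R (d n).+1%:R (Psi0 _) (ln _) => *; lra.
Qed.

Lemma whp_low_lower (eps : R) : 0 < eps -> whp (fun n G =>
  Flow G - eps * n%:R <= ln (treeZ (u n) G (beta * L n))).
Proof.
move=> eps0; have h2 : 0 < eps / 2 by rewrite divr_gt0.
have H2 := whp_typical a0_gt0 alpha_bd (@divr_gt0 _ 1 2 (@ltr01 R) (@ltr0n R 2)).
have low := @whp_lower _ _ _ _ a0_gt0 alpha_bd beta (eps / 2) (fun n G => lay (u n) G (d n)) beta_gt0 h2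
  (fun n G => subxx _) (fun n G => hist_lay _ _ _).
apply: (whp_mono q01) (whpI q01 (whpI q01 (whp_typical a0_gt0 alpha_bd h2) H2) low).
apply: ev_mono2 evr (evL (4 : R)) => n rg hL G _ [[ty ty2] lw].
have L0 := rgL0 rg; have n0 := rgn0 rg.
have [N1 N2 N0 Nn] := ty_N_bounds rg (lexx _) ty2.
apply: le_trans (lw _); last first.
  apply: le_trans N1.
  have -> : n%:R / L n ^+ 3 = n%:R * (2 * L n ^+ 2)^-1 / 2 * (4 / L n) by field; rewrite gt_eqF.
  apply: (@le_trans _ _ (n%:R * (2 * L n ^+ 2)^-1 / 2)).
    rewrite ler_piMr ?divr_ge0 ?mulr_ge0 ?invr_ge0 ?mulr_ge0 ?exprn_ge0 ?(ltW n0) ?(ltW L0)//.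
    by rewrite ler_pdivrMr// mul1r.
  by rewrite ler_wpM2r// ler_wpM2l ?(ltW n0)// (rg_lamC rg).
have := ty_lnX ty; rewrite ler_norml => /andP[h _].
rewrite /Flow; move: h {lw}.
move: (\sum_(_ in _) ln _) => x3; move: (n%:R) (L n) #|_|%:R (d n).+1%:R (Psi0 _) (ln _) => *; lra.
Qed.

(** The size of the layer enters multiplied by quantities of order L, which is why [ty_N] has
    relative accuracy e / L. *)
Lemma low_compare (e : R) n (G : graph n) : rgm n -> 0 <= e <= 1 / 2 -> typ e G ->
  L n / 2 <= ln (D n) <= 2 * L n -> 4 * L n ^+ 2 <= D n ->
  `|Flow G - (n%:R * Psi0 (lam n) + lam n * n%:R * ln ((1 - lam n) * D n)
     - beta * L n * ((d n)%:R + lam n) * n%:R)| <= (4 + beta) * e * n%:R.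
Proof.
move=> rg /andP[e0 e1] ty /andP[lD1 lD2] LD.
have L0 := rgL0 rg; have L1 := rg_L rg; have n0 := rgn0 rg; have q0 := rgq0 rg; have D0 := rgD0 rg.
have /andP[l0 l1] := rg_lam01 rg; have s0 : 0 < 1 - lam n by rewrite subr_gt0.
have [N1 N2 N0 Nn] := ty_N_bounds rg e1 ty.
have ns : 0 < n%:R * (1 - lam n) by rewrite mulr_gt0.
have eL : 0 <= e / L n <= 1 / 2.
  by rewrite divr_ge0 ?(ltW L0)//= ler_pdivrMr//; apply: le_trans e1 _; rewrite ler_peMr.
have lc := ln_close ns eL (ty_N ty).
have lN : ln (N n G * q n) = ln (N n G) + ln (q n) by rewrite lnM ?posrE.
have lS : ln ((1 - lam n) * D n) = ln (n%:R * (1 - lam n)) + ln (q n).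
  by rewrite -lnM ?posrE//; congr ln; rewrite /Dn; ring.
have lN2 : ln (N n G * q n) <= 2 * L n.
  have Nq0 : 0 < N n G * q n by apply: mulr_gt0.
  by apply: le_trans lD2; rewrite ler_ln ?posrE// /Dn ler_wpM2r ?(ltW q0).
have lN1 : 0 <= ln (N n G * q n).
  apply: ln_ge0; apply: (@le_trans _ _ (n%:R * (1 - lam n) / 2 * q n)); last by rewrite ler_wpM2r ?(ltW q0).
  have -> : n%:R * (1 - lam n) / 2 * q n = (1 - lam n) * D n / 2 by rewrite /Dn; field.
  rewrite ler_pdivlMr// mul1r; apply: (@le_trans _ _ ((2 * L n ^+ 2)^-1 * D n)); last first.
    by rewrite ler_wpM2r ?(ltW D0)// (rg_lamC rg).
  rewrite [leRHS]mulrC ler_pdivlMr ?mulr_gt0 ?exprn_gt0//.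
  by apply: le_trans LD; lra.
have eN : e / L n * (n%:R * (1 - lam n)) <= e / L n * n%:R.
  by rewrite ler_wpM2l ?(divr_ge0 e0 (ltW L0))// ler_piMr ?(ltW n0)//; lra.
have dN : `|N n G - n%:R * (1 - lam n)| <= e / L n * n%:R by apply: le_trans (ty_N ty) eN.
have -> : Flow G - (n%:R * Psi0 (lam n) + lam n * n%:R * ln ((1 - lam n) * D n)
     - beta * L n * ((d n)%:R + lam n) * n%:R) =
  lam n * n%:R * (ln (N n G) - ln (n%:R * (1 - lam n)))
  - (N n G - n%:R * (1 - lam n)) * ln (N n G * q n)
  + beta * L n * (N n G - n%:R * (1 - lam n)).
  rewrite /Flow lS lN -[(d n).+1%:R]natr1.
  by move: (ln (n%:R * _)) => x; ring.
have b1 : `|lam n * n%:R * (ln (N n G) - ln (n%:R * (1 - lam n)))| <= 2 * (e * n%:R).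
  rewrite normrM ger0_norm; last by apply: mulr_ge0; exact: ltW.
  apply: (@le_trans _ _ (1 * n%:R * (2 * (e / L n)))).
    by apply: ler_pM => //; [apply: mulr_ge0; exact: ltW|rewrite ler_wpM2r ?(ltW n0) ?(ltW l1)].
  have : e / L n * n%:R <= e * n%:R by rewrite ler_wpM2r ?(ltW n0)// ler_pdivrMr// ler_peMr.
  by move: (e / L n) (n%:R) => *; lra.
have eLn : e / L n * n%:R * L n = e * n%:R by field; rewrite gt_eqF.
have b2 : `|(N n G - n%:R * (1 - lam n)) * ln (N n G * q n)| <= 2 * (e * n%:R).
  rewrite normrM [`|ln _|]ger0_norm//; apply: (@le_trans _ _ (e / L n * n%:R * (2 * L n))).
    by apply: ler_pM.
  by rewrite -eLn; lra.
have b3 : `|beta * L n * (N n G - n%:R * (1 - lam n))| <= beta * (e * n%:R).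
  rewrite normrM ger0_norm ?mulr_ge0 ?(ltW beta_gt0) ?(ltW L0)// -mulrA ler_wpM2l ?(ltW beta_gt0)//.
  by rewrite -eLn mulrC ler_wpM2r ?(ltW L0).
apply: le_trans (ler_normD _ _) _; apply: le_trans (lerD (le_trans (ler_normB _ _) (lerD b1 b2)) b3) _.
by move: (n%:R) => *; lra.
Qed.

Lemma low_partition : is_op_n q (fun n (G : graph n) =>
  ln (partition_function beta G)
  - (n%:R * Psi0 (lambda_ alpha n)
     + lambda_ alpha n * n%:R * ln (alpha n * (1 - lambda_ alpha n) * ln n%:R)
     - beta * loglog R n * ((d_star alpha n)%:~R + lambda_ alpha n) * n%:R)).
Proof.
apply: (whp_op q01) => eps eps0; have h2 : 0 < eps / 2 by rewrite divr_gt0.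
pose e := Num.min (1 / 2) (eps / (2 * (4 + beta))).
have b4 : 0 < 4 + beta by rewrite addr_gt0.
have e0 : 0 < e by rewrite lt_min !divr_gt0// mulr_gt0.
have e1 : e <= 1 / 2 by rewrite ge_min lexx.
have e2 : (4 + beta) * e <= eps / 2.
  have : e <= eps / (2 * (4 + beta)) by rewrite ge_min lexx orbT.
  by rewrite ler_pdivlMr ?mulr_gt0//; lra.
have H := whpI q01 (whp_typical a0_gt0 alpha_bd e0) (whpI q01 (whp_low_upper h2) (whp_low_lower h2)).
apply: (whp_mono q01) H.
apply: ev_mono2 evr (evI (ev_lnD a0_gt0 alpha_bd) (ev_D a0_gt0 alpha_bd 4 2)) => n rg [lD LD] G _ [ty [up lo]].
have ee : 0 <= e <= 1 / 2 by rewrite ltW.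
have n0 := rgn0 rg.
have := low_compare rg ee ty lD LD.
have -> : alpha n * (1 - lambda_ alpha n) * ln n%:R = (1 - lam n) * D n.
  by rewrite (rg_D rg) (rg_ln rg) /lamn; ring.
rewrite (rg_d rg) -[partition_function beta G]/(treeZ (u n) G (beta * L n)) -/(lamn alpha n) -/(Ln R n).
have := ler_wpM2r (ltW n0) e2.
rewrite -[(Posz (d n))%:~R]/((d n)%:R : R).
move: up lo {LD lD}; move: (ln (treeZ _ _ _)) (Flow G) (n%:R * Psi0 _ + _ - _) => z f t up lo k.
rewrite !ler_norml => /andP[h3 h4]; move: (n%:R) up lo k h3 h4 => *; apply/andP; split; lra.
Qed.

End low_temperature.

(** * High temperature: an optimum inside the range of m *)

Section high_temperature.
Variables (R : realType) (alpha : nat -> R) (a0 a1 : R).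
Hypotheses (a0_gt0 : 0 < a0) (alpha_bd : ev (fun n => a0 <= alpha n <= a1)).
Local Notation rgm := (regime alpha a0 a1).
Local Notation q := (qn alpha).
Local Notation D := (Dn alpha).
Local Notation L := (Ln R).
Local Notation d := (dn alpha).
Local Notation mu := (mun alpha).
Local Notation lam := (lamn alpha).
Local Notation u := vertex1.
Local Notation whp := (whp q).
Local Notation evr := (ev_regime a0_gt0 alpha_bd).
Local Notation q01 := (ev_q01 a0_gt0 alpha_bd).
Local Notation X n G v := (deg G v (lay (u n) G (d n).-1)).
Local Notation typ e G := (@typical R alpha e _ G).

Variables (beta delta : R).
Hypotheses (beta_gt0 : 0 < beta) (delta_gt0 : 0 < delta).
Local Notation bc := (beta_crit alpha).
Local Notation N n G := (#|lay (u n) G (d n)|%:R : R).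
Hypothesis high_phase : ev (fun n => beta + delta <= bc n).

Definition gap n : R := 1 - Delta alpha n - beta.
Definition mopt n (k : nat) : nat := Num.truncn (k%:R / (gap n * kappa alpha n)).
(** The value of m (ln mu + beta L) + (n - m) ln (m q) at its maximiser, about n / (gap L), up to
    o(n). *)
Definition Fhigh n : R := n%:R * (ln (D n) - ln (gap n * L n) - 1).

Lemma rg_kappa_gt0 n : rgm n -> 0 < kappa alpha n.
Proof.
move=> rg; have /andP[_ l1] := rg_lam01 rg.
by apply: mulr_gt0; [rewrite subr_gt0|exact: rgL0 rg].
Qed.

(** Since gap = beta_crit - beta + 1 / kappa, the phase condition gives gap kappa >= 1: the interior
    optimum does not exceed the size of the layer. *)
Lemma ev_gap : ev (fun n => [/\ delta <= gap n, gap n <= 2 & 1 <= gap n * kappa alpha n]).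
Proof.
have [C HC] := ev_Delta a0_gt0 alpha_bd.
apply: ev_mono2 evr (evI high_phase HC) => n rg [hp [_ _ hD]].
have k0 := rg_kappa_gt0 rg.
have gE : gap n = bc n - beta + (kappa alpha n)^-1.
  by rewrite /gap /beta_crit; move: (Delta _ _) (_^-1) => *; ring.
have ki : 0 < (kappa alpha n)^-1 by rewrite invr_gt0.
have d1 := delta_gt0; have b1 := beta_gt0.
split.
- by rewrite gE; move: hp ki; move: (bc n) (_^-1) => *; lra.
- by move: hD; rewrite ler_norml /gap => /andP[]; move: (Delta _ _) => *; lra.
rewrite -ler_pdivrMr// gE; move: hp ki; rewrite mul1r; move: (bc n) (_^-1) => *; lra.
Qed.

(** A scale at which the sum of the X v / y is o(n); its factor L ^ 3 costs only 3 ln L per element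
    of I, negligible against gap L. *)
Definition yhigh n : R := L n ^+ 3 * mu n.

Lemma yhigh_gt0 n : rgm n -> 0 < yhigh n.
Proof.
by move=> rg; apply: mulr_gt0; [apply: exprn_gt0; exact: rgL0 rg|exact: rg_mu_gt0 rg].
Qed.

Lemma ln_yhigh n : rgm n -> ln (yhigh n) = 3 * ln (L n) + ln (mu n).
Proof.
move=> rg; have L0 := rgL0 rg.
by rewrite lnM ?posrE ?exprn_gt0 ?(rg_mu_gt0 rg)// lnXn// -[ln (L n) *+ 3]mulr_natl.
Qed.

Lemma ln_1B (x : R) : 0 <= x <= 1 / 2 -> - (2 * x) <= ln (1 - x).
Proof.
move=> /andP[x0 x1]; have y0 : 0 < 1 - x by lra.
have := ln_close (@ltr01 R) (introT andP (conj x0 x1)) (y := 1 - x).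
rewrite ln1 subr0; have -> : 1 - x - 1 = - x by ring.
by rewrite normrN mulr1 ger0_norm// => /(_ (lexx _)); rewrite ler_norml => /andP[].
Qed.

Lemma high_opt (eps : R) : 0 < eps ->
  ev (fun n => forall (p : R) (m : nat), (m <= n)%N -> 0 <= p -> 0 < m%:R * q n + p ->
    p <= eps / (8 * L n) * D n ->
    (n%:R - m%:R) * ln (m%:R * q n + p) + beta * L n * m%:R + m%:R * ln (yhigh n)
    <= Fhigh n + eps * n%:R).
Proof.
move=> eps0; have [C HC] := ev_Delta a0_gt0 alpha_bd.
pose c1 := 2 * `|C|; pose eps' := Num.min (eps / 8) (1 / 2).
have eps'0 : 0 < eps' by rewrite lt_min !divr_gt0.
have eps'1 : eps' <= 1 / 2 by rewrite ge_min lexx orbT.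
have eps'2 : eps' <= eps / 8 by rewrite ge_min lexx.
have H := evI HC (evI ev_gap (evI (ev_lnL (10 / (delta * eps'))) (evI (evL (2 * c1 / (delta * eps'))) (evL (8 / eps))))).
apply: ev_mono2 evr H => n rg [[hD hL _] [[g1 g2 _] [l1 [l2 l3]]]] p m mn p0 mp pe.
have L0 := rgL0 rg; have L1 := rg_L rg; have n0 := rgn0 rg; have q0 := rgq0 rg; have D0 := rgD0 rg.
have g0 : 0 < gap n by exact: lt_le_trans g1.
have de : 0 < delta * eps' by rewrite mulr_gt0.
rewrite -/(Ln R n) in l1.
(* h = gap L (1 - x) is gap L minus the slack: 2 |C| for [ev_Delta], and 5 ln L for the logarithms
   of [yhigh] (three) and of t = L ^ 2 (two). *)
pose x := (c1 + 5 * ln (L n)) / (gap n * L n).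
have lL0 : 0 <= ln (L n) by rewrite ln_ge0.
have c10 : 0 <= c1 by rewrite mulr_ge0.
have gL : 0 < gap n * L n by rewrite mulr_gt0.
have x0 : 0 <= x by rewrite divr_ge0 ?(ltW gL)// addr_ge0// mulr_ge0.
have xe : x <= eps'.
  rewrite /x ler_pdivrMr//; apply: (@le_trans _ _ (eps' * (delta * L n))); last first.
    by rewrite ler_wpM2l ?(ltW eps'0)// ler_wpM2r ?(ltW L0).
  move: l1 l2; rewrite mulrAC !ler_pdivrMr//; move: (ln (L n)) => y *; lra.
pose h := gap n * L n * (1 - x).
have hE : h = gap n * L n - c1 - 5 * ln (L n).
  by rewrite /h /x; move: (c1) (ln (L n)) => y z; field; rewrite !gt_eqF.
have x1 : 0 < 1 - x by lra.
have h0 : 0 < h by rewrite mulr_gt0.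
have lnh : ln (gap n * L n) - 2 * x <= ln h.
  rewrite /h [ln (_ * (1 - x))]lnM ?posrE// lerD2l; apply: ln_1B; rewrite x0/=; lra.
have t0 : 0 < L n ^+ 2 by rewrite exprn_gt0.
have hh : h + ln (L n ^+ 2) <= ln (n%:R * q n) - beta * L n - ln (yhigh n).
  rewrite (ln_yhigh rg) lnXn// -[ln (L n) *+ 2]mulr_natl -/(Dn alpha n) hE /gap /c1.
  have := ler_norm C; move: hD hL; rewrite !ler_norml.
  have -> : (1 - Delta alpha n - beta) * L n = L n - Delta alpha n * L n - beta * L n.
    by move: (Delta _ _) => y; ring.
  move: `|C| (beta * L n) (Delta alpha n * L n) (ln (D n)) (ln (mu n)) (ln (L n)) (L n) => *; lra.
have mm1 : (m%:R : R) <= n%:R by rewrite ler_nat.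
have mm : 0 <= (m%:R : R) <= (n%:R : R) by rewrite ler0n mm1.
apply: le_trans (high_temperature_max n0 mm q0 p0 mp t0 pe h0 hh) _.
have -> : Fhigh n + eps * n%:R = n%:R * (ln (D n) - ln (gap n * L n) - 1 + eps).
  by rewrite /Fhigh; move: (ln _) (ln _) => *; ring.
rewrite -/(Dn alpha n) ler_wpM2l ?(ltW n0)//.
have hk : h * (eps / (8 * L n)) <= eps / 4.
  have h2L : h <= 2 * L n.
    apply: (@le_trans _ _ (gap n * L n)); last by rewrite ler_wpM2r ?(ltW L0).
    by rewrite /h ler_piMr ?(ltW gL)//; lra.
  apply: (@le_trans _ _ (2 * L n * (eps / (8 * L n)))).
    by rewrite ler_wpM2r// divr_ge0 ?mulr_ge0 ?(ltW L0) ?(ltW eps0).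
  by rewrite le_eqVlt; apply/orP; left; apply/eqP; field; rewrite gt_eqF.
have tL : (L n ^+ 2)^-1 <= eps / 8.
  rewrite -[leRHS]invrK lef_pV2 ?posrE ?invr_gt0 ?divr_gt0// invf_div.
  by apply: le_trans l3 _; rewrite expr2 ler_peMr ?(ltW L0).
move: hk tL lnh xe {hh hE lL0 l1 l2 l3 hD hL pe mp}; move: (ln (D n)) (ln (gap n * L n)) (ln h) (L n ^- 2) (h * _) => *.
lra.
Qed.

Definition near_opt (e : R) n (m : nat) := `|m%:R - n%:R / (gap n * L n)| <= e * (n%:R / (gap n * L n)).

(** A relative error e in m moves ln m by O(e) and m gap L by O(e n), so m is only needed near the
    optimum; this absorbs both the rounding and the randomness of N_d. *)
Lemma high_value (eps : R) : 0 < eps -> exists2 e : R, 0 < e <= 1 / 2 &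
  ev (fun n => forall m : nat, near_opt e n m ->
    Fhigh n - eps * n%:R <= m%:R * (ln (mu n) - 1) + (n%:R - m%:R) * ln (m%:R * q n) + beta * L n * m%:R).
Proof.
move=> eps0; have [C HC] := ev_Delta a0_gt0 alpha_bd.
pose e := Num.min (eps / 8) (1 / 2).
have e0 : 0 < e by rewrite lt_min !divr_gt0.
have e1 : e <= 1 / 2 by rewrite ge_min lexx orbT.
have e2 : e <= eps / 8 by rewrite ge_min lexx.
exists e; first by rewrite e0.
have de : 0 < delta * e by rewrite mulr_gt0.
have H := evI HC (evI ev_gap (evI (evL ((2 * C + 2) / (delta * e))) (evL delta^-1))).
apply: ev_mono2 evr H => n rg [[hD hL _] [[g1 g2 _] [l1 l2]]] m nm.
have L0 := rgL0 rg; have n0 := rgn0 rg; have q0 := rgq0 rg; have D0 := rgD0 rg.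
have g0 : 0 < gap n by exact: lt_le_trans g1.
have gL : 0 < gap n * L n by rewrite mulr_gt0.
have M0 : 0 < n%:R / (gap n * L n) by rewrite divr_gt0.
have ee : 0 <= e <= 1 / 2 by rewrite ltW.
have lc := ln_close M0 ee nm.
have m0 : 0 < m%:R :> R.
  move: nm; rewrite /near_opt ler_norml => /andP[h _].
  have := ler_wpM2r (ltW M0) e1; move: (n%:R / _) M0 h => *; lra.
have lM : ln (n%:R / (gap n * L n)) = ln (D n) - ln (gap n * L n) - ln (q n).
  rewrite ln_div ?posrE//; have : ln (D n) = ln n%:R + ln (q n) by rewrite /Dn lnM ?posrE.
  by move: (ln (D n)) (ln n%:R) => *; lra.
have gl : 0 <= ln (gap n * L n).
  apply: ln_ge0; apply: (@le_trans _ _ (delta * L n)); last by rewrite ler_wpM2r ?(ltW L0).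
  by move: l2; rewrite -[delta^-1]div1r ler_pdivrMr// mulrC.
rewrite lnM ?posrE//.
have gE : gap n * L n = L n - Delta alpha n * L n - beta * L n.
  by rewrite /gap; move: (Delta _ _) => y; ring.
have c2 : 2 * C + 2 <= e * (gap n * L n).
  move: l1; rewrite ler_pdivrMr// => h; apply: le_trans h _.
  have := ler_wpM2l (ltW e0) (ler_wpM2r (ltW L0) g1); lra.
(* The coefficient of m is asymptotically gap * L, and m is asymptotically n / (gap * L). *)
have br : ln (D n) - ln (gap n * L n) + 2 * e - ln (mu n) + 1 - beta * L n <= gap n * L n * (1 + e).
  move: hD hL; rewrite !ler_norml; rewrite mulrDr mulr1 [gap n * L n * e]mulrC.
  move: c2; rewrite {3}gE; move: (e * (gap n * L n)) (ln (gap n * L n)) gl => *; lra.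
have mb : m%:R * (ln (D n) - ln (gap n * L n) + 2 * e - ln (mu n) + 1 - beta * L n) <= n%:R * (1 + 3 * e).
  apply: (@le_trans _ _ (m%:R * (gap n * L n * (1 + e)))); first by rewrite ler_wpM2l.
  apply: (@le_trans _ _ ((1 + e) * (n%:R / (gap n * L n)) * (gap n * L n * (1 + e)))).
    have e3 : 0 <= 1 + e by lra.
    apply: ler_wpM2r; first by apply: mulr_ge0 => //; exact: ltW.
    by move: nm; rewrite /near_opt ler_norml => /andP[_ h]; move: (n%:R / _) h => *; lra.
  have -> : (1 + e) * (n%:R / (gap n * L n)) * (gap n * L n * (1 + e)) = n%:R * ((1 + e) * (1 + e)).
    by move: (gap n * L n) gL => y y0; field; rewrite gt_eqF.
  rewrite ler_wpM2l ?(ltW n0)//.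
  have : e * e <= e * 1 by rewrite ler_wpM2l ?(ltW e0)//; lra.
  by lra.
move: lc; rewrite lM ler_norml => /andP[lc1 lc2]; rewrite /Fhigh.
have k1 : n%:R * (ln (D n) - ln (gap n * L n) - 2 * e) <= n%:R * (ln m%:R + ln (q n)).
  by rewrite ler_wpM2l ?(ltW n0)//; lra.
have k2 : m%:R * (ln m%:R + ln (q n)) <= m%:R * (ln (D n) - ln (gap n * L n) + 2 * e).
  by rewrite ler_wpM2l//; lra.
have k3 : n%:R * e <= n%:R * (eps / 8) by rewrite ler_wpM2l ?(ltW n0).
have k4 : 0 <= n%:R * e by rewrite mulr_ge0 ?(ltW n0) ?(ltW e0).
move: k1 k2 k3 k4 mb {br lc1 lc2 hD hL nm lM gE c2 gl l1 l2}.
move: (ln (gap n * L n)) (ln (D n)) (ln m%:R) (ln (q n)) (ln (mu n)) (L n) => y1 y2 y3 y4 y5 y6 *; lra.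
Qed.

Lemma mopt_near (e : R) : 0 < e -> exists2 e' : R, 0 < e' <= 1 / 2 &
  ev (fun n => forall G : graph n, typ e' G ->
    near_opt e n (mopt n #|lay (u n) G (d n)|)
    /\ (1 <= mopt n #|lay (u n) G (d n)| <= #|lay (u n) G (d n)|)%N).
Proof.
move=> e0; pose e' := Num.min (e / 2) (1 / 2).
have e'0 : 0 < e' by rewrite lt_min !divr_gt0.
have e'1 : e' <= 1 / 2 by rewrite ge_min lexx orbT.
have e'2 : e' <= e / 2 by rewrite ge_min lexx.
exists e'; first by rewrite e'0.
(* n / (gap L) has to be at least 2 / e + 2, so that rounding to an integer costs at most half of
   the allowed error; gap <= 2 doubles these constants. *)
have H := evI ev_gap (ev_Dpow a0_gt0 alpha_bd (4 / e + 4) 1).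
apply: ev_mono2 evr H => n rg [[g1 g2 g3] hn] G ty.
have L0 := rgL0 rg; have L1 := rg_L rg; have n0 := rgn0 rg; have D2 := rg_D2 rg.
have /andP[_ l1] := rg_lam01 rg; have s0 : 0 < 1 - lam n by rewrite subr_gt0.
have g0 : 0 < gap n by exact: lt_le_trans g1.
have gL : 0 < gap n * L n by rewrite mulr_gt0.
have gk : 0 < gap n * kappa alpha n by exact: lt_le_trans g3.
have [N1 N2 N0 Nn] := ty_N_bounds rg e'1 ty.
set x := N n G / (gap n * kappa alpha n).
have x0 : 0 <= x by rewrite divr_ge0// ltW.
have xE : x = N n G / (n%:R * (1 - lam n)) * (n%:R / (gap n * L n)).
  rewrite /x /kappa -/(lamn alpha n) -/(Ln R n).
  by move: (gap n) g0 => g g0; field; rewrite !gt_eqF.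
have ns : 0 < n%:R * (1 - lam n) by rewrite mulr_gt0.
have xc : `|x - n%:R / (gap n * L n)| <= e / 2 * (n%:R / (gap n * L n)).
  have M0 : 0 < n%:R / (gap n * L n) by rewrite divr_gt0.
  rewrite xE; have -> : N n G / (n%:R * (1 - lam n)) * (n%:R / (gap n * L n)) - n%:R / (gap n * L n)
     = (N n G - n%:R * (1 - lam n)) / (n%:R * (1 - lam n)) * (n%:R / (gap n * L n)).
    by move: (n%:R / (gap n * L n)) => M; field; rewrite !gt_eqF.
  rewrite normrM [`|n%:R / _|]gtr0_norm// ler_wpM2r ?(ltW M0)//.
  rewrite normrM normfV [`|n%:R * _|]gtr0_norm// ler_pdivrMr//.
  apply: le_trans (ty_N ty) _; rewrite ler_wpM2r ?(ltW ns)//; apply: le_trans e'2.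
  by rewrite ler_pdivrMr// ler_peMr// ltW.
have big : 2 / e + 2 <= n%:R / (gap n * L n).
  rewrite ler_pdivlMr//; apply: le_trans hn; rewrite !expr1.
  apply: (@le_trans _ _ ((2 / e + 2) * (2 * L n))).
    by rewrite ler_wpM2l ?ler_wpM2r ?(ltW L0)// addr_ge0// divr_ge0// ltW.
  have -> : (4 / e + 4) * (D n * L n) = (2 / e + 2) * (2 * (D n * L n)) by move: (D n) => y; ring.
  rewrite ler_wpM2l//; first by rewrite addr_ge0// divr_ge0// ltW.
  by rewrite ler_wpM2l// ler_peMl ?(ltW L0)//; lra.
have /andP[t1 t2] := truncn_itv x0; rewrite -/(mopt n #|lay (u n) G (d n)|) in t1 t2.
have e2 : 1 <= e / 2 * (n%:R / (gap n * L n)).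
  apply: (@le_trans _ _ (e / 2 * (2 / e + 2))); last by rewrite ler_wpM2l// divr_ge0// ltW.
  have -> : e / 2 * (2 / e + 2) = 1 + e by field; rewrite gt_eqF.
  by rewrite lerDl ltW.
split; last first.
  apply/andP; split; last first.
    rewrite -(ler_nat R); apply: le_trans t1 _.
    by rewrite /x ler_pdivrMr// ler_peMr.
  rewrite /mopt truncn_gt0 -/x.
  have M2 : 2 <= n%:R / (gap n * L n).
    by apply: le_trans big; rewrite lerDr divr_ge0// ltW.
  have r2 : 1 / 2 <= N n G / (n%:R * (1 - lam n)).
    by rewrite ler_pdivlMr//; move: N1; rewrite mulrC mul1r.
  by rewrite xE; have := ler_pM _ _ r2 M2; rewrite divfK//; apply.
rewrite /near_opt; move: xc; rewrite -natr1 in t2; rewrite !ler_norml.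
move: e2 t1 t2; move: (n%:R / _) (x) => y z *; apply/andP; split; lra.
Qed.

Lemma sum_high_tail (eps : R) : 0 < eps ->
  ev (fun n => n%:R * (2 / L n ^+ 3) <= eps * n%:R /\ ln (L n) * (n%:R * mu n) / yhigh n <= eps * n%:R).
Proof.
move=> eps0; apply: ev_mono2 evr (evI (evL (2 / eps)) (ev_lnL (1 : R))) => n rg [h1 h2].
have L0 := rgL0 rg; have L1 := rg_L rg; have n0 := rgn0 rg; have m0 := rg_mu_gt0 rg.
rewrite -/(Ln R n) mul1r in h2.
have x1 : 2 / L n ^+ 3 <= eps.
  rewrite ler_pdivrMr ?exprn_gt0//; move: h1; rewrite ler_pdivrMr// mulrC => h1.
  apply: le_trans h1 _; rewrite ler_wpM2l ?(ltW eps0)//.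
  by rewrite -[leLHS]expr1 ler_weXn2l.
split; first by rewrite mulrC ler_wpM2r ?(ltW n0).
have -> : ln (L n) * (n%:R * mu n) / yhigh n = ln (L n) / L n ^+ 3 * n%:R.
  by rewrite /yhigh; move: (mu n) m0 => y y0; field; rewrite !gt_eqF.
rewrite ler_wpM2r ?(ltW n0)//; move: h1; rewrite ler_pdivrMr// mulrC => h1.
rewrite ler_pdivrMr ?exprn_gt0//; apply: le_trans h2 _.
have -> : eps * L n ^+ 3 = L n * (eps * L n * L n) by ring.
rewrite ler_peMr ?(ltW L0)//; apply: (@le_trans _ _ (eps * L n)); first by lra.
by rewrite ler_peMr// mulr_ge0// ltW.
Qed.

Lemma high_tPhi : is_op_n q (fun n (G : graph n) => tPhi_max alpha beta G
  - tPhi alpha beta G (Num.truncn ((N_dstar alpha G)%:R / ((1 - Delta alpha n - beta) * kappa alpha n)))).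
Proof.
apply: (whp_op q01) => eps eps0; have h3 : 0 < eps / 3 by rewrite divr_gt0.
have [e1 /andP[e10 _] hv] := high_value h3.
have [e /andP[e0 e12] mo] := mopt_near e10.
apply: (whp_mono q01) (whp_typical a0_gt0 alpha_bd e0).
apply: ev_mono2 evr (evI hv (evI mo (evI (high_opt h3) (sum_high_tail h3)))) => n rg [hv1 [mo1 [ho [tl _]]]] G _ ty.
have L0 := rgL0 rg; have L1 := rg_L rg; have n0 := rgn0 rg; have q0 := rgq0 rg; have m0 := rg_mu_gt0 rg.
have D0 := rgD0 rg; have /andP[_ l1] := rg_lam01 rg; have s0 : 0 < 1 - lam n by rewrite subr_gt0.
have [N1 N2 N0 Nn] := ty_N_bounds rg e12 ty.
have NE := N_dstarE G rg; have [no mb] := mo1 G ty.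
rewrite -/(gap n) -[Num.truncn _]/(mopt n (N_dstar alpha G)); set ms := mopt n _.
rewrite -NE -/ms in no mb.
pose b := - (beta * L n * ((d_star alpha n)%:~R + 1) * n%:R).
have up m : (1 <= m <= N_dstar alpha G)%N -> tPhi alpha beta G m <= Fhigh n + 2 * (eps / 3 * n%:R) + b.
  move=> /andP[k1 mN].
  have mq : 0 < m%:R * q n + 0 by rewrite addr0 mulr_gt0// ltr0n.
  have mn : (m <= n)%N by apply: leq_trans mN _; rewrite NE -(ler_nat R).
  have p0 : 0 <= eps / 3 / (8 * L n) * D n.
    apply: mulr_ge0; last exact: ltW.
    by apply: divr_ge0; [exact: ltW|apply: mulr_ge0 => //; exact: ltW].
  have := ho 0 m mn (lexx _) mq p0; rewrite addr0.
  have := Psi_le (rg_lam01 rg) mN (yhigh_gt0 rg).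
  have tail : (N_dstar alpha G)%:R * (ln (lam n)^-1 / (1 - lam n)) / yhigh n <= eps / 3 * n%:R.
    apply: le_trans tl; rewrite (rg_lnlam rg) NE /yhigh.
    have -> : N n G * (mu n / (1 - lam n)) / (L n ^+ 3 * mu n) = N n G / (1 - lam n) / L n ^+ 3.
      by move: (mu n) m0 => y y0; field; rewrite !gt_eqF.
    rewrite [n%:R * _]mulrA ler_wpM2r ?invr_ge0 ?exprn_ge0 ?(ltW L0)// ler_pdivrMr//.
    by move: N2; rewrite mulrA [2 * n%:R]mulrC.
  rewrite /tPhi -/(lamn alpha n) -/(qn alpha n) -/(Ln R n) /b.
  move: tail; move: (_ / yhigh n) (Psi _ _ _) => t1 t2.
  by move: (Fhigh n) (n%:R) (m%:R) (ln (yhigh n)) (ln _) => *; lra.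
have /andP[b1 b2] := tPhi_max_bounds mb up.
have low : Fhigh n - eps / 3 * n%:R + b <= tPhi alpha beta G ms.
  have /andP[_ msN] := mb.
  have := Psi_ge (rg_lam01 rg) msN; rewrite (rg_lnlam rg).
  have := hv1 ms no; rewrite /tPhi -/(lamn alpha n) -/(qn alpha n) -/(Ln R n) /b.
  by move: (Fhigh n) (n%:R) (ms%:R) (Psi _ _ _) (ln (mu n)) (ln _) => *; lra.
rewrite ger0_norm ?subr_ge0//.
by move: b2 low {b1 ho hv1 mo1}; move: (tPhi_max _ _ _) (tPhi _ _ _ _) (Fhigh n) (n%:R) => *; lra.
Qed.

Lemma whp_high_upper (eps : R) : 0 < eps -> whp (fun n G =>
  ln (treeZ (u n) G (beta * L n)) <= Fhigh n - beta * L n * (d n).+1%:R * n%:R + eps * n%:R).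
Proof.
move=> eps0; have h3 : 0 < eps / 3 by rewrite divr_gt0.
pose K := 8 / (eps / 3); have K0 : 0 < K by rewrite divr_gt0.
have H2 := whp_typical a0_gt0 alpha_bd (@divr_gt0 _ 1 2 (@ltr01 R) (@ltr0n R 2)).
apply: (whp_mono q01) (whpI q01 H2 (whp_upper a0_gt0 alpha_bd beta_gt0 K0 h3)).
apply: ev_mono2 evr (evI (high_opt h3) (evI (sum_high_tail h3) (ev_pad a0_gt0 alpha_bd K0))).
move=> n rg [ho [[_ tl] p1]] G _ [ty up].
have L0 := rgL0 rg; have n0 := rgn0 rg; have q0 := rgq0 rg; have D0 := rgD0 rg.
have /andP[l0 l1] := rg_lam01 rg.
have p0 : 0 < padn alpha K n by exact: lt_le_trans p1.
have pe : padn alpha K n <= eps / 3 / (8 * L n) * D n.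
  have -> : padn alpha K n = (1 - lam n) * (eps / 3 / (8 * L n) * D n).
    by rewrite /padn /K; move: (D n) => y; field; rewrite !gt_eqF.
  apply: ler_piMl; last by lra.
  apply: mulr_ge0; last exact: ltW.
    by apply: divr_ge0; [exact: ltW|apply: mulr_ge0 => //; exact: ltW].
have hA m : (m <= #|lay (u n) G (d n)|)%N ->
    (#|vertex n|%:R - m%:R) * ln (m%:R * q n + padn alpha K n) + beta * L n * m%:R + m%:R * ln (yhigh n)
    <= Fhigh n + eps / 3 * n%:R.
  move=> mN; rewrite card_vertex ?(rg_n rg)//; apply: ho => //; last 2 first.
  - exact: ltW.
  - by rewrite ltr_wpDl// mulr_ge0// ltW.
  by apply: leq_trans mN _; rewrite -[leqRHS](card_vertex (rg_n rg)) max_card.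
have SS := isum_le_high (ltW q0) p1 (yhigh_gt0 rg) hA.
have lS : ln (isum (u n) (padn alpha K n) (beta * L n) (d n) (fun G I v => #|I|%:R * q n) G) <=
   Fhigh n + eps / 3 * n%:R + \sum_(v in lay (u n) G (d n)) (X n G v)%:R / yhigh n.
  rewrite -[leRHS]expRK ler_ln ?posrE ?expR_gt0//.
  rewrite /isum (bigD1 set0) ?sub0set//= ltr_pwDl ?sumr_ge0//.
    rewrite big_set0 mulr1 mulr_gt0 ?expR_gt0// prodr_gt0// => v _.
    by rewrite cards0 mul0r add0r.
  move=> I _; rewrite !mulr_ge0 ?expR_ge0 ?prodr_ge0// => v _.
  by apply: addr_ge0; [apply: mulr_ge0 => //; exact: ltW q0|exact: ltW].
have sI : \sum_(v in lay (u n) G (d n)) (X n G v)%:R / yhigh n <= eps / 3 * n%:R.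
  rewrite -mulr_suml; apply: le_trans tl; rewrite ler_wpM2r ?invr_ge0 ?(ltW (yhigh_gt0 rg))//.
  apply: le_trans (ty_sumX ty); apply: sum_le_sub => //.
  by apply/fintype.subsetP => v; rewrite /lay !inE => /andP[].
apply: le_trans up _; move: lS sI {hA SS ho pe tl}.
move: (ln (isum _ _ _ _ _ _)) (\sum_(_ in _) _) => x1 x2.
by move: (Fhigh n) (n%:R) (d n).+1%:R => *; lra.
Qed.

(** The case d = 0 is set apart so that the set is a function of the history for every n: layer d -
    1 has to lie in the explored ball. *)
Definition Isel n (G : graph n) : {set vertex n} :=
  if (0 < d n)%N then
    large_subset (lay (u n) G (d n)) (fun v => ln (X n G v)%:R : R) (mopt n #|lay (u n) G (d n)|)
  else set0.

Lemma Isel_sub n (G : graph n) : Isel G \subset lay (u n) G (d n).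
Proof. by rewrite /Isel; case: ifP => _; [exact: large_subset_sub|exact: sub0set]. Qed.

Lemma Isel_hist n (G : graph n) : Isel (hist (u n) G (d n)) = Isel G.
Proof.
have l1 : lay (u n) (hist (u n) G (d n)) (d n).-1 = lay (u n) G (d n).-1.
  by rewrite hist_layj// leq_pred.
rewrite /Isel hist_lay l1; case: ifP => // d0.
congr large_subset; apply/funext => v; rewrite hist_deg// rball_pred//.
exact: lay_sub.
Qed.

Lemma whp_high_lower (eps : R) : 0 < eps -> whp (fun n G =>
  Fhigh n - beta * L n * (d n).+1%:R * n%:R - eps * n%:R <= ln (treeZ (u n) G (beta * L n))).
Proof.
move=> eps0; have h3 : 0 < eps / 3 by rewrite divr_gt0.
have [e1 /andP[e10 e11] hv] := high_value h3.
have [e2 /andP[e20 e22] mo] := mopt_near e10.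
(* The selected sum loses 7 e n: 6 e n for replacing n (1 - lambda) by the size of the layer against
   ln mu = O(L), and e n from [ty_lnX]. *)
pose e := Num.min (eps / 21) (1 / 2).
have e0 : 0 < e by rewrite lt_min !divr_gt0.
have e01 : e <= 1 / 2 by rewrite ge_min lexx orbT.
have e02 : e <= eps / 21 by rewrite ge_min lexx.
have low := @whp_lower _ _ _ _ a0_gt0 alpha_bd beta (eps / 3) Isel beta_gt0 h3
  Isel_sub Isel_hist.
apply: (whp_mono q01) (whpI q01 (whpI q01 (whp_typical a0_gt0 alpha_bd e20) (whp_typical a0_gt0 alpha_bd e0)) low).
have H := evI hv (evI mo (evI (ev_lnD a0_gt0 alpha_bd) (evI ev_gap (evI (evL (4 : R)) (ev_lnL (2 : R)))))).
apply: ev_mono2 evr H => n rg [hv1 [mo1 [/andP[_ lD] [[g1 g2 _] [L4 lL]]]]] G _ [[ty2 ty] lw].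
have L0 := rgL0 rg; have L1 := rg_L rg; have n0 := rgn0 rg; have m0 := rg_mu_gt0 rg; have D0 := rgD0 rg.
have /andP[l0 l1] := rg_lam01 rg; have s0 : 0 < 1 - lam n by rewrite subr_gt0.
have [N1 N2 N0 Nn] := ty_N_bounds rg e01 ty.
have [no /andP[mb1 mb2]] := mo1 G ty2; set m := mopt n _ in no mb1 mb2.
have [cI sI] := large_subsetP (fun v => ln (X n G v)%:R : R) mb2.
have IE : Isel G = large_subset (lay (u n) G (d n)) (fun v => ln (X n G v)%:R : R) m.
  by rewrite /Isel (rgd0 rg).
rewrite -IE in cI sI; rewrite cI in lw.
have g0 : 0 < gap n by exact: lt_le_trans g1.
have gL : 0 < gap n * L n by rewrite mulr_gt0.
have nm : n%:R / (4 * L n) <= m%:R.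
  move: no; rewrite /near_opt ler_norml => /andP[h _].
  have M0 : n%:R / (2 * L n) <= n%:R / (gap n * L n).
    by rewrite ler_wpM2l ?(ltW n0)// lef_pV2 ?posrE ?mulr_gt0// ler_wpM2r ?(ltW L0).
  have M1 : 0 <= n%:R / (gap n * L n) by rewrite divr_ge0// ltW.
  have := ler_wpM2r M1 e11.
  have -> : n%:R / (4 * L n) = n%:R / (2 * L n) / 2 by field; rewrite gt_eqF.
  by move: M0 h M1; move: (n%:R / (2 * L n)) (n%:R / _) => *; lra.
apply: le_trans (lw _); last first.
  apply: le_trans nm; rewrite ler_wpM2l ?(ltW n0)// lef_pV2 ?posrE ?mulr_gt0 ?exprn_gt0//.
  rewrite exprS mulrC ler_wpM2l ?(ltW L0)// expr2; apply: le_trans L4 _; rewrite ler_peMr ?(ltW L0)//.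
have lmu : `|ln (mu n) - 1| <= 3 * L n.
  have u1 : ln (mu n) <= 2 * L n by apply: le_trans lD; rewrite ler_ln ?posrE// (rg_mu_le rg).
  have u2 : - L n <= ln (mu n).
    apply: (@le_trans _ _ (ln (L n ^+ 2)^-1)); last first.
      by rewrite ler_ln ?posrE ?invr_gt0 ?exprn_gt0// (rg_mu1 rg).
    rewrite lnV ?posrE ?exprn_gt0// lnXn// -[ln (L n) *+ 2]mulr_natl lerN2; exact: lL.
  by move: u1 u2; rewrite ler_norml; move: (ln (mu n)) => *; apply/andP; split; lra.
have sX : m%:R * (ln (mu n) - 1) - 7 * (e * n%:R) <= \sum_(v in Isel G) ln (X n G v)%:R.
  have := ty_lnX ty; rewrite ler_norml => /andP[t1 _].
  have t2 : (1 - lam n) * (ln (mu n) - 1) <= Psi0 (lam n).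
    rewrite (Psi0E (rg_lam01 rg)) (rg_lnlam rg) (rg_lam rg); exact: pois_lnp_ge.
  have mR : (m%:R : R) <= N n G by rewrite ler_nat.
  have mR0 : 0 <= m%:R :> R by [].
  have dN := ty_N ty.
  have t3 : `|(n%:R * (1 - lam n) - N n G) * (ln (mu n) - 1)| <= 6 * e * N n G.
    rewrite normrM distrC; apply: (@le_trans _ _ (e / L n * (n%:R * (1 - lam n)) * (3 * L n))).
      by apply: ler_pM.
    have -> : e / L n * (n%:R * (1 - lam n)) * (3 * L n) = 6 * e * (n%:R * (1 - lam n) / 2).
      by field; rewrite gt_eqF.
    by rewrite ler_wpM2l// mulr_ge0// ltW.
  rewrite -(ler_pM2l N0); apply: le_trans sI.
  have k1 : m%:R * (n%:R * ((1 - lam n) * (ln (mu n) - 1)) - e * n%:R) <= m%:R * \sum_(v in lay (u n) G (d n)) ln (X n G v)%:R.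
    rewrite ler_wpM2l//; have := ler_wpM2l (ltW n0) t2.
    by move: t1; move: (\sum_(_ in _) _) (n%:R * _) => *; lra.
  apply: le_trans k1.
  have k2 : m%:R * (- (6 * e * N n G)) <= m%:R * ((n%:R * (1 - lam n) - N n G) * (ln (mu n) - 1)).
    by rewrite ler_wpM2l//; move: t3; rewrite ler_norml => /andP[].
  have k3 : m%:R * (e * n%:R) <= N n G * (e * n%:R) by rewrite ler_wpM2r// mulr_ge0// ltW.
  have k4 : m%:R * (6 * e * N n G) <= n%:R * (6 * e * N n G).
    by rewrite ler_wpM2r ?mulr_ge0 ?(ltW e0)// (le_trans mR).
  move: k2 k3 k4; move: (ln (mu n)) (lam n) (n%:R) (m%:R) #|_|%:R => *; lra.
have := hv1 m no; have k5 : e * n%:R <= eps / 21 * n%:R by rewrite ler_wpM2r ?(ltW n0).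
move: sX k5 {lw sI hv1 mo1}; move: (\sum_(_ in _) _) (Fhigh n) => S F.
by move: (m%:R) (n%:R) (d n).+1%:R (ln (mu n)) (ln _) => *; lra.
Qed.

Lemma high_partition : is_op_n q (fun n (G : graph n) =>
  ln (partition_function beta G)
  - (n%:R * ln (alpha n * ln n%:R / ((1 - Delta alpha n - beta) * loglog R n))
     - n%:R - beta * loglog R n * ((d_star alpha n)%:~R + 1) * n%:R)).
Proof.
apply: (whp_op q01) => eps eps0.
apply: (whp_mono q01) (whpI q01 (whp_high_upper eps0) (whp_high_lower eps0)).
apply: ev_mono2 evr ev_gap => n rg [g1 _ _] G _ [up lo].
have L0 := rgL0 rg; have D0 := rgD0 rg; have g0 : 0 < gap n by exact: lt_le_trans g1.
have gL : 0 < gap n * L n by rewrite mulr_gt0.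
have -> : alpha n * ln n%:R = D n by rewrite (rg_D rg) (rg_ln rg).
rewrite -/(gap n) -[partition_function beta G]/(treeZ (u n) G (beta * L n)) -/(Ln R n) (rg_d rg).
rewrite -[(Posz (d n))%:~R]/((d n)%:R : R) ln_div ?posrE// natr1.
move: up lo; rewrite /Fhigh ler_norml; move: (ln (treeZ _ _ _)) (ln (gap n * _)) (ln (D n)) (n%:R) (d n).+1%:R => *.
by apply/andP; split; lra.
Qed.

End high_temperature.

(** * The low temperature condition in its two cases *)

Section phases.
Variables (R : realType) (alpha : nat -> R) (a0 a1 beta : R).
Hypotheses (a0_gt0 : 0 < a0) (alpha_bd : ev (fun n => a0 <= alpha n <= a1)).
Local Notation L := (Ln R).
Local Notation lam := (lamn alpha).
Local Notation bc := (beta_crit alpha).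
Local Notation evr := (ev_regime a0_gt0 alpha_bd).

(** The term - (beta - c) L dominates all the errors, so the positive part vanishes for large n. *)
Lemma low_phase_strict (c : R) : c < beta -> ev (fun n => bc n <= c) ->
  forall eps : R, 0 < eps -> exists2 e : R, 0 < e &
  ev (fun n => 2 * (1 - lam n) * Num.max 0 (L n * (bc n - beta) + 2 * e * L n + 3 * ln (L n)) <= eps).
Proof.
move=> cb hc eps eps0; pose t := beta - c.
have t0 : 0 < t by rewrite subr_gt0.
exists (t / 8); first by rewrite divr_gt0.
apply: ev_mono2 evr (evI hc (ev_lnL (6 / t))) => n rg [h1 h2].
rewrite -/(Ln R n) mulrAC ler_pdivrMr// in h2; have L0 := rgL0 rg.
have h3 : L n * (bc n - beta) <= L n * (- t).
  by rewrite ler_wpM2l ?(ltW L0)// /t; move: (bc n) h1 => *; lra.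
have Lt : 0 <= L n * t by rewrite mulr_ge0 ?ltW.
have -> : Num.max 0 (L n * (bc n - beta) + 2 * (t / 8) * L n + 3 * ln (L n)) = 0.
  apply/max_idPl; move: h2 h3 Lt; move: (L n * (bc n - beta)) (ln (L n)) => *; lra.
by rewrite mulr0 ltW.
Qed.

(** Here the positive part is only o(L), but a bounded kappa means that (1 - lambda) L is bounded,
    so the product with 1 - lambda is still o(1). *)
Lemma low_phase_critical (K : R) : (forall e : R, 0 < e -> ev (fun n => bc n <= beta + e)) ->
  ev (fun n => kappa alpha n <= K) ->
  forall eps : R, 0 < eps -> exists2 e : R, 0 < e &
  ev (fun n => 2 * (1 - lam n) * Num.max 0 (L n * (bc n - beta) + 2 * e * L n + 3 * ln (L n)) <= eps).
Proof.
move=> hc hK eps eps0; pose k : R := `|K| + 1.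
have k0 : 0 < k by rewrite ltr_wpDl.
pose e := eps / (8 * k); have e0 : 0 < e by rewrite divr_gt0// mulr_gt0.
exists e => //.
apply: ev_mono2 evr (evI (hc e e0) (evI hK (ev_lnL (3 / e)))) => n rg [h1 [h2 h3]].
rewrite -/(Ln R n) mulrAC ler_pdivrMr// in h3; have L0 := rgL0 rg.
have /andP[_ l1] := rg_lam01 rg; have s0 : 0 < 1 - lam n by rewrite subr_gt0.
have h4 : L n * (bc n - beta) <= L n * e.
  by rewrite ler_wpM2l ?(ltW L0)//; move: (bc n) h1 => *; lra.
have eL : 0 <= e * L n by rewrite mulr_ge0 ?ltW.
have mx : Num.max 0 (L n * (bc n - beta) + 2 * e * L n + 3 * ln (L n)) <= 4 * (e * L n).
  rewrite ge_max; apply/andP; split; first by lra.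
  by move: h3 h4; move: (L n * (bc n - beta)) (ln (L n)) => *; lra.
have s2 : 0 <= 2 * (1 - lam n) by rewrite mulr_ge0// ltW.
apply: le_trans (ler_wpM2l s2 mx) _.
have -> : 2 * (1 - lam n) * (4 * (e * L n)) = 8 * e * ((1 - lam n) * L n) by ring.
apply: (@le_trans _ _ (8 * e * k)).
  have h2' : (1 - lam n) * L n <= K := h2.
  have e8 : 0 <= 8 * e by apply: mulr_ge0 => //; exact: ltW.
  apply: (ler_wpM2l e8); apply: le_trans h2' _.
  by rewrite /k; have := ler_norm K; lra.
by rewrite le_eqVlt; apply/orP; left; apply/eqP; rewrite /e; field; rewrite gt_eqF.
Qed.

End phases.

Theorem theorem5p7 (R : realType) (alpha : nat -> R) (beta : R)
  (alpha_gt0 : forall n : nat, 0 < alpha n)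
  (alpha_liminf : (0 < limn_einf (fun n : nat => (alpha n)%:E))%E)
  (alpha_limsup : (limn_esup (fun n : nat => (alpha n)%:E) < +oo)%E)
  (beta_gt0 : 0 < beta) :
  (((limn_esup (fun n : nat => (beta_crit alpha n)%:E) < beta%:E)%E
    \/ (beta%:E = limn_esup (fun n : nat => (beta_crit alpha n)%:E)
        /\ (limn_esup (fun n : nat => (kappa alpha n)%:E) < +oo)%E)) ->
   is_op_n (edge_prob alpha) (fun (n : nat) (G : graph n) =>
     tPhi_max alpha beta G - tPhi alpha beta G (N_dstar alpha G))
   /\
   is_op_n (edge_prob alpha) (fun (n : nat) (G : graph n) =>
     ln (partition_function beta G)
     - (n%:R * Psi0 (lambda_ alpha n)
        + lambda_ alpha n * n%:R
          * ln (alpha n * (1 - lambda_ alpha n) * ln n%:R)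
        - beta * loglog R n
          * ((d_star alpha n)%:~R + lambda_ alpha n) * n%:R)))
  /\
  ((beta%:E < limn_einf (fun n : nat => (beta_crit alpha n)%:E))%E ->
   is_op_n (edge_prob alpha) (fun (n : nat) (G : graph n) =>
     tPhi_max alpha beta G
     - tPhi alpha beta G
         (Num.truncn ((N_dstar alpha G)%:R
                      / ((1 - Delta alpha n - beta) * kappa alpha n))))
   /\
   is_op_n (edge_prob alpha) (fun (n : nat) (G : graph n) =>
     ln (partition_function beta G)
     - (n%:R * ln (alpha n * ln n%:R
                   / ((1 - Delta alpha n - beta) * loglog R n))
        - n%:R
        - beta * loglog R n * ((d_star alpha n)%:~R + 1) * n%:R))).
Proof.
have [a0 a00 ha0] := limn_einf_gt alpha_liminf.
have [a1 _ ha1] := limn_esup_lt alpha_limsup.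
rewrite lte_fin in a00.
have bd : ev (fun n => a0 <= alpha n <= a1).
  by apply: ev_mono2 ha0 ha1 => n -> ->.
split => [low|].
  have ph : forall eps : R, 0 < eps -> exists2 e : R, 0 < e &
      ev (fun n => 2 * (1 - lamn alpha n) * Num.max 0 (Ln R n * (beta_crit alpha n - beta)
        + 2 * e * Ln R n + 3 * ln (Ln R n)) <= eps).
    case: low => [/limn_esup_lt[c cb hc]|[bE /limn_esup_lt[K _ hK]]].
      by rewrite lte_fin in cb; exact: low_phase_strict a00 bd _ cb hc.
    apply: (low_phase_critical a00 bd _ hK) => e e0.
    (* A limsup equal to beta gives beta_crit <= beta + e for large n, for each e > 0, which is what
       the critical case needs. *)
    have /limn_esup_lt[c cb hc] : (limn_esup (fun n => (beta_crit alpha n)%:E) < (beta + e)%:E)%E.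
      by rewrite -bE lte_fin ltrDl.
    by rewrite lte_fin in cb; apply: ev_mono hc => n /le_trans; apply; exact: ltW.
  have H1 := low_tPhi a00 bd ph; have H2 := low_partition a00 bd beta_gt0 ph.
  by split; [exact H1|exact H2].
move=> /limn_einf_gt[c cb hc]; rewrite lte_fin in cb.
have dl : 0 < c - beta by rewrite subr_gt0.
have ph : ev (fun n => beta + (c - beta) <= beta_crit alpha n).
  by apply: ev_mono hc => n; rewrite addrC subrK.
have H1 := high_tPhi a00 bd beta_gt0 dl ph; have H2 := high_partition a00 bd beta_gt0 dl ph.
by split; [exact H1|exact H2].
Qed.
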